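(* For any $u_{0L}\in H(\Omega_L)$ and $f_L\in L^2(0,T;V^*(\Omega_L))$, the auxiliary problem on the cross-section $\Omega_L=\Omega\cap L$, $$\frac{\partial u_L}{\partial t}-\nu\big[(1+a_1^{-2})D_1^2+(1+a_2^{-2})D_2^2\big]u_L-2\nu a_1^{-1}a_2^{-1}D_1D_2u_L+(u_{L1}-a_1^{-1}u_{L3})D_1u_L+(u_{L2}-a_2^{-1}u_{L3})D_2u_L=f_L,$$ $$\operatorname{div}u_L=D_1(u_{L1}-a_1^{-1}u_{L3})+D_2(u_{L2}-a_2^{-1}u_{L3})=0\quad\text{in }(0,T)\times\Omega_L,$$ $$u_L(0,x)=u_{0L}(x)\ \text{ in }\Omega_L,\qquad u_L|_{(0,T)\times\partial\Omega_L}=0,$$ has a weak solution $u_L$ belonging to $\mathcal V(Q_L^T)$.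
   Context: Setting: $T>0$, $\nu>0$; $\Omega\subset\mathbb R^3$ is a bounded open domain whose boundary is a locally Lipschitz hypersurface (class $Lip_{loc}$). $L=\{x\in\mathbb R^3: x_3=b-a_1x_1-a_2x_2\}$ is a plane with constants $b\in\mathbb R$, $a_1,a_2\in\mathbb R\setminus\{0\}$, such that $\Omega_L:=\Omega\cap L\neq\varnothing$. $\Omega_L$ is identified, through the affine bijection $(x_1,x_2)\mapsto(x_1,x_2,b-a_1x_1-a_2x_2)$, with its projection $P_{x_3}\Omega_L\subset\mathbb R^2$, which is taken to be Lipschitz (a finite union of bounded Lipschitz domains); functions on $\Omega_L$ are functions of $(x_1,x_2)$ and integrals over $\Omega_L$ are integrals over $P_{x_3}\Omega_L$ with respect to $dx_1dx_2$. $D_i=\partial/\partial x_i$ for $i=1,2$, and $D_3:=-a_1^{-1}D_1-a_2^{-1}D_2$. $Q_L^T=(0,T)\times\Omega_L$. Vector functions $u_L=(u_{L1},u_{L2},u_{L3})$ have three components, and on $\Omega_L$ $$\operatorname{div}\varphi:=D_1(\varphi_1-a_1^{-1}\varphi_3)+D_2(\varphi_2-a_2^{-1}\varphi_3),\qquad \Delta:=(1+a_1^{-2})D_1^2+(1+a_2^{-2})D_2^2+2a_1^{-1}a_2^{-1}D_1D_2 .$$ $V(\Omega_L)$ and $H(\Omega_L)$ are the closures of $\{\varphi\in(C_0^\infty(\Omega_L))^3:\operatorname{div}\varphi=0\}$ (with this div) in $(W_0^{1,2}(\Omega_L))^3$ and $(L^2(\Omega_L))^3$; $V^*(\Omega_L)$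 is the dual of $V(\Omega_L)$ with pivot space $H(\Omega_L)$. $V(Q_L^T)=L^2(0,T;V(\Omega_L))\cap L^\infty(0,T;H(\Omega_L))$ and $\mathcal V(Q_L^T)=\{w\in V(Q_L^T): w'\in L^{4/3}(0,T;V^*(\Omega_L))\}$. $\langle g,h\rangle_{\Omega_L}=\sum_{i=1}^3\int_{P_{x_3}\Omega_L}g_ih_i\,dx_1dx_2$, extended to the pairing of $V^*(\Omega_L)$ and $V(\Omega_L)$. A weak solution is a $u_L\in\mathcal V(Q_L^T)$ such that for every $v\in V(\Omega_L)$ and a.e. $t\in(0,T)$ $$\frac d{dt}\langle u_L,v\rangle_{\Omega_L}-\langle\nu\Delta u_L,v\rangle_{\Omega_L}+\Big\langle\sum_{j=1}^3u_{Lj}D_ju_L,v\Big\rangle_{\Omega_L}=\langle f_L,v\rangle_{\Omega_L},$$ together with $\langle u_L(t),v\rangle_{\Omega_L}|_{t=0}=\langle u_{0L},v\rangle_{\Omega_L}$. *)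

(* Defs.v *)
From mathcomp Require Import all_boot all_order all_algebra.
From mathcomp Require Import all_classical all_reals all_analysis.
Set Implicit Arguments.
Unset Strict Implicit.
Unset Printing Implicit Defensive.
Import Order.TTheory GRing.Theory Num.Theory.
Import numFieldNormedType.Exports.
Local Open Scope classical_set_scope.
Local Open Scope ring_scope.

Definition boundary_of (E : topologicalType) (A : set E) : set E :=
  closure A `\` interior A.

(* In suitable rectangular coordinates [x *m Q] the boundary is, near each of
   its points, the graph of the last coordinate over the others. *)
Definition lipschitz_boundary (R : realType) (n : nat)
    (A : set 'rV[R]_n.+2) : Prop :=
  forall x0, boundary_of A x0 ->
    exists (Q : 'M[R]_n.+2) (g : 'rV[R]_n.+1 -> R) (k : R),
      [/\ Q *m Q^T = 1%:M, k.-lipschitz g &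
          \forall x \near x0, boundary_of A x <->
            (x *m Q) ord0 ord_max = g (col' ord_max (x *m Q))].

Definition bounded_lipschitz_domain (R : realType) (n : nat)
    (A : set 'rV[R]_n.+2) : Prop :=
  [/\ open A, connected A, A !=set0, bounded_set A & lipschitz_boundary A].

Definition plane (R : realType) (a1 a2 b : R) : set 'rV[R]_3 :=
  [set x | x ord0 2%:R = b - a1 * x ord0 0 - a2 * x ord0 1].

Definition proj12 (R : realType) (n : nat) (x : 'rV[R]_n.+2) : R * R :=
  (x ord0 0, x ord0 1).

(* P_{x3} Omega_L, as a subset of the (x1, x2) plane *)
Definition cross_section (R : realType) (Omega : set 'rV[R]_3) (a1 a2 b : R) :
    set (R * R) :=
  [set proj12 x | x in Omega `&` plane a1 a2 b].

Definition union_lipschitz_domains (R : realType) (P : set (R * R)) : Prop :=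
  exists (k : nat) (G : 'I_k -> set 'rV[R]_2),
    (forall i, bounded_lipschitz_domain (G i)) /\
    P = \bigcup_i [set proj12 x | x in G i].

(* [d] ranges over all directions, so this is the usual C^k when E has finite
   dimension. *)
Fixpoint Ck (R : realType) (E : normedModType R) (k : nat) (f : E -> R) :
    Prop :=
  if k is k'.+1 then
    forall d : E, (forall x, derivable f x d) /\ Ck k' (fun x => 'D_d f x)
  else continuous f.

(* C_0^infinity(U) *)
Definition test (R : realType) (E : normedModType R) (U : set E) :
    set (E -> R) :=
  [set f | [/\ forall k, Ck k f, compact (closure [set x | f x != 0]) &
               closure [set x | f x != 0] `<=` U]].

(* Functions on the cross-section are total functions on R * R of which only
   the values on P matter; Lebesgue classes are handled through
   representatives, and the norms below are seminorms on representatives. *)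

Definition leb2 (R : realType) :
    {measure set (measurableTypeR R * measurableTypeR R) -> \bar R} :=
  (@lebesgue_measure R \x @lebesgue_measure R)%E.
Arguments leb2 R : clear implicits.

Definition e1 (R : realType) : R * R := (1, 0).
Definition e2 (R : realType) : R * R := (0, 1).

Definition L2 (R : realType) (P : set (R * R)) : set (R * R -> R) :=
  [set f | f \_ P \in Lfun (leb2 R) 2%:E].

Definition is_wderiv (R : realType) (P : set (R * R)) (d : R * R)
    (f g : R * R -> R) : Prop :=
  L2 P g /\
  forall psi, test P psi ->
    \int[leb2 R]_(x in P) (f x * 'D_d psi x)
    = - \int[leb2 R]_(x in P) (g x * psi x).

(* The weak derivative in direction d (unique up to a null set), if any *)
Definition wderiv (R : realType) (P : set (R * R)) (d : R * R)
    (f : R * R -> R) : R * R -> R :=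
  get [set g | is_wderiv P d f g].

Definition closure_in (R : realType) (X : zmodType) (N : X -> R)
    (S A : set X) : set X :=
  [set f | S f /\ forall e : R, 0 < e -> exists2 h, A h & N (f - h) < e].

Definition W12 (R : realType) (P : set (R * R)) : set (R * R -> R) :=
  [set f | [/\ L2 P f, exists g, is_wderiv P (e1 R) f g &
               exists g, is_wderiv P (e2 R) f g]].

Definition norm12 (R : realType) (P : set (R * R)) (f : R * R -> R) : R :=
  Num.sqrt (\int[leb2 R]_(x in P) (f x ^+ 2)
            + \int[leb2 R]_(x in P) (wderiv P (e1 R) f x ^+ 2)
            + \int[leb2 R]_(x in P) (wderiv P (e2 R) f x ^+ 2)).

Definition W12_0 (R : realType) (P : set (R * R)) : set (R * R -> R) :=
  closure_in (norm12 P) (W12 P) (test P).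

Notation field3 R := (R * R -> 'rV[R]_3).

Definition comp3 (R : realType) (u : field3 R) (j : 'I_3) : R * R -> R :=
  fun x => u x ord0 j.

Definition pair3 (R : realType) (P : set (R * R)) (g h : field3 R) : R :=
  \sum_(j < 3) \int[leb2 R]_(x in P) (comp3 g j x * comp3 h j x).

Definition vderiv (R : realType) (P : set (R * R)) (d : R * R)
    (u : field3 R) : field3 R :=
  fun x => \row_j wderiv P d (comp3 u j) x.

Definition normH (R : realType) (P : set (R * R)) (u : field3 R) : R :=
  Num.sqrt (pair3 P u u).

Definition normV (R : realType) (P : set (R * R)) (u : field3 R) : R :=
  Num.sqrt (\sum_(j < 3) norm12 P (comp3 u j) ^+ 2).

Definition divfree_test (R : realType) (P : set (R * R)) (a1 a2 : R) :
    set (field3 R) :=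
  [set phi | (forall j, test P (comp3 phi j)) /\
     forall x,
       'D_(e1 R) (fun y => comp3 phi 0 y - a1^-1 * comp3 phi 2%:R y) x
       + 'D_(e2 R) (fun y => comp3 phi 1 y - a2^-1 * comp3 phi 2%:R y) x = 0].

Definition spaceV (R : realType) (P : set (R * R)) (a1 a2 : R) :
    set (field3 R) :=
  closure_in (normV P) [set u | forall j, W12_0 P (comp3 u j)]
    (divfree_test P a1 a2).

Definition spaceH (R : realType) (P : set (R * R)) (a1 a2 : R) :
    set (field3 R) :=
  closure_in (normH P) [set u | forall j, L2 P (comp3 u j)]
    (divfree_test P a1 a2).

(* Functionals are total functions of which only the values on V matter;
   h in H is identified with [pair3 P h]. *)
Notation functional R := (field3 R -> R^o).

Definition dualV (R : realType) (P : set (R * R)) (a1 a2 : R) :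
    set (functional R) :=
  [set l | (forall (c : R) v w, spaceV P a1 a2 v -> spaceV P a1 a2 w ->
              l (c *: v + w) = c * l v + l w) /\
           exists C : R, forall v, spaceV P a1 a2 v ->
             `|l v : R| <= C * normV P v].

Definition norm_dualV (R : realType) (P : set (R * R)) (a1 a2 : R)
    (l : functional R) : R :=
  sup [set `|l v : R| | v in [set v | spaceV P a1 a2 v /\ normV P v <= 1]].

Definition ae0T (R : realType) (T : R) (Q : R -> Prop) : Prop :=
  {ae lebesgue_measure, forall t : R, t \in `]0, T[ -> Q t}.

Definition strongly_measurable (R : realType) (T : R) (X : lmodType R)
    (N : X -> R) (S : set X) (u : R -> X) : Prop :=
  exists s : nat -> R -> X,
    (forall n, exists (m : nat) (A : 'I_m -> set R) (x : 'I_m -> X),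
       (forall i, measurable (A i) /\ S (x i)) /\
       s n = (fun t => \sum_(i < m) (\1_(A i) t : R) *: x i)) /\
    ae0T T (fun t => (fun n => N (s n t - u t)) @ \oo --> (0 : R)).

(* L^p(0, T; S) for S normed by N, with 1 <= p <= +oo *)
Definition bochner (R : realType) (T : R) (p : \bar R) (X : lmodType R)
    (N : X -> R) (S : set X) : set (R -> X) :=
  [set u | [/\ ae0T T (fun t => S (u t)), strongly_measurable T N S u &
     finite_norm (@lebesgue_measure R) p
       ((fun t => N (u t)) \_ (`]0, T[ : set R))]].

(* h is the derivative of F in the sense of distributions on (0, T) *)
Definition weak_ddt (R : realType) (T : R) (F h : R -> R) : Prop :=
  forall theta : R -> R, test (`]0, T[ : set R) theta ->
    \int[@lebesgue_measure R]_(t in `]0, T[) (F t * derive1 theta t)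
    = - \int[@lebesgue_measure R]_(t in `]0, T[) (h t * theta t).

(* Since evaluation at v in V commutes with V*-valued Bochner integrals, the
   V*-valued distributional derivative is tested against each v. *)
Definition is_time_derivative (R : realType) (T : R) (P : set (R * R))
    (a1 a2 : R) (u : R -> field3 R) (g : R -> functional R) : Prop :=
  forall v, spaceV P a1 a2 v ->
    weak_ddt T (fun t => pair3 P (u t) v) (fun t => g t v).

Definition spaceVQ (R : realType) (T : R) (P : set (R * R)) (a1 a2 : R) :
    set (R -> field3 R) :=
  bochner T 2%:E (normV P) (spaceV P a1 a2) `&`
  bochner T +oo%E (normH P) (spaceH P a1 a2).

Definition spaceVVQ (R : realType) (T : R) (P : set (R * R)) (a1 a2 : R) :
    set (R -> field3 R) :=
  [set w | spaceVQ T P a1 a2 w /\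
     exists2 g, bochner T (4 / 3)%:E (norm_dualV P a1 a2) (dualV P a1 a2) g &
                is_time_derivative T P a1 a2 w g].

(* The derivative of an L^2 field in direction d, as an element of V* *)
Definition dual_deriv (R : realType) (P : set (R * R)) (d : R * R)
    (g : field3 R) : functional R :=
  fun v => - pair3 P g (vderiv P d v).

Definition lapl (R : realType) (P : set (R * R)) (a1 a2 : R) (u : field3 R) :
    functional R :=
  (1 + a1 ^- 2) *: dual_deriv P (e1 R) (vderiv P (e1 R) u)
  + (1 + a2 ^- 2) *: dual_deriv P (e2 R) (vderiv P (e2 R) u)
  + (2 * a1^-1 * a2^-1) *: dual_deriv P (e1 R) (vderiv P (e2 R) u).

(* D_1, D_2, and D_3 := - a1^-1 D_1 - a2^-1 D_2 *)
Definition Dj (R : realType) (P : set (R * R)) (a1 a2 : R) (j : 'I_3)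
    (u : field3 R) : field3 R :=
  match nat_of_ord j with
  | 0%N => vderiv P (e1 R) u
  | 1%N => vderiv P (e2 R) u
  | _ => - a1^-1 *: vderiv P (e1 R) u - a2^-1 *: vderiv P (e2 R) u
  end.

Definition convection (R : realType) (P : set (R * R)) (a1 a2 : R)
    (u : field3 R) : field3 R :=
  fun x => \sum_(j < 3) comp3 u j x *: Dj P a1 a2 j u x.

(* [u t] is only determined for almost every t: its value at t = 0 paired with
   v is that of the continuous representative of [pair3 P (u t) v]. The
   boundary condition and div u = 0 are carried by V. *)
Definition weak_solution (R : realType) (T nu : R) (P : set (R * R))
    (a1 a2 : R) (u0 : field3 R) (f : R -> functional R)
    (u : R -> field3 R) : Prop :=
  spaceVVQ T P a1 a2 u /\
  forall v, spaceV P a1 a2 v ->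
    (exists h : R -> R,
       [/\ (@lebesgue_measure R).-integrable `]0, T[ (EFin \o h),
           weak_ddt T (fun t => pair3 P (u t) v) h &
           ae0T T (fun t =>
             h t - (nu *: lapl P a1 a2 (u t)) v
             + pair3 P (convection P a1 a2 (u t)) v = f t v)]) /\
    (exists F : R -> R,
       [/\ {within `[0, T], continuous F},
           ae0T T (fun t => F t = pair3 P (u t) v) &
           F 0 = pair3 P u0 v]).

(* Main.v *)
(* On the plane domain [P] the problem is a two-dimensional Navier-Stokes system
   for a three-component field: the second-order form is
   [|D_1 u|^2 + |D_2 u|^2 + |D_1 u / a1 + D_2 u / a2|^2], hence coercive by
   Poincare's inequality, and the convection field [(u_1 - u_3 / a1, u_2 - u_3 / a2)]
   is divergence free, so that the convection form [b(u, v, w)] is antisymmetric in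
   [(v, w)]; Ladyzhenskaya's inequality bounds it by
   [(|u| |u|_V)^(1/2) |v|_V |w|_V], which puts [u'] in [L^(4/3)(0, T; V^* )].

   Existence holds for any such pair of forms. Approximate solutions combine a
   Galerkin projection on finitely many divergence-free test fields with a
   semi-implicit Euler step; they satisfy the energy estimate, and their pairings
   with a fixed test field are equi-Hoelder in time. Along an ultrafilter these
   pairings converge uniformly in time. Since the unit ball of V is totally bounded
   in H (Poincare's inequality on small cells), the approximations are Cauchy in
   [L^2(0, T; H)], and convex combinations of them are Cauchy in [L^2(0, T; V)]; the
   equation passes to the limit against test fields, for which both forms are
   continuous in H, and then against all of V by density. *)
Require Import Defs.
From mathcomp Require Import all_boot all_order all_algebra.
From mathcomp Require Import all_classical all_reals all_analysis.
From mathcomp Require Import measurable_realfun ess_sup_inf.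
From mathcomp Require Import ring lra.
Set Implicit Arguments.
Unset Strict Implicit.
Unset Printing Implicit Defensive.
Import Order.TTheory GRing.Theory Num.Theory.
Import numFieldNormedType.Exports.
Local Open Scope classical_set_scope.
Local Open Scope ring_scope.

(** * Positive forms on subspaces *)

(** [bochner] asks for simple fields that approach the solution pointwise in the norm of V, whereas
    compactness yields convergence in H only; this is what the convex combinations are for. The
    spaces of fields carry no sigma-algebra, so measurability is only ever expressed through norms
    and pairings, and the approximations are kept finite-valued, so that every function of them is
    measurable. The time derivative is not a limit of difference quotients: it is defined from the
    solution as the force minus both forms, and it is identified with the weak derivative one test
    field at a time, from the time-integrated equation; no vector-valued integral occurs. Elements
    of the spaces are representatives and all norms are seminorms, so no argument may rely on
    definiteness: null vectors are treated apart wherever a vector is normalized. *)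

Lemma sqr_le_addn (R : realType) (x y z : R) : 0 <= x -> x <= y + z ->
  x ^+ 2 <= 2 * y ^+ 2 + 2 * z ^+ 2.
Proof.
move=> x0 h; have : x ^+ 2 <= (y + z) ^+ 2.
  by apply: lerXn2r; rewrite ?nnegrE//; exact: le_trans h.
have := sqr_ge0 (y - z); rewrite !sqrrD !mulr2n sqrrN mulrN; lra.
Qed.

Section forms.
Variables (R : realType) (X : lmodType R).
Implicit Types (S : set X) (q : X -> X -> R) (l : X -> R) (u v w : X).

(** Integrals are additive only on functions for which they converge, while the ambient module
    consists of all total functions. Linear and bilinear notions are therefore relative to a
    subset. *)
Definition subsp S := S 0 /\ forall (c : R) u v, S u -> S v -> S (c *: u + v).

Definition lin_on S l :=
  forall (c : R) u v, S u -> S v -> l (c *: u + v) = c * l u + l v.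

Definition bil_on S q :=
  (forall w, S w -> lin_on S (q ^~ w)) /\ (forall u, S u -> lin_on S (q u)).

Definition psd_on S q :=
  [/\ bil_on S q, forall u v, S u -> S v -> q u v = q v u &
      forall u, S u -> 0 <= q u u].

Definition nrm q u : R := Num.sqrt (q u u).

Lemma lin_on_sub S S' l : S' `<=` S -> lin_on S l -> lin_on S' l.
Proof. by move=> h ll c u v /h ? /h ?; exact: ll. Qed.

Lemma bil_on_sub S S' q : S' `<=` S -> bil_on S q -> bil_on S' q.
Proof.
move=> h [q1 q2]; split => w /h Sw; apply: lin_on_sub h _; [exact: q1|exact: q2].
Qed.

Lemma psd_on_sub S S' q : S' `<=` S -> psd_on S q -> psd_on S' q.
Proof.
move=> h [q1 q2 q3]; split; first exact: bil_on_sub q1.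
  by move=> u v /h ? /h ?; exact: q2.
by move=> u /h ?; exact: q3.
Qed.

Section subspace.
Variable S : set X.
Hypothesis hS : subsp S.

Lemma subsp0 : S 0. Proof. by case: hS. Qed.

Lemma subspD u v : S u -> S v -> S (u + v).
Proof. by move=> Su Sv; rewrite -(scale1r u); apply: hS.2. Qed.

Lemma subspZ (c : R) u : S u -> S (c *: u).
Proof. by move=> Su; rewrite -(addr0 (_ *: _)); apply: hS.2 => //; exact: subsp0. Qed.

Lemma subspB u v : S u -> S v -> S (u - v).
Proof. by move=> Su Sv; rewrite -scaleN1r addrC; apply: hS.2. Qed.

Lemma subsp_sum (I : Type) (r : seq I) (P : pred I) (F : I -> X) :
  (forall i, P i -> S (F i)) -> S (\sum_(i <- r | P i) F i).
Proof. by move=> SF; elim/big_ind: _ => //; [exact: subsp0|exact: subspD]. Qed.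

Section linear.
Variable l : X -> R.
Hypothesis hl : lin_on S l.

Lemma lin_on0 : l 0 = 0.
Proof.
have := hl 1 subsp0 subsp0; rewrite scale1r addr0 mul1r => /eqP.
by rewrite -subr_eq0 opprD addrA subrr sub0r oppr_eq0 => /eqP.
Qed.

Lemma lin_onZ c u : S u -> l (c *: u) = c * l u.
Proof.
by move=> Su; rewrite -(addr0 (_ *: _)) hl ?lin_on0 ?addr0 //; exact: subsp0.
Qed.

Lemma lin_onB u v : S u -> S v -> l (u - v) = l u - l v.
Proof. by move=> Su Sv; rewrite -scaleN1r addrC hl// mulN1r addrC. Qed.

Lemma lin_on_sum (I : Type) (r : seq I) (x : I -> R) (F : I -> X) :
  (forall i, S (F i)) ->
  l (\sum_(i <- r) x i *: F i) = \sum_(i <- r) x i * l (F i).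
Proof.
move=> SF; elim: r => [|i r IH]; first by rewrite !big_nil lin_on0.
rewrite !big_cons hl ?IH//; apply: subsp_sum => j _; exact: subspZ.
Qed.

End linear.

Section psd.
Variable q : X -> X -> R.
Hypothesis hq : psd_on S q.

Let ql w : S w -> lin_on S (q ^~ w). Proof. by case: hq => -[h _] _ _; exact: h. Qed.
Let qr w : S w -> lin_on S (q w). Proof. by case: hq => -[_ h] _ _; exact: h. Qed.
Let qC u v : S u -> S v -> q u v = q v u. Proof. by case: hq => _ + _; apply. Qed.

Lemma psd_ge0 u : S u -> 0 <= q u u. Proof. by case: hq => _ _; apply. Qed.

Lemma nrm_ge0 u : 0 <= nrm q u. Proof. exact: sqrtr_ge0. Qed.

Lemma nrm_sqr u : S u -> nrm q u ^+ 2 = q u u.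
Proof. by move=> Su; rewrite sqr_sqrtr// psd_ge0. Qed.

Lemma psd_quad (c : R) u v : S u -> S v ->
  q (c *: u + v) (c *: u + v) = c ^+ 2 * q u u + 2 * c * q u v + q v v.
Proof.
move=> Su Sv; have Sw : S (c *: u + v) by apply: hS.2.
rewrite (ql Sw)// (qr Su)// (qr Sv)// (qC Sv Su); ring.
Qed.

Lemma psd_CS u v : S u -> S v -> `|q u v| <= nrm q u * nrm q v.
Proof.
move=> Su Sv; rewrite -sqrtrM ?psd_ge0// -sqrtr_sqr ler_wsqrtr//.
have h c : 0 <= c ^+ 2 * q u u + 2 * c * q u v + q v v.
  by rewrite -psd_quad// psd_ge0//; apply: hS.2.
have := psd_ge0 Su; rewrite le0r => /orP[/eqP quu0|quu0].
  rewrite quu0 mul0r; rewrite leNgt; apply/negP => qp.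
  have q0 : q u v != 0 by apply: contraTneq qp => ->; rewrite expr0n /= ltxx.
  (* With [q u u = 0] the quadratic is affine in its variable; this value of the variable would make
     it -1. *)
  have := h (- (q v v + 1) / (2 * q u v)); rewrite quu0 mulr0 add0r.
  have -> : 2 * (- (q v v + 1) / (2 * q u v)) * q u v = - (q v v + 1) by field.
  lra.
(* The minimizer of the quadratic. *)
have := h (- q u v / q u u).
have -> : (- q u v / q u u) ^+ 2 * q u u + 2 * (- q u v / q u u) * q u v + q v v
   = (q u u * q v v - q u v ^+ 2) / q u u by field; rewrite gt_eqF.
by rewrite pmulr_lge0 ?invr_gt0// subr_ge0.
Qed.

Lemma nrm_triangle u v : S u -> S v -> nrm q (u + v) <= nrm q u + nrm q v.
Proof.
move=> Su Sv; rewrite -(ger0_norm (addr_ge0 (nrm_ge0 u) (nrm_ge0 v))) -sqrtr_sqr.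
rewrite ler_wsqrtr// -{1 2}(scale1r u) psd_quad// sqrrD !nrm_sqr//.
have := ler_norm (q u v); have := psd_CS Su Sv; lra.
Qed.

Lemma nrmZ c u : S u -> nrm q (c *: u) = `|c| * nrm q u.
Proof.
move=> Su; rewrite /nrm -sqrtr_sqr -sqrtrM ?sqr_ge0//; congr Num.sqrt.
by rewrite (lin_onZ (ql (subspZ _ Su)))// (lin_onZ (qr Su))// expr2 mulrA.
Qed.

Lemma nrmN u : S u -> nrm q (- u) = nrm q u.
Proof. by move=> Su; rewrite -scaleN1r nrmZ// normrN1 mul1r. Qed.

Lemma nrm_distC u v : S u -> S v -> nrm q (u - v) = nrm q (v - u).
Proof. by move=> Su Sv; rewrite -opprB nrmN//; apply: subspB. Qed.

Lemma nrm_dist u v : S u -> S v -> `|nrm q u - nrm q v| <= nrm q (u - v).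
Proof.
move=> Su Sv; rewrite ler_norml.
have h1 := nrm_triangle (subspB Su Sv) Sv.
have h2 := nrm_triangle (subspB Sv Su) Su.
rewrite !subrK in h1 h2; rewrite nrm_distC// in h2; lra.
Qed.

(** Parallelogram identity in midpoint form. The negative term is what forces near-minimizers over a
    family closed under midpoints to be close to each other. *)
Lemma nrm_mid u v : S u -> S v ->
  q (2^-1 *: (u + v)) (2^-1 *: (u + v)) =
  2^-1 * q u u + 2^-1 * q v v - 4^-1 * q (u - v) (u - v).
Proof.
move=> Su Sv.
have -> : u - v = (-1) *: v + u by rewrite scaleN1r addrC.
rewrite psd_quad//.
have -> : 2^-1 *: (u + v) = 2^-1 *: u + 2^-1 *: v by rewrite scalerDr.
have Sv2 := subspZ 2^-1 Sv.
rewrite psd_quad// (lin_onZ (ql Sv2))// (lin_onZ (qr Sv))// (lin_onZ (qr Su))// (qC Sv Su); by field.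
Qed.

End psd.
End subspace.
End forms.

Section galerkin_step.
Variables (R : realType) (X : lmodType R) (D : set X) (B q : X -> X -> R).
Hypotheses (hD : subsp D) (hB : bil_on D B).
Hypothesis coer : exists2 c : R, 0 < c & forall u, D u -> c * q u u <= B u u.

Let comb m (s : 'I_m -> X) (x : 'I_m -> R) : X := \sum_(i <- enum 'I_m) x i *: s i.

(* The columns of [cokermx] are coefficient vectors of null elements, so the
   right-hand side, bounded by the seminorm, is in the row space: no
   linear independence of [s] is needed. *)
Lemma galerkin_step (m : nat) (s : 'I_m -> X) (F : X -> R) :
  (forall i, D (s i)) -> lin_on D F ->
  (exists C : R, forall v, D v -> `|F v| <= C * nrm q v) ->
  exists2 u, D u & B u u = F u /\ forall i, B u (s i) = F (s i).
Proof.
move=> Ds lF [C FC].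
have [c c0 Bc] := coer.
pose M : 'M[R]_m := \matrix_(i, j) B (s i) (s j).
pose r : 'rV[R]_m := \row_j F (s j).
have Dc x : D (comb s x) by apply: subsp_sum => // i _; exact: subspZ.
have Fc x : F (comb s x) = \sum_(i <- enum 'I_m) x i * F (s i) by exact: (lin_on_sum hD).
have Bcl x w : D w -> B (comb s x) w = \sum_(i <- enum 'I_m) x i * B (s i) w.
  by move=> Dw; exact: (lin_on_sum hD (hB.1 _ Dw)).
have Bcr x w : D w -> B w (comb s x) = \sum_(i <- enum 'I_m) x i * B w (s i).
  by move=> Dw; exact: (lin_on_sum hD (hB.2 _ Dw)).
have rM : (r <= M)%MS.
  rewrite submxE; apply/eqP/rowP => k; rewrite !mxE.
  pose y i := cokermx M i k.
  have My i : B (s i) (comb s y) = 0.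
    have /matrixP/(_ i k) := mulmx_coker M; rewrite !mxE => Mc.
    rewrite Bcr// -[RHS]Mc big_enum /=; apply: eq_bigr => j _.
    by rewrite mxE mulrC.
  have By : B (comb s y) (comb s y) = 0.
    by rewrite Bcl// big1// => i _; rewrite My mulr0.
  have q0 : nrm q (comb s y) = 0.
    have := Bc _ (Dc y); rewrite By pmulr_rle0// => h.
    by apply/eqP; rewrite sqrtr_eq0.
  have : `|F (comb s y)| <= 0 by apply: le_trans (FC _ (Dc y)) _; rewrite q0 mulr0.
  rewrite normr_le0 Fc big_enum => /eqP Fy; rewrite -[RHS]Fy.
  by apply: eq_bigr => j _; rewrite mxE mulrC.
have /submxP[x rx] := rM.
pose u := comb s (fun i => x ord0 i).
have us i : B u (s i) = F (s i).
  have /rowP/(_ i) := rx; rewrite !mxE => ->.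
  by rewrite Bcl// big_enum; apply: eq_bigr => j _; rewrite mxE.
exists u; first exact: Dc.
split => //.
rewrite {2}/u Bcr; last exact: Dc.
rewrite /u Fc; apply: eq_bigr => i _.
by rewrite us.
Qed.

End galerkin_step.

(** * Bounded functionals and their seminorm *)

Section dual.
Variables (R : realType) (X : lmodType R) (V : set X) (q : X -> X -> R).
Hypotheses (hV : subsp V) (hq : psd_on V q).

(** [dualof] and [ndual] are shaped so that [dualV] and [norm_dualV] unfold to them once [normV] is
    rewritten as [nrm (ip3 P)]. *)
Definition dualof : set (X -> R^o) :=
  [set l | (forall (c : R) v w, V v -> V w -> l (c *: v + w) = c * l v + l w) /\
           exists C : R, forall v, V v -> `|l v : R| <= C * nrm q v].

Definition ndual (l : X -> R^o) : R :=
  sup [set `|l v : R| | v in [set v | V v /\ nrm q v <= 1]].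

Lemma nrm0 : nrm q 0 = 0.
Proof.
by rewrite -(scale0r 0) (nrmZ hV hq) ?normr0 ?mul0r//; exact: subsp0.
Qed.

Let dset (l : X -> R^o) := [set `|l v : R| | v in [set v | V v /\ nrm q v <= 1]].

Lemma dual_has_sup l : dualof l -> has_sup (dset l).
Proof.
move=> [ll [C lC]]; split.
  by exists `|l 0|; exists 0 => //; split; [exact: subsp0|rewrite nrm0 ler01].
exists `|C| => _ [v [Vv v1] <-]; apply: le_trans (lC _ Vv) _.
apply: le_trans (ler_norm _) _; rewrite normrM (ger0_norm (nrm_ge0 _ _)).
by rewrite ler_piMr.
Qed.

Lemma ndual_ge0 l : dualof l -> 0 <= ndual l.
Proof.
move=> dl; apply: le_trans (normr_ge0 (l 0 : R)) _.
apply: ub_le_sup; first by case: (dual_has_sup dl).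
by exists 0 => //; split; [exact: subsp0|rewrite nrm0 ler01].
Qed.

Lemma le_ndual l v : dualof l -> V v -> `|l v : R| <= ndual l * nrm q v.
Proof.
move=> dl Vv; have := nrm_ge0 q v; rewrite le0r => /orP[/eqP q0|q0].
  (* A null vector cannot be normalized, but any bound for [l] makes [l] vanish on it. *)
  by have [_ [C lC]] := dl; have := lC _ Vv; rewrite q0 !mulr0.
have Vw : V ((nrm q v)^-1 *: v) by exact: subspZ.
have ll : lin_on V (l : X -> R) by case: dl.
rewrite -ler_pdivrMr//; apply: ub_le_sup; first by case: (dual_has_sup dl).
exists ((nrm q v)^-1 *: v).
  split => //; rewrite (nrmZ hV hq)// ger0_norm ?invr_ge0 ?nrm_ge0//.
  by rewrite mulVf ?gt_eqF.
by rewrite (lin_onZ hV ll)// normrM ger0_norm ?invr_ge0 ?nrm_ge0// mulrC.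
Qed.

Lemma ndual_le l (C : R) : 0 <= C ->
  (forall v, V v -> `|l v : R| <= C * nrm q v) -> ndual l <= C.
Proof.
move=> C0 lC; apply: ge_sup.
  by exists `|l 0|; exists 0 => //; split; [exact: subsp0|rewrite nrm0 ler01].
move=> _ [v [Vv v1] <-]; apply: le_trans (lC _ Vv) _.
by rewrite ler_piMr.
Qed.

Lemma dualof_lin (c : R) l m : dualof l -> dualof m -> dualof (c *: l + m).
Proof.
move=> dl dm; split.
  move=> d v w Vv Vw; rewrite !fctE /=.
  rewrite dl.1// dm.1// /GRing.scale /=; ring.
exists (`|c| * ndual l + ndual m) => v Vv.
rewrite !fctE /=; apply: le_trans (ler_normD _ _) _.
rewrite mulrDl lerD ?le_ndual//.
by rewrite /GRing.scale /= normrM -mulrA ler_wpM2l ?le_ndual.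
Qed.

Let fun0E (v : X) : (0 : X -> R^o) v = 0. Proof. by []. Qed.

Lemma dualof_subsp : subsp dualof.
Proof.
split; last by move=> c u v; exact: dualof_lin.
split; first by move=> c v w _ _; rewrite !fun0E mulr0 addr0.
by exists 0 => v _; rewrite fun0E normr0 mul0r.
Qed.

Lemma dualof0 : dualof 0. Proof. exact: dualof_subsp.1. Qed.

Lemma dualofB l m : dualof l -> dualof m -> dualof (l - m).
Proof. by move=> dl dm; exact: (subspB dualof_subsp dl dm). Qed.

Lemma ndual_triangle l m : dualof l -> dualof m ->
  ndual (l + m) <= ndual l + ndual m.
Proof.
move=> dl dm; apply: ndual_le; first by rewrite addr_ge0 ?ndual_ge0.
move=> v Vv; rewrite !fctE /= mulrDl; apply: le_trans (ler_normD _ _) _.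
by rewrite lerD ?le_ndual.
Qed.

Lemma ndual0 : ndual 0 = 0.
Proof.
apply/eqP; rewrite eq_le ndual_ge0 ?andbT; last exact: dualof0.
by apply: ndual_le => // v _; rewrite fun0E normr0 mul0r.
Qed.

Lemma ndualN l : ndual (- l) = ndual l.
Proof.
congr (sup _); apply/seteqP; split => _ [v vP <-]; exists v => //;
by rewrite ?fctE /= normrN.
Qed.

Lemma ndual_dist l m : dualof l -> dualof m ->
  `|ndual l - ndual m| <= ndual (l - m).
Proof.
move=> dl dm; rewrite ler_norml.
have h1 := ndual_triangle (dualofB dl dm) dm.
have h2 := ndual_triangle (dualofB dm dl) dl.
rewrite !subrK in h1 h2; rewrite -(opprB l m) ndualN in h2; lra.
Qed.

End dual.

(** * Square-integrable functions *)

Section integrable_toolkit.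
Context d (T : measurableType d) (R : realType) (mu : {measure set T -> \bar R}).
Variables (D : set T) (mD : measurable D).
Local Notation intg f := (mu.-integrable D (EFin \o f)).
Implicit Types f g : T -> R.

Lemma intg_meas f : intg f -> measurable_fun D f.
Proof. by move=> /(measurable_int mu)/measurable_EFinP. Qed.

Lemma intgD f g : intg f -> intg g -> intg (fun x => f x + g x).
Proof. by move=> hf hg; exact: (integrableD mD hf hg). Qed.

Lemma intgZ (c : R) f : intg f -> intg (fun x => c * f x).
Proof. by move=> hf; exact: (integrableZl mD c hf). Qed.

Lemma intgN f : intg f -> intg (fun x => - f x).
Proof.
move=> /(intgZ (-1)); apply: eq_integrable => // x _.
by rewrite /= mulN1r.
Qed.

Lemma intgB f g : intg f -> intg g -> intg (fun x => f x - g x).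
Proof. by move=> hf hg; apply: intgD => //; exact: intgN. Qed.

Lemma intg0 : intg (fun=> 0).
Proof. exact: (integrable0 mu D). Qed.

Lemma intg_le f g : measurable_fun D f -> (forall x, D x -> `|f x| <= g x) ->
  intg g -> intg f.
Proof.
move=> mf fg ig; apply: (le_integrable mD _ _ ig); first exact/measurable_EFinP.
move=> x Dx; rewrite lee_fin; apply: le_trans (fg _ Dx) _; exact: ler_norm.
Qed.

Lemma intg_norm f : intg f -> intg (fun x => `|f x|).
Proof. by move=> hf; exact: integrable_norm. Qed.

Lemma EFin_Rint f : intg f ->
  (\int[mu]_(x in D) f x)%:E = (\int[mu]_(x in D) (f x)%:E)%E.
Proof. by move=> hf; rewrite /Rintegral fineK//; exact: integrable_fin_num. Qed.

Lemma intg_bounded f (C : R) : (mu D < +oo)%E -> measurable_fun D f ->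
  (forall x, D x -> `|f x| <= C) -> intg f.
Proof.
move=> muD mf fC; apply: measurable_bounded_integrable => //.
exists `|C|; split; first exact: num_real.
move=> y Cy x Dx /=; apply: le_trans (fC _ Dx) _.
by apply: ltW; apply: le_lt_trans (ler_norm _) Cy.
Qed.

Lemma intg_ge0P f : measurable_fun D f -> (forall x, D x -> 0 <= f x) ->
  (\int[mu]_(x in D) (f x)%:E < +oo)%E -> intg f.
Proof.
move=> mf f0 fi; apply/integrableP; split; first exact/measurable_EFinP.
rewrite (eq_integral (fun x => (f x)%:E))// => x /set_mem Dx.
by rewrite /= ger0_norm// f0.
Qed.

(** Measurability of [f] is asked separately because it does not follow from that of its square. *)
Definition sqi f := measurable_fun D f /\ intg (fun x => f x ^+ 2).

Lemma sqi_mul f g : sqi f -> sqi g -> intg (fun x => f x * g x).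
Proof.
move=> [mf f2] [mg g2]; apply: (intg_le _ _ (intgD f2 g2)).
  exact: measurable_funM.
move=> x _; rewrite normrM -(real_normK (num_real (f x))) -(real_normK (num_real (g x))).
have := sqr_ge0 (`|f x| - `|g x|); have := sqr_ge0 (`|f x| + `|g x|); nra.
Qed.

Lemma sqi_lin (c : R) f g : sqi f -> sqi g -> sqi (fun x => c * f x + g x).
Proof.
move=> hf hg; split.
  apply: measurable_funD; last exact: hg.1.
  by apply: measurable_funM => //; exact: hf.1.
apply: eq_integrable (intgD (intgD (intgZ (c ^+ 2) hf.2) (intgZ (2 * c) (sqi_mul hf hg))) hg.2) => //.
move=> x _ /=; congr EFin; ring.
Qed.

Definition dot f g : R := \int[mu]_(x in D) (f x * g x).

Lemma sqi_subsp : subsp (sqi : set (T -> R^o)).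
Proof.
split; last by move=> c u v; exact: sqi_lin.
split; first exact: measurable_cst.
by apply: eq_integrable intg0 => // x _; rewrite /= expr0n.
Qed.

Lemma dot_psd : psd_on (sqi : set (T -> R^o)) dot.
Proof.
have lin w : sqi w -> lin_on (sqi : set (T -> R^o)) (dot ^~ w).
  move=> sw c u v su sv; rewrite /dot -RintegralZl//; last exact: sqi_mul.
  rewrite -RintegralD//; [|by apply: intgZ; exact: sqi_mul|exact: sqi_mul].
  by apply: eq_Rintegral => x _; rewrite !fctE /GRing.scale /=; ring.
have sym u v : dot u v = dot v u.
  by apply: eq_Rintegral => x _; rewrite mulrC.
split; [split => // u su c v w sv sw|by []|].
  by rewrite !(sym u); exact: lin.
by move=> u su; apply: Rintegral_ge0 => x _; rewrite -expr2 sqr_ge0.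
Qed.

Lemma Rint_ge0_le0 f : intg f -> (forall x, D x -> 0 <= f x) ->
  \int[mu]_(x in D) f x <= 0 -> {ae mu, forall x, D x -> f x = 0}.
Proof.
move=> hf f0 f1.
have : (\int[mu]_(x in D) `|(EFin \o f) x| = 0)%E.
  rewrite (eq_integral (fun x => (f x)%:E)).
    rewrite -EFin_Rint//; congr EFin; apply/eqP.
    by rewrite eq_le f1 Rintegral_ge0.
  by move=> x /set_mem Dx; rewrite /= ger0_norm// f0.
move/ae_eq_integral_abs; move=> /(_ mD (measurable_int mu hf)).
by apply: filterS => x h /h [].
Qed.

(** The series of the [2 ^+ n * q n x ^+ 2] has integral at most the sum of the [2^-n], hence is
    finite almost everywhere, and [q n x] is at most [2 ^+ n * q n x ^+ 2 + 2^-n]. Splitting each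
    term this way avoids any assumption that the measure is finite. *)
Lemma fast_summable (q : nat -> T -> R) :
  (forall n, measurable_fun D (q n)) -> (forall n x, 0 <= q n x) ->
  (forall n, \int[mu]_(x in D) (q n x ^+ 2)%:E <= (4^-1 ^+ n)%:E)%E ->
  {ae mu, forall x, D x -> cvgn (series (fun n => q n x))}.
Proof.
move=> mq q0 qi.
pose F n x : \bar R := (2 ^+ n * q n x ^+ 2)%:E.
have F0 n x : (0 <= F n x)%E by rewrite lee_fin mulr_ge0 ?exprn_ge0 ?sqr_ge0.
have mF n : measurable_fun D (F n).
  by apply/measurable_EFinP; apply: measurable_funM => //; exact: measurable_funX.
(* The bound is [2^-n], in the form that [epsilon_trick0] sums. *)
have Fi n : (\int[mu]_(x in D) F n x <= ((2 / (2 ^ n.+1)%:R) : R)%:E)%E.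
  rewrite /F; under eq_integral do rewrite EFinM.
  rewrite ge0_integralZl//; last 2 first.
  - by apply/measurable_EFinP; exact: measurable_funX.
  - by move=> x _; rewrite lee_fin sqr_ge0.
  apply: le_trans (lee_wpmul2l _ (qi n)) _; first by rewrite lee_fin exprn_ge0.
  rewrite -EFinM lee_fin -exprMn natrX exprS invfM mulrA mulfV// mul1r -exprVn.
  by apply: lerXn2r; rewrite ?nnegrE; lra.
have Foo : (\int[mu]_(x in D) (\sum_(n <oo) F n x) < +oo)%E.
  rewrite integral_nneseries//.
  apply: le_lt_trans (lee_nneseries _ _) _.
  - by move=> n _ _; apply: integral_ge0 => x _.
  - by move=> n _; exact: Fi.
  apply: le_lt_trans (epsilon_trick0 _ _) _ => //.
  by rewrite ltry.
have SF0 x : (0 <= \sum_(n <oo) F n x)%E by apply: nneseries_ge0.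
have mS : measurable_fun D (fun x => \sum_(n <oo) F n x)%E.
  exact: ge0_emeasurable_sum.
have /(integrable_ae mD) : mu.-integrable D (fun x => \sum_(n <oo) F n x)%E.
  apply/integrableP; split => //.
  by rewrite (eq_integral (fun x => \sum_(n <oo) F n x)%E)// => x _; rewrite gee0_abs.
apply: filterS => x h /h {}h.
apply: nondecreasing_is_cvgn.
  by apply/nondecreasing_seqP => n; rewrite /series /= big_nat_recr//= lerDl.
exists (fine (\sum_(n <oo) F n x)%E + 2) => _ [n _ <-].
rewrite /series /= big_mkord.
have h1 : \sum_(i < n) 2 ^+ i * q i x ^+ 2 <= fine (\sum_(n <oo) F n x)%E.
  rewrite -lee_fin fineK// -sumEFin.
  have := @nneseries_lim_ge _ (F ^~ x) xpredT 0 n (fun k _ _ => F0 k x).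
  by rewrite big_mkord.
have h2 : \sum_(i < n) (2^-1 : R) ^+ i <= 2.
  have -> : \sum_(i < n) (2^-1 : R) ^+ i = 2 - 2 * 2^-1 ^+ n.
    elim: n {h1} => [|n IH]; first by rewrite big_ord0 expr0; ring.
    by rewrite big_ord_recr /= IH exprS; field.
  by rewrite gerBl mulr_ge0// exprn_ge0// invr_ge0.
apply: le_trans (lerD h1 h2); rewrite -big_split /=.
apply: ler_sum => i _.
have : (2 ^+ i : R) * 2^-1 ^+ i = 1 by rewrite -exprMn mulfV// expr1n.
have : 0 < (2 ^+ i : R) by rewrite exprn_gt0.
move: (2 ^+ i) (2^-1 ^+ i) (q i x) (q0 i x) => a b c c0 a0 ab.
have b0 : 0 < b by nra.
have : 0 <= a * (c - b) ^+ 2 by rewrite mulr_ge0 ?sqr_ge0// ltW.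
have -> : a * (c - b) ^+ 2 = a * c ^+ 2 - 2 * c * (a * b) + (a * b) * b by ring.
rewrite ab; lra.
Qed.

End integrable_toolkit.

(** * Completeness of square-integrable fields *)

Section riesz_fischer.
Context d (T : measurableType d) (R : realType) (mu : {measure set T -> \bar R}).
Variables (D : set T) (mD : measurable D).
Variables (X : lmodType R) (S : set X) (q : X -> X -> R).
Hypotheses (hS : subsp S) (hq : psd_on S q).
Local Notation N := (nrm q).

Definition complete_on := forall u : nat -> X, (forall n, S (u n)) ->
  (forall e : R, 0 < e -> exists K, forall n m, (K <= n)%N -> (K <= m)%N ->
     N (u n - u m) <= e) ->
  exists2 l, S l & (fun n => N (u n - l)) @ \oo --> (0 : R).

Lemma nrm_tele (u : nat -> X) n m : (forall n, S (u n)) -> (n <= m)%N ->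
  N (u m - u n) <= series (fun k => N (u k.+1 - u k)) m
                   - series (fun k => N (u k.+1 - u k)) n.
Proof.
move=> Su; elim: m => [|m IH].
  by rewrite leqn0 => /eqP ->; rewrite !subrr (nrm0 hS hq).
rewrite leq_eqVlt => /orP[/eqP->|]; first by rewrite !subrr (nrm0 hS hq).
rewrite ltnS => nm; rewrite {1}/series /= big_nat_recr//=.
rewrite addrAC; apply: le_trans (lerD (IH nm) (lexx _)).
have -> : u m.+1 - u n = (u m - u n) + (u m.+1 - u m).
  by rewrite [RHS]addrC addrA subrK.
by apply: (nrm_triangle hS hq); apply: subspB.
Qed.

Lemma series_nrm_cauchy (u : nat -> X) : (forall n, S (u n)) ->
  cvgn (series (fun k => N (u k.+1 - u k))) ->
  forall e : R, 0 < e -> exists K, forall n m, (K <= n)%N -> (K <= m)%N ->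
     N (u n - u m) <= e.
Proof.
move=> Su /cvg_ex[l /cvgrPdist_lt sl] e e0.
have [K _ hK] := sl _ (divr_gt0 e0 (ltr0n R 2)).
exists K => n m.
wlog nm : n m / (n <= m)%N => [hw Kn Km|Kn Km].
  have [nm|/ltnW mn] := leqP n m; first exact: hw.
  by rewrite (nrm_distC hS hq)//; exact: hw.
rewrite (nrm_distC hS hq)//; apply: le_trans (nrm_tele Su nm) _.
have := hK _ Kn; have := hK _ Km; rewrite !ltr_norml; lra.
Qed.

Hypothesis cS : complete_on.
Variable w : nat -> T -> X.
Hypothesis Sw : forall n x, S (w n x).
Hypothesis mw : forall n, measurable_fun D (fun x => N (w n x)).
Hypothesis mww : forall n m, measurable_fun D (fun x => N (w n x - w m x)).
Hypothesis cw : forall e : R, 0 < e -> exists K, forall n m,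
  (K <= n)%N -> (K <= m)%N ->
  (\int[mu]_(x in D) (N (w n x - w m x) ^+ 2)%:E <= e%:E)%E.

(** Serves twice: with real values for the completeness of L^2, and with values in V for the limit
    in time. A subsequence with summable increments converges pointwise outside a null set, and
    Fatou's lemma turns the Cauchy bounds into convergence in mean. Only norms are required to be
    measurable, since [X] has no sigma-algebra. *)
Lemma riesz_fischer : exists (f : nat -> nat) (E : set T) (u : T -> X),
  [/\ measurable E, E `<=` D, mu.-negligible (D `\` E),
      forall x, S (u x) /\ (~ E x -> u x = 0) &
      [/\ forall x, E x -> (fun k => N (w (f k) x - u x)) @ \oo --> (0 : R),
          forall n, measurable_fun D (fun x => N (w n x - u x)) &
          forall e : R, 0 < e -> exists K, forall n, (K <= n)%N ->
          (\int[mu]_(x in D) (N (w n x - u x) ^+ 2)%:E <= e%:E)%E]].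
Proof.
have e4 n : (0 : R) < 4^-1 ^+ n by rewrite exprn_gt0.
pose K n := sval (cid (cw (e4 n))).
have KP n := svalP (cid (cw (e4 n))).
(* Strictly increasing and above each [K n], so consecutive terms satisfy the bounds [4^-n]. *)
pose f n := (\sum_(i < n.+1) (K i).+1)%N.
have fK n : (K n <= f n)%N by rewrite /f big_ord_recr /= addnS ltnW// ltnS leq_addl.
have fS n : (f n < f n.+1)%N by rewrite /f [ltnRHS]big_ord_recr /= addnS ltnS leq_addr.
have /(fast_summable mD) : forall n, measurable_fun D (fun x => N (w (f n.+1) x - w (f n) x)).
  by move=> n; exact: mww.
have q0 n x : 0 <= N (w (f n.+1) x - w (f n) x) by exact: nrm_ge0.
have qi n : (\int[mu]_(x in D) (N (w (f n.+1) x - w (f n) x) ^+ 2)%:E <= (4^-1 ^+ n)%:E)%E.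
  exact: KP (leq_trans (fK n) (ltnW (fS n))) (fK n).
move=> /(_ mu q0 qi) [B [mB B0 subB]].
pose E := D `\` B.
have mE : measurable E by exact: measurableD.
have Elim x : E x -> {l | S l & (fun k => N (w (f k) x - l)) @ \oo --> (0 : R)}.
  move=> [Dx nB]; apply: cid2; apply: cS => // e e0.
  apply: (series_nrm_cauchy (u := fun k => w (f k) x)) => //.
  by apply: contrapT => h; apply: nB; apply: subB => /= /(_ Dx).
(* The value 0 off [E] keeps [u] in [S] and makes the norm of [w n - u] there equal to that of
   [w n], which is measurable. *)
pose u x := if pselect (E x) is left Ex then s2val (Elim x Ex) else 0.
have Su x : S (u x).
  by rewrite /u; case: pselect => [Ex|_]; [case: (Elim x Ex)|exact: subsp0].
have uE x : E x -> (fun k => N (w (f k) x - u x)) @ \oo --> (0 : R).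
  by move=> Ex; rewrite /u; case: pselect => [Ex'|//]; case: (Elim x Ex').
have u0 x : ~ E x -> u x = 0 by rewrite /u; case: pselect.
have DE : D = E `|` (D `&` B).
  by rewrite /E setDE setIC [X in _ `|` X]setIC -setIUl setUC setUv setTI.
have wlim n x : E x -> (fun k => N (w n x - w (f k) x)) @ \oo --> N (w n x - u x).
  move=> Ex; apply/cvgrPdist_le => e e0.
  have /cvgrPdist_le/(_ _ e0) := uE _ Ex; apply: filterS => k.
  rewrite sub0r normrN (ger0_norm (nrm_ge0 _ _)); apply: le_trans.
  apply: le_trans (nrm_dist hS hq (subspB hS (Sw n x) (Su x)) (subspB hS (Sw n x) (Sw (f k) x))) _.
  by rewrite opprB addrC addrA subrK.
have mwu n : measurable_fun E (fun x => N (w n x - u x)).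
  apply: (measurable_fun_cvg (h := fun k x => N (w n x - w (f k) x))).
    by move=> k; apply: measurable_funS (mww n (f k)) => //; exact: subDsetl.
  by move=> x Ex; exact: wlim.
have mwuD n : measurable_fun D (fun x => N (w n x - u x)).
  rewrite DE; apply/measurable_funU => //; first exact: measurableI.
  split => //.
  apply: (eq_measurable_fun (fun x => N (w n x))).
    by move=> x /set_mem[_ Bx]; rewrite u0 ?subr0// => -[].
  by apply: measurable_funS (mw n) => //; exact: subIsetl.
have DB : mu.-negligible (D `\` E).
  by exists B; split => // x [Dx nE]; apply: contrapT => nB; apply: nE.
exists f, E, u; split; [by []|exact: subDsetl|by []| |].
  by move=> x; split; [exact: Su|exact: u0].
split; [exact: uE|exact: mwuD|move=> e e0].
have [K0 hK] := cw e0; exists K0 => n Kn.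
have -> : (\int[mu]_(x in D) (N (w n x - u x) ^+ 2)%:E =
           \int[mu]_(x in E) (N (w n x - u x) ^+ 2)%:E)%E.
  rewrite [LHS](ge0_negligible_integral mB mD)//.
  - by apply/measurable_EFinP; exact: measurable_funX.
  - by move=> x _; rewrite lee_fin sqr_ge0.
have mws k : measurable_fun E (fun x => (N (w n x - w (f k) x) ^+ 2)%:E).
  apply/measurable_EFinP; apply: measurable_funX.
  by apply: measurable_funS (mww n (f k)) => //; exact: subDsetl.
have w0 k x : E x -> (0 <= (N (w n x - w (f k) x) ^+ 2)%:E)%E by rewrite lee_fin sqr_ge0.
(* For fixed [n], the Cauchy bound for [w n - w (f k)] passes to the limit in [k]. *)
have := fatou mu mE mws w0.
have -> : (\int[mu]_(x in E) limn_einf (fun k => (N (w n x - w (f k) x) ^+ 2)%:E))%E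
  = (\int[mu]_(x in E) (N (w n x - u x) ^+ 2)%:E)%E.
  apply: eq_integral => x /set_mem Ex; apply: (cvg_limn_einf_sup _).1.
  by apply: cvg_EFin; [exact: nearW|apply: cvgM; exact: wlim].
move=> /le_trans; apply.
rewrite limn_einf_lim; apply: lime_le; first exact: is_cvg_einfs.
exists K0 => // k Kk; apply: le_trans (_ : _ <= \int[mu]_(x in E) (N (w n x - w (f k) x) ^+ 2)%:E)%E _.
  by apply: ereal_inf_lbound; exists k => //=.
apply: le_trans (hK n (f k) Kn _).
  apply: ge0_subset_integral => //; last exact: subDsetl.
  - by apply/measurable_EFinP; exact: measurable_funX.
  - by move=> x _; rewrite lee_fin sqr_ge0.
have kf : (k <= f k)%N by elim: (k) => // m IH; exact: leq_ltn_trans IH (fS m).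
exact: leq_trans Kk kf.
Qed.

End riesz_fischer.

(** * Finite-valued maps and simple fields *)

Section finite_valued.
Context d (T : measurableType d).

(** No sigma-algebra on [Y] is involved: a composite of such a map with an arbitrary function is
    again of this kind. Norms and forms evaluated on step functions are measurable for this reason
    alone. *)
Definition finval (Y : Type) (w : T -> Y) :=
  finite_set (range w) /\ forall B : set Y, measurable (w @^-1` B).

Lemma finvalP (Y : Type) (w : T -> Y) : finite_set (range w) ->
  (forall y, measurable (w @^-1` [set y])) -> finval w.
Proof.
move=> fw mw; split => // B.
have -> : w @^-1` B = \bigcup_(y in range w `&` B) w @^-1` [set y].
  apply/seteqP; split => [t Bt|t [y [_ By] /= ->//]].
  by exists (w t) => //; split => //; exists t.
by apply: fin_bigcup_measurable => //; exact: finite_setIl.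
Qed.

Lemma finval_cst (Y : Type) (y : Y) : finval (fun=> y).
Proof.
split=> [|B]; last by rewrite preimage_cst; case: ifP => _; [exact: measurableT|exact: measurable0].
by apply: (sub_finite_set (B := [set y])); [move=> _ [t _ <-]|exact: finite_set1].
Qed.

Lemma finval_indic (R : realType) (A : set T) : measurable A ->
  finval (\1_A : T -> R).
Proof.
move=> mA; split => [|B].
  apply: (sub_finite_set (B := [set 0; 1])); last by rewrite finite_setU; split; exact: finite_set1.
  by move=> _ [t _ <-]; rewrite /= indicE; case: (_ \in _); [right|left].
have -> : (\1_A : T -> R) @^-1` B = (A `&` [set _ | B 1]) `|` (~` A `&` [set _ | B 0]).
  apply/seteqP; split => t /=; rewrite indicE.
    by have [At|nAt] := pselect (A t); [rewrite mem_set//; left|rewrite memNset//; right].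
  by move=> [[At]|[nAt]]; [rewrite mem_set|rewrite memNset].
have mQ (Q : Prop) : measurable [set _ : T | Q].
  have [q|q] := pselect Q.
    by rewrite (_ : mkset _ = setT)//; apply/seteqP; split.
  by rewrite (_ : mkset _ = set0)//; apply/seteqP; split.
by apply: measurableU; apply: measurableI => //; exact: measurableC.
Qed.

Lemma finval_comp (Y Z : Type) (w : T -> Y) (g : Y -> Z) :
  finval w -> finval (g \o w).
Proof.
move=> [fw mw]; split => [|B]; last by rewrite comp_preimage; exact: mw.
apply: (sub_finite_set (B := g @` range w)); last exact: finite_image.
by move=> _ [t _ <-]; exists (w t) => //; exists t.
Qed.

Lemma finval_pair (Y Z : Type) (w : T -> Y) (w' : T -> Z) :
  finval w -> finval w' -> finval (fun t => (w t, w' t)).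
Proof.
move=> [fw mw] [fw' mw']; apply: finvalP.
  apply: sub_finite_set (finite_setX fw fw').
  by move=> _ [t _ <-]; split => /=; exists t.
move=> [y z]; have -> : (fun t => (w t, w' t)) @^-1` [set (y, z)] =
   w @^-1` [set y] `&` w' @^-1` [set z].
  by apply/seteqP; split => t /=; [move=> [-> ->]|move=> [-> ->]].
exact: measurableI.
Qed.

Lemma finval_measurable d' (Z : measurableType d') (w : T -> Z) (D : set T) :
  finval w -> measurable_fun D w.
Proof. by move=> [_ mw] mD B mB; apply: measurableI => //; exact: mw. Qed.

Lemma finval_bounded (R : realType) (w : T -> R) : finval w ->
  exists C : R, forall t, `|w t| <= C.
Proof.
move=> [/finite_seqP[s ws] _]; exists (\sum_(y <- s) `|y|) => t.
have : w t \in s.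
  have : range w (w t) by exists t.
  by rewrite ws.
elim: s {ws} => // y s IH; rewrite big_cons inE => /orP[/eqP ->|/IH h].
  by rewrite lerDl sumr_ge0.
by apply: le_trans h _; rewrite lerDr.
Qed.

End finite_valued.

Section simple_fields.
Variables (R : realType) (X : lmodType R).
Implicit Types (S : set X) (w : R -> X).

(** The class of approximating fields that occurs in [strongly_measurable]. *)
Definition simple_in S w := exists (m : nat) (A : 'I_m -> set R) (x : 'I_m -> X),
  (forall i, measurable (A i) /\ S (x i)) /\
  w = (fun t => \sum_(i < m) (\1_(A i) t : R) *: x i).

Lemma simple_finval S w : simple_in S w -> finval w.
Proof.
move=> [m [A [x [mA ->]]]].
elim: m A x mA => [|m IH] A x mA.
  under eq_fun do rewrite big_ord0; exact: finval_cst.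
under eq_fun do rewrite big_ord_recr /=.
have h1 := IH (fun i => A (widen_ord (leqnSn m) i))
  (fun i => x (widen_ord (leqnSn m) i)) (fun i => mA _).
have h2 := @finval_indic _ _ R _ (mA ord_max).1.
exact: (finval_comp (fun p : X * R => p.1 + p.2 *: x ord_max) (finval_pair h1 h2)).
Qed.

Lemma simple_in_sub S S' w : S `<=` S' -> simple_in S w -> simple_in S' w.
Proof.
move=> SS' [m [A [x [mA ->]]]]; exists m, A, x; split => // i.
by have [? ?] := mA i; split => //; exact: SS'.
Qed.

Lemma simple_mem S w t : subsp S -> simple_in S w -> S (w t).
Proof.
move=> hS [m [A [x [mA ->]]]]; apply: subsp_sum => // i _; apply: subspZ => //.
by have [] := mA i.
Qed.

Lemma simple_lin S (c : R) w w' : subsp S -> simple_in S w -> simple_in S w' ->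
  simple_in S (fun t => c *: (w t + w' t)).
Proof.
move=> hS [m [A [x [mA ->]]]] [m' [A' [x' [mA' ->]]]].
exists (m + m')%N, (fun i => match fintype.split i with inl j => A j | inr j => A' j end),
  (fun i => c *: match fintype.split i with inl j => x j | inr j => x' j end); split.
  move=> i; case: (fintype.split i) => j; [have [? ?] := mA j|have [? ?] := mA' j];
  by split => //; exact: subspZ.
apply/funext => t; rewrite big_split_ord /= scalerDr !scaler_sumr.
congr (_ + _); apply: eq_bigr => i _.
  rewrite (_ : fintype.split (lshift m' i) = inl i) ?scalerA 1?mulrC//.
  by rewrite -[lshift _ _]/(unsplit (inl i)) unsplitK.
rewrite (_ : fintype.split (rshift m i) = inr i) ?scalerA 1?mulrC//.
by rewrite -[rshift _ _]/(unsplit (inr i)) unsplitK.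
Qed.

End simple_fields.

(** * Time discretization of an abstract evolution equation *)

Section time_steps.
Variables (R : realType) (T : R) (hT : 0 < T) (n : nat).
Local Notation mu := (@lebesgue_measure R).
Local Notation I := (`]0, T[%classic : set R).

Definition tau : R := T / n.+1%:R.

(** For [k <= n] the intersection with the open time interval only removes the point 0 from the
    first step, so these sets partition the open interval from 0 to [T]. *)
Definition Jstep (k : nat) : set R := I `&` `[k%:R * tau, k.+1%:R * tau[%classic.

Lemma tau_gt0 : 0 < tau. Proof. by rewrite divr_gt0. Qed.

Lemma tauE : n.+1%:R * tau = T. Proof. by rewrite /tau mulrC divfK. Qed.

Lemma ktau_le k : (k <= n.+1)%N -> k%:R * tau <= T.
Proof. by move=> kn; rewrite -tauE ler_pM2r ?tau_gt0// ler_nat. Qed.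

Lemma ktau_ge0 k : 0 <= k%:R * tau.
Proof. by rewrite mulr_ge0// ltW ?tau_gt0. Qed.

Lemma ktauS k : k.+1%:R * tau = k%:R * tau + tau.
Proof. by rewrite -natr1 mulrDl mul1r. Qed.

Lemma Jstep_measurable k : measurable (Jstep k : set (measurableTypeR R)).
Proof. by apply: measurableI; exact: measurable_itv. Qed.

Lemma JstepP k t : Jstep k t <-> [/\ 0 < t < T, k%:R * tau <= t & t < k.+1%:R * tau].
Proof.
rewrite /Jstep /=; split; rewrite !in_itv /=; first by move=> [-> /andP[-> ->]].
by move=> [-> -> ->].
Qed.

Lemma Jstep_inj k j t : Jstep k t -> Jstep j t -> k = j.
Proof.
move=> /JstepP[_ h1 h2] /JstepP[_ h3 h4]; apply/eqP; rewrite eqn_leq.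
apply/andP; split; rewrite -ltnS -(ltr_nat R) -(ltr_pM2r tau_gt0).
  exact: le_lt_trans h1 h4.
exact: le_lt_trans h3 h2.
Qed.

Lemma Jstep_ex t : I t -> exists2 k, (k <= n)%N & Jstep k t.
Proof.
move=> It; have := It; rewrite /= in_itv /= => /andP[t0 tT].
have h0 : 0 <= t / tau by rewrite divr_ge0// ltW// tau_gt0.
have /andP[h1 h2] := truncn_itv h0.
rewrite ler_pdivlMr ?tau_gt0// in h1; rewrite ltr_pdivrMr ?tau_gt0// in h2.
exists (Num.truncn (t / tau)); last by apply/JstepP; split => //; rewrite t0.
rewrite -ltnS -(ltr_nat R) -(ltr_pM2r tau_gt0) tauE.
exact: le_lt_trans h1 tT.
Qed.

Lemma Jstep_union k : (k <= n)%N ->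
  `]0, k.+1%:R * tau[%classic = `]0, k%:R * tau[%classic `|` Jstep k.
Proof.
move=> kn; have kT : k.+1%:R * tau <= T by exact: ktau_le.
have t0 := tau_gt0; have k0 := ktau_ge0 k.
apply/seteqP; split => t.
  rewrite /= in_itv /= => /andP[h1 h2].
  have [h|h] := ltP t (k%:R * tau); [left|right].
    by rewrite /= in_itv /= h1.
  by apply/JstepP; split => //; rewrite h1 (lt_le_trans h2).
move=> [|/JstepP[/andP[h1 h2] h3 h4]]; rewrite /= !in_itv /=; last by rewrite h1.
by move=> /andP[-> h]; rewrite /= ktauS ltr_wpDr// ltW.
Qed.

Lemma mu_itvoo0 (x : R) : 0 <= x -> mu `]0, x[%classic = x%:E.
Proof.
move=> x0; rewrite lebesgue_measure_itv /= lte_fin; case: ltgtP x0 => // [x0 _|<-//].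
by rewrite -EFinD subr0.
Qed.

Lemma sub_itv0 (x y : R) : x <= y -> `]0, x[%classic `<=` (`]0, y[%classic : set R).
Proof.
by move=> xy t /=; rewrite !in_itv /= => /andP[-> tx]; rewrite (lt_le_trans tx).
Qed.

Lemma Jstep_disj k : [disjoint `]0, k%:R * tau[%classic & Jstep k].
Proof.
apply/disj_set2P/seteqP; split => // t [/=]; rewrite in_itv /= => /andP[_ h1].
by move=> /JstepP[_ h2 _]; move: (lt_le_trans h1 h2); rewrite ltxx.
Qed.

(** By additivity, as the difference of the lengths of two initial intervals; infinite values are
    excluded before cancelling. *)
Lemma mu_Jstep k : (k <= n)%N -> mu (Jstep k) = tau%:E.
Proof.
move=> kn.
have /disj_set2P dJ := Jstep_disj k.
have := measureU mu (measurable_itv `]0, k%:R * tau[) (Jstep_measurable k) dJ.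
rewrite -Jstep_union// => h.
have h1 := mu_itvoo0 (ktau_ge0 k.+1); have h2 := mu_itvoo0 (ktau_ge0 k).
move: h; rewrite [LHS]h1 [X in (_ = X + _)%E]h2 ktauS EFinD.
pose x : \bar R := mu (Jstep k).
rewrite -[X in _ = (_ + X)%E]/x -[X in _ -> X = _]/x.
case: x => [r| |]; rewrite -?EFinD // => -[h]; congr EFin.
by apply: (@addrI _ (k%:R * tau)); rewrite -h.
Qed.

Lemma Jstep_sum (g : R -> R) K : mu.-integrable I (EFin \o g) -> (K <= n.+1)%N ->
  \sum_(k < K) \int[mu]_(t in Jstep k) g t = \int[mu]_(t in `]0, K%:R * tau[) g t.
Proof.
move=> ig; elim: K => [_|K IH Kn].
  by rewrite big_ord0 mul0r set_itvoo0 Rintegral_set0.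
rewrite big_ord_recr /= IH; last exact: ltnW.
rewrite Jstep_union// Rintegral_setU//; first exact: Jstep_measurable.
  apply: integrableS ig => //.
    by apply: measurableU => //; exact: Jstep_measurable.
  by rewrite -Jstep_union//; apply: sub_itv0; exact: ktau_le.
exact: Jstep_disj.
Qed.

Section step_function.
Variables (X : lmodType R) (U : nat -> X).

Definition stepf (t : R) : X := \sum_(k < n.+1) (\1_(Jstep k) t : R) *: U k.

Lemma stepfE k t : (k <= n)%N -> Jstep k t -> stepf t = U k.
Proof.
move=> kn Jt; rewrite /stepf (bigD1 (Ordinal (kn : (k < n.+1)%N)))//= big1.
  by rewrite indicE mem_set// scale1r addr0.
move=> j jk; rewrite indicE memNset ?scale0r// => Jj.
by move: jk; rewrite (_ : j = Ordinal (kn : (k < n.+1)%N)) ?eqxx//; apply: val_inj;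
   exact: Jstep_inj Jj Jt.
Qed.

Lemma stepf_simple (S : set X) : (forall k, S (U k)) -> simple_in S stepf.
Proof.
move=> SU; exists n.+1, (fun k => Jstep k), (fun k => U k); split => // i.
by split => //; exact: Jstep_measurable.
Qed.

End step_function.

Lemma itv0T_finite : (mu I < +oo)%E.
Proof. by rewrite mu_itvoo0 ?ltry// ltW. Qed.

Lemma bounded_time_int (g : R -> R) (C : R) : measurable_fun I g ->
  (forall t, I t -> `|g t| <= C) -> mu.-integrable I (EFin \o g).
Proof.
move=> mg gC; apply: (@intg_bounded _ _ _ mu I (measurable_itv `]0, T[) _ C) => //.
exact: itv0T_finite.
Qed.

(** [Phi] is arbitrary: applied to two finite-valued fields it takes finitely many values, so it is
    bounded and measurable. *)
Lemma simple_integrable (X Y : lmodType R) (S : set X) (S' : set Y)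
    (u : R -> X) (l : R -> Y) (Phi : X -> Y -> R) :
  simple_in S u -> simple_in S' l ->
  mu.-integrable I (EFin \o (fun t => Phi (u t) (l t))).
Proof.
move=> /simple_finval su /simple_finval sl.
have h := finval_comp (fun p => Phi p.1 p.2) (finval_pair su sl).
have [C hC] := finval_bounded h.
apply: (@bounded_time_int _ C); first exact: finval_measurable h.
by move=> t _; exact: hC.
Qed.

Lemma stepf_integral (X Y : lmodType R) (U : nat -> X) (L : nat -> Y) (Phi : X -> Y -> R) :
  \int[mu]_(t in I) Phi (stepf U t) (stepf L t) =
  \sum_(k < n.+1) tau * Phi (U k) (L k).
Proof.
have := Jstep_sum (simple_integrable Phi (stepf_simple (S := setT) (U := U) (fun _ => Logic.I))
  (stepf_simple (S := setT) (U := L) (fun _ => Logic.I))) (leqnn _).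
rewrite tauE => <-; apply: eq_bigr => k _.
rewrite (@eq_Rintegral _ _ _ mu _ (fun=> Phi (U k) (L k))).
  rewrite Rintegral_cst; last exact: Jstep_measurable.
  rewrite mulrC; congr (_ * _).
  have kn : (k <= n)%N by rewrite -ltnS.
  exact: (congr1 fine (mu_Jstep kn)).
by move=> t /set_mem Jt; rewrite !(stepfE _ _ Jt)// -ltnS.
Qed.

End time_steps.

Section time_hoelder.
Variables (R : realType) (T : R) (hT : 0 < T).
Local Notation mu := (@lebesgue_measure R).
Local Notation I := (`]0, T[%classic : set (measurableTypeR R)).

Lemma sub_itv0_int (g : R -> R) (t : R) : t <= T -> mu.-integrable I (EFin \o g) ->
  mu.-integrable `]0, t[ (EFin \o g).
Proof. by move=> tT; apply: integrableS => //; exact: sub_itv0. Qed.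

(* Cauchy-Schwarz against the indicator of the time interval [s, t] *)
Lemma primitive_hoelder (g G : R -> R) (s t : R) : 0 <= s -> s <= t -> t <= T ->
  measurable_fun I g -> (forall x, I x -> `|g x| <= G x) -> sqi mu I G ->
  `|\int[mu]_(x in `]0, t[) g x - \int[mu]_(x in `]0, s[) g x| <=
  Num.sqrt (\int[mu]_(x in I) G x ^+ 2) * Num.sqrt (t - s).
Proof.
move=> s0 st tT mg gG sG.
have mI : measurable I by exact: measurable_itv.
have sg : sqi mu I g.
  split => //; apply: (intg_le mI _ _ sG.2); first exact: measurable_funX.
  move=> x Ix; have := gG _ Ix; have := normr_ge0 (g x).
  by rewrite normrX => h1 h2; apply: lerXn2r; rewrite ?nnegrE//; lra.
have s1 : sqi mu I (fun=> 1 : R).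
  split; first exact: measurable_cst.
  by apply: (bounded_time_int hT (C := 1)) => // x _; rewrite expr1n normr1.
have ig : mu.-integrable I (EFin \o g).
  by apply: eq_integrable (sqi_mul mI sg s1) => // x _; rewrite /= mulr1.
pose B : set (measurableTypeR R) := `]0, t[%classic `\` `]0, s[%classic.
have mB : measurable B by apply: measurableD; exact: measurable_itv.
have BI : B `<=` I by move=> x [xt _]; exact: sub_itv0 tT _ xt.
have dB : `]0, s[%classic `&` B = set0.
  by apply/seteqP; split => // x [? []].
have UB : `]0, t[%classic = `]0, s[%classic `|` B.
  by rewrite /B setDUK//; exact: sub_itv0.
have muB : mu B = (t - s)%:E.
  have := measureU mu (measurable_itv `]0, s[) mB dB.
  rewrite -UB => h.
  have h1 := mu_itvoo0 (le_trans s0 st); have h2 := mu_itvoo0 s0.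
  move: h; rewrite [LHS]h1 [X in (_ = X + _)%E]h2.
  pose x : \bar R := mu B.
  rewrite -[X in _ = (_ + X)%E]/x -[X in _ -> X = _]/x.
  case: x => [r| |]; rewrite -?EFinD // => -[->]; congr EFin.
  by rewrite addrC addKr.
rewrite UB Rintegral_setU//; last 2 first.
- by rewrite -UB; exact: sub_itv0_int.
- exact/disj_set2P.
rewrite addrC addKr -(setIidr BI) Rintegral_mkcondr.
have sB : sqi mu I (\1_B : R -> R).
  split; first exact: measurable_indic.
  apply: (bounded_time_int hT (C := 1)) => [|x _].
    by apply: measurable_funX; exact: measurable_indic.
  by rewrite indicE; case: (_ \in _); rewrite ?expr1n ?normr1// expr0n /= normr0.
have -> : \int[mu]_(x in I) (g \_ B) x = dot mu I g (\1_B : R -> R).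
  by apply: eq_Rintegral => x _; rewrite patchE indicE; case: ifPn => _; rewrite ?mulr1 ?mulr0.
apply: le_trans (psd_CS (sqi_subsp mu mI) (dot_psd mu mI) sg sB) _.
apply: ler_pM; rewrite ?nrm_ge0//; apply: ler_wsqrtr.
  apply: le_Rintegral => //.
    by apply: eq_integrable sg.2 => // x _; rewrite /= expr2.
  - exact: sG.2.
  - move=> x Ix; have := gG _ Ix; have := normr_ge0 (g x).
  by rewrite -expr2 -(real_normK (num_real (g x))) => h1 h2; apply: lerXn2r; rewrite ?nnegrE//; lra.
rewrite /dot (@eq_Rintegral _ _ _ mu _ (\1_B : R -> R)); last first.
  by move=> x _; rewrite indicE; case: (_ \in _); rewrite ?mulr1 ?mulr0.
rewrite /Rintegral integral_indic// (setIidl BI).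
by rewrite [X in fine X]muB.
Qed.

End time_hoelder.

(** Coercivity and skew-symmetry are asked on [D] only, where the approximations take their values.
    [es_b_le] is the shape given by Ladyzhenskaya's inequality. [kap v] expresses that against a
    test field both forms are continuous in H, so that strong convergence in H suffices in the
    quadratic term. *)
Record evolution_setting (R : realType) (X : lmodType R) (V D : set X)
    (ipH ipV a : X -> X -> R) (b : X -> X -> X -> R) (ca Ca Cb : R)
    (kap : X -> R) : Prop := EvolutionSetting {
  es_V : subsp V;
  es_D : subsp D;
  es_DV : D `<=` V;
  es_H : psd_on V ipH;
  es_ipV : psd_on V ipV;
  es_HV : forall u, V u -> ipH u u <= ipV u u;
  es_complete : complete_on V ipV;
  es_dense : forall v, V v -> forall e : R, 0 < e -> exists2 d, D d & nrm ipV (v - d) < e;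
  es_a : bil_on V a;
  es_a_le : forall u v, V u -> V v -> `|a u v| <= Ca * nrm ipV u * nrm ipV v;
  es_ca : 0 < ca;
  es_coer : forall u, D u -> ca * ipV u u <= a u u;
  es_b : forall w, V w -> bil_on V (b w);
  es_bl : forall v w, V v -> V w -> lin_on V (fun u => b u v w);
  es_b_le : forall u v w, V u -> V v -> V w ->
    `|b u v w| <= Cb * Num.sqrt (nrm ipH u * nrm ipV u) * nrm ipV v * nrm ipV w;
  es_skew : forall u v, D u -> D v -> b u v v = 0;
  es_kap0 : forall v, 0 <= kap v;
  es_a_smooth : forall u v, V u -> D v -> `|a u v| <= kap v * nrm ipH u;
  es_b_smooth : forall u w v, V u -> V w -> D v ->
    `|b u w v| <= kap v * nrm ipH u * nrm ipH w;
  es_compact : forall e : R, 0 < e -> exists2 s : seq X, (forall p, p \in s -> D p) &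
    forall w, D w -> nrm ipV w <= 1 -> exists2 p, p \in s & nrm ipH (w - p) <= e
}.

(** The bounds hold at every time rather than almost every one; [phi] stands for the dual norm of
    the force. *)
Record force_setting (R : realType) (X : lmodType R) (V : set X)
    (ipV : X -> X -> R) (T : R) (f : R -> X -> R) (phi : R -> R) : Prop :=
    ForceSetting {
  fs_meas : forall v, V v -> measurable_fun (`]0, T[ : set R) (f ^~ v);
  fs_lin : forall t, lin_on V (f t);
  fs_le : forall t v, V v -> `|f t v| <= phi t * nrm ipV v;
  fs_phi0 : forall t, 0 <= phi t;
  fs_phi : sqi (@lebesgue_measure R) `]0, T[ phi
}.

(** * The semi-implicit Galerkin scheme *)

Section approximation.
Variables (R : realType) (X : lmodType R) (V D : set X).
Variables (ipH ipV a : X -> X -> R) (b : X -> X -> X -> R) (ca Ca Cb : R) (kap : X -> R).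
Hypothesis ES : evolution_setting V D ipH ipV a b ca Ca Cb kap.
Variables (T : R) (hT : 0 < T) (f : R -> X -> R) (phi : R -> R).
Hypothesis FS : force_setting V ipV T f phi.
Local Notation mu := (@lebesgue_measure R).
Local Notation I := (`]0, T[%classic : set R).
Local Notation nH := (nrm ipH).
Local Notation nV := (nrm ipV).
Local Notation J := (Jstep T).

Let hV : subsp V := es_V ES.
Let hD : subsp D := es_D ES.
Let DV := es_DV ES.
Let psdHD : psd_on D ipH := psd_on_sub DV (es_H ES).
Let psdVD : psd_on D ipV := psd_on_sub DV (es_ipV ES).

Lemma nH_le_nV u : V u -> nH u <= nV u.
Proof. by move=> Vu; rewrite ler_wsqrtr// (es_HV ES). Qed.

Let mI : measurable (I : set (measurableTypeR R)). Proof. exact: measurable_itv. Qed.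
Let phi_int : mu.-integrable I (EFin \o phi).
Proof.
have h : sqi mu I (fun=> 1 : R).
  split; first exact: measurable_cst.
  apply: (@bounded_time_int _ _ hT _ 1) => //.
  by move=> x _; rewrite expr1n normr1.
have := sqi_mul mI (fs_phi FS) h.
by apply: eq_integrable => // x _; rewrite /= mulr1.
Qed.

Lemma force_int v : V v -> mu.-integrable I (EFin \o (f ^~ v)).
Proof.
move=> Vv; apply: (intg_le mI (fs_meas FS Vv) _ (intgZ mI (nV v) phi_int)).
by move=> t _; rewrite mulrC (fs_le FS).
Qed.

Lemma force_intJ n k v : V v -> mu.-integrable (J n k) (EFin \o (f ^~ v)).
Proof.
move=> Vv; apply: integrableS (force_int Vv) => //; first exact: Jstep_measurable.
exact: subIsetl.
Qed.

Lemma phi_intJ n k : mu.-integrable (J n k) (EFin \o phi).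
Proof.
apply: integrableS phi_int => //; first exact: Jstep_measurable.
exact: subIsetl.
Qed.

Lemma phi2_intJ n k : mu.-integrable (J n k) (EFin \o (fun t => phi t ^+ 2)).
Proof.
apply: integrableS (fs_phi FS).2 => //; first exact: Jstep_measurable.
exact: subIsetl.
Qed.

(** Not divided by the step length: the scheme is written multiplied by [tau]. *)
Definition fmean n k v : R := \int[mu]_(t in J n k) f t v.

Lemma fmean_lin n k : lin_on V (fmean n k).
Proof.
move=> c u v Vu Vv; have mJ := Jstep_measurable T n k.
rewrite /fmean -RintegralZl//; last exact: force_intJ.
rewrite -RintegralD//; [|apply: intgZ => //; exact: force_intJ|exact: force_intJ].
by apply: eq_Rintegral => t _; rewrite (fs_lin FS).
Qed.

Lemma fmean_le n k v : V v -> `|fmean n k v| <= (\int[mu]_(t in J n k) phi t) * nV v.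
Proof.
move=> Vv; have mJ := Jstep_measurable T n k.
apply: le_trans (le_normr_Rintegral mJ (force_intJ n k Vv)) _.
rewrite -RintegralZr//; last exact: phi_intJ.
apply: le_Rintegral => //; first by apply: intg_norm => //; exact: force_intJ.
  by apply: eq_integrable (intgZ mJ (nV v) (phi_intJ n k)) => // x _; rewrite /= mulrC.
by move=> t _; exact: fs_le FS _ _ Vv.
Qed.

(** Young's inequality with weight [ca]: the last term is half of what coercivity provides in the
    doubled equation, so the other half remains in the energy estimate. *)
Lemma fmean_young n k v : (k <= n)%N -> V v ->
  2 * fmean n k v <= ca^-1 * (\int[mu]_(t in J n k) phi t ^+ 2)
                     + tau T n * ca * ipV v v.
Proof.
move=> kn Vv; have mJ := Jstep_measurable T n k.
have ca0 := es_ca ES; have ci0 : 0 < ca^-1 by rewrite invr_gt0.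
have icst : mu.-integrable (J n k) (EFin \o (fun=> ca * ipV v v)).
  apply: integrableS (_ : mu.-integrable I _) => //; first exact: subIsetl.
  exact: (@bounded_time_int _ _ hT _ `|ca * ipV v v|).
rewrite /fmean -RintegralZl//; last exact: force_intJ.
rewrite -(RintegralZl _ mJ); last exact: phi2_intJ.
have -> : tau T n * ca * ipV v v = \int[mu]_(t in J n k) (ca * ipV v v).
  rewrite Rintegral_cst// [X in _ = _ * X](_ : _ = tau T n); first by ring.
  exact: (congr1 fine (mu_Jstep hT kn)).
rewrite -RintegralD//; last by apply: intgZ => //; exact: phi2_intJ.
apply: le_Rintegral => //.
- by apply: intgZ => //; exact: force_intJ.
- by apply: intgD => //; apply: intgZ => //; exact: phi2_intJ.
move=> t _; have := fs_le FS t Vv; have := ler_norm (f t v).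
rewrite -(nrm_sqr (es_ipV ES) Vv); have := nrm_ge0 ipV v; have := fs_phi0 FS t.
move: (f t v) (phi t) (nV v) => x p N p0 N0 h1 h2.
have : 0 <= ca^-1 * (p - ca * N) ^+ 2 by rewrite mulr_ge0 ?sqr_ge0// ltW.
have -> : ca^-1 * (p - ca * N) ^+ 2 = ca^-1 * p ^+ 2 - 2 * p * N + ca * N ^+ 2.
  by field; rewrite gt_eqF.
lra.
Qed.

(** [w] is the old value and [u] the new one. Transport by the old value makes the step linear in
    [u], while [b w u u] still vanishes. *)
Definition scheme_eq n k (w u : X) (v : X) : Prop :=
  ipH (u - w) v + tau T n * a u v + tau T n * b w u v = fmean n k v.

(** The equation against [u] itself is stated separately because it is the one used for the energy;
    it holds since [u] is a combination of members of [s]. *)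
Lemma scheme_step n k (s : seq X) (w : X) : (forall v, v \in s -> D v) -> D w ->
  exists u, [/\ D u, scheme_eq n k w u u & forall v, v \in s -> scheme_eq n k w u v].
Proof.
move=> Ds Dw; have t0 := tau_gt0 hT n.
pose B u v := ipH u v + tau T n * a u v + tau T n * b w u v.
pose F v := fmean n k v + ipH w v.
have aD : bil_on D a := bil_on_sub DV (es_a ES).
have bD : bil_on D (b w) := bil_on_sub DV (es_b ES (DV Dw)).
have hB : bil_on D B.
  have [[h1 h2] _ _] := psdHD; split=> v Dv c x y Dx Dy; rewrite /B.
    by rewrite (h1 v)// (aD.1 v)// (bD.1 v)//; ring.
  by rewrite (h2 v)// (aD.2 v)// (bD.2 v)//; ring.
have hF : lin_on D F.
  have [[_ h2] _ _] := psdHD; move=> c x y Dx Dy; rewrite /F (h2 w)//.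
  by rewrite fmean_lin//; [ring|exact: DV|exact: DV].
have coer : exists2 c : R, 0 < c & forall u, D u -> c * ipV u u <= B u u.
  exists (tau T n * ca); first by rewrite mulr_gt0// (es_ca ES).
  move=> u Du; rewrite /B (es_skew ES)// mulr0 addr0 -mulrA.
  apply: le_trans (ler_wpM2l (ltW t0) (es_coer ES Du)) _.
  by rewrite lerDr (psd_ge0 psdHD).
have Fle : exists C : R, forall v, D v -> `|F v| <= C * nV v.
  exists ((\int[mu]_(t in J n k) phi t) + nH w) => v Dv.
  rewrite mulrDl; apply: le_trans (ler_normD _ _) _; apply: lerD.
    by apply: fmean_le; exact: DV.
  apply: le_trans (psd_CS hD psdHD Dw Dv) _; rewrite ler_wpM2l ?nrm_ge0//.
  by apply: nH_le_nV; exact: DV.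
have [u Du [uu us]] := galerkin_step (s := fun i : 'I_(size s) => tnth (in_tuple s) i) hD hB
  coer (fun i => Ds _ (mem_tnth i (in_tuple s))) hF Fle.
have eqE v : D v -> B u v = F v -> scheme_eq n k w u v.
  move=> Dv; rewrite /B /F /scheme_eq => h.
  have [[h1 _] _ _] := psdHD; rewrite (lin_onB (h1 v Dv))//; lra.
exists u; split => //; first exact: eqE.
move=> v vs; apply: eqE; first exact: Ds.
by have /tnthP[i ->] : v \in in_tuple s by [].
Qed.

(** [z] need not be spanned by [s]: only the value produced by each step is. *)
Lemma scheme n (s : seq X) (z : X) : (forall v, v \in s -> D v) -> D z ->
  exists U : nat -> X, U 0 = z /\ forall k, [/\ D (U k),
    scheme_eq n k (U k) (U k.+1) (U k.+1) &
    forall v, v \in s -> scheme_eq n k (U k) (U k.+1) v].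
Proof.
move=> Ds Dz.
pose nx k (w : {w | D w}) : {w | D w} :=
  let h := cid (scheme_step n k Ds (proj2_sig w)) in
  exist _ (sval h) (let: And3 h1 _ _ := svalP h in h1).
pose W := fix W k : {w | D w} := if k is k'.+1 then nx k' (W k') else exist _ z Dz.
exists (fun k => proj1_sig (W k)); split => // k.
split; first exact: proj2_sig.
  by have [] := svalP (cid (scheme_step n k Ds (proj2_sig (W k)))).
by have [] := svalP (cid (scheme_step n k Ds (proj2_sig (W k)))).
Qed.

Variables (M0 : R).

(** Bounds the squared H norm at all times and, divided by [ca], the square of the norm in L^2(0, T;
    V). *)
Definition bigE : R := M0 + ca^-1 * \int[mu]_(t in I) phi t ^+ 2.

Lemma scheme_energy n (U : nat -> X) : ipH (U 0) (U 0) <= M0 ->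
  (forall k, D (U k) /\ scheme_eq n k (U k) (U k.+1) (U k.+1)) ->
  forall K, (K <= n.+1)%N ->
  ipH (U K) (U K) + \sum_(k < K) ipH (U k.+1 - U k) (U k.+1 - U k)
  + ca * (\sum_(k < K) tau T n * ipV (U k.+1) (U k.+1)) <= bigE.
Proof.
move=> U0 hU K Kn.
have key : ipH (U K) (U K) + \sum_(k < K) ipH (U k.+1 - U k) (U k.+1 - U k)
  + ca * (\sum_(k < K) tau T n * ipV (U k.+1) (U k.+1)) <=
  M0 + ca^-1 * \sum_(k < K) \int[mu]_(t in J n k) phi t ^+ 2.
  elim: K Kn => [_|K IH Kn]; first by rewrite !big_ord0 !mulr0 !addr0.
  rewrite !big_ord_recr /= !mulrDr.
  have [DK] := hU K; rewrite /scheme_eq => eqK; have [DK1 _] := hU K.+1.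
  have := @fmean_young n K _ Kn (DV DK1); rewrite -eqK (es_skew ES)// mulr0 addr0.
  have := es_coer ES DK1; have := IH (ltnW Kn); have t0 := tau_gt0 hT n.
  move=> h1 /(ler_wpM2l (ltW t0)) h2.
  (* Polarization. The extra square is the dissipation of the implicit step; it will bound the
     distance between the new-value and old-value step functions. *)
  have h3 : 2 * ipH (U K.+1 - U K) (U K.+1) = ipH (U K.+1) (U K.+1) - ipH (U K) (U K)
       + ipH (U K.+1 - U K) (U K.+1 - U K).
    have [[l1 l2] sym _] := psdHD.
    rewrite !(lin_onB (l1 _ _))//; last exact: subspB.
    by rewrite !(lin_onB (l2 _ _))// (sym (U K.+1) (U K))//; ring.
  rewrite mulrDr h3; move: h1 h2; clear.
  move: (\sum_(k < K) ipH _ _) (\sum_(k < K) tau T n * _).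
  move: (\sum_(k < K) \int[mu]_(t in J n k) _) (\int[mu]_(t in J n K) _).
  move: (ipH _ _) (ipH (U K.+1) _) (ipH (U K) _) (ipV _ _) (a _ _) (ca^-1) (tau T n).
  move=> *; lra.
apply: le_trans key _; rewrite lerD2l ler_pM2l ?invr_gt0 ?(es_ca ES)//.
rewrite (Jstep_sum hT _ Kn); last exact: (fs_phi FS).2.
rewrite -lee_fin !EFin_Rint//; [|exact: (fs_phi FS).2|].
  apply: ge0_subset_integral => //.
  - by apply/measurable_EFinP; apply: measurable_funX; exact: (fs_phi FS).1.
  - by move=> t _; rewrite lee_fin sqr_ge0.
  - by apply: sub_itv0; exact: ktau_le.
apply: integrableS (fs_phi FS).2 => //.
by apply: sub_itv0; exact: ktau_le.
Qed.

(** The integrand of the time-integrated equation; [l] is the transporting field, lagging one step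
    behind [u] in the scheme and equal to [u] in the limit. *)
Definition gint (u l : R -> X) (v : X) (t : R) : R :=
  f t v - a (u t) v - b (l t) (u t) v.

(** Under the energy bound the linear form contributes [kap v * Num.sqrt bigE] and the quadratic one
    [kap v * bigE]. The result is square-integrable in time and the same for all approximations. *)
Definition gbound (v : X) (t : R) : R :=
  phi t * nV v + kap v * (Num.sqrt bigE + bigE).

Definition gcst (v : X) : R := Num.sqrt (\int[mu]_(t in I) gbound v t ^+ 2).

Lemma cst_sqi (c : R) : sqi mu I (fun=> c : R).
Proof.
split; first exact: measurable_cst.
by apply: (@bounded_time_int _ _ hT _ `|c ^+ 2|).
Qed.

Lemma gbound_sqi v : sqi mu I (gbound v).
Proof.
have := sqi_lin mI (nV v) (fs_phi FS) (cst_sqi (kap v * (Num.sqrt bigE + bigE))).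
by congr sqi; apply/funext => t; rewrite /gbound mulrC.
Qed.

Lemma gint_meas (u l : R -> X) v : V v -> simple_in D u -> simple_in D l ->
  measurable_fun I (gint u l v).
Proof.
move=> Vv su sl; apply: measurable_funB; first apply: measurable_funB.
- exact: fs_meas FS _ Vv.
- exact: finval_measurable (finval_comp (fun x => a x v) (simple_finval su)).
- exact: finval_measurable (finval_comp (fun p => b p.1 p.2 v)
    (finval_pair (simple_finval sl) (simple_finval su))).
Qed.

Lemma gint_le (u l : R -> X) v t : D v -> V (u t) -> V (l t) ->
  ipH (u t) (u t) <= bigE -> ipH (l t) (l t) <= bigE ->
  `|gint u l v t| <= gbound v t.
Proof.
move=> Dv Vu Vl uE lE; rewrite /gint /gbound.
have E0 : 0 <= bigE by apply: le_trans uE; exact: psd_ge0 (es_H ES) _ Vu.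
have h1 := fs_le FS t (DV Dv).
have k0 := es_kap0 ES v.
have hu : nH (u t) <= Num.sqrt bigE by exact: ler_wsqrtr.
have hl : nH (l t) <= Num.sqrt bigE by exact: ler_wsqrtr.
have h2 := le_trans (es_a_smooth ES Vu Dv) (ler_wpM2l k0 hu).
have h3 : `|b (l t) (u t) v| <= kap v * bigE.
  apply: le_trans (es_b_smooth ES Vl Vu Dv) _.
  rewrite -mulrA ler_wpM2l// -(sqr_sqrtr E0) expr2.
  by apply: ler_pM => //; exact: nrm_ge0.
rewrite mulrDr addrA; apply: le_trans (ler_normB _ _) _; apply: lerD => //.
by apply: le_trans (ler_normB _ _) _; exact: lerD.
Qed.

(** On step [k], [u] has the value at the right end of the step and [l] the one at the left end. *)
Lemma approximant n (s : seq X) (z : X) : (forall v, v \in s -> D v) -> D z ->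
  ipH z z <= M0 -> exists (u l : R -> X),
  [/\ simple_in D u, simple_in D l,
      forall t, ipH (u t) (u t) <= bigE /\ ipH (l t) (l t) <= bigE,
      \int[mu]_(t in I) ipV (u t) (u t) <= ca^-1 * bigE /\
      \int[mu]_(t in I) ipH (u t - l t) (u t - l t) <= tau T n * bigE &
      forall v, v \in s -> forall t, I t ->
      `|ipH (u t) v - ipH z v - \int[mu]_(x in `]0, t[) gint u l v x| <=
      gcst v * Num.sqrt (tau T n)].
Proof.
move=> Ds Dz zM; have t0 := tau_gt0 hT n.
have [U [Uz hU]] := scheme n Ds Dz.
have DU k : D (U k) by case: (hU k).
have En := scheme_energy (n := n) (U := U); rewrite Uz in En.
have {}En := En zM (fun k => conj (DU k) (let: And3 _ h _ := hU k in h)).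
have qH0 u : D u -> 0 <= ipH u u by exact: psd_ge0 psdHD u.
have qV0 u : D u -> 0 <= ipV u u by exact: psd_ge0 psdVD u.
have ca0 := es_ca ES.
have SH0 K : 0 <= \sum_(k < K) ipH (U k.+1 - U k) (U k.+1 - U k).
  by apply: sumr_ge0 => k _; apply: qH0; exact: subspB.
have SV0 K : 0 <= \sum_(k < K) tau T n * ipV (U k.+1) (U k.+1).
  by apply: sumr_ge0 => k _; apply: mulr_ge0; [exact: ltW|exact: qV0].
have E0 : 0 <= bigE.
  apply: le_trans (En 0 isT); rewrite !big_ord0 mulr0 !addr0 Uz; exact: qH0.
have UE k : (k <= n.+1)%N -> ipH (U k) (U k) <= bigE.
  move=> kn; apply: le_trans (En k kn).
  by rewrite -addrA lerDl addr_ge0// mulr_ge0// ltW.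
pose u := stepf T n (fun k => U k.+1); pose l := stepf T n U.
have su : simple_in D u by apply: stepf_simple => k; exact: DU.
have sl : simple_in D l by apply: stepf_simple.
have Du t : D (u t) by exact: simple_mem su.
have Dl t : D (l t) by exact: simple_mem sl.
(* Outside the time interval both step functions vanish, so that the energy bound can be claimed for
   every [t]. *)
have notI t : ~ I t -> u t = 0 /\ l t = 0.
  by move=> nI; split; rewrite /u /l /stepf big1// => k _; rewrite indicE memNset ?scale0r// => -[].
have H00 : ipH 0 0 = 0.
  by have [[h _] _ _] := psdHD; rewrite (lin_on0 hD (h 0 (subsp0 hD))).
have uE t : ipH (u t) (u t) <= bigE /\ ipH (l t) (l t) <= bigE.
  have [It|/notI[-> ->]] := pselect (I t); last by rewrite H00.
  have [k kn Jk] := Jstep_ex hT n It.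
  by rewrite /u /l !(stepfE hT _ kn Jk); split; apply: UE => //; exact: ltnW.
have gm v : V v -> measurable_fun I (gint u l v) by move=> Vv; exact: gint_meas.
have gb v t : D v -> `|gint u l v t| <= gbound v t.
  by move=> Dv; apply: gint_le => //; [exact: DV|exact: DV|case: (uE t)|case: (uE t)].
have gi v : D v -> mu.-integrable I (EFin \o gint u l v).
  move=> Dv; have := sqi_mul mI (gbound_sqi v) (cst_sqi 1).
  apply: (intg_le mI (gm _ (DV Dv))) => t _; by rewrite mulr1 gb.
exists u, l; split => //.
  split.
    rewrite (stepf_integral hT n (fun k => U k.+1) (fun k => U k.+1) ipV).
    rewrite [leRHS]mulrC ler_pdivlMr// mulrC; apply: le_trans (En n.+1 (leqnn _)).
    by rewrite lerDr addr_ge0// qH0.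
  rewrite (stepf_integral hT n (fun k => U k.+1) U (fun x y => ipH (x - y) (x - y))).
  rewrite -mulr_sumr ler_pM2l//; apply: le_trans (En n.+1 (leqnn _)).
  by rewrite addrAC lerDr addr_ge0// ?qH0// mulr_ge0// ltW.
move=> v vs t It; have Dv := Ds _ vs.
have [k kn Jk] := Jstep_ex hT n It.
(* At grid times the integrated equation holds exactly, as the sum of the scheme over the steps. *)
have telesc K : (K <= n.+1)%N ->
    ipH (U K) v - ipH z v = \int[mu]_(x in `]0, K%:R * tau T n[) gint u l v x.
  move=> Kn; rewrite -(Jstep_sum hT (gi v Dv) Kn).
  elim: K Kn => [_|K IH Kn]; first by rewrite big_ord0 Uz subrr.
  rewrite big_ord_recr /= -IH; last exact: ltnW.
  have [_ _ /(_ v vs)] := hU K; rewrite /scheme_eq => eqK.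
  have [[h1 _] _ _] := psdHD; move: eqK; rewrite (lin_onB (h1 v Dv))// => eqK.
  have mJ := Jstep_measurable T n K.
  have -> : \int[mu]_(x in J n K) gint u l v x =
     fmean n K v - tau T n * (a (U K.+1) v + b (U K) (U K.+1) v).
    have icst : mu.-integrable (J n K) (EFin \o (fun=> a (U K.+1) v + b (U K) (U K.+1) v)).
      apply: integrableS (_ : mu.-integrable I _) => //; first exact: subIsetl.
      exact: (@bounded_time_int _ _ hT _ `|a (U K.+1) v + b (U K) (U K.+1) v|).
    rewrite (@eq_Rintegral _ _ _ mu _ (fun t => f t v - (a (U K.+1) v + b (U K) (U K.+1) v))).
      rewrite RintegralB//; last by apply: force_intJ; exact: DV.
      rewrite Rintegral_cst// [X in _ - _ * X](_ : _ = tau T n); first by rewrite (mulrC (tau _ _)).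
      exact: (congr1 fine (mu_Jstep hT (Kn : (K <= n)%N))).
    move=> x /set_mem Jx; rewrite /gint /u /l !(stepfE hT _ (Kn : (K <= n)%N) Jx); ring.
  rewrite -eqK; ring.
have -> : ipH (u t) v = ipH (U k.+1) v by rewrite /u (stepfE hT _ kn Jk).
rewrite telesc//.
have /JstepP[/andP[tt0 ttT] kt tk] := Jk.
(* [u t] is the value at the right end of the step containing [t]; moving the end of the integral
   from there to [t] costs the Hoelder modulus over at most one step. *)
apply: le_trans (primitive_hoelder hT (ltW tt0) (ltW tk) (ktau_le hT (kn : (k.+1 <= n.+1)%N))
  (gm v (DV Dv)) (fun x _ => gb v x Dv) (gbound_sqi v)) _.
apply: ler_wpM2l; first exact: sqrtr_ge0.
by apply: ler_wsqrtr; rewrite ktauS; lra.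
Qed.

End approximation.

(** The values lie in a compact segment, hence cluster somewhere, and an ultrafilter must contain
    the preimage of every ball around a cluster point. *)
Lemma ultra_bounded_cauchy (R : realType) (A : Type) (F : set_system A) (y : A -> R) (C : R) :
  UltraFilter F -> (forall i, `|y i| <= C) -> forall e : R, 0 < e ->
  exists2 B, F B & forall i j, B i -> B j -> `|y i - y j| <= e.
Proof.
move=> FU yC e e0.
have [p [_ clp]] : `[- C, C] `&` cluster (y @ F) !=set0.
  apply: segment_compact; apply: (@filterS _ F _ setT); last exact: filterT.
  by move=> i _; rewrite /= in_itv /= -ler_norml; exact: yC.
exists [set i | `|y i - p| < e / 2]; last first.
  move=> i j /= hi hj; have -> : y i - y j = (y i - p) - (y j - p) by ring.
  by apply: le_trans (ler_normB _ _) _; lra.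
(* Otherwise the complement belongs to [F], and the ball around [p] could not meet its image. *)
have [//|h] := in_ultra_setVsetC [set i | `|y i - p| < e / 2] FU.
have h1 : (y @ F) [set r | ~ `|r - p| < e / 2] by [].
have [r [/= h2 h3]] := clp _ _ h1 (nbhsx_ballx p (e / 2) (divr_gt0 e0 (ltr0n R 2))).
by move: h3; rewrite /ball /= distrC.
Qed.

(** * Compactness of the approximations *)

Section compactness.
Variables (R : realType) (X : lmodType R) (V D : set X).
Variables (ipH ipV a : X -> X -> R) (b : X -> X -> X -> R) (ca Ca Cb : R) (kap : X -> R).
Hypothesis ES : evolution_setting V D ipH ipV a b ca Ca Cb kap.
Variables (T : R) (hT : 0 < T) (f : R -> X -> R) (phi : R -> R).
Hypothesis FS : force_setting V ipV T f phi.
Local Notation mu := (@lebesgue_measure R).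
Local Notation I := (`]0, T[%classic : set (measurableTypeR R)).
Local Notation nH := (nrm ipH).
Local Notation nV := (nrm ipV).
Variables (M0 : R) (z : nat -> X).
Hypotheses (Dz : forall n, D (z n)) (zM : forall n, ipH (z n) (z n) <= M0).

Let hV : subsp V := es_V ES.
Let hD : subsp D := es_D ES.
Let DV := es_DV ES.
Let psdHD : psd_on D ipH := psd_on_sub DV (es_H ES).
Let psdVD : psd_on D ipV := psd_on_sub DV (es_ipV ES).
Local Notation E := (bigE ca T phi M0).
Local Notation gint := (gint a b f).
Local Notation gcst := (gcst ipV ca kap T phi M0).

Let mI : measurable I. Proof. exact: measurable_itv. Qed.

(** The energy bounds hold for every index; only the smallness of the time step and the equation
    against a given test field hold eventually along [F]. *)
Record approx_family (A : Type) (F : set_system A) (u l : A -> R -> X)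
    (m : A -> nat) : Prop := ApproxFamily {
  af_ultra : UltraFilter F;
  af_u : forall i, simple_in D (u i);
  af_l : forall i, simple_in D (l i);
  af_uE : forall i t, ipH (u i t) (u i t) <= E;
  af_lE : forall i t, ipH (l i t) (l i t) <= E;
  af_V : forall i, \int[mu]_(t in I) ipV (u i t) (u i t) <= ca^-1 * E;
  af_ul : forall i, \int[mu]_(t in I) ipH (u i t - l i t) (u i t - l i t)
            <= tau T (m i) * E;
  af_m : forall N, F [set i | (N <= m i)%N];
  af_eq : forall v, D v -> F [set i | forall t, I t ->
     `|ipH (u i t) v - ipH (z (m i)) v - \int[mu]_(x in `]0, t[) gint (u i) (l i) v x|
     <= gcst v * Num.sqrt (tau T (m i))]
}.

(* The index set pairs a finite list of test fields with a number of time
   steps; an ultrafilter finer than the order filter replaces the extraction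
   of subsequences, and no countable basis is needed. *)
Lemma approx_family_exists : exists (F : set_system (seq X * nat)) u l,
  approx_family F u l snd.
Proof.
pose s' (s : seq X) := [seq v <- s | `[< D v >]].
have Ds' s v : v \in s' s -> D v by rewrite mem_filter => /andP[/asboolP].
have h (i : seq X * nat) := approximant ES hT FS i.2 (Ds' i.1) (Dz i.2) (zM i.2).
pose u i := sval (cid (h i)); pose l i := sval (cid (svalP (cid (h i)))).
have P i := svalP (cid (svalP (cid (h i)))).
pose B (p : seq X * nat) := [set i : seq X * nat | {subset p.1 <= i.1} /\ (p.2 <= i.2)%N].
have FB : ProperFilter (filter_from setT B).
  apply: filter_from_proper; last by move=> i _; exists i; split.
  apply: filter_fromT_filter; first by exists ([::], 0).
  move=> p q; exists (p.1 ++ q.1, maxn p.2 q.2) => i [/= h1].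
  rewrite geq_max => /andP[h2 h3]; split; split => // v vp; apply: h1;
  by rewrite mem_cat vp ?orbT.
have [F [FU BF]] := ultraFilterLemma FB.
exists F, u, l; split => //.
- by move=> i; case: (P i).
- by move=> i; case: (P i).
- by move=> i t; case: (P i) => _ _ /(_ t)[].
- by move=> i t; case: (P i) => _ _ /(_ t)[].
- by move=> i; case: (P i) => _ _ _ [].
- by move=> i; case: (P i) => _ _ _ [].
- by move=> N; apply: BF; exists ([::], N) => // i [].
move=> v Dv; apply: BF; exists ([:: v], 0) => // i [/= vi _].
case: (P i) => _ _ _ _; apply.
by rewrite mem_filter vi ?inE// andbT; apply/asboolP.
Qed.

Section family.
Variables (A : Type) (F : set_system A) (u l : A -> R -> X) (m : A -> nat).
Hypothesis AF : approx_family F u l m.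

Let FU : UltraFilter F := af_ultra AF.
#[local] Existing Instance FU.
Let FP : ProperFilter F. Proof. exact: ultra_proper. Qed.
#[local] Existing Instance FP.

Lemma af_Du i t : D (u i t). Proof. exact: simple_mem hD (af_u AF i). Qed.
Lemma af_Dl i t : D (l i t). Proof. exact: simple_mem hD (af_l AF i). Qed.
Let Du := af_Du.
Let Dl := af_Dl.

Lemma bigE_ge0 : 0 <= E.
Proof.
have /filter_ex[i _] : F setT by exact: filterT.
exact: (le_trans (psd_ge0 psdHD (Du i 0)) (af_uE AF i 0)).
Qed.

Lemma sqrt_tau_small (c e : R) : 0 <= c -> 0 < e ->
  exists N, forall n, (N <= n)%N -> c * Num.sqrt (tau T n) <= e.
Proof.
move=> c0 e0; exists (Num.truncn (T * c ^+ 2 / e ^+ 2)) => n Nn.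
rewrite -(ger0_norm (mulr_ge0 c0 (sqrtr_ge0 _))) -sqrtr_sqr -(ger0_norm (ltW e0)).
rewrite -[leRHS]sqrtr_sqr ler_wsqrtr// exprMn sqr_sqrtr ?(ltW (tau_gt0 hT n))//.
rewrite /tau mulrA ler_pdivrMr// [leLHS]mulrC.
have := truncnS_gt (T * c ^+ 2 / e ^+ 2); rewrite ltr_pdivrMr ?exprn_gt0// [ltRHS]mulrC => h.
apply: ltW; apply: lt_le_trans h _; rewrite ler_pM2l ?exprn_gt0//.
by rewrite ler_nat ltnS.
Qed.

(** The integrals have a uniform Hoelder modulus; [e] absorbs the error of the scheme at [s] and at
    [t]. *)
Lemma af_equicontinuous v : D v -> forall e : R, 0 < e ->
  F [set i | forall s t, I s -> I t -> s <= t ->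
     `|ipH (u i t) v - ipH (u i s) v| <= gcst v * Num.sqrt (t - s) + e].
Proof.
move=> Dv e e0.
have c0 : 0 <= gcst v by exact: sqrtr_ge0.
have [N hN] := sqrt_tau_small c0 (divr_gt0 e0 (ltr0n R 2)).
apply: filterS (filterI (af_m AF N) (af_eq AF Dv)) => i [/= Ni hi] s t Is It st.
have := hN _ Ni; have := hi _ Is; have := hi _ It.
have st0 : 0 <= s /\ t <= T.
  by move: Is It; rewrite /= !in_itv /= => /andP[/ltW ? _] /andP[_ /ltW].
have hb x : I x -> `|gint (u i) (l i) v x| <= gbound ipV ca kap T phi M0 v x.
  move=> _; exact: (gint_le ES FS Dv (DV (Du i x)) (DV (Dl i x)) (af_uE AF i x) (af_lE AF i x)).
have := primitive_hoelder hT st0.1 st st0.2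
   (gint_meas a b FS (DV Dv) (af_u AF i) (af_l AF i)) hb (gbound_sqi ca kap hT FS M0 v).
rewrite -/(gcst v).
move: (\int[mu]_(x in `]0, t[) _) (\int[mu]_(x in `]0, s[) _) (ipH (z _) _) => x y w.
rewrite !ler_norml; lra.
Qed.

(** The argument of Arzela and Ascoli: boundedness makes the pairings Cauchy at finitely many times,
    and equicontinuity spreads this over the whole interval. With slack [e / 8], moving to a sample
    time costs at most [e / 4] on each side. *)
Lemma af_cauchy_pairing v : D v -> forall e : R, 0 < e ->
  exists2 B, F B & forall i j t, B i -> B j -> I t ->
    `|ipH (u i t) v - ipH (u j t) v| <= e.
Proof.
move=> Dv e e0; have c0 : 0 <= gcst v by exact: sqrtr_ge0.
have e8 : 0 < e / 8 by rewrite divr_gt0.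
have [N /(_ N (leqnn N)) hN] := sqrt_tau_small c0 e8.
(* Midpoints of the steps are sampled because the end points 0 and [T] lie outside the open
   interval. *)
pose g (k : 'I_N.+1) : R := k%:R * tau T N + tau T N / 2.
have t0 := tau_gt0 hT N.
have Ig k : I (g k).
  rewrite /= in_itv /= /g; have := ktau_ge0 hT N k.
  have := @ktau_le _ _ hT N k.+1 (ltn_ord k); rewrite ktauS.
  by move=> h1 h2; apply/andP; split; lra.
have /choice[Bk hBk] k : exists B, F B /\
    forall i j, B i -> B j -> `|ipH (u i (g k)) v - ipH (u j (g k)) v| <= e / 8.
  have yC i : `|ipH (u i (g k)) v| <= Num.sqrt E * nH v.
    apply: le_trans (psd_CS hD psdHD (Du _ _) Dv) _.
    by rewrite ler_wpM2r ?nrm_ge0// ler_wsqrtr// (af_uE AF).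
  by have [B FB hB] := ultra_bounded_cauchy FU yC e8; exists B.
exists ([set i | forall k, Bk k i] `&` [set i | forall s t, I s -> I t -> s <= t ->
     `|ipH (u i t) v - ipH (u i s) v| <= gcst v * Num.sqrt (t - s) + e / 8]).
  apply: filterI; last exact: af_equicontinuous.
  by apply: filter_forall => k; case: (hBk k).
move=> i j t [/= Bi hi] [/= Bj hj] It.
have [k0 kN /JstepP[_ h1 h2]] := Jstep_ex hT N It.
pose k : 'I_N.+1 := Ordinal (kN : (k0 < N.+1)%N).
have close w : (forall s t, I s -> I t -> s <= t ->
     `|ipH (w t) v - ipH (w s) v| <= gcst v * Num.sqrt (t - s) + e / 8) ->
     `|ipH (w t) v - ipH (w (g k)) v| <= e / 4.
  move=> hw; have [tg|gt] := leP t (g k).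
    rewrite distrC; apply: le_trans (hw _ _ It (Ig k) tg) _.
    have : gcst v * Num.sqrt (g k - t) <= gcst v * Num.sqrt (tau T N).
      by rewrite ler_wpM2l// ler_wsqrtr// /g /=; lra.
    lra.
  apply: le_trans (hw _ _ (Ig k) It (ltW gt)) _.
  have : gcst v * Num.sqrt (t - g k) <= gcst v * Num.sqrt (tau T N).
    by rewrite ler_wpM2l// ler_wsqrtr// /g /=; move: h2; rewrite ktauS; lra.
  lra.
have := close _ hi; have := close _ hj; have [_ /(_ i j (Bi k) (Bj k))] := hBk k.
by rewrite !ler_norml; lra.
Qed.

Let eq_le1 (x : R) : x = 1 -> x <= 1. Proof. by move->. Qed.

(** An Ehrling-type inequality. Scale [w] to unit V norm, pick [p] from the finite net within [e] of
    it in H, and split the square as the pairing with [w - p] plus the pairing with [p]. The term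
    linear in [nV w] comes from undoing the scaling. *)
Lemma ehrling_compact (e : R) : 0 < e -> exists2 s : seq X, (forall p, p \in s -> D p) &
  forall (eta : R) w, D w -> (forall p, p \in s -> `|ipH w p| <= eta) ->
    ipH w w <= e * ipV w w + eta * nV w.
Proof.
move=> e0; have [s Ds hs] := es_compact ES e0; exists s => // eta w Dw heta.
have := nrm_ge0 ipV w; rewrite le0r => /orP[/eqP N0|N0].
  have := nH_le_nV ES (DV Dw); rewrite N0 => h.
  rewrite -(nrm_sqr psdVD Dw) -(nrm_sqr psdHD Dw) N0 mulr0 expr0n /= mulr0 addr0.
  have -> : nH w = 0 by apply/eqP; rewrite eq_le h nrm_ge0.
  by rewrite expr0n.
pose w' := (nV w)^-1 *: w.
have Dw' : D w' by exact: subspZ.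
have nw' : nV w' = 1.
  rewrite (nrmZ hD psdVD)// ger0_norm ?invr_ge0 ?nrm_ge0// mulVf ?gt_eqF//.
have [p ps hp] := hs w' Dw' (eq_le1 nw'); have Dp := Ds _ ps.
have hw : w = nV w *: w' by rewrite scalerA mulfV ?scale1r// gt_eqF.
have [[l1 l2] sym _] := psdHD.
have -> : ipH w w = nV w ^+ 2 * ipH w' w' .
  rewrite {1 2}hw (lin_onZ hD (l1 _ (subspZ hD _ Dw')))// (lin_onZ hD (l2 _ Dw'))//; ring.
have h1 : ipH w' w' = ipH w' (w' - p) + ipH w' p.
  by rewrite (lin_onB (l2 _ Dw'))// subrK.
have h2 : `|ipH w' (w' - p)| <= e.
  apply: le_trans (psd_CS hD psdHD Dw' (subspB hD Dw' Dp)) _.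
  rewrite -[leRHS]mul1r; apply: ler_pM; rewrite ?nrm_ge0//.
  by rewrite -nw'; exact: nH_le_nV ES _ (DV Dw').
have h3 : nV w * ipH w' p <= eta.
  rewrite -(lin_onZ hD (l1 _ Dp))// -hw; exact: le_trans (ler_norm _) (heta _ ps).
rewrite h1 mulrDr -(nrm_sqr psdVD Dw); apply: lerD.
  by rewrite mulrC ler_wpM2r ?sqr_ge0//; exact: le_trans (ler_norm _) h2.
by rewrite expr2 -mulrA mulrC ler_wpM2r// ltW.
Qed.

Lemma simple2_int (v w : R -> X) (Phi : X -> X -> R) : simple_in D v -> simple_in D w ->
  mu.-integrable I (EFin \o (fun t => Phi (v t) (w t))).
Proof. by move=> sv sw; exact: (simple_integrable hT Phi sv sw). Qed.

(** Pairings with the finite net are uniformly close in time, and the energy estimate controls the V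
    norms that remain. *)
Lemma af_cauchy_L2H (e : R) : 0 < e -> exists2 B, F B & forall i j, B i -> B j ->
  \int[mu]_(t in I) ipH (u i t - u j t) (u i t - u j t) <= e.
Proof.
move=> e0; have ca0 := es_ca ES; have E0 := bigE_ge0.
have [Q QE] : exists Q, Q = 4 * (ca^-1 * E) by eexists.
have Q0 : 0 <= Q by rewrite QE !mulr_ge0// invr_ge0 ltW.
(* The pointwise estimate [key] below integrates to at most [d * (2 * Q + T)]; the added 1 gives a
   visibly positive denominator. *)
pose d := e / (2 * Q + T + 1).
have T0 := hT.
have d0 : 0 < d by rewrite divr_gt0//; lra.
have dQ : d * (2 * Q + T) <= e.
  by rewrite /d mulrAC ler_pdivrMr ?ler_pM2l//; lra.
clearbody d.
have [s Ds hs] := ehrling_compact d0.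
have /choice[Bk hBk] (p : 'I_(size s)) : exists B, F B /\
    forall i j t, B i -> B j -> I t ->
    `|ipH (u i t) (tnth (in_tuple s) p) - ipH (u j t) (tnth (in_tuple s) p)| <= d.
  by have [B FB hB] := af_cauchy_pairing (Ds _ (mem_tnth p (in_tuple s))) d0; exists B.
exists [set i | forall k, Bk k i]; first by apply: filter_forall => k; case: (hBk k).
move=> i j /= Bi Bj.
have key t : I t -> ipH (u i t - u j t) (u i t - u j t) <=
   2 * (2 * d) * ipV (u i t) (u i t) + 2 * (2 * d) * ipV (u j t) (u j t) + d.
  move=> It; have Dw : D (u i t - u j t) by exact: subspB.
  have heta p : p \in s -> `|ipH (u i t - u j t) p| <= d.
    move=> ps; have [[l1 l2] sym _] := psdHD; rewrite (lin_onB (l1 _ (Ds _ ps)))//.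
    have /tnthP[k ->] : p \in in_tuple s by [].
    by have [_ h] := hBk k; exact: h.
  apply: le_trans (hs _ _ Dw heta) _.
  have := nrm_triangle hD psdVD (Du i t) (subspZ hD (-1) (Du j t)).
  rewrite scaleN1r (nrmN hD psdVD)// => h; have := nrm_ge0 ipV (u i t - u j t).
  rewrite -!(nrm_sqr psdVD)//; move: h.
  move: (nV (u i t - u j t)) (nV (u i t)) (nV (u j t)) (nrm_ge0 ipV (u i t)) (nrm_ge0 ipV (u j t)).
  move=> x y w y0 w0 h x0.
  have h1 : x ^+ 2 <= 2 * y ^+ 2 + 2 * w ^+ 2.
    have : 0 <= (y - w) ^+ 2 by exact: sqr_ge0.
    have : x ^+ 2 <= (y + w) ^+ 2 by apply: lerXn2r; rewrite ?nnegrE//; lra.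
    rewrite !expr2; lra.
  have h2 : x <= x ^+ 2 + 1 by have := sqr_ge0 (x - 1); rewrite !expr2; nra.
  have : d * x <= d * (x ^+ 2 + 1) by rewrite ler_pM2l.
  have : d * x ^+ 2 <= d * (2 * y ^+ 2 + 2 * w ^+ 2) by rewrite ler_pM2l.
  lra.
have iV k : mu.-integrable I (EFin \o (fun t => ipV (u k t) (u k t))).
  by apply: simple2_int; exact: af_u AF k.
have cstI : mu.-integrable I (EFin \o (fun=> d)).
  exact: (@bounded_time_int _ _ hT _ `|d|).
apply: (@le_trans _ _ (\int[mu]_(t in I) (2 * (2 * d) * ipV (u i t) (u i t)
     + 2 * (2 * d) * ipV (u j t) (u j t) + d))).
  apply: le_Rintegral => //.
    exact: (simple2_int (fun x y => ipH (x - y) (x - y)) (af_u AF i) (af_u AF j)).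
  by apply: intgD => //; apply: intgD => //; exact: intgZ.
rewrite RintegralD//; last by apply: intgD => //; exact: intgZ.
rewrite RintegralD//; [|exact: intgZ|exact: intgZ].
rewrite !RintegralZl// Rintegral_cst//.
have -> : fine (mu I) = T by rewrite [X in fine X](mu_itvoo0 (ltW hT)).
have := af_V AF i; have := af_V AF j; have := dQ; rewrite QE.
move: (\int[mu]_(x in I) _) (\int[mu]_(x in I) _) => x y h1 h2 h3.
have : 4 * d * (x + y) <= 4 * d * (2 * (ca^-1 * E)).
  by rewrite ler_pM2l; [lra|rewrite mulr_gt0].
lra.
Qed.

End family.
End compactness.

(** * Passage to the limit *)

Section limit.
Variables (R : realType) (X : lmodType R) (V D : set X).
Variables (ipH ipV a : X -> X -> R) (b : X -> X -> X -> R) (ca Ca Cb : R) (kap : X -> R).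
Hypothesis ES : evolution_setting V D ipH ipV a b ca Ca Cb kap.
Variables (T : R) (hT : 0 < T) (f : R -> X -> R) (phi : R -> R).
Local Notation mu := (@lebesgue_measure R).
Local Notation I := (`]0, T[%classic : set (measurableTypeR R)).
Local Notation nH := (nrm ipH).
Local Notation nV := (nrm ipV).
Variables (M0 : R) (z : nat -> X).
Local Notation E := (bigE ca T phi M0).
Variables (A : Type) (F : set_system A) (u l : A -> R -> X) (m : A -> nat).
Hypothesis AF : approx_family D ipH ipV a b ca kap T f phi M0 z F u l m.
Hypothesis small : forall e : R, 0 < e -> exists2 B, F B & forall i j, B i -> B j ->
  \int[mu]_(t in I) ipH (u i t - u j t) (u i t - u j t) <= e.

Let hV : subsp V := es_V ES.
Let hD : subsp D := es_D ES.
Let DV := es_DV ES.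
Let psdH := es_H ES.
Let psdV := es_ipV ES.
Let psdHD : psd_on D ipH := psd_on_sub DV (es_H ES).
Let psdVD : psd_on D ipV := psd_on_sub DV (es_ipV ES).
Let mI : measurable I. Proof. exact: measurable_itv. Qed.
Let FU : UltraFilter F := af_ultra AF.
#[local] Existing Instance FU.
Let FP : ProperFilter F. Proof. exact: ultra_proper. Qed.
#[local] Existing Instance FP.

(** Midpoints replace general convex combinations: the parallelogram identity needs no more, and
    energy bounds, diameters and simplicity follow by induction. *)
Inductive mid_hull (S : set A) : (R -> X) -> Prop :=
| mid_hull_base i : S i -> mid_hull S (u i)
| mid_hull_mid w w' : mid_hull S w -> mid_hull S w' ->
    mid_hull S (fun t => 2^-1 *: (w t + w' t)).

Lemma mid_hull_sub S S' w : S `<=` S' -> mid_hull S w -> mid_hull S' w.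
Proof.
move=> SS'; elim=> [i /SS' Si|v v' _ hv _ hv']; first exact: mid_hull_base.
exact: mid_hull_mid.
Qed.

Lemma mid_hull_simple S w : mid_hull S w -> simple_in D w.
Proof.
elim=> [i _|v v' _ hv _ hv']; first exact: af_u AF i.
exact: simple_lin.
Qed.

Let sint (v w : R -> X) (Phi : X -> X -> R) : simple_in D v -> simple_in D w ->
  mu.-integrable I (EFin \o (fun t => Phi (v t) (w t))).
Proof. by move=> sv sw; exact: (simple_integrable hT Phi sv sw). Qed.

Let sD w t : simple_in D w -> D (w t). Proof. exact: simple_mem hD. Qed.

Lemma nrm_mid_le (q : X -> X -> R) x y : psd_on D q -> D x -> D y ->
  q (2^-1 *: (x + y)) (2^-1 *: (x + y)) <= 2^-1 * q x x + 2^-1 * q y y.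
Proof.
move=> hq Dx Dy; rewrite (nrm_mid hD hq)// gerBl mulr_ge0//.
by apply: (psd_ge0 hq); exact: subspB.
Qed.

Lemma mid_hull_ipH S w t : mid_hull S w -> ipH (w t) (w t) <= E.
Proof.
elim=> [i _|v v' hv h hv' h']; first exact: af_uE AF i t.
have := nrm_mid_le psdHD (sD t (mid_hull_simple hv)) (sD t (mid_hull_simple hv')).
lra.
Qed.

Definition energyV (w : R -> X) : R := \int[mu]_(t in I) ipV (w t) (w t).

Lemma energyV_mid v w : simple_in D v -> simple_in D w ->
  energyV (fun t => 2^-1 *: (v t + w t)) =
  2^-1 * energyV v + 2^-1 * energyV w - 4^-1 * energyV (fun t => v t - w t).
Proof.
move=> sv sw; have i1 := sint ipV sv sv; have i2 := sint ipV sw sw.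
have i3 := sint (fun x y => ipV (x - y) (x - y)) sv sw.
rewrite /energyV -!RintegralZl// -RintegralD//; [|exact: intgZ|exact: intgZ].
rewrite -RintegralB//; [|by apply: intgD => //; exact: intgZ|exact: intgZ].
by apply: eq_Rintegral => t _; rewrite (nrm_mid hD psdVD)//; exact: sD.
Qed.

Lemma energyV_ge0 w : simple_in D w -> 0 <= energyV w.
Proof. by move=> sw; apply: Rintegral_ge0 => t _; apply: (psd_ge0 psdVD); exact: sD. Qed.

Lemma mid_hull_energyV S w : mid_hull S w -> energyV w <= ca^-1 * E.
Proof.
elim=> [i _|v v' hv h hv' h']; first exact: af_V AF i.
have sv := mid_hull_simple hv; have sv' := mid_hull_simple hv'.
rewrite energyV_mid//.
have : 0 <= energyV (fun t => v t - v' t).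
  apply: Rintegral_ge0 => t _; apply: (psd_ge0 psdVD).
  by apply: subspB => //; exact: sD.
lra.
Qed.

(** The squared distance to a fixed [u j] is convex, so combinations stay as close to [u j] as the
    members of [S] are. *)
Lemma mid_hull_diam (S : set A) (e : R) w j : (forall i j, S i -> S j ->
    \int[mu]_(t in I) ipH (u i t - u j t) (u i t - u j t) <= e) ->
  S j -> mid_hull S w -> \int[mu]_(t in I) ipH (w t - u j t) (w t - u j t) <= e.
Proof.
move=> hS Sj; elim=> [i Si|v v' hv h hv' h']; first exact: hS.
have sv := mid_hull_simple hv; have sv' := mid_hull_simple hv'.
have su := af_u AF j.
pose Phi x y := ipH (x - y) (x - y).
apply: (@le_trans _ _ (\int[mu]_(t in I) (2^-1 * Phi (v t) (u j t) + 2^-1 * Phi (v' t) (u j t)))).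
  apply: le_Rintegral => //.
  - exact: (sint Phi (simple_lin 2^-1 hD sv sv') su).
  - by apply: intgD => //; apply: intgZ => //; exact: sint.
  move=> t _; have Dv := sD t sv; have Dv' := sD t sv'; have Du := sD t su.
  have -> : 2^-1 *: (v t + v' t) - u j t = 2^-1 *: ((v t - u j t) + (v' t - u j t)).
    rewrite addrACA -opprD scalerBr; congr (_ - _).
    have -> : u j t + u j t = (2 : R) *: u j t by rewrite scaler_nat mulr2n.
    by rewrite scalerA mulVf// scale1r.
  by apply: nrm_mid_le => //; exact: subspB.
rewrite RintegralD//; [|by apply: intgZ => //; exact: sint|by apply: intgZ => //; exact: sint].
rewrite !RintegralZl//; [|exact: sint|exact: sint].
by rewrite /Phi; lra.
Qed.

Let hull_ex S : F S -> exists w, mid_hull S w.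
Proof. by move=> /filter_ex[i Si]; exists (u i); exact: mid_hull_base. Qed.

Definition infV (S : set A) : R := inf [set energyV w | w in mid_hull S].

Let infV_has S : F S -> has_inf [set energyV w | w in mid_hull S].
Proof.
move=> FS; split.
  by have [w hw] := hull_ex FS; exists (energyV w); exists w.
by exists 0 => _ [w hw <-]; apply: energyV_ge0; exact: mid_hull_simple hw.
Qed.

Let infV_le S w : F S -> mid_hull S w -> infV S <= energyV w.
Proof.
move=> FS hw; apply: ge_inf; first by case: (infV_has FS).
by exists w.
Qed.

(* Mazur's lemma by the parallelogram identity: the infima of the energy over
   the midpoint hulls of the tails increase to a limit, and near-minimizers form
   a Cauchy sequence. *)
Lemma mazur : exists (w : nat -> R -> X) (B : nat -> set A),
  [/\ forall n, F (B n) /\ mid_hull (B n) (w n),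
      forall n i j, B n i -> B n j ->
        \int[mu]_(t in I) ipH (u i t - u j t) (u i t - u j t) <= n.+1%:R^-1 &
      forall n k, (n <= k)%N -> energyV (fun t => w k t - w n t) <= 8 * n.+1%:R^-1].
Proof.
have [d dE] : exists d, d = sup [set infV S | S in [set S | F S]] by eexists.
have hsup : has_sup [set infV S | S in [set S | F S]].
  split; first by exists (infV setT); exists setT => //; exact: filterT.
  exists (ca^-1 * E) => _ [S FS <-]; have [w hw] := hull_ex FS.
  by apply: le_trans (infV_le FS hw) _; exact: mid_hull_energyV hw.
have dn (n : nat) : 0 < (n.+1%:R^-1 : R) by rewrite invr_gt0.
(* [C n] nearly attains the supremum of the infima and [G n] has small diameter in L^2(0, T; H); the
   finite intersections [B n] have both properties and decrease. *)
have /choice[C hC] n : exists S, F S /\ d - n.+1%:R^-1 < infV S.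
  by rewrite dE; have [_ [S FS <-] h] := sup_adherent (dn n) hsup; exists S.
have /choice[G hG] n : exists S, F S /\ forall i j, S i -> S j ->
    \int[mu]_(t in I) ipH (u i t - u j t) (u i t - u j t) <= n.+1%:R^-1.
  by have [S FS hS] := small (dn n); exists S.
pose B n := [set i | forall k : 'I_n.+1, C k i /\ G k i].
have FB n : F (B n).
  apply: filter_forall => k; apply: filterI; first by case: (hC k).
  by case: (hG k).
have Bsub n k : (n <= k)%N -> B k `<=` B n.
  move=> nk i Bi j; exact: (Bi (widen_ord (nk : (n.+1 <= k.+1)%N) j)).
have dB n : d - n.+1%:R^-1 < infV (B n).
  have [FC] := hC n; move/lt_le_trans; apply.
  apply: lb_le_inf; first by case: (infV_has (FB n)).
  move=> _ [w hw <-]; apply: infV_le => //; apply: mid_hull_sub hw => i Bi.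
  by case: (Bi ord_max).
have Bd n : infV (B n) <= d.
  by rewrite dE; apply: ub_le_sup; [case: hsup|exists (B n)].
have /choice[w hw] n : exists w, mid_hull (B n) w /\ energyV w < d + n.+1%:R^-1.
  have [_ [w hw <-] h] := inf_adherent (dn n) (infV_has (FB n)).
  by exists w; split => //; apply: lt_le_trans h _; rewrite lerD2r; exact: Bd.
exists w, B; split.
- by move=> n; split => //; case: (hw n).
- by move=> n i j Bi Bj; case: (hG n) => _; apply; [case: (Bi ord_max)|case: (Bj ord_max)].
move=> n k nk; have [hk ek] := hw k; have [hn en] := hw n.
(* The midpoint of [w k] and [w n] lies in the hull of [B n], so its energy exceeds
   [d - n.+1%:R^-1], while both energies are below [d + n.+1%:R^-1]. The parallelogram identity
   leaves a quarter of the energy of the difference below [2 * n.+1%:R^-1], whence the factor 8. *)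
have h := infV_le (FB n) (mid_hull_mid (mid_hull_sub (Bsub _ _ nk) hk) hn).
rewrite energyV_mid in h; [|exact: mid_hull_simple hk|exact: mid_hull_simple hn].
have := dB n.
have : (k.+1%:R^-1 : R) <= n.+1%:R^-1 by rewrite lef_pV2 ?posrE// ler_nat.
move: ek en h.
move: (energyV (w k)) (energyV (w n)) (energyV _) (infV _) (k.+1%:R^-1) (n.+1%:R^-1).
by move=> *; lra.
Qed.

(** The combinations [w] certify that the limit is strongly measurable into V, while the
    approximations [u j], the ones that satisfy the scheme, are known to be close to it in H
    only. *)
Lemma limit_exists : exists (u0 : R -> X) (G : set R) (w : nat -> R -> X),
  [/\ [/\ measurable (G : set (measurableTypeR R)), G `<=` I & mu.-negligible (I `\` G)],
      (forall t, V (u0 t)) /\ (forall t, ~ G t -> u0 t = 0),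
      (forall n, simple_in D (w n)) /\
        forall t, G t -> (fun k => nV (w k t - u0 t)) @ \oo --> (0 : R),
      forall t, ipH (u0 t) (u0 t) <= E &
      mu.-integrable I (EFin \o (fun t => ipV (u0 t) (u0 t))) /\
      forall e : R, 0 < e -> exists2 B, F B & forall j, B j ->
        mu.-integrable I (EFin \o (fun t => ipH (u0 t - u j t) (u0 t - u j t))) /\
        \int[mu]_(t in I) ipH (u0 t - u j t) (u0 t - u j t) <= e].
Proof.
have [w [B [hB diamB cauw]]] := mazur.
have sw n : simple_in D (w n) by case: (hB n) => _ /mid_hull_simple.
have swV n : simple_in V (w n) by exact: simple_in_sub DV (sw n).
have Vw n t : V (w n t) by exact: simple_mem hV (swV n).
have mw n : measurable_fun I (fun t => nV (w n t)).
  exact: finval_measurable (finval_comp nV (simple_finval (sw n))).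
have mww n k : measurable_fun I (fun t => nV (w n t - w k t)).
  exact: finval_measurable (finval_comp (fun p => nV (p.1 - p.2))
    (finval_pair (simple_finval (sw n)) (simple_finval (sw k)))).
have cw (e : R) : 0 < e -> exists K, forall n k, (K <= n)%N -> (K <= k)%N ->
  (\int[mu]_(t in I) (nV (w n t - w k t) ^+ 2)%:E <= e%:E)%E.
  move=> e0; exists (Num.truncn (8 / e)) => n k.
  wlog nk : n k / (n <= k)%N => [hw Kn Kk|Kn Kk].
    have [nk|/ltnW kn] := leqP n k; first exact: hw.
    rewrite (eq_integral (fun t : measurableTypeR R => (nV (w k t - w n t) ^+ 2)%:E)); first exact: hw.
    by move=> t _; rewrite (nrm_distC hV psdV).
  rewrite (eq_integral (fun t : measurableTypeR R => (ipV (w k t - w n t) (w k t - w n t))%:E)); last first.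
    by move=> t _; rewrite (nrm_distC hV psdV)// (nrm_sqr psdV)//; exact: subspB.
  rewrite -EFin_Rint//; last exact: (sint (fun x y => ipV (x - y) (x - y)) (sw k) (sw n)).
  rewrite lee_fin; apply: le_trans (cauw _ _ nk) _.
  have := truncnS_gt (8 / e); rewrite ltr_pdivrMr// ler_pdivrMr// => h.
  by apply: ltW; apply: lt_le_trans h _; rewrite mulrC ler_pM2l// ler_nat.
have [g [G [u0 [mG GI nG Vu0 [w0 mwu intwu]]]]] :=
  riesz_fischer mI hV psdV (es_complete ES) Vw mw mww cw.
have Vu t : V (u0 t) by case: (Vu0 t).
have u00 t : ~ G t -> u0 t = 0 by case: (Vu0 t) => _ h /h.
have nHV t n : nH (w n t - u0 t) <= nV (w n t - u0 t).
  by apply: (nH_le_nV ES); exact: subspB.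
have [K0 hK0] := intwu 1 ltr01.
have wuI n : (K0 <= n)%N -> mu.-integrable I (EFin \o (fun t => nV (w n t - u0 t) ^+ 2)).
  move=> Kn; apply: intg_ge0P => //; first exact: measurable_funX.
    by move=> t _; exact: sqr_ge0.
  by apply: le_lt_trans (hK0 _ Kn) _; rewrite ltry.
have w0H t : G t -> (fun k => nH (w (g k) t - u0 t)) @ \oo --> (0 : R).
  move=> Gt; apply: (squeeze_cvgr _ (cvg_cst 0) (w0 t Gt)).
  by apply: nearW => k; rewrite nrm_ge0 nHV.
have nHlim t (y : X) : G t -> V y ->
    (fun k => nH (w (g k) t - y)) @ \oo --> nH (u0 t - y).
  move=> Gt Vy; apply/cvgrPdist_le => e e0.
  have /cvgrPdist_le/(_ _ e0) := w0H _ Gt; apply: filterS => k.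
  rewrite sub0r normrN (ger0_norm (nrm_ge0 _ _)); apply: le_trans.
  apply: le_trans (nrm_dist hV psdH (subspB hV (Vu t) Vy) (subspB hV (Vw (g k) t) Vy)) _.
  rewrite opprB addrA subrK (nrm_distC hV psdH)//.
have IG : I = G `|` (I `\` G) by rewrite setUC setDKU.
have mID : measurable (I `\` G) by exact: measurableD.
have mnH (s : R -> X) : simple_in D s -> measurable_fun I (fun t => nH (u0 t - s t)).
  move=> ss; have Vs t : V (s t) by exact: simple_mem hV (simple_in_sub DV ss).
  rewrite IG; apply/measurable_funU => //; split.
    apply: (measurable_fun_cvg (h := fun k t => nH (w (g k) t - s t))).
      move=> k; exact: finval_measurable (finval_comp (fun p => nH (p.1 - p.2))
        (finval_pair (simple_finval (sw (g k))) (simple_finval ss))).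
    by move=> t Gt; exact: nHlim.
  apply: (eq_measurable_fun (fun t => nH (0 - s t))).
    by move=> t /set_mem[_ nGt]; rewrite u00.
  exact: finval_measurable (finval_comp (fun x => nH (0 - x)) (simple_finval ss)).
have mnV : measurable_fun I (fun t => nV (u0 t)).
  rewrite IG; apply/measurable_funU => //; split; last first.
    apply: (eq_measurable_fun (fun t => nV 0)) => [t /set_mem[_ nGt]|]; first by rewrite u00.
    exact: measurable_cst.
  apply: (measurable_fun_cvg (h := fun k t => nV (w (g k) t))).
    by move=> k; apply: measurable_funS (mw (g k)).
  move=> t Gt; apply/cvgrPdist_le => e e0.
  have /cvgrPdist_le/(_ _ e0) := w0 _ Gt; apply: filterS => k.
  rewrite sub0r normrN (ger0_norm (nrm_ge0 _ _)); apply: le_trans.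
  by rewrite (nrm_distC hV psdV)//; exact: (nrm_dist hV psdV (Vu t) (Vw (g k) t)).
exists u0, G, (w \o g); split => //.
- by split => // n; exact: sw.
- move=> t; have [Gt|nGt] := pselect (G t); last first.
    rewrite u00//; have [[h _] _ _] := psdH; rewrite (lin_on0 hV (h 0 (subsp0 hV))).
    exact: (bigE_ge0 ES AF).
  rewrite -(nrm_sqr psdH)// -(sqr_sqrtr (bigE_ge0 ES AF)).
  apply: lerXn2r; rewrite ?nnegrE ?nrm_ge0 ?sqrtr_ge0//.
  have := nHlim t 0 Gt (subsp0 hV); rewrite subr0 => h; apply: (cvgr_to_le h).
  apply: nearW => k; rewrite subr0; apply: ler_wsqrtr.
  by have [_ hh] := hB (g k); exact: mid_hull_ipH hh.
split.
  have i1 := wuI K0 (leqnn _); have i2 := sint ipV (sw K0) (sw K0).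
  apply: (intg_le mI _ _ (intgD mI (intgZ mI 2 i1) (intgZ mI 2 i2))).
    apply: (eq_measurable_fun (fun t => nV (u0 t) ^+ 2)).
      by move=> t _; rewrite (nrm_sqr psdV).
    exact: measurable_funX.
  move=> t _; rewrite ger0_norm ?(psd_ge0 psdV)// -!(nrm_sqr psdV)//.
  have := nrm_triangle hV psdV (subspB hV (Vu t) (Vw K0 t)) (Vw K0 t).
  rewrite subrK (nrm_distC hV psdV)//.
  by apply: sqr_le_addn; exact: nrm_ge0.
move=> e e0.
(* The triangle inequality through [w n] doubles two squared distances, each made at most
   [e / 4]. *)
have e4 : 0 < e / 4 by rewrite divr_gt0.
have [K1 hK1] := intwu _ e4.
pose n := maxn (Num.truncn (4 / e)) (maxn K0 K1).
have n0 : (K0 <= n)%N by rewrite /n !leq_max leqnn orbT.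
have n1 : (K1 <= n)%N by rewrite /n !leq_max leqnn !orbT.
have ne : n.+1%:R^-1 <= e / 4.
  have := truncnS_gt (4 / e); rewrite ltr_pdivrMr// => h.
  rewrite -[e / 4]invrK invf_div lef_pV2 ?posrE ?divr_gt0//.
  rewrite ler_pdivrMr//; apply: ltW; apply: lt_le_trans h _.
  by rewrite ler_pM2r// ler_nat ltnS /n leq_maxl.
clearbody n; have [FB hw] := hB n; exists (B n) => // j Bj.
have su := af_u AF j; have Vuj t : V (u j t) by exact: DV (sD t su).
have i1 := wuI n n0; have i2 := sint (fun x y => ipH (x - y) (x - y)) (sw n) su.
have key t : ipH (u0 t - u j t) (u0 t - u j t) <=
    2 * nV (w n t - u0 t) ^+ 2 + 2 * ipH (w n t - u j t) (w n t - u j t).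
  have V1 : V (u0 t - u j t) by exact: subspB.
  have V2 : V (w n t - u j t) by exact: subspB.
  rewrite -!(nrm_sqr psdH)//.
  have := nrm_triangle hV psdH (subspB hV (Vu t) (Vw n t)) V2.
  rewrite addrA subrK (nrm_distC hV psdH (Vu t) (Vw n t)).
  move=> h; apply: sqr_le_addn; first exact: nrm_ge0.
  by apply: le_trans h _; rewrite lerD2r.
have i3 : mu.-integrable I (EFin \o (fun t => ipH (u0 t - u j t) (u0 t - u j t))).
  apply: (intg_le mI _ _ (intgD mI (intgZ mI 2 i1) (intgZ mI 2 i2))).
    apply: (eq_measurable_fun (fun t => nH (u0 t - u j t) ^+ 2)).
      by move=> t _; rewrite (nrm_sqr psdH)//; exact: subspB.
    by apply: measurable_funX; exact: mnH.
  move=> t _; rewrite ger0_norm//; apply: (psd_ge0 psdH); exact: subspB.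
split=> //; apply: (@le_trans _ _ (\int[mu]_(t in I)
   (2 * nV (w n t - u0 t) ^+ 2 + 2 * ipH (w n t - u j t) (w n t - u j t)))).
  by apply: le_Rintegral => //; apply: intgD => //; exact: intgZ.
rewrite RintegralD//; [|exact: intgZ|exact: intgZ].
rewrite !RintegralZl//.
have h1 : \int[mu]_(t in I) (nV (w n t - u0 t) ^+ 2) <= e / 4.
  by rewrite -lee_fin EFin_Rint//; exact: hK1.
have := mid_hull_diam (diamB n) Bj hw; move: h1 ne.
move: (\int[mu]_(t in I) _) (\int[mu]_(t in I) _) (n.+1%:R^-1) => *; lra.
Qed.

End limit.

(** * Primitives and weak time derivatives *)

Section real_calculus.
Variable R : realType.
Local Notation mu := (@lebesgue_measure R).

Lemma FTC_C1 (F f : R -> R) (a b : R) : a <= b -> (forall x, derivable F x 1) ->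
  (forall x, 'D_1 F x = f x) -> continuous f ->
  \int[mu]_(x in `[a, b]) f x = F b - F a.
Proof.
rewrite le_eqVlt => /predU1P[<- _ _ _|ab dF Ff cf].
  by rewrite subrr set_itv1 Rintegral_set1.
have cF : continuous F.
  by move=> x; apply: differentiable_continuous; apply/derivable1_diffP; exact: dF.
rewrite /Rintegral (continuous_FTC2 (F := F) ab)//.
- exact: continuous_subspaceT.
- split; first by move=> x _; exact: dF.
    by apply: cvg_at_right_filter; exact: cF.
  by apply: cvg_at_left_filter; exact: cF.
- by move=> x _; rewrite derive1E Ff.
Qed.

Variables (T : R) (hT : 0 < T).
Local Notation I := (`]0, T[%classic : set (measurableTypeR R)).
Let mI : measurable I. Proof. exact: measurable_itv. Qed.

Definition prim (g : R -> R) (t : R) : R := \int[mu]_(x in `]0, t[) g x.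

Lemma prim_continuous (g : R -> R) : mu.-integrable I (EFin \o g) ->
  {within `[0, T], continuous (prim g)}.
Proof.
move=> ig; pose h := g \_ I.
have ih : mu.-integrable `[0, T] (EFin \o h).
  have /(integrable_mkcond _ mI) := ig.
  have -> : (EFin \o g) \_ I = EFin \o h.
    by apply/funext => x; rewrite /h /= !patchE; case: ifP.
  apply: integrableS => //.
have := parameterized_integral_continuous (ltW hT) ih.
apply: subspace_eq_continuous => t; rewrite /from_subspace /= inE /= in_itv /= => /andP[t0 tT].
rewrite /parameterized_integral /prim.
have it : mu.-integrable `]0, t[ (EFin \o h).
  by apply: integrableS ih => // x /=; rewrite !in_itv /= => /andP[/ltW -> /ltW xt]; exact: le_trans xt tT.
have it' : mu.-integrable `]0, t] (EFin \o h).
  by apply: integrableS ih => // x /=; rewrite !in_itv /= => /andP[/ltW -> xt]; exact: le_trans xt tT.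
rewrite -Rintegral_itv_obnd_cbnd// -Rintegral_itv_bndo_bndc//.
apply: eq_Rintegral => x /set_mem /=; rewrite in_itv /= => /andP[x0 xt].
by rewrite /h patchE mem_set//= in_itv /= x0 (lt_le_trans xt).
Qed.

Lemma prim_measurable (g : R -> R) : mu.-integrable I (EFin \o g) ->
  measurable_fun I (prim g).
Proof.
move=> /prim_continuous h; apply: (@measurable_funS _ _ _ _ `[0, T]%classic) => //.
  by move=> x /=; rewrite !in_itv /= => /andP[/ltW -> /ltW ->].
exact: subspace_continuous_measurable_fun.
Qed.

Lemma prim_le (g : R -> R) t : t <= T -> mu.-integrable I (EFin \o g) ->
  `|prim g t| <= \int[mu]_(x in I) `|g x|.
Proof.
move=> tT ig; have it := sub_itv0_int tT ig.
apply: le_trans (le_normr_Rintegral _ it) _ => //.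
rewrite -lee_fin !EFin_Rint//; [|exact: intg_norm|exact: intg_norm].
apply: ge0_subset_integral => //; last exact: sub_itv0.
apply/measurable_EFinP; apply: measurableT_comp => //; exact: intg_meas ig.
Qed.

Lemma Rint_le_sqrt (h : R -> R) : sqi mu I h ->
  \int[mu]_(x in I) `|h x| <= Num.sqrt (\int[mu]_(x in I) h x ^+ 2) * Num.sqrt T.
Proof.
move=> sh.
have sn : sqi mu I (fun x => `|h x|).
  split; first by apply: measurableT_comp => //; exact: sh.1.
  by apply: eq_integrable sh.2 => // x _ /=; rewrite real_normK ?num_real.
have s1 := cst_sqi hT 1.
have := psd_CS (sqi_subsp mu mI) (dot_psd mu mI) sn s1.
move=> /(le_trans (ler_norm _)); rewrite /nrm /dot.
congr (_ <= Num.sqrt _ * Num.sqrt _).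
- by apply: eq_Rintegral => x _; rewrite mulr1.
- by apply: eq_Rintegral => x _; rewrite -expr2 real_normK ?num_real.
- rewrite Rintegral_cst// mulr1 mul1r.
  by rewrite [X in fine X](mu_itvoo0 (ltW hT)).
Qed.

Lemma test_itv0 (th : R -> R) : test (`]0, T[ : set R) th ->
  forall t, ~ I t -> th t = 0.
Proof.
move=> [_ _ h] t nI; apply: contrapT => t0; apply: nI; apply: h.
by apply: subset_closure; apply/eqP.
Qed.

Lemma cont_bounded (h : R -> R) : continuous h ->
  exists C : R, 0 <= C /\ forall x, I x -> `|h x| <= C.
Proof.
move=> ch.
have /compact_bounded[M [_ hM]] : compact (h @` `[0, T]%classic).
  by apply: continuous_compact; [exact: continuous_subspaceT|exact: segment_compact].
have hC x : I x -> `|h x| <= M + 1.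
  rewrite /= in_itv /= => /andP[x0 xT].
  by apply: (hM (M + 1)); [rewrite ltrDl|exists x => //=; rewrite in_itv /= !ltW].
exists (M + 1); split => //; apply: le_trans (normr_ge0 _) (hC (T / 2) _).
by rewrite /= in_itv /= divr_gt0//= ltr_pdivrMr// ltr_pMr// ltr1n.
Qed.

(* Exchange the order of integration over the triangle s < t. *)
Lemma weak_ddt_prim (F g : R -> R) (c : R) : measurable_fun I F ->
  mu.-integrable I (EFin \o g) ->
  {ae mu, forall t, I t -> F t = c + prim g t} -> weak_ddt T F g.
Proof.
move=> mF ig Fae th hth.
have [Cth _ _] := hth.
have [dth cth] : (forall x, derivable th x 1) /\ continuous ('D_1 th).
  by have [h1 h2] := Cth 1 1.
have thE : derive1 th = 'D_1 th by apply/funext => x; rewrite derive1E.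
have th_m : measurable_fun [set: measurableTypeR R] ('D_1 th) by exact: continuous_measurable_fun.
have [C [C0 thC]] := cont_bounded cth.
have [C' [C'0 thC']] : exists C : R, 0 <= C /\ forall x, I x -> `|th x| <= C.
  apply: cont_bounded => x; apply: differentiable_continuous; apply/derivable1_diffP; exact: dth.
have thT : th T = 0 by apply: (test_itv0 hth); rewrite /= in_itv /= ltxx andbF.
have th0 : th 0 = 0 by apply: (test_itv0 hth); rewrite /= in_itv /= ltxx.
have dint (D : set (measurableTypeR R)) : measurable D -> D `<=` I ->
    mu.-integrable D (EFin \o 'D_1 th).
  move=> mD DI; apply: integrableS (_ : mu.-integrable I _) => //.
  by apply: (bounded_time_int hT (C := C)) => //; exact: measurable_funTS.
have FTC s : 0 <= s -> s <= T -> \int[mu]_(t in `]s, T[) 'D_1 th t = - th s.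
  move=> s0 sT; rewrite -[RHS]add0r -thT -(FTC_C1 sT dth (fun=> erefl) cth).
  have h1 : mu.-integrable `[s, T] (EFin \o 'D_1 th).
    apply: continuous_compact_integrable; first exact: segment_compact.
    exact: continuous_subspaceT.
  rewrite Rintegral_itv_bndo_bndc; last first.
    by apply: integrableS h1 => // x /=; rewrite !in_itv /= => /andP[/ltW -> /ltW ->].
  rewrite Rintegral_itv_obnd_cbnd//.
  by apply: integrableS h1 => // x /=; rewrite !in_itv /= => /andP[/ltW -> ->].
pose gI := g \_ I; pose dI := 'D_1 th \_ I.
have mgI : measurable_fun [set: measurableTypeR R] gI by apply/(measurable_restrictT _ mI); exact: intg_meas ig.
have mdI : measurable_fun [set: measurableTypeR R] dI by apply/(measurable_restrictT _ mI); exact: measurable_funTS.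
have igI : mu.-integrable setT (EFin \o gI).
  have /(integrable_mkcond _ mI) := ig; congr integrable.
  by apply/funext => x; rewrite /= /gI !patchE; case: ifP.
have idI : mu.-integrable setT (EFin \o dI).
  have /(integrable_mkcond _ mI) := dint I mI (@subset_refl _ _); congr integrable.
  by apply/funext => x; rewrite /= /dI !patchE; case: ifP.
pose k (z : R * R) : R := if z.1 < z.2 then gI z.1 * dI z.2 else 0.
have mprod : measurable_fun setT (fun z : measurableTypeR R * measurableTypeR R => gI z.1 * dI z.2).
  by apply: measurable_funM; apply: measurableT_comp.
have mk : measurable_fun setT (k : measurableTypeR R * measurableTypeR R -> R).
  apply: measurable_fun_ifT => //; exact: measurable_fun_ltr.
have iprod : (mu \x mu)%E.-integrable setT
    (EFin \o (fun z : measurableTypeR R * measurableTypeR R => gI z.1 * dI z.2)).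
  apply/integrable12ltyP; first exact/measurable_EFinP.
  rewrite (eq_integral (fun x => `|gI x|%:E * \int[mu]_y `|dI y|%:E)%E).
    rewrite ge0_integralZr//.
    - have /integrableP[_ h1] := igI; have /integrableP[_ h2] := idI.
      by apply: lte_mul_pinfty => //; [exact: integral_ge0|rewrite ge0_fin_numE//; exact: integral_ge0].
    - by apply/measurable_EFinP; exact: measurableT_comp.
    - exact: integral_ge0.
  move=> x _; rewrite -ge0_integralZl//; last by apply/measurable_EFinP; exact: measurableT_comp.
  by apply: eq_integral => y _; rewrite /= normrM EFinM.
have ik : (mu \x mu)%E.-integrable setT (EFin \o (k : measurableTypeR R * measurableTypeR R -> R)).
  apply: le_integrable iprod => //; first exact/measurable_EFinP.
  by move=> z _; rewrite /k /=; case: ifP => // _; rewrite normr0 lee_fin.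
(* Integrating first in [t]: since [th] vanishes at [T], its derivative integrates to [- th s] from
   [s] to [T]. *)
have e1 : (\int[mu]_s (\int[mu]_t (EFin \o k) (s, t)) =
    \int[mu]_(s in [set: measurableTypeR R]) (- (gI s * th s))%:E)%E.
  apply: eq_integral => s _; have [Is|nIs] := pselect (I s); last first.
    rewrite (_ : gI s = 0); last by rewrite /gI patchE memNset.
    rewrite mul0r oppr0 (eq_integral (cst 0%E)) ?integral0// => t _.
    by rewrite /k /= /gI patchE memNset// mul0r; case: ifP.
  have [s0 sT] : 0 <= s /\ s <= T by move: Is; rewrite /= in_itv /= => /andP[/ltW ? /ltW].
  have sub : `]s, T[%classic `<=` I by move=> x /=; rewrite !in_itv /= => /andP[/(le_lt_trans s0) -> ->].
  rewrite (eq_integral (fun t : measurableTypeR R => ((EFin \o (fun t => gI s * 'D_1 th t)) \_ `]s, T[) t)).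
    have ms : measurable (`]s, T[%classic : set (measurableTypeR R)) by exact: measurable_itv.
    have ids := dint _ ms sub.
    by rewrite -integral_mkcond -(EFin_Rint ms (intgZ ms _ ids)) RintegralZl// FTC// mulrN.
  move=> t _; rewrite /k /=. rewrite /dI !patchE !mem_setE /= !in_itv /=.
  have [st|ts] := ltP s t => //=.
  rewrite (le_lt_trans s0 st) /=; case: ifP => //; by rewrite mulr0.
have := etrans (esym e1) (Fubini ik).
rewrite [RHS](eq_integral (fun t : measurableTypeR R => (dI t * prim g t)%:E)); last first.
  move=> t _; have [It|nIt] := pselect (I t); last first.
    rewrite (_ : dI t = 0); last by rewrite /dI patchE memNset.
    rewrite mul0r (eq_integral (cst 0%E)) ?integral0// => s _.
    by rewrite /k /= /dI patchE memNset// mulr0; case: ifP.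
  have [t0 tT] : 0 < t /\ t < T by move: It; rewrite /= in_itv /= => /andP[].
  have it := sub_itv0_int (ltW tT) ig.
  rewrite (eq_integral (fun s : measurableTypeR R => ((EFin \o (fun s => dI t * g s)) \_ `]0, t[) s)).
    have mt : measurable (`]0, t[%classic : set (measurableTypeR R)) by exact: measurable_itv.
    by rewrite -integral_mkcond -(EFin_Rint mt (intgZ mt _ it)) RintegralZl.
  move=> s _; rewrite /k /= /gI !patchE !mem_setE /= !in_itv /=.
  have [st|ts] := ltP s t; last by rewrite andbF.
  by rewrite (lt_trans st tT) !andbT; case: ifP => //; rewrite ?mul0r ?mulr0// mulrC.
move=> fub.
have pth : mu.-integrable I (EFin \o (fun t => prim g t * 'D_1 th t)).
  apply: (bounded_time_int hT (C := (\int[mu]_(x in I) `|g x|) * C)).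
    by apply: measurable_funM; [exact: prim_measurable|exact: measurable_funTS].
  move=> t It; rewrite normrM; apply: ler_pM => //; last exact: thC.
  by apply: prim_le => //; move: It; rewrite /= in_itv /= => /andP[_ /ltW].
have dth1 : mu.-integrable I (EFin \o 'D_1 th) by exact: dint.
(* The constant [c], that is the initial value, does not contribute. *)
have intd : \int[mu]_(t in I) 'D_1 th t = 0.
  by rewrite FTC// ?th0 ?oppr0// ltW.
have -> : \int[mu]_(t in I) (F t * derive1 th t) =
          \int[mu]_(t in I) (c * 'D_1 th t + prim g t * 'D_1 th t).
  rewrite /Rintegral; congr fine; apply: ae_eq_integral => //.
  - apply/measurable_EFinP; apply: measurable_funM => //.
    by rewrite thE; exact: measurable_funTS.
  - apply/measurable_EFinP; exact: (intg_meas (intgD mI (intgZ mI c dth1) pth)).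
  - by apply: filterS Fae => t h It; rewrite h// thE mulrDl.
rewrite RintegralD//; last exact: intgZ.
rewrite RintegralZl// intd mulr0 add0r.
have gth : mu.-integrable I (EFin \o (fun s => g s * th s)).
  apply: (intg_le mI _ _ (intgZ mI C' (intg_norm ig))).
    apply: measurable_funM; first exact: intg_meas ig.
    apply: measurable_funTS; apply: continuous_measurable_fun => x.
    by apply: differentiable_continuous; apply/derivable1_diffP; exact: dth.
  by move=> x Ix; rewrite normrM mulrC ler_wpM2r// thC'.
have -> : - (\int[mu]_(t in I) (g t * th t)) = \int[mu]_(t in I) (- (g t * th t)).
  rewrite -mulN1r -(RintegralZl _ mI gth).
  by apply: eq_Rintegral => x _; rewrite mulN1r.
rewrite /Rintegral; congr fine; rewrite [RHS]integral_mkcond [LHS]integral_mkcond.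
apply/esym; move: fub; congr (_ = _); apply: eq_integral => s _.
  by rewrite /gI !patchE /=; case: ifP => _; rewrite ?mul0r ?oppr0.
by rewrite /dI !patchE /=; case: ifP => _; rewrite ?mul0r// mulrC.
Qed.

End real_calculus.

(** * The equation satisfied by the limit *)

Section limit_equation.
Variables (R : realType) (X : lmodType R) (V D : set X).
Variables (ipH ipV a : X -> X -> R) (b : X -> X -> X -> R) (ca Ca Cb : R) (kap : X -> R).
Hypothesis ES : evolution_setting V D ipH ipV a b ca Ca Cb kap.
Variables (T : R) (hT : 0 < T) (f : R -> X -> R) (phi : R -> R).
Hypothesis FS : force_setting V ipV T f phi.
Local Notation mu := (@lebesgue_measure R).
Local Notation I := (`]0, T[%classic : set (measurableTypeR R)).
Local Notation nH := (nrm ipH).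
Local Notation nV := (nrm ipV).
Variables (M0 : R) (z : nat -> X) (c0 : X -> R).
(** The initial datum is represented by its pairings [c0] alone: it belongs to H, and the abstract
    setting has no space larger than [V]. *)
Hypothesis zc : forall v, V v -> (fun n => ipH (z n) v) @ \oo --> c0 v.
Hypothesis zM : forall n, D (z n) /\ ipH (z n) (z n) <= M0.
Local Notation E := (bigE ca T phi M0).
Variables (A : Type) (F : set_system A) (u l : A -> R -> X) (m : A -> nat).
Hypothesis AF : approx_family D ipH ipV a b ca kap T f phi M0 z F u l m.
Variables (u0 : R -> X) (G : set R) (w : nat -> R -> X).
Hypothesis G_set : [/\ measurable (G : set (measurableTypeR R)), G `<=` I & mu.-negligible (I `\` G)].
Hypothesis Vu0 : forall t, V (u0 t).
Hypothesis u0_out : forall t, ~ G t -> u0 t = 0.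
Hypothesis sw : forall n, simple_in D (w n).
Hypothesis wu0 : forall t, G t -> (fun k => nV (w k t - u0 t)) @ \oo --> (0 : R).
Hypothesis u0E : forall t, ipH (u0 t) (u0 t) <= E.
Hypothesis u0V : mu.-integrable I (EFin \o (fun t => ipV (u0 t) (u0 t))).
Hypothesis u0u : forall e : R, 0 < e -> exists2 B, F B & forall j, B j ->
  mu.-integrable I (EFin \o (fun t => ipH (u0 t - u j t) (u0 t - u j t))) /\
  \int[mu]_(t in I) ipH (u0 t - u j t) (u0 t - u j t) <= e.

Let hV : subsp V := es_V ES.
Let hD : subsp D := es_D ES.
Let DV := es_DV ES.
Let psdH := es_H ES.
Let psdV := es_ipV ES.
Let psdHD : psd_on D ipH := psd_on_sub DV (es_H ES).
Let mI : measurable I. Proof. exact: measurable_itv. Qed.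
Let FU : UltraFilter F := af_ultra AF.
#[local] Existing Instance FU.
Let FP : ProperFilter F. Proof. exact: ultra_proper. Qed.
#[local] Existing Instance FP.

Lemma a_le u1 v : V u1 -> V v -> `|a u1 v| <= `|Ca| * nV u1 * nV v.
Proof.
move=> Vu Vv; apply: le_trans (es_a_le ES Vu Vv) _.
by rewrite !ler_wpM2r ?nrm_ge0// ler_norm.
Qed.

Lemma b_le u1 u2 v : V u1 -> V u2 -> V v ->
  `|b u1 u2 v| <= `|Cb| * Num.sqrt (nH u1 * nV u1) * nV u2 * nV v.
Proof.
move=> Vu Vu' Vv; apply: le_trans (es_b_le ES Vu Vu' Vv) _.
by rewrite !ler_wpM2r ?nrm_ge0 ?sqrtr_ge0// ler_norm.
Qed.

Lemma sqrt_HV u1 : V u1 -> Num.sqrt (nH u1 * nV u1) <= nV u1.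
Proof.
move=> Vu; rewrite -[leRHS]ger0_norm ?nrm_ge0// -sqrtr_sqr ler_wsqrtr//.
by rewrite expr2 ler_wpM2r ?nrm_ge0// (nH_le_nV ES).
Qed.

Lemma b_le_V u1 u2 v : V u1 -> V u2 -> V v -> `|b u1 u2 v| <= `|Cb| * nV u1 * nV u2 * nV v.
Proof.
move=> Vu Vu' Vv; apply: le_trans (b_le Vu Vu' Vv) _.
by rewrite !ler_wpM2r ?nrm_ge0// ler_wpM2l// sqrt_HV.
Qed.

Lemma b_diff u1 u2 v : V u1 -> V u2 -> V v ->
  b u1 u1 v - b u2 u2 v = b (u1 - u2) u1 v + b u2 (u1 - u2) v.
Proof.
move=> V1 V2 Vv; rewrite (lin_onB (es_bl ES V1 Vv))//.
by rewrite (lin_onB ((es_b ES V2).1 _ Vv))//; ring.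
Qed.

Lemma cvg_le0 (x e : nat -> R) (y C : R) : (forall k, `|x k - y| <= C * e k) ->
  e @ \oo --> (0 : R) -> x @ \oo --> y.
Proof.
move=> h he.
have he' : (fun k => C * e k) @ \oo --> (0 : R) by rewrite -(mulr0 C); apply: cvgMr.
apply/cvgrPdist_le => d d0; have /cvgrPdist_le/(_ _ d0) := he'; apply: filterS => k.
rewrite sub0r normrN distrC => h1; apply: le_trans (h k) _.
exact: le_trans (ler_norm _) h1.
Qed.

(** The factor [nV v] is separated, so this is an estimate in the dual norm: it shows that the
    functionals defined by [w k] tend to the one defined by the limit field. *)
Lemma ab_diff u1 u2 v : V u1 -> V u2 -> V v ->
  `|(a u1 v + b u1 u1 v) - (a u2 v + b u2 u2 v)| <=
  (`|Ca| + `|Cb| * (2 * nV u2 + 1)) * (nV (u1 - u2) * (1 + nV (u1 - u2))) * nV v.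
Proof.
move=> V1 V2 Vv; have Ve : V (u1 - u2) by exact: subspB.
have -> : (a u1 v + b u1 u1 v) - (a u2 v + b u2 u2 v) =
   a (u1 - u2) v + (b u1 u1 v - b u2 u2 v).
  by rewrite (lin_onB ((es_a ES).1 _ Vv))//; ring.
rewrite b_diff//; apply: le_trans (ler_normD _ _) _.
have ha := a_le Ve Vv; have hb1 := b_le_V Ve V1 Vv; have hb2 := b_le_V V2 Ve Vv.
have hw : nV u1 <= nV (u1 - u2) + nV u2.
  by have := nrm_triangle hV psdV Ve V2; rewrite subrK.
have := ler_normD (b (u1 - u2) u1 v) (b u2 (u1 - u2) v).
have v0 := nrm_ge0 ipV v; have N0 := nrm_ge0 ipV u2; have e0 := nrm_ge0 ipV (u1 - u2).
have c1 := normr_ge0 Ca; have c2 := normr_ge0 Cb.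
move: (nV (u1 - u2)) e0 (nV u2) N0 (nV v) v0 (nV u1) hw `|Ca| c1 `|Cb| c2 ha hb1 hb2.
move=> x x0 N N0 y y0 p hp A1 A10 B1 B10 ha hb1 hb2 h.
have hb1' : B1 * x * p * y <= B1 * x * (x + N) * y.
  by rewrite ler_wpM2r// ler_wpM2l// mulr_ge0.
have r : A1 * x * y + (B1 * x * (x + N) * y + B1 * N * x * y) <=
   (A1 + B1 * (2 * N + 1)) * (x * (1 + x)) * y.
  rewrite -subr_ge0.
  have -> : (A1 + B1 * (2 * N + 1)) * (x * (1 + x)) * y -
     (A1 * x * y + (B1 * x * (x + N) * y + B1 * N * x * y)) =
     A1 * x * y * x + B1 * x * y * (1 + 2 * N * x) by ring.
  by rewrite addr_ge0// !mulr_ge0// addr_ge0// !mulr_ge0.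
lra.
Qed.

Lemma wu0_cvg2 t : G t ->
  (fun k => nV (w k t - u0 t) * (1 + nV (w k t - u0 t))) @ \oo --> (0 : R).
Proof.
move=> Gt; rewrite -(mul0r (1 + 0)); apply: cvgM; first exact: wu0.
by apply: cvgD; [exact: cvg_cst|exact: wu0].
Qed.

Lemma gint_cvg v t : V v -> G t ->
  (fun k => gint a b f (w k) (w k) v t) @ \oo --> gint a b f u0 u0 v t.
Proof.
move=> Vv Gt; have Vw k : V (w k t) by exact: DV (simple_mem t hD (sw k)).
apply: (cvg_le0 (C := (`|Ca| + `|Cb| * (2 * nV (u0 t) + 1)) * nV v) _ (wu0_cvg2 Gt)) => k.
rewrite mulrAC; apply: le_trans (ab_diff (Vw k) (Vu0 t) Vv).
by rewrite -normrN /gint le_eqVlt; apply/orP; left; apply/eqP; congr `|_|; ring.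
Qed.

Let IG : I = G `|` (I `\` G).
Proof. by case: G_set => _ GI _; rewrite setUC setDKU. Qed.
Let mG : measurable (G : set (measurableTypeR R)). Proof. by case: G_set. Qed.
Let mIG : measurable (I `\` G). Proof. exact: measurableD. Qed.
Let GI : G `<=` I. Proof. by case: G_set. Qed.

Lemma limit_measurable (h : nat -> R -> R) (h0 : R -> R) :
  (forall k, measurable_fun I (h k)) ->
  (forall t, G t -> (fun k => h k t) @ \oo --> h0 t) ->
  measurable_fun (I `\` G) h0 -> measurable_fun I h0.
Proof.
move=> mh hh mh0; rewrite IG; apply/measurable_funU => //; split => //.
apply: (measurable_fun_cvg (h := h)) => //.
by move=> k; apply: measurable_funS (mh k).
Qed.

Lemma ipH_cvg v t : V v -> G t -> (fun k => ipH (w k t) v) @ \oo --> ipH (u0 t) v.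
Proof.
move=> Vv Gt; have Vw k : V (w k t) by exact: DV (simple_mem t hD (sw k)).
apply: (cvg_le0 (C := nV v) _ (wu0 Gt)) => k.
have [[h _] _ _] := psdH; rewrite -(lin_onB (h v Vv))//.
have Ve : V (w k t - u0 t) by exact: subspB.
apply: le_trans (psd_CS hV psdH Ve Vv) _; rewrite mulrC.
by apply: ler_pM; rewrite ?nrm_ge0// (nH_le_nV ES).
Qed.

Lemma ipH_meas v : V v -> measurable_fun I (fun t => ipH (u0 t) v).
Proof.
move=> Vv; apply: (@limit_measurable (fun k t => ipH (w k t) v)).
- by move=> k; exact: finval_measurable (finval_comp (ipH ^~ v) (simple_finval (sw k))).
- by move=> t; exact: ipH_cvg.
apply: (eq_measurable_fun (fun t => ipH 0 v)); last exact: measurable_cst.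
by move=> t /set_mem[_ nG]; rewrite u0_out.
Qed.

Lemma g0_meas v : V v -> measurable_fun I (gint a b f u0 u0 v).
Proof.
move=> Vv; apply: (@limit_measurable (fun k t => gint a b f (w k) (w k) v t)).
- by move=> k; exact: (gint_meas a b FS Vv (sw k) (sw k)).
- by move=> t; exact: gint_cvg.
apply: (eq_measurable_fun (fun t => f t v - a 0 v - b 0 0 v)).
  by move=> t /set_mem[_ nG]; rewrite /gint u0_out.
apply: measurable_funB; last exact: measurable_cst.
apply: measurable_funB; last exact: measurable_cst.
by apply: measurable_funS (fs_meas FS Vv) => //; exact: subDsetl.
Qed.

(** A crude dual bound for the limit integrand, with [Num.sqrt (nH * nV)] replaced by [nV]. It is
    integrable in time, which is enough to form primitives. *)
Definition gam t : R := phi t + `|Ca| * nV (u0 t) + `|Cb| * ipV (u0 t) (u0 t).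

Lemma nV_meas : measurable_fun I (fun t => nV (u0 t)).
Proof.
have h := intg_meas u0V.
by apply: measurableT_comp h => //; apply: continuous_measurable_fun; exact: sqrt_continuous.
Qed.

Lemma nV_int : mu.-integrable I (EFin \o (fun t => nV (u0 t))).
Proof.
have c1 : mu.-integrable I (EFin \o (fun=> 1 : R)).
  by apply: (bounded_time_int hT (C := 1)) => // t _; rewrite normr1.
apply: (intg_le mI nV_meas _ (intgD mI c1 u0V)) => t _.
rewrite ger0_norm ?nrm_ge0// -(nrm_sqr psdV)//; have := sqr_ge0 (nV (u0 t) - 1).
by rewrite sqrrB expr1n mulr1 mulr2n; have := sqr_ge0 (nV (u0 t)); have := nrm_ge0 ipV (u0 t); lra.
Qed.

Lemma gam_int : mu.-integrable I (EFin \o gam).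
Proof.
apply: intgD => //; last exact: intgZ.
apply: intgD => //; last by apply: intgZ => //; exact: nV_int.
have := sqi_mul mI (fs_phi FS) (cst_sqi hT 1).
by apply: eq_integrable => // x _; rewrite /= mulr1.
Qed.

Lemma g0_le v t : V v -> `|gint a b f u0 u0 v t| <= gam t * nV v.
Proof.
move=> Vv; rewrite /gint /gam -(nrm_sqr psdV)//.
have h1 := fs_le FS t Vv; have h2 := a_le (Vu0 t) Vv.
have h3 := b_le_V (Vu0 t) (Vu0 t) Vv.
apply: le_trans (ler_normB _ _) _; rewrite mulrDl; apply: lerD; last by rewrite expr2 mulrA.
by apply: le_trans (ler_normB _ _) _; rewrite mulrDl; exact: lerD.
Qed.

Lemma g0_int v : V v -> mu.-integrable I (EFin \o gint a b f u0 u0 v).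
Proof.
move=> Vv; apply: (intg_le mI (g0_meas Vv) _ (intgZ mI (nV v) gam_int)) => t _.
by rewrite mulrC g0_le.
Qed.

(** The amount by which the integrated equation fails at time [t]. *)
Let defect v t : R := ipH (u0 t) v - c0 v - prim (gint a b f u0 u0 v) t.

Let ipH_int v : V v -> mu.-integrable I (EFin \o (fun t => ipH (u0 t) v)).
Proof.
move=> Vv; apply: (bounded_time_int hT (C := Num.sqrt E * nH v)); first exact: ipH_meas.
move=> t _; apply: le_trans (psd_CS hV psdH (Vu0 t) Vv) _.
by rewrite ler_wpM2r ?nrm_ge0// ler_wsqrtr.
Qed.

Let defect_int v : V v -> mu.-integrable I (EFin \o defect v).
Proof.
move=> Vv; apply: intgB => //.
  apply: intgB => //; first exact: ipH_int.
  exact: (bounded_time_int hT (C := `|c0 v|)).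
apply: (bounded_time_int hT (C := \int[mu]_(x in I) `|gint a b f u0 u0 v x|)).
  exact: (prim_measurable hT (g0_int Vv)).
move=> t; rewrite /= in_itv /= => /andP[_ /ltW tT].
by apply: prim_le => //; exact: g0_int.
Qed.

Let E0 : 0 <= E := bigE_ge0 ES AF.

(** Cauchy-Schwarz in time turns the L^2 smallness of [u0 - u j], and of the lag [u j - l j] left by
    the scheme, into L^1 smallness. *)
Lemma L1_small (e : R) : 0 < e -> exists2 B, F B & forall j, B j ->
  [/\ mu.-integrable I (EFin \o (fun t => nH (u0 t - u j t))),
      \int[mu]_(t in I) nH (u0 t - u j t) <= e,
      mu.-integrable I (EFin \o (fun t => nH (u j t - l j t))) &
      \int[mu]_(t in I) nH (u j t - l j t) <= e].
Proof.
move=> e0; have Du j t : D (u j t) := af_Du ES AF j t.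
have Dl j t : D (l j t) := af_Dl ES AF j t.
have Vd j t : V (u0 t - u j t) by apply: subspB => //; exact: DV.
have Vd' j t : D (u j t - l j t) by exact: subspB.
have st0 : 0 < Num.sqrt T by rewrite sqrtr_gt0.
have e1 : 0 < (e / Num.sqrt T) ^+ 2 by rewrite exprn_gt0// divr_gt0.
have key (h : R -> X) : (forall t, V (h t)) ->
    mu.-integrable I (EFin \o (fun t => ipH (h t) (h t))) ->
    mu.-integrable I (EFin \o (fun t => nH (h t))) /\
    (\int[mu]_(t in I) ipH (h t) (h t) <= (e / Num.sqrt T) ^+ 2 ->
     \int[mu]_(t in I) nH (h t) <= e).
  move=> Vh ih.
  have mh : measurable_fun I (fun t => nH (h t)).
    apply: measurableT_comp (intg_meas ih) => //.
    by apply: continuous_measurable_fun; exact: sqrt_continuous.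
  have sh : sqi mu I (fun t => nH (h t)).
    by split => //; apply: eq_integrable ih => // t _; rewrite /= (nrm_sqr psdH).
  split.
    have := sqi_mul mI sh (cst_sqi hT 1).
    by apply: eq_integrable => // x _; rewrite /= mulr1.
  move=> hle.
  rewrite (_ : \int[mu]_(t in I) nH (h t) = \int[mu]_(t in I) `|nH (h t)|); last first.
    by apply: eq_Rintegral => t _; rewrite ger0_norm ?nrm_ge0.
  apply: le_trans (Rint_le_sqrt hT sh) _; rewrite -ler_pdivlMr//.
  have q0 : 0 <= e / Num.sqrt T by rewrite divr_ge0 ?sqrtr_ge0// ltW.
  rewrite -(ger0_norm q0) -(sqrtr_sqr (e / _)); apply: ler_wsqrtr.
  apply: le_trans hle; rewrite le_eqVlt; apply/orP; left; apply/eqP.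
  by apply: eq_Rintegral => t _; rewrite (nrm_sqr psdH).
have [B FB hB] := u0u e1.
have [N hN] := sqrt_tau_small hT (sqrtr_ge0 E) (divr_gt0 e0 st0).
exists (B `&` [set j | (N <= m j)%N]); first by apply: filterI => //; exact: af_m AF N.
move=> j [Bj /= Nj]; have [i1 i2] := hB j Bj.
have [k1 k2] := key _ (Vd j) i1.
have i3 := simple2_int hT (fun x y => ipH (x - y) (x - y)) (af_u AF j) (af_l AF j).
have [k3 k4] := key _ (fun t => DV (Vd' j t)) i3.
split => //; first exact: k2.
apply: k4; apply: le_trans (af_ul AF j) _.
have t0 := ltW (tau_gt0 hT (m j)).
have -> : tau T (m j) * E = Num.sqrt (tau T (m j) * E) ^+ 2 by rewrite sqr_sqrtr// mulr_ge0.
apply: lerXn2r; rewrite ?nnegrE ?sqrtr_ge0//.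
  by rewrite divr_ge0 ?sqrtr_ge0// ltW.
by rewrite sqrtrM// mulrC; exact: hN.
Qed.

(** Compare with one approximation far along [F]. The defect is made of the distance to [u0], the
    error of the initial pairing, the error of the scheme and the change of the integrand, all small
    in the mean because both forms are continuous in H against [v]. *)
Lemma limit_eq_smooth v : D v -> {ae mu, forall t, I t -> defect v t = 0}.
Proof.
move=> Dv; have Vv := DV Dv; have k0 := es_kap0 ES v.
suff small e : 0 < e -> \int[mu]_(t in I) `|defect v t| <= e.
  have h0 : \int[mu]_(t in I) `|defect v t| <= 0.
    by apply/ler_addgt0Pr => e e0; rewrite add0r; exact: small.
  have := Rint_ge0_le0 mI (intg_norm (defect_int Vv)) (fun t _ => normr_ge0 _) h0.
  by apply: filterS => t h /h /eqP; rewrite normr_eq0 => /eqP.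
move=> e0.
(* The 1 accounts for the linear form; [2 * Num.sqrt E] accounts for the two terms into which the
   difference of the quadratic form splits. *)
have [K KE] : exists K, K = kap v * (1 + 2 * Num.sqrt E) by eexists.
have K0 : 0 <= K by rewrite KE mulr_ge0// addr_ge0// mulr_ge0// sqrtr_ge0.
have T0 := hT; have nv0 := nrm_ge0 ipH v.
(* Integrating the pointwise bound [ptw] below gives at most [d * (nH v + T * (2 + 2 * K))]. *)
have [d [d0 dE]] : exists d, 0 < d /\ d * (nH v + T * (2 + 2 * K)) <= e.
  have q0 : 0 < nH v + T * (2 + 2 * K) + 1.
    by rewrite ltr_wpDl// addr_ge0// mulr_ge0 ?(ltW T0)//; lra.
  exists (e / (nH v + T * (2 + 2 * K) + 1)); split; first exact: divr_gt0.
  by rewrite mulrAC ler_pdivrMr// ler_pM2l//; lra.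
have [B FB hB] := L1_small d0.
have [N1 hN1] := sqrt_tau_small hT (sqrtr_ge0 _ : 0 <= gcst ipV ca kap T phi M0 v) d0.
have [N2 _ hN2] : \forall n \near \oo, `|c0 v - ipH (z n) v| <= d.
  by have /cvgrPdist_le/(_ _ d0) := zc Vv.
pose S := [set i | forall t, I t ->
  `|ipH (u i t) v - ipH (z (m i)) v - \int[mu]_(x in `]0, t[) gint a b f (u i) (l i) v x|
  <= gcst ipV ca kap T phi M0 v * Num.sqrt (tau T (m i))].
have /filter_ex[j [[Bj Nj] [/= N2j eqj]]] :
    F ((B `&` [set j | (N1 <= m j)%N]) `&` ([set j | (N2 <= m j)%N] `&` S)).
  apply: filterI; first by apply: filterI => //; exact: af_m AF N1.
  by apply: filterI; [exact: af_m AF N2|exact: (af_eq AF Dv)].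
have [iu su il sl] := hB _ Bj.
have hz := hN2 _ N2j; have ht := hN1 _ Nj.
have Du t : D (u j t) := af_Du ES AF j t.
have Dl t : D (l j t) := af_Dl ES AF j t.
have Vu t := DV (Du t); have Vl t := DV (Dl t).
have sE (x : X) : ipH x x <= E -> nH x <= Num.sqrt E by exact: ler_wsqrtr.
pose g0 := gint a b f u0 u0 v; pose gj := gint a b f (u j) (l j) v.
have gdiff t : `|gj t - g0 t| <= K * (nH (u0 t - u j t) + nH (u j t - l j t)).
  have Ve : V (u0 t - u j t) by exact: subspB.
  have Ve' : V (u0 t - l j t) by exact: subspB.
  (* One argument of [b] is changed at a time, each factor of the new terms being a field bounded in
     H or a small difference. *)
  have -> : gj t - g0 t = a (u0 t - u j t) v + (b (u0 t - l j t) (u0 t) v + b (l j t) (u0 t - u j t) v).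
    rewrite /gj /g0 /gint (lin_onB ((es_a ES).1 _ Vv))//.
    rewrite (lin_onB (es_bl ES (Vu0 t) Vv))// (lin_onB ((es_b ES (Vl t)).1 _ Vv))//; ring.
  have h1 := es_a_smooth ES Ve Dv.
  have h2 := es_b_smooth ES Ve' (Vu0 t) Dv.
  have h3 := es_b_smooth ES (Vl t) Ve Dv.
  have h4 : nH (u0 t - l j t) <= nH (u0 t - u j t) + nH (u j t - l j t).
    have := nrm_triangle hV psdH Ve (DV (subspB hD (Du t) (Dl t))).
    by rewrite addrA subrK.
  have h5 := sE _ (u0E t); have h6 := sE _ (af_lE AF j t).
  apply: le_trans (ler_normD _ _) _.
  have := ler_normD (b (u0 t - l j t) (u0 t) v) (b (l j t) (u0 t - u j t) v).
  have x1 := nrm_ge0 ipH (u0 t - u j t); have x2 := nrm_ge0 ipH (u j t - l j t).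
  have x3 := nrm_ge0 ipH (u0 t - l j t); have x4 := nrm_ge0 ipH (u0 t).
  have x5 := nrm_ge0 ipH (l j t).
  rewrite KE; move: h1 h2 h3 h4 h5 h6 x1 x2 x3 x4 x5 (sqrtr_ge0 E) k0.
  move: (nH (u0 t - u j t)) (nH (u j t - l j t)) (nH (u0 t - l j t)) (nH (u0 t)) (nH (l j t)).
  move: (Num.sqrt E) (kap v) `|a _ _| `|b (u0 t - _) _ _| `|b (l j t) _ _| `|_ + _|.
  move=> s k A1 B1 B2 B3 x y p q r h1 h2 h3 h4 h5 h6 x0 y0 p0 q0 r0 s0 kk h7.
  have h2' : k * p * q <= k * (x + y) * s.
    by apply: ler_pM; rewrite ?mulr_ge0// ler_wpM2l.
  have h3' : k * r * x <= k * s * x by rewrite ler_wpM2r// ler_wpM2l.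
  have : k * (1 + 2 * s) * (x + y) - (k * x + k * (x + y) * s + k * s * x) = k * y + k * s * y by ring.
  have : 0 <= k * y + k * s * y by rewrite addr_ge0// !mulr_ge0.
  lra.
have gji : mu.-integrable I (EFin \o gj).
  have hb x : I x -> `|gj x| <= gbound ipV ca kap T phi M0 v x.
    by move=> _; exact: (gint_le ES FS Dv (Vu x) (Vl x) (af_uE AF j x) (af_lE AF j x)).
  have := sqi_mul mI (gbound_sqi ca kap hT FS M0 v) (cst_sqi hT 1).
  apply: (intg_le mI (gint_meas a b FS Vv (af_u AF j) (af_l AF j))) => t It.
  by rewrite mulr1 hb.
have g0i := g0_int Vv.
have dint : mu.-integrable I (EFin \o (fun t => nH (u0 t - u j t) + nH (u j t - l j t))).
  exact: intgD.
have Lle : \int[mu]_(t in I) (nH (u0 t - u j t) + nH (u j t - l j t)) <= 2 * d.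
  by rewrite RintegralD//; lra.
have pdiff t : I t -> `|prim gj t - prim g0 t| <= K * (2 * d).
  rewrite /= in_itv /= => /andP[_ /ltW tT].
  have -> : prim gj t - prim g0 t = prim (fun x => gj x - g0 x) t.
    by rewrite /prim RintegralB//; [exact: sub_itv0_int tT gji|exact: sub_itv0_int tT g0i].
  apply: le_trans (prim_le tT (intgB mI gji g0i)) _.
  apply: (@le_trans _ _ (\int[mu]_(t in I) (K * (nH (u0 t - u j t) + nH (u j t - l j t))))).
    by apply: le_Rintegral => //; [apply: intg_norm; exact: intgB|exact: intgZ].
  by rewrite RintegralZl// ler_wpM2l.
have ptw t : I t -> `|defect v t| <= nH v * nH (u0 t - u j t) + (2 * d + K * (2 * d)).
  move=> It; rewrite /defect -/g0.
  have := pdiff t It; have := eqj t It; rewrite -/gj -/(prim gj t).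
  have h1 : `|ipH (u0 t) v - ipH (u j t) v| <= nH v * nH (u0 t - u j t).
    have [[h _] _ _] := psdH; rewrite -(lin_onB (h v Vv))// mulrC.
    by apply: (psd_CS hV psdH) => //; exact: subspB.
  move: hz ht h1; move: (gcst _ _ _ _ _ _ _ * _) (nH v * _) (prim gj t) (prim g0 t).
  move: (ipH (u0 t) v) (ipH (u j t) v) (c0 v) (ipH (z (m j)) v) => q1 q2 p1 p2 x1 x2 x3 x4.
  rewrite !ler_norml => *; lra.
have cstI (x : R) : mu.-integrable I (EFin \o (fun=> x)).
  exact: (bounded_time_int hT (C := `|x|)).
apply: (@le_trans _ _ (\int[mu]_(t in I) (nH v * nH (u0 t - u j t) + (2 * d + K * (2 * d))))).
  apply: le_Rintegral => //; first by apply: intg_norm; exact: defect_int.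
  by apply: intgD => //; exact: intgZ.
rewrite RintegralD//; last exact: intgZ.
rewrite RintegralZl// Rintegral_cst//.
rewrite [X in _ + _ * X](_ : _ = T); last by rewrite [X in fine X](mu_itvoo0 (ltW hT)).
have := ler_wpM2l nv0 su; lra.
Qed.

(** The defect is Lipschitz in [v] for the V norm, with a constant independent of time, and test
    fields are dense in [V]. *)
Lemma limit_eq v : V v ->
  {ae mu, forall t, I t -> ipH (u0 t) v = c0 v + prim (gint a b f u0 u0 v) t}.
Proof.
move=> Vv.
have dn (n : nat) : 0 < (n.+1%:R^-1 : R) by rewrite invr_gt0.
have /choice[d hd] n : exists d, D d /\ nV (v - d) < n.+1%:R^-1.
  by have [d Dd hd] := es_dense ES Vv (dn n); exists d.
have Dd n : D (d n) by case: (hd n).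
have Ve n : V (v - d n) by apply: subspB => //; exact: DV.
have [Q QE] : exists Q, Q = \int[mu]_(x in I) gam x by eexists.
pose C := Num.sqrt E + Num.sqrt M0 + Q.
have H1 n t : I t -> `|defect v t - defect (d n) t| <= C * nV (v - d n).
  move=> It; have Vd := DV (Dd n).
  have h0 := nH_le_nV ES (Ve n).
  have h1 : `|ipH (u0 t) v - ipH (u0 t) (d n)| <= Num.sqrt E * nV (v - d n).
    have [[_ h] _ _] := psdH; rewrite -(lin_onB (h (u0 t) (Vu0 t)))//.
    apply: le_trans (psd_CS hV psdH (Vu0 t) (Ve n)) _.
    by apply: ler_pM; rewrite ?nrm_ge0//; exact: ler_wsqrtr.
  have h2 : `|c0 v - c0 (d n)| <= Num.sqrt M0 * nV (v - d n).
    have hc : (fun k => `|ipH (z k) v - ipH (z k) (d n)|) @ \oo --> `|c0 v - c0 (d n)|.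
      by apply: cvg_norm; apply: cvgB; exact: zc.
    apply: (cvgr_to_le hc); apply: nearW => k.
    have [Dz zk] := zM k; have Vz := DV Dz.
    have [[_ h] _ _] := psdH; rewrite -(lin_onB (h (z k) Vz))//.
    apply: le_trans (psd_CS hV psdH Vz (Ve n)) _.
    by apply: ler_pM; rewrite ?nrm_ge0//; exact: ler_wsqrtr.
  have h3 : `|prim (gint a b f u0 u0 v) t - prim (gint a b f u0 u0 (d n)) t| <= Q * nV (v - d n).
    have tT : t <= T by move: It; rewrite /= in_itv /= => /andP[_ /ltW].
    have i1 := g0_int Vv; have i2 := g0_int Vd.
    have -> : prim (gint a b f u0 u0 v) t - prim (gint a b f u0 u0 (d n)) t =
        prim (gint a b f u0 u0 (v - d n)) t.
      rewrite /prim -RintegralB//; [|exact: sub_itv0_int tT i1|exact: sub_itv0_int tT i2].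
      apply: eq_Rintegral => x _; rewrite /gint.
      rewrite (lin_onB (fs_lin FS x))// (lin_onB ((es_a ES).2 _ (Vu0 x)))//.
      by rewrite (lin_onB ((es_b ES (Vu0 x)).2 _ (Vu0 x)))//; ring.
    apply: le_trans (prim_le tT (g0_int (Ve n))) _.
    rewrite QE -RintegralZr//; last exact: gam_int.
    apply: le_Rintegral => //; first by apply: intg_norm; exact: g0_int.
      by apply: eq_integrable (intgZ mI (nV (v - d n)) gam_int) => // x _; rewrite /= mulrC.
    by move=> x _; exact: g0_le.
  rewrite /defect /C !mulrDl; move: h1 h2 h3; move: (prim _ t) (prim _ t) (ipH (u0 t) v).
  move: (ipH (u0 t) (d n)) (c0 v) (c0 (d n)) (_ * _) (_ * _) (_ * _) => x1 x2 x3 x4 x5 x6 x7 x8 x9.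
  rewrite !ler_norml => *; lra.
have C0 : 0 <= C.
  rewrite /C addr_ge0 ?addr_ge0 ?sqrtr_ge0// QE; apply: Rintegral_ge0 => x _.
  rewrite /gam !addr_ge0 ?(fs_phi0 FS) ?mulr_ge0 ?nrm_ge0//; exact: (psd_ge0 psdV).
(* A sequence of test fields suffices, so the exceptional times form a countable union of null
   sets. *)
have /ae_foralln : forall n, {ae mu, forall t, I t -> defect (d n) t = 0}.
  by move=> n; exact: limit_eq_smooth.
apply: filterS => t ht It.
suff : defect v t = 0 by rewrite /defect; lra.
apply/eqP; rewrite -normr_le0; apply/ler_addgt0Pr => e e0; rewrite add0r.
pose n := Num.truncn (C / e).
have := H1 n t It; rewrite (ht n It) subr0 => /le_trans; apply.
have [_ /ltW hn] := hd n; apply: le_trans (ler_wpM2l C0 hn) _.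
rewrite ler_pdivrMr// mulrC -ler_pdivrMr//.
exact/ltW/truncnS_gt.
Qed.

End limit_equation.

(** * Finiteness of Lebesgue norms *)

Section norms_of_measures.
Context d (T : measurableType d) (R : realType) (mu : {measure set T -> \bar R}).

(* No measurability: the integral of a nonnegative function is a supremum over
   the simple functions below it. *)
Lemma ge0_le_integral_nomeas (D : set T) (f g : T -> \bar R) :
  (forall x, D x -> (0 <= f x)%E) -> (forall x, D x -> (f x <= g x)%E) ->
  (\int[mu]_(x in D) f x <= \int[mu]_(x in D) g x)%E.
Proof.
move=> f0 fg; rewrite !ge0_integralE//; last first.
  by move=> x Dx; apply: le_trans (f0 x Dx) (fg x Dx).
apply: le_ereal_sup => _ [h hf <-]; exists h => // x.
apply: le_trans (hf x) _; rewrite !patchE; case: ifPn => // /set_mem; exact: fg.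
Qed.

Lemma finite_normP (r : R) (h : T -> R) :
  (\int[mu]_x (`|h x| `^ r)%:E < +oo)%E -> finite_norm mu r%:E h.
Proof.
move=> hr; rewrite /finite_norm unlock; apply: poweR_lty.
exact: hr.
Qed.

Lemma finite_norm2_lty (h : T -> R) : finite_norm mu 2%:E h ->
  (\int[mu]_x (h x ^+ 2)%:E < +oo)%E.
Proof.
rewrite /finite_norm => /(poweR_lty 2); rewrite poweR_Lnorm//.
apply: le_lt_trans; rewrite le_eqVlt; apply/orP; left; apply/eqP.
by apply: eq_integral => x _ /=; rewrite powR_mulrn// real_normK ?num_real.
Qed.

(** Domination by an integrable [k] is enough and [h] may be any function; this is how the dual norm
    of the time derivative is handled. *)
Lemma finite_norm_patch (D : set T) (mD : measurable D) (r : R) (h k : T -> R) : r != 0 ->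
  (forall x, D x -> `|h x| `^ r <= k x) -> mu.-integrable D (EFin \o k) ->
  finite_norm mu r%:E (h \_ D).
Proof.
move=> r0 hk ik; apply: finite_normP.
have -> : (fun x => (`|(h \_ D) x| `^ r)%:E) = ((fun x => (`|h x| `^ r)%:E) \_ D).
  by apply/funext => x; rewrite !patchE; case: ifP => // _; rewrite normr0 powR0.
rewrite -integral_mkcond.
apply: le_lt_trans (ge0_le_integral_nomeas (g := EFin \o k) _ _) _.
- by move=> x _; rewrite lee_fin powR_ge0.
- by move=> x Dx; rewrite lee_fin hk.
by rewrite /comp -EFin_Rint// ltry.
Qed.

Lemma finite_norm_oo (h : T -> R) (C : R) : (forall x, `|h x| <= C) ->
  finite_norm mu +oo%E h.
Proof.
move=> hC; rewrite /finite_norm unlock; case: ifP => _; last by rewrite ltry.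
apply: le_lt_trans (_ : _ <= C%:E)%E _; last by rewrite ltry.
by apply/ess_supP; apply: aeW => x /=; rewrite lee_fin.
Qed.

End norms_of_measures.

Lemma finval_simple (R : realType) (X : lmodType R) (S : set X) (h : R -> X) :
  finval h -> (forall t, S (h t)) -> simple_in S h.
Proof.
move=> [fh mh] Sh; have /finite_seqP[s0 ss0] := fh.
pose s := undup s0.
have su : uniq s by exact: undup_uniq.
have sE y : (y \in s) <-> range h y by rewrite ss0 /s mem_undup.
exists (size s), (fun i => h @^-1` [set tnth (in_tuple s) i]), (fun i => tnth (in_tuple s) i).
split.
  move=> i; split; first exact: mh.
  by have /sE[t _ <-] := mem_tnth i (in_tuple s).
apply/funext => t; have /sE/(@tnthP _ _ (in_tuple s))[i hi] : range h (h t) by exists t.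
rewrite (bigD1 i)//= big1 ?addr0.
  by rewrite indicE mem_set// scale1r.
move=> j ji; rewrite indicE memNset ?scale0r//= => hj.
have /tuple_uniqP inj : uniq (in_tuple s) by [].
by move: ji; rewrite -(inj_eq inj) -hj hi eqxx.
Qed.

(** * A measurable version of the force *)

Section force.
Variables (R : realType) (X : lmodType R) (V : set X) (ipV : X -> X -> R).
Hypotheses (hV : subsp V) (psdV : psd_on V ipV).
Variables (T : R) (hT : 0 < T) (f : R -> X -> R^o).
Local Notation mu := (@lebesgue_measure R).
Local Notation I := (`]0, T[%classic : set (measurableTypeR R)).
Local Notation nd := (ndual V ipV).
Local Notation dV := (dualof V ipV).
Local Notation nV := (nrm ipV).
Hypothesis fB : bochner T 2%:E nd dV f.

(** The force is known to be a bounded functional, and a limit of simple ones, at almost every time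
    only. Setting it to 0 off a measurable set [H] of full measure makes all bounds hold everywhere;
    its evaluations and norms are measurable as limits of finite-valued functions. *)
Lemma force_borel : exists (H : set R) (s : nat -> R -> X -> R^o),
  [/\ measurable (H : set (measurableTypeR R)), H `<=` I, mu.-negligible (I `\` H),
      forall n, simple_in dV (s n) &
      (forall t, H t -> dV (f t) /\ (fun n => nd (s n t - f t)) @ \oo --> (0 : R)) /\
      force_setting V ipV T (fun t => if t \in H then f t else 0)
        (fun t => nd (if t \in H then f t else 0))].
Proof.
have mI : measurable I by exact: measurable_itv.
have [fd [s [hs sf]] fN] := fB.
have [B [mB B0 subB]] := negligibleU fd sf.
pose H : set R := I `\` B.
have mH : measurable (H : set (measurableTypeR R)) by exact: measurableD.
have Hf t : H t -> dV (f t) /\ (fun n => nd (s n t - f t)) @ \oo --> (0 : R).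
  move=> [It nB]; split; apply: contrapT => h; apply: nB; apply: subB.
    by left => /(_ It).
  by right => /(_ It).
have ss n : simple_in dV (s n) by exact: hs.
have dsub := dualof_subsp hV psdV.
have ds n t : dV (s n t) by exact: (simple_mem t dsub (ss n)).
pose f' t : X -> R^o := if t \in H then f t else 0.
have f'H t : H t -> f' t = f t by move=> Ht; rewrite /f' mem_set.
have f'N t : ~ H t -> f' t = 0 by move=> Ht; rewrite /f' memNset.
have df' t : dV (f' t).
  have [Ht|nH] := pselect (H t); first by rewrite f'H//; case: (Hf t Ht).
  by rewrite f'N//; exact: dualof0.
have cvg_f v t : V v -> H t -> (fun n => s n t v : R) @ \oo --> (f' t v : R).
  move=> Vv Ht; have [_ sft] := Hf t Ht.
  apply: (cvg_le0 (C := nV v) _ sft) => n; rewrite mulrC f'H//.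
  have := le_ndual hV psdV (dualofB hV psdV (ds n t) (df' t)) Vv.
  by rewrite f'H.
have cvg_n t : H t -> (fun n => nd (s n t)) @ \oo --> nd (f' t).
  move=> Ht; have [_ sft] := Hf t Ht.
  apply: (cvg_le0 (C := 1) _ sft) => n; rewrite mul1r.
  have := ndual_dist hV psdV (ds n t) (df' t); by rewrite f'H.
have IH : I = H `|` (I `\` H).
  by rewrite setUC setDKU//; exact: subDsetl.
have mIH : measurable (I `\` H) by exact: measurableD.
(* Off [H] the functions concerned are constant; their value at 0 names this constant, since 0 is
   not in the open time interval. *)
have mlim (h : nat -> R -> R) (h0 : R -> R) : (forall k, measurable_fun I (h k)) ->
    (forall t, H t -> (fun k => h k t) @ \oo --> h0 t) ->
    (forall t, ~ H t -> h0 t = h0 0) -> measurable_fun I h0.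
  move=> mh hh mh0; rewrite IH; apply/measurable_funU => //; split.
    apply: (measurable_fun_cvg (h := h)) => // k.
    by apply: measurable_funS (mh k) => //; exact: subDsetl.
  apply: (eq_measurable_fun (fun=> h0 0)); last exact: measurable_cst.
  by move=> t /set_mem[_ nH]; rewrite mh0.
have nH0 : ~ H 0 by move=> [+ _]; rewrite /= in_itv /= ltxx.
have mphi : measurable_fun I (fun t => nd (f' t)).
  apply: (mlim (fun k t => nd (s k t))) => //.
    by move=> k; exact: finval_measurable (finval_comp nd (simple_finval (ss k))).
  by move=> t nHt; rewrite !f'N.
exists H, s; split => //; first exact: subDsetl.
  by exists B; split => // t [It nHt]; apply: contrapT => nB; apply: nHt.
split => //; split.
- move=> v Vv; apply: (mlim (fun k t => s k t v)).
  + by move=> k; exact: finval_measurable (finval_comp (fun l : X -> R^o => l v : R) (simple_finval (ss k))).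
  + by move=> t Ht; exact: cvg_f.
  + by move=> t nHt; rewrite -/(f' t) -/(f' 0) !f'N.
- by move=> t; case: (df' t).
- by move=> t v Vv; exact: (le_ndual hV psdV (df' t) Vv).
- by move=> t; exact: (ndual_ge0 hV psdV (df' t)).
split => //; apply: intg_ge0P => //; first exact: measurable_funX.
  by move=> t _; exact: sqr_ge0.
have := finite_norm2_lty fN.
have -> : (fun t => ((((fun t => nd (f t)) \_ (`]0, T[ : set R)) t) ^+ 2)%:E) =
   ((fun t => (nd (f t) ^+ 2)%:E) \_ I).
  by apply/funext => t; rewrite !patchE; case: ifP => // _; rewrite expr0n.
rewrite -integral_mkcond; apply: le_lt_trans; apply: ge0_le_integral_nomeas.
  by move=> t _; rewrite lee_fin sqr_ge0.
move=> t _; rewrite lee_fin -/(f' t).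
have [Ht|nHt] := pselect (H t); first by rewrite f'H.
by rewrite f'N// (ndual0 hV psdV) expr0n /= sqr_ge0.
Qed.

End force.

(** * Existence for the abstract evolution equation *)

Section existence.
Variables (R : realType) (X : lmodType R) (V D : set X).
Variables (ipH ipV a : X -> X -> R) (b : X -> X -> X -> R) (ca Ca Cb : R) (kap : X -> R).
Hypothesis ES : evolution_setting V D ipH ipV a b ca Ca Cb kap.
Variables (T : R) (hT : 0 < T) (f : R -> X -> R^o).
Local Notation mu := (@lebesgue_measure R).
Local Notation I := (`]0, T[%classic : set (measurableTypeR R)).
Local Notation nH := (nrm ipH).
Local Notation nV := (nrm ipV).
Local Notation nd := (ndual V ipV).
Local Notation dV := (dualof V ipV).
Hypothesis fB : bochner T 2%:E nd dV f.
Variables (M0 : R) (z : nat -> X) (c0 : X -> R).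
Hypothesis zc : forall v, V v -> (fun n => ipH (z n) v) @ \oo --> c0 v.
Hypothesis zM : forall n, D (z n) /\ ipH (z n) (z n) <= M0.

Let hV : subsp V := es_V ES.
Let hD : subsp D := es_D ES.
Let DV := es_DV ES.
Let psdH := es_H ES.
Let psdV := es_ipV ES.
Let mI : measurable I. Proof. exact: measurable_itv. Qed.

Theorem evolution_existence : exists (u : R -> X) (g : R -> X -> R^o),
  [/\ bochner T 2%:E nV V u, bochner T +oo%E nH V u,
      bochner T (4 / 3)%:E nd dV g &
      forall v, V v ->
      [/\ mu.-integrable I (EFin \o (fun t => g t v : R)),
          weak_ddt T (fun t => ipH (u t) v) (fun t => g t v),
          ae0T T (fun t => g t v = f t v - a (u t) v - b (u t) (u t) v) &
          exists F : R -> R, [/\ {within `[0, T], continuous F},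
            ae0T T (fun t => F t = ipH (u t) v) & F 0 = c0 v]]].
Proof.
have [H [s [mH HI nHn ss [sf FS]]]] := force_borel hV psdV fB.
set f' := (fun t => if t \in H then f t else 0) in FS.
set phi := (fun t => nd _) in FS.
have [F [u_ [l_ AF]]] := approx_family_exists ES hT FS (fun n => (zM n).1) (fun n => (zM n).2).
have [u [G [w [Gset [Vu uout] [sw wu] uE [uV uu]]]]] :=
  limit_exists ES hT AF (af_cauchy_L2H ES hT FS AF).
have dsub := dualof_subsp hV psdV.
have [E [E0 EE]] : exists E, 0 <= E /\ E = bigE ca T phi M0.
  by exists (bigE ca T phi M0); split => //; exact: (bigE_ge0 ES AF).
have f'H t : H t -> f' t = f t by move=> Ht; rewrite /f' mem_set.
have df' t : dV (f' t).
  have [Ht|nHt] := pselect (H t); first by rewrite f'H//; case: (sf t Ht).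
  by rewrite /f' memNset//; exact: dualof0.
pose ab (x : X) : X -> R^o := fun v => a x v + b x x v.
(* The time derivative, defined by the equation itself. *)
pose g t : X -> R^o := f' t - ab (u t).
have gE v t : g t v = gint a b f' u u v t by rewrite /g /gint /ab !fctE /=; ring.
have dab x : V x -> dV (ab x).
  move=> Vx; split.
    move=> c v v' Vv Vv'; rewrite /ab ((es_a ES).2 _ Vx)// ((es_b ES Vx).2 _ Vx)//.
    by rewrite /GRing.scale /=; ring.
  exists (`|Ca| * nV x + `|Cb| * nV x * nV x) => v Vv; rewrite /ab mulrDl.
  apply: le_trans (ler_normD _ _) _; apply: lerD; first exact: (a_le ES _ _).
  exact: (b_le_V ES _ _ _).
have dg t : dV (g t) by apply: (dualofB hV psdV) => //; exact: dab.
have [mG GI nG] := Gset.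
have aeG (Q : R -> Prop) : (forall t, G t -> Q t) -> ae0T T Q.
  move=> GQ; apply: negligibleS nG => t /= h; split.
    by apply: contrapT => nI; apply: h => It.
  by move=> Gt; apply: h => _; exact: GQ.
have aeGH (Q : R -> Prop) : (forall t, G t -> H t -> Q t) -> ae0T T Q.
  move=> GQ; apply: negligibleS (negligibleU nG nHn) => t /= h.
  have It : I t by apply: contrapT => nI; apply: h => It.
  have [Gt|nGt] := pselect (G t); last by left.
  by right; split => // Ht; apply: h => _; exact: GQ.
have swV n : simple_in V (w n) by exact: simple_in_sub DV (sw n).
have Vw n t : V (w n t) by exact: (simple_mem t hV (swV n)).
have bV : bochner T 2%:E nV V u.
  split; first by apply: aeG.
    by exists w; split; [exact: swV|exact: aeG].
  apply: (finite_norm_patch mI (k := fun t => ipV (u t) (u t))) => //.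
  by move=> t _; rewrite powR_mulrn// ger0_norm ?nrm_ge0// (nrm_sqr psdV).
have bH : bochner T +oo%E nH V u.
  split; first by apply: aeG.
    exists w; split; first exact: swV.
    apply: aeG => t Gt; apply: (cvg_le0 (C := 1) _ (wu t Gt)) => n.
    rewrite subr0 mul1r ger0_norm ?nrm_ge0//; apply: (nH_le_nV ES); exact: subspB.
  apply: (@finite_norm_oo _ _ _ mu _ (Num.sqrt (bigE ca T phi M0))) => t.
  rewrite patchE; case: ifP => _; last by rewrite normr0 sqrtr_ge0.
  by rewrite ger0_norm ?nrm_ge0//; apply: ler_wsqrtr.
have nVs : sqi mu I (fun t => nV (u t)).
  split; first exact: (nV_meas uV).
  by apply: eq_integrable uV => // t _; rewrite /= (nrm_sqr psdV).
exists u, g; split => //.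
  split; first by apply: aeG.
    (* Simple approximations of the force and of the solution combine into simple functionals; they
       converge in the dual norm by [ab_diff]. *)
    exists (fun n t => s n t - ab (w n t)); split.
      move=> n; have h : simple_in dV (fun t => s n t - ab (w n t)).
        apply: finval_simple.
          exact: (finval_comp (fun p : (X -> R^o) * X => p.1 - ab p.2)
            (finval_pair (simple_finval (ss n)) (simple_finval (sw n)))).
        move=> t; apply: (dualofB hV psdV); first exact: (simple_mem t dsub (ss n)).
        exact: dab.
      exact: h.
    apply: aeGH => t Gt Ht; have [dft sft] := sf t Ht.
    pose K := `|Ca| + `|Cb| * (2 * nV (u t) + 1).
    have K0 : 0 <= K by rewrite /K addr_ge0// mulr_ge0// addr_ge0// mulr_ge0// nrm_ge0.
    have hK : (fun k => K * (nV (w k t - u t) * (1 + nV (w k t - u t)))) @ \oo --> (0 : R).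
      by rewrite -(mulr0 K); apply: cvgMr; exact: (wu0_cvg2 wu Gt).
    have hs : (fun n => nd (s n t - f t) + K * (nV (w n t - u t) * (1 + nV (w n t - u t)))) @ \oo --> (0 : R).
      by rewrite -(addr0 0); apply: cvgD.
    apply: (cvg_le0 (C := 1) _ hs) => n; rewrite subr0 mul1r.
    have dsn : dV (s n t) by exact: (simple_mem t dsub (ss n)).
    have d1 : dV (s n t - f t) by exact: (dualofB hV psdV).
    have d2 : dV (s n t - ab (w n t) - g t).
      by apply: (dualofB hV psdV) => //; apply: (dualofB hV psdV) => //; exact: dab.
    rewrite ger0_norm ?(ndual_ge0 hV psdV)//.
    have q0 : 0 <= K * (nV (w n t - u t) * (1 + nV (w n t - u t))).
      apply: mulr_ge0 => //; apply: mulr_ge0; first exact: nrm_ge0.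
      by apply: addr_ge0 => //; exact: nrm_ge0.
    apply: (ndual_le hV psdV); first by rewrite addr_ge0// (ndual_ge0 hV psdV).
    move=> v Vv; rewrite mulrDl.
    have -> : (s n t - ab (w n t) - g t) v = (s n t - f t) v - (ab (w n t) v - ab (u t) v).
      by rewrite /g f'H// !fctE /=; ring.
    apply: le_trans (ler_normB _ _) _; apply: lerD; first exact: (le_ndual hV psdV).
    exact: (ab_diff ES).
  (* The dual norm of [g t] is at most [K * m t * Num.sqrt (m t)]: the quadratic form contributes
     [nV] times the root of [nH * nV], with [nH] bounded by the energy. Its power 4/3 is then a
     multiple of [m t ^+ 2], which is integrable. The summand 1 ensures that [m t] is at most
     [m t * Num.sqrt (m t)], for the terms of first order. *)
  pose m t := 1 + phi t + nV (u t).
  have m1 t : 1 <= m t by rewrite /m -addrA lerDl addr_ge0 ?nrm_ge0//; exact: (fs_phi0 FS).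
  have ms : sqi mu I m.
    have h := sqi_lin mI 1 (cst_sqi hT 1) (fs_phi FS).
    have := sqi_lin mI 1 h nVs; congr sqi; apply/funext => t; rewrite /m; ring.
  pose K := 1 + `|Ca| + `|Cb| * Num.sqrt (Num.sqrt E).
  have K0 : 0 <= K by rewrite /K !addr_ge0// mulr_ge0// sqrtr_ge0.
  apply: (finite_norm_patch mI (k := fun t => K `^ (4 / 3) * m t ^+ 2)).
  - by rewrite mulf_neq0.
  - move=> t _; rewrite ger0_norm ?(ndual_ge0 hV psdV)//.
    have m0 : 0 <= m t by exact: le_trans (m1 t).
    have h : nd (g t) <= K * (m t `^ (3 / 2)).
      apply: (ndual_le hV psdV); first by rewrite mulr_ge0// powR_ge0.
      move=> v Vv; rewrite gE /gint.
      have h1 := fs_le FS t Vv; have h2 := a_le ES (Vu t) Vv.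
      have h3 := b_le ES (Vu t) (Vu t) Vv.
      have nvm : nV (u t) <= m t by rewrite /m lerDr addr_ge0//; exact: (fs_phi0 FS).
      have pm : phi t <= m t by rewrite /m addrAC lerDr addr_ge0// nrm_ge0.
      have q : m t * Num.sqrt (m t) = m t `^ (3 / 2).
        have -> : 3 / 2 = 1 + 2^-1 :> R by field.
        rewrite powRD ?powRr1// ?powR12_sqrt//; apply/implyP => _.
        by rewrite gt_eqF//; exact: lt_le_trans (m1 t).
      have s1 : 1 <= Num.sqrt (m t) by rewrite -sqrtr1 ler_wsqrtr.
      have b1 : Num.sqrt (nH (u t) * nV (u t)) <= Num.sqrt (Num.sqrt E) * Num.sqrt (m t).
        rewrite -sqrtrM ?sqrtr_ge0// ler_wsqrtr//; apply: ler_pM; rewrite ?nrm_ge0//.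
        by rewrite EE; apply: ler_wsqrtr.
      rewrite -q /K; have v0 := nrm_ge0 ipV v.
      apply: le_trans (ler_normB _ _) _.
      have -> : (1 + `|Ca| + `|Cb| * Num.sqrt (Num.sqrt E)) * (m t * Num.sqrt (m t)) * nV v =
        (m t * Num.sqrt (m t) * nV v + `|Ca| * (m t * Num.sqrt (m t)) * nV v) +
        `|Cb| * (Num.sqrt (Num.sqrt E) * Num.sqrt (m t)) * m t * nV v by ring.
      have mm : m t <= m t * Num.sqrt (m t) by rewrite ler_peMr.
      apply: lerD.
        apply: le_trans (ler_normB _ _) _; apply: lerD.
          by apply: le_trans h1 _; rewrite ler_wpM2r//; exact: (le_trans pm mm).
        by apply: le_trans h2 _; rewrite ler_wpM2r// ler_wpM2l//; exact: (le_trans nvm mm).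
      apply: le_trans h3 _; rewrite ler_wpM2r//; apply: ler_pM => //;
        by rewrite ?nrm_ge0 ?ler_wpM2l ?mulr_ge0 ?sqrtr_ge0.
    apply: le_trans (ge0_ler_powR _ _ _ h) _.
    + by rewrite divr_ge0.
    + by rewrite nnegrE; exact: (ndual_ge0 hV psdV (dg t)).
    + by rewrite nnegrE mulr_ge0// powR_ge0.
    rewrite powRM ?powR_ge0// -powRrM.
    have -> : 3 / 2 * (4 / 3) = 2 :> R by field.
    by rewrite powR_mulrn.
  - by apply: intgZ => //; exact: ms.2.
move=> v Vv.
have gi := g0_int ES hT FS Gset Vu uout sw wu uV Vv.
have leq := limit_eq ES hT FS zc zM AF Gset Vu uout sw wu uE uV uu Vv.
have gfun : (fun t => g t v : R) = gint a b f' u u v by apply/funext => t; exact: gE.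
rewrite gfun; split => //.
- exact: (weak_ddt_prim hT (ipH_meas ES Gset Vu uout sw wu Vv) gi leq).
- by apply: aeGH => t Gt Ht; rewrite gE /gint f'H.
(* The continuous representative of the pairing; its value at 0 is [c0 v] because the primitive is
   over an empty interval there. *)
exists (fun t => c0 v + prim (gint a b f' u u v) t); split.
- by move=> t; apply: cvgD; [exact: cvg_cst|exact: prim_continuous].
- by apply: filterS leq => t h It; rewrite h.
- by rewrite /prim set_itvoo0 Rintegral_set0 addr0.
Qed.

End existence.

(** * Smooth functions on plane domains *)

Section plane_topology.
Variable R : realType.
Local Notation R2 := (measurableTypeR R * measurableTypeR R)%type.

Lemma rat_dense_itv (x y : R) : x < y -> exists q : rat, x < ratr q < y.
Proof. by move=> /rat_in_itvoo[q]; rewrite in_itv /=; exists q. Qed.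

Lemma open_boxes (U : set (R * R)) (z : R * R) : open U -> U z ->
  exists2 e : R, 0 < e & forall x y, `|z.1 - x| < e -> `|z.2 - y| < e -> U (x, y).
Proof.
move=> /[swap] Uz /(_ _ Uz); rewrite /= nbhs_ballP => -[e /= e0 h].
by exists e => // x y xe ye; apply: h; split.
Qed.

Definition rat_box (k : (rat * rat) * (rat * rat)) : set R2 :=
  `]ratr k.1.1, ratr k.1.2[%classic `*` `]ratr k.2.1, ratr k.2.2[%classic.

(** Open boxes serve for measurability; the inclusion of the closed box in [U] makes bumps supported
    in the box test functions. *)
Lemma open_bigcup_rat (U : set (R * R)) (z : R * R) : open U -> U z ->
  exists k, [/\ rat_box k z, rat_box k `<=` U &
    `[ratr k.1.1, ratr k.1.2]%classic `*` `[ratr k.2.1, ratr k.2.2]%classic `<=` U].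
Proof.
move=> oU Uz; have [e e0 he] := open_boxes oU Uz.
have [|q1 /andP[q11 q12]] := @rat_dense_itv (z.1 - e) z.1; first lra.
have [|q2 /andP[q21 q22]] := @rat_dense_itv z.1 (z.1 + e); first lra.
have [|q3 /andP[q31 q32]] := @rat_dense_itv (z.2 - e) z.2; first lra.
have [|q4 /andP[q41 q42]] := @rat_dense_itv z.2 (z.2 + e); first lra.
exists ((q1, q2), (q3, q4)); split.
- by split; rewrite /= in_itv /=; apply/andP.
- move=> [x y] [] /=; rewrite !in_itv /= => /andP[x1 x2] /andP[y1 y2].
  by apply: he; rewrite ltr_norml; lra.
- move=> [x y] [] /=; rewrite !in_itv /= => /andP[x1 x2] /andP[y1 y2].
  by apply: he; rewrite ltr_norml; lra.
Qed.

Lemma rat_box_measurable k : measurable (rat_box k).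
Proof. by apply: measurableX; exact: measurable_itv. Qed.

(** The sigma-algebra of the plane is generated by measurable rectangles, so an open set has to be
    exhausted by countably many of them. *)
Lemma open_measurable2 (U : set (R * R)) : open U -> measurable (U : set R2).
Proof.
move=> oU.
have -> : (U : set R2) =
    \bigcup_k (if `[< rat_box k `<=` U >] then rat_box k else set0).
  apply/seteqP; split => [z /(open_bigcup_rat oU)[k [kz kU _]]|z [k _]].
    by exists k => //; case: asboolP.
  by case: asboolP => // kU; exact: kU.
apply: countable_bigcupT_measurable => [|k]; first exact: countableP.
by case: ifP => _; [exact: rat_box_measurable|exact: measurable0].
Qed.

Lemma continuous_measurable2 (D : set R2) (f : R * R -> R) : measurable D ->
  continuous f -> measurable_fun D (f : R2 -> R).
Proof.
move=> mD cf; apply: measurable_funS (subsetT _) _ => //.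
apply: (measurability _ (RGenOInfty.measurableE R)).
move=> /= _ [_ [a ->]] <-; apply: measurableI => //; apply: open_measurable2.
have /continuousP := cf; apply.
exact: interval_open.
Qed.

Lemma compact_support_bounded (E : normedModType R) (f : E -> R) : continuous f ->
  compact (closure [set x | f x != 0]) -> exists C, forall x, `|f x| <= C.
Proof.
move=> cf cK; have /compact_bounded[C [_ hC]] :
    compact (f @` closure [set x | f x != 0]).
  by apply: continuous_compact => //; exact: continuous_subspaceT.
exists (`|C| + 1) => x; have [->|fx] := eqVneq (f x) 0.
  by rewrite normr0 addr_ge0.
have C1 : C < `|C| + 1 by rewrite (le_lt_trans (ler_norm _))// ltrDl.
by apply: (hC _ C1); exists x => //; exact: subset_closure.
Qed.

Lemma cross_section_open (Omega : set 'rV[R]_3) (a1 a2 b : R) : open Omega ->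
  open (cross_section Omega a1 a2 b).
Proof.
rewrite !openE => oO _ [p [Op pp] <-]; have := oO _ Op.
rewrite /interior /= !nbhs_ballP => -[e /= e0 he].
(* A shift of both coordinates by less than [e / k] moves the third coordinate on the plane by at
   most [(k - 1) * (e / k)], which is less than [e]. *)
pose k := 1 + `|a1| + `|a2|.
have k1 : 1 <= k by rewrite /k -addrA lerDl addr_ge0.
exists (e / k); first by rewrite /= divr_gt0//; lra.
have ek : e / k <= e by rewrite ler_pdivrMr ?ler_peMr//; lra.
have ek' : e / k * k = e by rewrite divfK// gt_eqF//; lra.
have [d dE] : exists d, d = e / k by eexists.
rewrite -dE in ek ek' *.
move=> [x y] [/= xe ye]; rewrite /ball /= in xe ye.
pose p' : 'rV[R]_3 := \row_j nth 0 [:: x; y; b - a1 * x - a2 * y] j.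
have p0 : p' ord0 0 = x by rewrite mxE.
have p1 : p' ord0 1 = y by rewrite mxE.
have p2 : p' ord0 2%:R = b - a1 * x - a2 * y by rewrite mxE.
exists p'; last by rewrite /proj12 p0 p1.
split; last by rewrite /plane /= p0 p1 p2.
apply: he; split => // i j; rewrite (ord1 i) /ball /=.
have [j0|[j1|j2]] : j = 0 \/ j = 1 \/ j = 2%:R.
  by case: j => -[|[|[|//]]] h; [left|right;left|right;right]; apply/val_inj.
- by rewrite j0 p0; apply: lt_le_trans xe _.
- by rewrite j1 p1; apply: lt_le_trans ye _.
rewrite j2 p2 pp.
set X := p ord0 0 in xe *; set Y := p ord0 1 in ye *.
have -> : b - a1 * X - a2 * Y - (b - a1 * x - a2 * y)
   = - (a1 * (X - x)) - a2 * (Y - y) by ring.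
apply: le_lt_trans (ler_normB _ _) _; rewrite normrN !normrM.
have h1 : `|a1| * `|X - x| <= `|a1| * d by apply: ler_wpM2l => //; exact: ltW.
have h2 : `|a2| * `|Y - y| <= `|a2| * d by apply: ler_wpM2l => //; exact: ltW.
have d0 : 0 < d by rewrite dE divr_gt0//; lra.
apply: le_lt_trans (lerD h1 h2) _; rewrite -ek' /k; nra.
Qed.

Definition in_square (P : set (R * R)) (M : R) :=
  forall z, P z -> `|z.1| < M /\ `|z.2| < M.

Lemma cross_section_in_square (Omega : set 'rV[R]_3) (a1 a2 b : R) :
  bounded_set Omega ->
  exists2 M, 0 < M & in_square (cross_section Omega a1 a2 b) M.
Proof.
move=> [C [_ hC]]; exists (`|C| + 2); first by rewrite ltr_pwDr.
have C1 : C < `|C| + 1 by rewrite (le_lt_trans (ler_norm _))// ltrDl.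
move=> _ [p [Op _] <-] /=.
have h j : `|p ord0 j| < `|C| + 2.
  apply: le_lt_trans (_ : `|C| + 1 < _); last by rewrite ltrD2l ltr1n.
  apply: le_trans (hC _ C1 _ Op).
  rewrite [leRHS]/Num.Def.normr /= mx_normrE; apply/bigmax_geP; right => /=.
  by exists (ord0, j).
by split; exact: h.
Qed.

End plane_topology.

(** * Smooth functions and test functions *)

Section smooth_functions.
Variables (R : realType) (E : normedModType R).
Implicit Types (f g : E -> R) (d : E) (c : R).

Definition smooth f := forall k, Ck k f.

Lemma smooth_continuous f : smooth f -> continuous f.
Proof. by move/(_ 0%N). Qed.

Lemma smooth_derivable f x d : smooth f -> derivable f x d.
Proof. by move/(_ 1%N) => /(_ d)[]. Qed.

Arguments smooth_derivable {f} x d _.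

Lemma smooth_derive f d : smooth f -> smooth (fun x => 'D_d f x).
Proof. by move=> sf k; have [] := sf k.+1 d. Qed.

Lemma derivable_lin c f g x d : derivable f x d -> derivable g x d ->
  derivable (fun y => c * f y + g y) x d.
Proof.
move=> df dg; apply: (@derivableD _ _ _ (fun y => c * f y) g) => //.
exact: (@derivableZ _ _ _ f c).
Qed.

Lemma derive_lin c f g x d : derivable f x d -> derivable g x d ->
  'D_d (fun y => c * f y + g y) x = c * 'D_d f x + 'D_d g x.
Proof.
move=> df dg; rewrite (@deriveD _ _ _ (fun y => c * f y) g)//.
  by rewrite (@deriveZ _ _ _ f c).
exact: (@derivableZ _ _ _ f c).
Qed.

Lemma derive_mul f g x d : derivable f x d -> derivable g x d ->
  derivable (fun y => f y * g y) x d /\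
  'D_d (fun y => f y * g y) x = 'D_d f x * g x + f x * 'D_d g x.
Proof.
move=> df dg; split; first exact: (@derivableM _ _ f g).
by rewrite (@deriveM _ _ f g)// addrC; congr (_ + _); exact: mulrC.
Qed.

Lemma Ck_lin k c f g : Ck k f -> Ck k g -> Ck k (fun x => c * f x + g x).
Proof.
elim: k f g => [|k IH] f g /=.
  by move=> cf cg x; apply: cvgD; [apply: cvgMr; exact: cf|exact: cg].
move=> hf hg d; have [df kf] := hf d; have [dg kg] := hg d; split.
  by move=> x; exact: derivable_lin.
rewrite (_ : (fun x => _) = (fun x => c * 'D_d f x + 'D_d g x)); first exact: IH.
by apply/funext => x; rewrite derive_lin.
Qed.

Lemma smooth_lin c f g : smooth f -> smooth g -> smooth (fun x => c * f x + g x).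
Proof. by move=> sf sg k; exact: Ck_lin. Qed.

Lemma smooth_mul f g : smooth f -> smooth g -> smooth (fun x => f x * g x).
Proof.
move=> sf sg k; elim: k f g sf sg => [|k IH] f g sf sg /=.
  by move=> x; apply: cvgM; exact: smooth_continuous.
move=> d; split=> [x|].
  by have [] := derive_mul (smooth_derivable x d sf) (smooth_derivable x d sg).
rewrite (_ : (fun x => _) = (fun x => 1 * ('D_d f x * g x) + f x * 'D_d g x)).
  by apply: Ck_lin; apply: IH => //; exact: smooth_derive.
apply/funext => x; rewrite mul1r.
by have [] := derive_mul (smooth_derivable x d sf) (smooth_derivable x d sg).
Qed.

Lemma smooth_cst c : smooth (fun=> c).
Proof.
move=> k; elim: k c => [|k IH] c /=; first by move=> x; exact: cst_continuous.
move=> d; split; first by move=> x; exact: (@derivable_cst _ _ _ c).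
have -> : (fun x => 'D_d (fun=> c) x) = fun=> 0 :> R; last exact: IH.
by apply/funext => x; exact: (@derive_cst _ _ _ c).
Qed.

(** A coinductive principle: smoothness is proved by exhibiting a class of functions that contains
    its own derivatives. *)
Lemma smooth_class (K : set (E -> R)) :
  (forall f, K f -> continuous f /\
     forall d, (forall x, derivable f x d) /\ K (fun x => 'D_d f x)) ->
  forall f, K f -> smooth f.
Proof.
move=> hK f Kf k; elim: k f Kf => [|k IH] f /hK[cf df]//= d.
by have [? ?] := df d; split => //; exact: IH.
Qed.

Variable U : set E.

Lemma test_smooth f : test U f -> smooth f. Proof. by case. Qed.

Lemma test_off f x : test U f -> ~ U x -> f x = 0.
Proof.
move=> [_ _ fU] Ux; apply/eqP/negPn/negP => fx; apply: Ux; apply: fU.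
exact: subset_closure.
Qed.

Lemma test_closed_support f (K : set E) : smooth f -> compact K -> closed K ->
  K `<=` U -> (forall x, ~ K x -> f x = 0) -> test U f.
Proof.
move=> sf cK clK KU fK.
have sub : closure [set x | f x != 0] `<=` K.
  rewrite [X in _ `<=` X](closure_id K).1//; apply: closure_subset => x /= fx.
  by apply: contrapT => /fK f0; rewrite f0 eqxx in fx.
split => //; last exact: subset_trans sub KU.
by apply: subclosed_compact sub => //; exact: closed_closure.
Qed.

Lemma test0 : test U (fun=> 0).
Proof.
apply: (@test_closed_support _ set0) => //; [exact: smooth_cst|exact: compact0|].
exact: closed0.
Qed.

Lemma test_lin c f g : test U f -> test U g -> test U (fun x => c * f x + g x).
Proof.
move=> [sf cf fU] [sg cg gU]; pose K := closure [set x | f x != 0] `|` closure [set x | g x != 0].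
apply: (@test_closed_support _ K).
- exact: smooth_lin.
- exact: compactU.
- by apply: closedU; exact: closed_closure.
- by move=> x [/fU|/gU].
move=> x nK; have -> : f x = 0.
  by apply/eqP/negPn/negP => fx; apply: nK; left; exact: subset_closure.
have -> : g x = 0.
  by apply/eqP/negPn/negP => gx; apply: nK; right; exact: subset_closure.
by rewrite mulr0 addr0.
Qed.

Lemma test_mul f g : test U f -> smooth g -> test U (fun x => f x * g x).
Proof.
move=> [sf cf fU] sg; apply: (@test_closed_support _ _ _ cf) => //.
- exact: smooth_mul.
- exact: closed_closure.
move=> x nK; rewrite (_ : f x = 0) ?mul0r//.
by apply/eqP/negPn/negP => fx; apply: nK; exact: subset_closure.
Qed.

Lemma test_derive f d : test U f -> test U (fun x => 'D_d f x).
Proof.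
move=> [sf cf fU]; apply: (@test_closed_support _ _ _ cf) => //.
- exact: smooth_derive.
- exact: closed_closure.
(* Off the closed support [f] is locally zero, so its derivative is that of a constant. *)
move=> x nK; rewrite (_ : 0 = 'D_d (cst (0 : R)) x); last by rewrite derive_cst.
apply: near_eq_derive => //.
have : nbhs x (~` closure [set x | f x != 0]).
  by apply: open_nbhs_nbhs; split => //; apply: closed_openC; exact: closed_closure.
apply: filterS => y nKy; apply/eqP/negPn/negP => fy; apply: nKy.
exact: subset_closure.
Qed.

Lemma test_bounded f : test U f -> exists C, forall x, `|f x| <= C.
Proof.
by move=> [sf cf _]; apply: compact_support_bounded => //; exact: smooth_continuous.
Qed.

End smooth_functions.
Arguments smooth_derivable {R E f} x d _.

(** * Integration of derivatives and integration by parts *)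

Section line_integrals.
Variables (R : realType).
Local Notation mu := (@lebesgue_measure R).

Lemma derive_line (E : normedModType R) (g : E -> R) (z v : E) (s : R) :
  derivable g (z + s *: v) v ->
  derivable (fun t : R => g (z + t *: v)) s 1 /\
  'D_1 (fun t : R => g (z + t *: v)) s = 'D_v g (z + s *: v).
Proof.
move=> dg; have e : (fun h : R => h^-1 *: (((fun t : R => g (z + t *: v)) \o shift s) (h *: (1 : R^o)) - g (z + s *: v)))
   = (fun h : R => h^-1 *: ((g \o shift (z + s *: v)) (h *: v) - g (z + s *: v))).
  apply/funext => h /=; congr (_ *: (g _ - _)).
  by rewrite [h *: _]mulr1 scalerDl addrCA.
by rewrite /derivable /derive e.
Qed.

Lemma FTC_line (E : normedModType R) (g : E -> R) (z v : E) (a b : R) : a <= b ->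
  (forall x, derivable g x v) -> continuous (fun x => 'D_v g x) ->
  \int[mu]_(s in `[a, b]) 'D_v g (z + s *: v) = g (z + b *: v) - g (z + a *: v).
Proof.
move=> ab dg cg; apply: (@FTC_C1 _ (fun t : R => g (z + t *: v))) => //.
- by move=> s; have [] := derive_line (dg (z + s *: v)).
- by move=> s; have [] := derive_line (dg (z + s *: v)).
move=> s; apply: (@continuous_comp _ _ _ (fun t : R => z + t *: v) (fun x => 'D_v g x)); last exact: cg.
by apply: cvgD; [exact: cvg_cst|apply: cvgZr_tmp; exact: cvg_id].
Qed.

Variable g : R * R -> R.
Hypothesis sg : smooth g.

Lemma FTC_slice1 (y a b : R) : a <= b ->
  \int[mu]_(s in `[a, b]) 'D_(e1 R) g (s, y) = g (b, y) - g (a, y).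
Proof.
move=> ab; have h s : (s, y) = (0, y) + s *: e1 R.
  by apply: injective_projections; rewrite /= ?add0r ?scaler0 ?addr0// [_ *: _]mulr1.
transitivity (\int[mu]_(s in `[a, b]) 'D_(e1 R) g ((0, y) + s *: e1 R)).
  by apply: eq_Rintegral => s _; rewrite h.
apply: etrans (FTC_line (0, y) ab (fun p => smooth_derivable p (e1 R) sg)
  (smooth_continuous (smooth_derive (e1 R) sg))) _.
exact: (congr2 (fun p q => g p - g q) (esym (h b)) (esym (h a))).
Qed.

Lemma FTC_slice2 (x a b : R) : a <= b ->
  \int[mu]_(s in `[a, b]) 'D_(e2 R) g (x, s) = g (x, b) - g (x, a).
Proof.
move=> ab; have h s : (x, s) = (x, 0) + s *: e2 R.
  by apply: injective_projections; rewrite /= ?add0r ?scaler0 ?addr0// [_ *: _]mulr1.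
transitivity (\int[mu]_(s in `[a, b]) 'D_(e2 R) g ((x, 0) + s *: e2 R)).
  by apply: eq_Rintegral => s _; rewrite h.
apply: etrans (FTC_line (x, 0) ab (fun p => smooth_derivable p (e2 R) sg)
  (smooth_continuous (smooth_derive (e2 R) sg))) _.
exact: (congr2 (fun p q => g p - g q) (esym (h b)) (esym (h a))).
Qed.

End line_integrals.

Lemma continuous_slice1 (R : realType) (g : R * R -> R) (y : R) :
  continuous g -> continuous (fun x => g (x, y)).
Proof.
move=> cg x; apply: (@continuous_comp _ _ _ (fun x : R => (x, y)) g); last exact: cg.
exact: (cvg_pair cvg_id (cvg_cst _)).
Qed.

Lemma continuous_slice2 (R : realType) (g : R * R -> R) (x : R) :
  continuous g -> continuous (fun y => g (x, y)).
Proof.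
move=> cg y; apply: (@continuous_comp _ _ _ (fun y : R => (x, y)) g); last exact: cg.
exact: (cvg_pair (cvg_cst _) cvg_id).
Qed.

Section plane_integrals.
Variables (R : realType) (P : set (R * R)) (M : R).
Hypotheses (oP : open P) (M0 : 0 < M) (PM : in_square P M).
Local Notation mR := (measurableTypeR R).
Local Notation R2 := (mR * mR)%type.
Local Notation mu := (@lebesgue_measure R).
Local Notation mu2 := (leb2 R).
Local Notation PR := (P : set R2).
Local Notation J := (`[- M, M]%classic : set mR).

Lemma dom_measurable : measurable PR. Proof. exact: open_measurable2. Qed.
Let mP := dom_measurable.

Lemma dom_finite : (mu2 PR < +oo)%E.
Proof.
have sub : PR `<=` J `*` J.
  move=> z /PM[]; rewrite !ltr_norml => /andP[/ltW a1 /ltW a2] /andP[/ltW b1 /ltW b2].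
  by split; rewrite /= in_itv /= ?a1 ?a2 ?b1 ?b2.
apply: (@le_lt_trans _ _ (mu2 (J `*` J))).
  by apply: le_measure => //; rewrite ?inE//; apply: measurableX; exact: measurable_itv.
have -> : mu2 (J `*` J) = (mu J * mu J)%E.
  by apply: product_measure1E; exact: measurable_itv.
rewrite lebesgue_measure_itv /= lte_fin; case: ifP => _; last by rewrite mule0 ltry.
by rewrite -EFinD -EFinM ltry.
Qed.

Lemma integral_dom (F : R2 -> \bar R) : (forall z, ~ P z -> F z = 0%E) ->
  (\int[mu2]_(z in PR) F z = \int[mu2]_z F z)%E.
Proof.
move=> F0; rewrite integral_mkcond; apply: eq_integral => z _.
by rewrite patchE; case: ifPn => // /negP nz; rewrite F0// => Pz; apply: nz; rewrite inE.
Qed.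

Lemma dom_off1 (x y : R) : ~ J x -> ~ P (x, y).
Proof.
move=> h /PM[/=]; rewrite ltr_norml => /andP[/ltW a /ltW b] _; apply: h.
by rewrite /= in_itv /= a b.
Qed.

Lemma dom_off2 (x y : R) : ~ J y -> ~ P (x, y).
Proof.
move=> h /PM[_ /=]; rewrite ltr_norml => /andP[/ltW a /ltW b]; apply: h.
by rewrite /= in_itv /= a b.
Qed.

Lemma integral_slice1 (F : R2 -> \bar R) y : (forall z, ~ P z -> F z = 0%E) ->
  (\int[mu]_x F (x, y) = \int[mu]_(x in J) F (x, y))%E.
Proof.
move=> F0; rewrite [RHS]integral_mkcond; apply: eq_integral => x _.
rewrite patchE; case: ifPn => // /negP nx; rewrite F0//; apply: dom_off1 => Jx.
by apply: nx; rewrite inE.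
Qed.

Lemma integral_slice2 (F : R2 -> \bar R) x : (forall z, ~ P z -> F z = 0%E) ->
  (\int[mu]_y F (x, y) = \int[mu]_(y in J) F (x, y))%E.
Proof.
move=> F0; rewrite [RHS]integral_mkcond; apply: eq_integral => y _.
rewrite patchE; case: ifPn => // /negP ny; rewrite F0//; apply: dom_off2 => Jy.
by apply: ny; rewrite inE.
Qed.

Lemma continuous_sqi f : continuous f -> (exists C, forall x, `|f x| <= C) ->
  sqi mu2 PR f.
Proof.
move=> cf [C fC]; have mf := continuous_measurable2 mP cf.
split => //; apply: (@intg_bounded _ _ _ _ _ mP _ (C ^+ 2)).
- exact: dom_finite.
- exact: measurable_funX.
by move=> x _; rewrite normrX lerXn2r ?nnegrE//; exact: le_trans (fC x).
Qed.

Lemma test_sqi f : test P f -> sqi mu2 PR f.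
Proof.
move=> tf; apply: continuous_sqi; last exact: test_bounded tf.
by apply: smooth_continuous; exact: test_smooth tf.
Qed.

Lemma test_integrable f : test P f -> mu2.-integrable setT (EFin \o (f : R2 -> R)).
Proof.
move=> tf; have cf : continuous f by apply: smooth_continuous; exact: test_smooth tf.
have [C fC] := test_bounded tf.
have : mu2.-integrable PR (EFin \o (f : R2 -> R)).
  apply: (@intg_bounded _ _ _ _ _ mP _ C); [exact: dom_finite| |by move=> x _].
  exact: continuous_measurable2.
move/(integrable_mkcond _ mP); apply: eq_integrable => // z _.
rewrite patchE; case: ifPn => // /negP nz; rewrite /= (test_off tf)// => Pz.
by apply: nz; rewrite inE.
Qed.

(** By Fubini's theorem and the fundamental theorem on horizontal lines: [f] vanishes at both ends
    of the segment from [- M] to [M], which lie outside [P]. *)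
Lemma int_derive_test1 f : test P f -> \int[mu2]_(x in PR) 'D_(e1 R) f x = 0.
Proof.
move=> tf; have tdf := test_derive (e1 R) tf.
rewrite /Rintegral integral_dom; last by move=> z /(test_off tdf) ->.
rewrite -integral21_prod_meas1; last exact: test_integrable tdf.
rewrite [X in fine X](_ : _ = 0%E)//; apply: integral0_eq => y _.
rewrite /fubini_G; apply: etrans (@integral_slice1 (EFin \o (fun z => 'D_(e1 R) f z)) y _) _.
  by move=> z /(test_off tdf) /= ->.
have cf : continuous (fun x => 'D_(e1 R) f (x, y)).
  apply: (@continuous_slice1 _ (fun z => 'D_(e1 R) f z)).
  by apply: smooth_continuous; exact: test_smooth tdf.
have MM : - M <= M by have := M0; lra.
rewrite -EFin_Rint; [|exact: measurable_itv|]; last first.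
  apply: continuous_compact_integrable; first exact: segment_compact.
  exact: continuous_subspaceT.
apply: (congr1 EFin (_ : _ = 0 :> R)); apply: etrans (FTC_slice1 (test_smooth tf) y MM) _.
rewrite !(test_off tf) ?subrr// => /PM[/=]; rewrite ?normrN gtr0_norm// ltxx//.
Qed.

Lemma int_derive_test2 f : test P f -> \int[mu2]_(x in PR) 'D_(e2 R) f x = 0.
Proof.
move=> tf; have tdf := test_derive (e2 R) tf.
rewrite /Rintegral integral_dom; last by move=> z /(test_off tdf) ->.
rewrite -integral12_prod_meas1; last exact: test_integrable tdf.
rewrite [X in fine X](_ : _ = 0%E)//; apply: integral0_eq => x _.
rewrite /fubini_F; apply: etrans (@integral_slice2 (EFin \o (fun z => 'D_(e2 R) f z)) x _) _.
  by move=> z /(test_off tdf) /= ->.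
have cf : continuous (fun y => 'D_(e2 R) f (x, y)).
  apply: (@continuous_slice2 _ (fun z => 'D_(e2 R) f z)).
  by apply: smooth_continuous; exact: test_smooth tdf.
have MM : - M <= M by have := M0; lra.
rewrite -EFin_Rint; [|exact: measurable_itv|]; last first.
  apply: continuous_compact_integrable; first exact: segment_compact.
  exact: continuous_subspaceT.
apply: (congr1 EFin (_ : _ = 0 :> R)); apply: etrans (FTC_slice2 (test_smooth tf) x MM) _.
rewrite !(test_off tf) ?subrr// => /PM[_ /=]; rewrite ?normrN gtr0_norm// ltxx//.
Qed.

Definition axis (d : R * R) := d = e1 R \/ d = e2 R.

Lemma int_derive_test d f : axis d -> test P f ->
  \int[mu2]_(x in PR) 'D_d f x = 0.
Proof. by case=> ->; [exact: int_derive_test1|exact: int_derive_test2]. Qed.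

Lemma test_by_parts d f g : axis d -> test P f -> test P g ->
  \int[mu2]_(x in PR) (f x * 'D_d g x) = - \int[mu2]_(x in PR) ('D_d f x * g x).
Proof.
move=> ad tf tg; have sf := test_smooth tf; have sg := test_smooth tg.
have := int_derive_test ad (test_mul tf sg).
under eq_Rintegral do
  rewrite (derive_mul (smooth_derivable _ _ sf) (smooth_derivable _ _ sg)).2.
rewrite RintegralD//; first by move/eqP; rewrite addrC addr_eq0 => /eqP.
- by apply: sqi_mul => //; apply: test_sqi => //; exact: test_derive.
- by apply: sqi_mul => //; apply: test_sqi => //; exact: test_derive.
Qed.

End plane_integrals.

Lemma e12 (R : realType) : (e2 R == e1 R) = false.
Proof.
apply/negP => /eqP/(congr1 fst) /= h; have := @oner_neq0 R; rewrite -h.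
by rewrite eqxx.
Qed.

(** * Uniqueness of weak derivatives *)

Section dynkin_integral.
Context d d1 (T : measurableType d) (T1 : measurableType d1) (R : realType).
Variables (mu : {measure set T -> \bar R}) (f : T -> T1) (D : set T) (h : T -> R).
Hypotheses (mf : measurable_fun setT f) (mD : measurable D).
Hypothesis ih : mu.-integrable D (EFin \o h).

(** The integrand has no sign, so this is Dynkin induction on the vanishing of the integral rather
    than uniqueness of measures. The map [f] lets it apply to each coordinate and to the
    identity. *)
Lemma integral_preimage_eq0 (G : set (set T1)) :
  @measurable _ T1 = <<s G >> -> setI_closed G ->
  \int[mu]_(x in D) h x = 0 ->
  (forall S, G S -> \int[mu]_(x in D `&` f @^-1` S) h x = 0) ->
  forall S, measurable S -> \int[mu]_(x in D `&` f @^-1` S) h x = 0.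
Proof.
move=> mG GI D0 GS S mS.
have mpre A : measurable A -> measurable (f @^-1` A).
  by move=> mA; rewrite -[_ @^-1` _]setTI; exact: mf.
have mpD A : measurable A -> measurable (D `&` f @^-1` A).
  by move=> mA; apply: measurableI => //; exact: mpre.
apply: (dynkin_induction (P := fun S => \int[mu]_(x in D `&` f @^-1` S) h x = 0) mG GI).
- by rewrite preimage_setT setIT.
- exact: GS.
- move=> A mA hA; have e : D = (D `&` f @^-1` A) `|` (D `&` f @^-1` (~` A)).
    by rewrite -setIUr preimage_setC setUv setIT.
  move: D0; rewrite {1}e Rintegral_setU.
  + by rewrite hA add0r.
  + exact: mpD.
  + by apply: mpD; exact: measurableC.
  + by rewrite -e.
  + apply/disj_setPS => x [[_ Ax] [_ nAx]].
    exact: nAx.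
- move=> F mF tF F0; rewrite preimage_bigcup setI_bigcupr.
  rewrite /Rintegral integral_bigcup.
  + rewrite (eq_eseriesr (g := fun=> 0%E)); first by rewrite eseries0.
    move=> n _; rewrite -EFin_Rint ?F0//; first exact: mpD.
    by apply: integrableS ih => //; exact: mpD.
  + apply/trivIsetP => i j _ _ ij; rewrite -setIIr -preimage_setI.
    by move/trivIsetP : tF => /(_ i j I I ij) ->; rewrite preimage_set0 setI0.
  + by move=> k; exact: mpD.
  + apply: integrableS ih => //; last by move=> x [n _ []].
    by apply: bigcupT_measurable => n; exact: mpD.
by rewrite -mG.
Qed.

End dynkin_integral.

Section null_functions.
Variables (R : realType).
Local Notation mR := (measurableTypeR R).
Local Notation R2 := (mR * mR)%type.
Local Notation mu2 := (leb2 R).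

Lemma rays_measurable : @measurable _ mR = <<s @RGenOInfty.G R >>.
Proof. exact: RGenOInfty.measurableE. Qed.

Lemma rays_setI_closed : setI_closed (@RGenOInfty.G R).
Proof.
move=> _ _ [a ->] [b ->]; exists (Num.max a b).
by apply/seteqP; split => x /=; rewrite !in_itv /= !andbT gt_max => /andP.
Qed.

(** Dynkin's argument is applied to one coordinate, then to the other, then to rectangles. Rays do
    not include the whole line, hence the separate hypotheses on [B] and on half-planes. *)
Lemma null_of_rays (B : set R2) (h : R2 -> R) : measurable B ->
  mu2.-integrable B (EFin \o h) ->
  \int[mu2]_(z in B) h z = 0 ->
  (forall a, \int[mu2]_(z in B `&` fst @^-1` `]a, +oo[) h z = 0) ->
  (forall c, \int[mu2]_(z in B `&` snd @^-1` `]c, +oo[) h z = 0) ->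
  (forall a c, \int[mu2]_(z in B `&` snd @^-1` `]c, +oo[ `&` fst @^-1` `]a, +oo[) h z = 0) ->
  {ae mu2, forall z, B z -> h z = 0}.
Proof.
move=> mB ih h0 hx hy hxy.
have mI (a : R) : measurable (`]a, +oo[%classic : set mR) by exact: measurable_itv.
have mF A : measurable A -> measurable (B `&` (fst : R2 -> mR) @^-1` A).
  move=> mA; apply: measurableI => //; rewrite -[_ @^-1` _]setTI.
  exact: (@measurable_fst _ _ mR mR).
have mS A : measurable A -> measurable (B `&` (snd : R2 -> mR) @^-1` A).
  move=> mA; apply: measurableI => //; rewrite -[_ @^-1` _]setTI.
  exact: (@measurable_snd _ _ mR mR).
have st1 (A : set mR) : measurable A -> \int[mu2]_(z in B `&` fst @^-1` A) h z = 0.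
  apply: (integral_preimage_eq0 (@measurable_fst _ _ mR mR) mB ih rays_measurable
    rays_setI_closed h0) => _ [a ->]; exact: hx.
have st2 c (A : set mR) : measurable A ->
    \int[mu2]_(z in B `&` snd @^-1` `]c, +oo[ `&` fst @^-1` A) h z = 0.
  have ih' : mu2.-integrable (B `&` snd @^-1` `]c, +oo[) (EFin \o h).
    by apply: integrableS ih => //; exact: mS.
  apply: (integral_preimage_eq0 (@measurable_fst _ _ mR mR) (mS _ (mI c)) ih'
    rays_measurable rays_setI_closed (hy c)) => _ [a ->]; exact: hxy.
have st3 (A C : set mR) : measurable A -> measurable C ->
    \int[mu2]_(z in B `&` fst @^-1` A `&` snd @^-1` C) h z = 0.
  move=> mA mC.
  have ih' : mu2.-integrable (B `&` fst @^-1` A) (EFin \o h).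
    by apply: integrableS ih => //; exact: mF.
  apply: (integral_preimage_eq0 (@measurable_snd _ _ mR mR) (mF _ mA) ih'
    rays_measurable rays_setI_closed (st1 _ mA)) => // _ [c ->].
  by rewrite setIAC; exact: st2.
have st4 (S : set R2) : measurable S -> \int[mu2]_(z in B `&` id @^-1` S) h z = 0.
  apply: (integral_preimage_eq0 (@measurable_id _ R2 setT) mB ih
    (measurable_prod_measurableType mR mR)) => //.
    move=> _ _ [A1 mA1 [C1 mC1 <-]] [A2 mA2 [C2 mC2 <-]].
    exists (A1 `&` A2); first exact: measurableI.
    exists (C1 `&` C2); first exact: measurableI.
    by rewrite setXI.
  move=> _ [A mA [C mC <-]]; have := st3 _ _ mA mC.
  by rewrite -setIA; congr (_ = _).
have : ae_eq mu2 B (EFin \o h) (fun=> 0%E).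
  apply: integral_ae_eq; [exact: mB|exact: ih|exact: measurable_cst|].
  move=> E EB mE; rewrite integral0 -(@EFin_Rint _ _ _ mu2)//.
    by have := st4 _ mE; rewrite preimage_id (setIidr EB) => ->.
  exact: integrableS ih.
by apply: filterS => z hz /hz [].
Qed.

End null_functions.

(** * Smooth bumps and the vanishing lemma *)

Section flat_functions.
Variable R : realType.
Implicit Types (p q : {poly R}) (x y : R).

(** The induction on [p] needs an extra power of [y], which takes up the factor produced by each
    coefficient. *)
Lemma poly_expR_bounded p : exists2 C : R, 0 <= C &
  forall y, 0 < y -> `|p.[y]| * expR (- y) <= C.
Proof.
suff h : forall n : nat, exists2 C : R, 0 <= C &
    forall y, 0 < y -> `|y ^+ n * p.[y]| * expR (- y) <= C.
  by have [C C0 hC] := h 0%N; exists C => // y /hC; rewrite expr0 mul1r.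
have mono n y : 0 < y -> y ^+ n * expR (- y) <= n`!%:R.
  move=> y0; rewrite expRN ler_pdivrMr ?expR_gt0//.
  case: n => [|n]; first by rewrite expr0 mul1r ltW// expR_gt1.
  have := expR_ge1Dxn n (ltW y0).
  have f0 : (0 : R) < (n.+1)`!%:R by rewrite ltr0n fact_gt0.
  move=> h; rewrite mulrC -ler_pdivrMr//; apply: le_trans h.
  by rewrite lerDr.
elim/poly_ind: p => [|p c IH] n.
  by exists 0 => // y _; rewrite horner0 mulr0 normr0 mul0r.
have [C C0 hC] := IH n.+1; exists (C + `|c| * n`!%:R).
  by rewrite addr_ge0// mulr_ge0.
move=> y y0; rewrite !hornerE mulrDr (mulrC p.[y]) mulrA -exprSr.
apply: (@le_trans _ _ ((`|y ^+ n.+1 * p.[y]| + `|y ^+ n * c|) * expR (- y))).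
  by rewrite ler_wpM2r ?expR_ge0//; exact: ler_normD.
rewrite mulrDl lerD ?hC// normrM.
have := mono n y y0; rewrite (ger0_norm (exprn_ge0 n (ltW y0))).
by have := normr_ge0 c; move: (y ^+ n) (expR _) `|c| => a b k; nra.
Qed.

(* A family of one-sided bumps that is closed under derivation. *)
Definition flat p x : R := if 0 < x then p.[x^-1] * expR (- x^-1) else 0.

(** The polynomial bound applied to [p * 'X^2]: the two additional powers of [x^-1] become the
    factor [x ^+ 2]. *)
Lemma flat_le p : exists2 C : R, 0 <= C & forall x, `|flat p x| <= C * x ^+ 2.
Proof.
have [C C0 hC] := poly_expR_bounded (p * 'X^2); exists C => // x.
rewrite /flat; case: ifPn => [x0|_]; last by rewrite normr0 mulr_ge0 ?sqr_ge0.
have xi : 0 < x^-1 by rewrite invr_gt0.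
have := hC _ xi; rewrite hornerM hornerXn (normrM _ (_ ^+ 2)) (normrM _ (expR _)) (ger0_norm (exprn_ge0 2 (ltW xi))).
rewrite (ger0_norm (expR_ge0 _)) => h.
rewrite (_ : _ * _ = `|p.[x^-1]| * x^-1 ^+ 2 * expR (- x^-1) * x ^+ 2).
  by rewrite ler_wpM2r// sqr_ge0.
by field; rewrite gt_eqF.
Qed.

(** In the variable [y = x^-1] the derivative of [p e^-y] is [(p' - p) e^-y], and the chain rule
    multiplies it by [- y ^+ 2]. *)
Lemma flat_derive_pos p x : 0 < x ->
  is_derive x 1 (flat p) (flat ((p - p^`()) * 'X^2) x).
Proof.
move=> x0; have xn : x != 0 by rewrite gt_eqF.
have e : \forall y \near x, p.[y^-1] * expR (- y^-1) = flat p y.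
  by near=> y; rewrite /flat ifT//; near: y; exact: lt_nbhsr.
apply: (near_eq_is_derive e).
have dV : is_derive x 1 (fun y : R => y^-1) (- x ^- 2).
  by have := @is_deriveV _ id x 1 1 xn (is_derive_id _ _); rewrite /GRing.scale /= mulr1.
have d1 := is_derive1_comp (is_derive_poly p x^-1) dV.
have dN : is_derive x 1 (fun y : R => - y^-1) (x ^- 2).
  by have := is_deriveN dV; rewrite opprK.
have d2 := @is_derive1_comp _ expR (fun y : R => - y^-1) x _ _ (is_derive_expR (- x^-1)) dN.
have := is_deriveM d1 d2; set l := (X in is_derive _ _ _ X -> _) => h.
suff <- : l = flat ((p - p^`()) * 'X^2) x by exact: h.
rewrite /l /flat x0 !hornerE /GRing.scale /=; field.
Unshelve. all: by end_near. Qed.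

Lemma flat_derive p x : is_derive x 1 (flat p) (flat ((p - p^`()) * 'X^2) x).
Proof.
have [x0|x0|->] := ltgtP x 0; last 1 first.
- have [C C0 hC] := flat_le p.
  have f0 q : flat q 0 = 0 by rewrite /flat ltxx.
  (* By [flat_le] the difference quotient at 0 is at most [C * |h|]. *)
  have lim0 : h^-1 *: ((flat p \o shift 0) (h *: 1) - flat p 0) @[h --> 0^'] --> (0 : R).
    apply/cvgrPdist_le => e e0; near=> h.
    rewrite f0 sub0r normrN /= subr0 addr0 [h *: 1]mulr1 normrM normfV.
    have h0 : h != 0 by near: h; exact: nbhs_dnbhs_neq.
    rewrite ler_pdivrMl ?normr_gt0//; apply: le_trans (hC h) _.
    rewrite -real_normK ?num_real// expr2 mulrA mulrC ler_wpM2l//.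
    have : `|h| < e / (C + 1).
      near: h; apply: dnbhs0_lt; rewrite divr_gt0//; lra.
    rewrite ltr_pdivlMr; last lra.
    have := normr_ge0 h; nra.
  split; first by apply/cvg_ex; exists 0.
  by rewrite f0; apply: cvg_lim.
- have e : \forall y \near x, cst 0 y = flat p y.
    by near=> y; rewrite /flat ifF//; apply/negbTE; rewrite -leNgt ltW//; near: y; exact: lt_nbhsl.
  apply: (near_eq_is_derive e); rewrite /flat ifF; last by apply/negbTE; rewrite -leNgt ltW.
  exact: is_derive_cst.
- exact: flat_derive_pos.
Unshelve. all: by end_near. Qed.

Lemma flat_affine_smooth (p : {poly R}) (c b : R) : smooth (fun x : R => flat p (c * x + b)).
Proof.
apply: (@smooth_class _ _ [set f | exists q : {poly R}, f = fun x : R => flat q (c * x + b)]); last by exists p.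
move=> _ [q ->].
have der x : is_derive x 1 (fun x : R => flat q (c * x + b))
   (flat ((q - q^`()) * 'X^2) (c * x + b) * c).
  have dl : is_derive x 1 (fun y : R => c * y + b) c.
    have := is_deriveD (is_deriveZ c (is_derive_id x (1 : R))) (is_derive_cst b x (1 : R)).
    by rewrite addr0 [_ *: _]mulr1.
  exact: (@is_derive1_comp _ (flat q) (fun y : R => c * y + b) x _ _ (flat_derive q (c * x + b)) dl).
have dif x : differentiable (fun x : R => flat q (c * x + b)) x.
  by apply/derivable1_diffP; have [] := der x.
split; first by move=> x; exact: differentiable_continuous.
move=> d; split; first by move=> x; exact: diff_derivable.
exists ((d * c) *: ((q - q^`()) * 'X^2)); apply/funext => x.
rewrite deriveE// -[d]mulr1 [d * 1](_ : _ = d *: (1 : R))// linearZ /= -deriveE//.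
have [_ ->] := der x; rewrite /flat; case: ifP => _; rewrite ?hornerZ /GRing.scale /=; ring.
Qed.

End flat_functions.

Section box_bumps.
Variable R : realType.
Local Notation mR := (measurableTypeR R).
Local Notation R2 := (mR * mR)%type.
Local Notation mu2 := (leb2 R).

Lemma smooth_fst (h : R -> R) : smooth h -> smooth (fun z : R * R => h z.1).
Proof.
move=> sh; apply: (@smooth_class _ _ [set f | exists2 h : R -> R, smooth h & f = fun z : R * R => h z.1]).
  move=> _ [k sk ->]; split.
    move=> z; apply: (@continuous_comp _ _ _ fst k); first exact: cvg_fst.
    exact: smooth_continuous.
  move=> d; split; first by move=> z; exact: (smooth_derivable z.1 d.1 sk).
  by exists (fun x => 'D_(d.1) k x) => //; exact: smooth_derive.
by exists h.
Qed.

Lemma smooth_snd (h : R -> R) : smooth h -> smooth (fun z : R * R => h z.2).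
Proof.
move=> sh; apply: (@smooth_class _ _ [set f | exists2 h : R -> R, smooth h & f = fun z : R * R => h z.2]).
  move=> _ [k sk ->]; split.
    move=> z; apply: (@continuous_comp _ _ _ snd k); first exact: cvg_snd.
    exact: smooth_continuous.
  move=> d; split; first by move=> z; exact: (smooth_derivable z.2 d.2 sk).
  by exists (fun x => 'D_(d.2) k x) => //; exact: smooth_derive.
by exists h.
Qed.

(** The function [exp (- 1 / ((n + 1) t))] for positive [t], extended by 0: a smooth approximation
    of the indicator of the positive half-line. *)
Definition ramp (n : nat) (t : R) : R := flat 1 (n.+1%:R * t).

Lemma ramp_itv n t : 0 <= ramp n t <= 1.
Proof.
rewrite /ramp /flat; case: ifPn => [x0|_]; last by rewrite lexx ler01.
rewrite hornerC mul1r expR_ge0 /= -[leRHS]expR0 ler_expR lerNl oppr0 invr_ge0.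
exact: ltW.
Qed.

Lemma ramp0 n t : t <= 0 -> ramp n t = 0.
Proof.
by move=> t0; rewrite /ramp /flat ifF//; apply/negbTE; rewrite -leNgt pmulr_rle0.
Qed.

Lemma ramp_cvg t : 0 < t -> ramp n t @[n --> \oo] --> (1 : R).
Proof.
move=> t0; rewrite (_ : (fun n => _) = (fun n => expR (- (t^-1 * harmonic n)))).
  rewrite -[X in _ --> X]expR0 -oppr0 -(mulr0 t^-1).
  apply: continuous_cvg; first exact: continuous_expR.
  by apply: cvgN; apply: cvgMr; exact: cvg_harmonic.
apply/funext => n; rewrite /ramp /flat ifT ?mulr_gt0// hornerC mul1r invfM.
by rewrite mulrC.
Qed.

Lemma ramp_smooth n (c b : R) : smooth (fun x : R => ramp n (c * x + b)).
Proof.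
rewrite (_ : (fun x => _) = (fun x => flat 1 (n.+1%:R * c * x + n.+1%:R * b))).
  exact: flat_affine_smooth.
by apply/funext => x; rewrite /ramp mulrDr mulrA.
Qed.

(** A smooth approximation of the indicator of an open box, one ramp for each side; the arguments
    are written as [c * x + b] to fit [ramp_smooth]. *)
Definition bump n (a b c d : R) (z : R * R) : R :=
  ramp n (1 * z.1 + - a) * ramp n ((-1) * z.1 + b) *
  (ramp n (1 * z.2 + - c) * ramp n ((-1) * z.2 + d)).

Lemma bump_smooth n a b c d : smooth (bump n a b c d).
Proof.
apply: smooth_mul; apply: smooth_mul;
  [apply: (@smooth_fst (fun x => ramp n (1 * x + - a)))
  |apply: (@smooth_fst (fun x => ramp n ((-1) * x + b)))
  |apply: (@smooth_snd (fun x => ramp n (1 * x + - c)))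
  |apply: (@smooth_snd (fun x => ramp n ((-1) * x + d)))]; exact: ramp_smooth.
Qed.

Lemma bump_itv n a b c d z : 0 <= bump n a b c d z <= 1.
Proof.
rewrite /bump; move: (ramp_itv n (1 * z.1 + - a)) (ramp_itv n ((-1) * z.1 + b)).
move: (ramp_itv n (1 * z.2 + - c)) (ramp_itv n ((-1) * z.2 + d)).
move: (ramp n _) (ramp n _) (ramp n _) (ramp n _) => x y u v.
move=> /andP[x0 x1] /andP[y0 y1] /andP[u0 u1] /andP[v0 v1].
by rewrite !mulr_ge0//= !mulr_ile1// mulr_ge0.
Qed.

Definition obox (a b c d : R) : set R2 := `]a, b[%classic `*` `]c, d[%classic.
Definition cbox (a b c d : R) : set (R * R) := `[a, b]%classic `*` `[c, d]%classic.

Lemma obox_sub a b c d : obox a b c d `<=` cbox a b c d.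
Proof. by move=> z [/=]; rewrite !in_itv /= => /andP[/ltW ? /ltW ?] /andP[/ltW ? /ltW ?]; split; rewrite /= in_itv; apply/andP. Qed.

Lemma obox_measurable a b c d : measurable (obox a b c d).
Proof. by apply: measurableX; exact: measurable_itv. Qed.

Lemma bump_off n a b c d z : ~ obox a b c d z -> bump n a b c d z = 0.
Proof.
move=> nz; have [h|h|h|h] : [\/ z.1 <= a, b <= z.1, z.2 <= c | d <= z.2].
- case: (lerP z.1 a) => h1; first exact: Or41.
  case: (lerP b z.1) => h2; first exact: Or42.
  case: (lerP z.2 c) => h3; first exact: Or43.
  case: (lerP d z.2) => h4; first exact: Or44.
  by exfalso; apply: nz; split; rewrite /= in_itv /=; apply/andP.
- by rewrite /bump ramp0 ?mul0r//; lra.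
- by rewrite /bump (@ramp0 n ((-1) * z.1 + b)) ?mulr0 ?mul0r//; lra.
- by rewrite /bump (@ramp0 n (1 * z.2 + - c)) ?mul0r ?mulr0//; lra.
- by rewrite /bump (@ramp0 n ((-1) * z.2 + d)) ?mulr0//; lra.
Qed.

Lemma bump_on a b c d z : obox a b c d z -> bump n a b c d z @[n --> \oo] --> (1 : R).
Proof.
move=> [/=]; rewrite !in_itv /= => /andP[h1 h2] /andP[h3 h4].
suff : bump n a b c d z @[n --> \oo] --> (1 * 1 * (1 * 1) : R) by rewrite !mulr1.
by rewrite /bump; apply: cvgM; apply: cvgM; apply: ramp_cvg; lra.
Qed.

Variable P : set (R * R).
Hypothesis oP : open P.
Local Notation PR := (P : set R2).
Let mP : measurable PR. Proof. exact: open_measurable2. Qed.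

Lemma bump_test n a b c d : cbox a b c d `<=` P -> test P (bump n a b c d).
Proof.
have cK : compact (cbox a b c d) by apply: compact_setX; exact: segment_compact.
move=> sub; apply: (@test_closed_support _ _ _ _ (cbox a b c d)) => //.
- exact: bump_smooth.
- by apply: compact_closed => //; exact: norm_hausdorff.
by move=> z nz; apply: bump_off => /obox_sub.
Qed.

Variable g : R2 -> R.
Hypothesis ig : mu2.-integrable PR (EFin \o g).
Hypothesis orth : forall psi, test P psi -> \int[mu2]_(x in PR) (g x * psi x) = 0.

(** Dominated convergence along the bumps, which are between 0 and 1 and tend to the indicator of
    the box. *)
Lemma orth_box a b c d : cbox a b c d `<=` P -> \int[mu2]_(x in obox a b c d) g x = 0.
Proof.
move=> sub; pose B := obox a b c d.
have mg : measurable_fun PR g by exact: intg_meas ig.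
have BP : B `<=` PR by move=> z /obox_sub/sub.
have mb n : measurable_fun PR (bump n a b c d : R2 -> R).
  by apply: continuous_measurable2 => //; apply: smooth_continuous; exact: bump_smooth.
have ib n : mu2.-integrable PR (EFin \o (fun z => g z * bump n a b c d z)).
  apply: (@intg_le _ _ _ _ _ mP _ (fun z => `|g z|)); last exact: intg_norm.
    exact: measurable_funM.
  move=> z _; rewrite normrM ler_piMr//.
  by have /andP[? ?] := bump_itv n a b c d z; rewrite ger0_norm.
have := @dominated_cvg _ _ _ mu2 PR mP (fun n z => (g z * bump n a b c d z)%:E)
  (EFin \o (g \_ B)) (fun z => `|g z|%:E).
move=> DC; have : (fun n => \int[mu2]_(x in PR) (g x * bump n a b c d x)%:E)%E @ \oo
   --> (\int[mu2]_(x in PR) (EFin \o (g \_ B)) x)%E; first apply: DC.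
- by move=> n; apply/measurable_EFinP; exact: measurable_funM.
- move=> z Pz; apply: cvg_EFin; first by near=> n.
  rewrite /= patchE; case: ifPn => [/set_mem Bz|/negP nBz].
    rewrite -[X in _ --> X]mulr1; apply: cvgMr; exact: bump_on.
  rewrite (_ : (fun n => _) = fun=> 0); first exact: cvg_cst.
  apply/funext => n /=; rewrite bump_off ?mulr0// => Bz; apply: nBz; exact: mem_set.
- by [].
- exact: (intg_norm ig).
- move=> n z _; rewrite lee_fin normrM ler_piMr//.
  by have /andP[? ?] := bump_itv n a b c d z; rewrite ger0_norm.
move=> h; rewrite (_ : (fun n => _) = fun=> 0%E) in h; last first.
  by apply/funext => n; rewrite -EFin_Rint// orth//; exact: bump_test.
have := cvg_unique _ h (cvg_cst _); rewrite /Rintegral => /(_ (@ereal_hausdorff _)) e.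
rewrite -[obox a b c d](setIidr BP) integral_mkcondr.
rewrite (eq_integral (EFin \o (g \_ B))) ?e//.
by move=> z _; rewrite /= !patchE; case: ifP.
Unshelve. all: by end_near. Qed.

(** The fundamental lemma of the calculus of variations: [g] is null on every rational box whose
    closure lies in [P], and countably many such boxes cover [P]. *)
Lemma orth_test_null : {ae mu2, forall z, P z -> g z = 0}.
Proof.
pose Q (k : (rat * rat) * (rat * rat)) := rat_box k : set R2.
have nul k : cbox (ratr k.1.1) (ratr k.1.2) (ratr k.2.1) (ratr k.2.2) `<=` P ->
    {ae mu2, forall z, Q k z -> g z = 0}.
  move=> sub; have ob : Q k = obox (ratr k.1.1) (ratr k.1.2) (ratr k.2.1) (ratr k.2.2) by [].
  move: sub ob; move: (ratr k.1.1) (ratr k.1.2) (ratr k.2.1) (ratr k.2.2) => a b c d sub ->.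
  (* A box cut by a ray is again a box, possibly empty, and [orth_box] makes no assumption on the
     order of the end points. *)
  have r1 (x : R) : obox a b c d `&` fst @^-1` `]x, +oo[ = obox (Num.max a x) b c d.
    apply/seteqP; split => z.
      move=> [[/= + z2]]; rewrite !in_itv /= andbT => /andP[h1 h2] h3; split => //=.
      by rewrite in_itv /= gt_max h1 h2 h3.
    move=> [/= + z2]; rewrite in_itv /= gt_max => /andP[/andP[h1 h2] h3].
    by split; [split => //=|]; rewrite /= in_itv /= ?h1 ?h2.
  have r2 a' (x : R) : obox a' b c d `&` snd @^-1` `]x, +oo[ = obox a' b (Num.max c x) d.
    apply/seteqP; split => z.
      move=> [[/= z1 +]]; rewrite !in_itv /= andbT => /andP[h1 h2] h3; split => //=.
      by rewrite in_itv /= gt_max h1 h2 h3.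
    move=> [/= z1 +]; rewrite in_itv /= gt_max => /andP[/andP[h1 h2] h3].
    by split; [split => //=|]; rewrite /= in_itv /= ?h1 ?h2.
  have subs a' c' : a <= a' -> c <= c' -> cbox a' b c' d `<=` P.
    move=> aa cc z [/=]; rewrite !in_itv /= => /andP[h1 h2] /andP[h3 h4].
    by apply: sub; split; rewrite /= in_itv /= ?h2 ?h4 andbT; [exact: le_trans h1|exact: le_trans h3].
  have aM x : a <= Num.max a x by rewrite le_max lexx.
  have cM x : c <= Num.max c x by rewrite le_max lexx.
  apply: null_of_rays.
  - exact: obox_measurable.
  - by apply: integrableS ig => //; [exact: obox_measurable|move=> z /obox_sub/sub].
  - exact: orth_box.
  - by move=> x; rewrite r1; apply: orth_box; exact: subs.
  - by move=> x; rewrite r2; apply: orth_box; exact: subs.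
  - by move=> x y; rewrite setIAC r1 r2; apply: orth_box; exact: subs.
(* An enumeration of the rational boxes; the box given to numbers that encode none is immaterial,
   since only surjectivity is used. *)
have [f] : exists f : nat -> (rat * rat) * (rat * rat), forall k, exists n, f n = k.
  exists (fun n => odflt ((0, 0), (0, 0)) (unpickle n)) => k.
  by exists (pickle k); rewrite pickleK.
move=> fS.
pose N n := [set z | cbox (ratr (f n).1.1) (ratr (f n).1.2) (ratr (f n).2.1) (ratr (f n).2.2) `<=` P
   /\ Q (f n) z /\ g z <> 0].
have : mu2.-negligible (\bigcup_n N n).
  apply: negligible_bigcup => n.
  have [sub|nsub] := pselect (cbox (ratr (f n).1.1) (ratr (f n).1.2) (ratr (f n).2.1) (ratr (f n).2.2) `<=` P).
    apply: negligibleS (nul _ sub) => z [_ [Qz gz]] h; exact: gz (h Qz).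
  by rewrite (_ : N n = set0); [exact: negligible_set0|apply/seteqP; split => // z []].
apply: negligibleS => z /= h; apply: contrapT => nz; apply: h => Pz.
apply: contrapT => gz; apply: nz.
have [k [kz _ kP]] := open_bigcup_rat oP Pz; have [n fn] := fS k.
by exists n => //; rewrite /N /= fn.
Qed.

End box_bumps.

(** * Sobolev spaces *)

Section closures.
Variables (R : realType) (X : lmodType R) (S A : set X) (q : X -> X -> R).
Hypotheses (hS : subsp S) (hA : subsp A) (AS : A `<=` S) (hq : psd_on S q).
Local Notation C := (closure_in (nrm q) S A).

Lemma closure_in_sub : C `<=` S. Proof. by move=> u []. Qed.

Lemma sub_closure_in : A `<=` C.
Proof.
move=> u Au; split; first exact: AS.
by move=> e e0; exists u => //; rewrite subrr (nrm0 hS hq).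
Qed.

Lemma closure_in_subsp : subsp C.
Proof.
split; first by apply: sub_closure_in; exact: subsp0.
move=> c u v [Su hu] [Sv hv]; split; first exact: hS.2.
move=> e e0; have k0 : 0 < 2 * (`|c| + 1) by rewrite mulr_gt0// ltr_wpDl.
have [a Aa ha] := hu _ (divr_gt0 e0 k0); have [b Ab hb] := hv _ (divr_gt0 e0 (ltr0n R 2)).
exists (c *: a + b); first exact: hA.2.
have -> : c *: u + v - (c *: a + b) = c *: (u - a) + (v - b).
  by rewrite opprD addrACA scalerBr.
have Sua := subspB hS Su (AS Aa); have Svb := subspB hS Sv (AS Ab).
apply: le_lt_trans (nrm_triangle hS hq (subspZ hS c Sua) Svb) _.
rewrite (nrmZ hS hq)//; have : `|c| * nrm q (u - a) <= e / 2.
  have := normr_ge0 c; have := nrm_ge0 q (u - a); move: ha; rewrite ltr_pdivlMr//.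
  move: (nrm q _) `|c| => x y; nra.
lra.
Qed.

Lemma closure_in_complete : complete_on S q -> complete_on C q.
Proof.
move=> cS u Cu cu; have [l Sl ul] := cS u (fun n => closure_in_sub (Cu n)) cu.
exists l => //; split=> // e e0.
have /cvgrPdist_lt/(_ _ (divr_gt0 e0 (ltr0n R 2)))[K _ hK] := ul.
have := hK K (leqnn K); rewrite /= sub0r normrN ger0_norm ?nrm_ge0// => h1.
have [Su hu] := Cu K; have [a Aa ha] := hu _ (divr_gt0 e0 (ltr0n R 2)).
exists a => //; have -> : l - a = (l - u K) + (u K - a) by rewrite addrA subrK.
apply: le_lt_trans (nrm_triangle hS hq _ _) _.
- exact: subspB.
- by apply: subspB => //; exact: AS.
rewrite (nrm_distC hS hq)//; lra.
Qed.

End closures.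

Section triples.
Variables (R : realType) (S : set (R * R -> R^o)) (q : (R * R -> R^o) -> (R * R -> R^o) -> R).
Hypotheses (hS : subsp S) (hq : psd_on S q).

Definition triple : set (field3 R) := [set u | forall j, S (comp3 u j)].
Definition triple_form (u v : field3 R) := \sum_(j < 3) q (comp3 u j) (comp3 v j).

Lemma comp3_lin (c : R) (u v : field3 R) j :
  comp3 (c *: u + v) j = c *: (comp3 u j : R * R -> R^o) + (comp3 v j : R * R -> R^o).
Proof. by apply/funext => x; rewrite /comp3 !fctE !mxE. Qed.

Lemma comp3B (u v : field3 R) j :
  comp3 (u - v) j = (comp3 u j : R * R -> R^o) - (comp3 v j : R * R -> R^o).
Proof. by apply/funext => x; rewrite /comp3 !fctE !mxE. Qed.

Lemma triple_subsp : subsp triple.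
Proof.
split=> [j|c u v Su Sv j]; last by rewrite comp3_lin; apply: hS.2.
rewrite (_ : comp3 0 j = 0); first exact: subsp0.
by apply/funext => x; rewrite /comp3 mxE.
Qed.

Lemma triple_psd : psd_on triple triple_form.
Proof.
have [[h1 h2] h3 h4] := hq.
split; [split=> w Sw c u v Su Sv|move=> u v Su Sv|move=> u Su]; rewrite /triple_form.
- rewrite mulr_sumr -big_split /=; apply: eq_bigr => j _.
  by rewrite comp3_lin (h1 _ (Sw j)).
- rewrite mulr_sumr -big_split /=; apply: eq_bigr => j _.
  by rewrite comp3_lin (h2 _ (Sw j)).
- by apply: eq_bigr => j _; rewrite h3.
- by apply: sumr_ge0 => j _; exact: h4.
Qed.

Lemma triple_ge u j : triple u -> nrm q (comp3 u j) <= nrm triple_form u.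
Proof.
move=> Su; rewrite ler_wsqrtr// /triple_form (bigD1 j)//= lerDl.
by apply: sumr_ge0 => i _; exact: (psd_ge0 hq).
Qed.

Lemma triple_le u : triple u -> nrm triple_form u <= \sum_(j < 3) nrm q (comp3 u j).
Proof.
move=> Su; rewrite -[leRHS]ger0_norm; last by apply: sumr_ge0 => j _; exact: nrm_ge0.
rewrite -sqrtr_sqr ler_wsqrtr// /triple_form !big_ord_recl !big_ord0 !addr0.
rewrite -!(nrm_sqr hq)//; move: (nrm_ge0 q (comp3 u ord0)).
move: (nrm_ge0 q (comp3 u (lift ord0 ord0))) (nrm_ge0 q (comp3 u (lift ord0 (lift ord0 ord0)))).
move: (nrm q _) (nrm q _) (nrm q _) => x y z; nra.
Qed.

Lemma triple_complete : complete_on S q -> complete_on triple triple_form.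
Proof.
move=> cS u Su cu.
have h j : exists2 l, S l & (fun n => nrm q (comp3 (u n) j - l)) @ \oo --> (0 : R).
  apply: cS => [n|e e0]; first exact: Su.
  have [K hK] := cu _ e0; exists K => n m Kn Km; apply: le_trans (hK n m Kn Km).
  by rewrite -comp3B; apply: triple_ge; exact: (subspB triple_subsp).
pose l j := s2val (cid2 (h j)).
pose L : field3 R := fun x => \row_j l j x.
have Ll j : comp3 L j = l j by apply/funext => x; rewrite /comp3 /L mxE.
have SL : triple L by move=> j; rewrite Ll /l; exact: (s2valP (cid2 (h j))).
exists L => //.
have lim0 : (fun n => \sum_(j < 3) nrm q (comp3 (u n) j - l j)) @ \oo --> (0 : R).
  pose z j n := nrm q (comp3 (u n) j - l j).
  have g j : z j @ \oo --> (0 : R) by exact: (s2valP' (cid2 (h j))).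
  have hG : (fun n => z ord0 n + (z (lift ord0 ord0) n + z (lift ord0 (lift ord0 ord0)) n)) @ \oo
      --> (0 + (0 + 0) : R).
    by apply: cvgD => //; apply: cvgD.
  rewrite !addr0 in hG; rewrite (_ : (fun n => _) = (fun n => z ord0 n +
    (z (lift ord0 ord0) n + z (lift ord0 (lift ord0 ord0)) n)))//.
  by apply/funext => n; rewrite !big_ord_recl big_ord0 addr0.
apply: (squeeze_cvgr _ (cvg_cst (0 : R)) lim0); apply: nearW => n.
rewrite nrm_ge0 /=; apply: le_trans (triple_le _) _.
  by exact: (subspB triple_subsp).
by apply: ler_sum => j _; rewrite comp3B Ll.
Qed.

End triples.

Section L2_complete.
Context d (T : measurableType d) (R : realType) (mu : {measure set T -> \bar R}).
Variables (D : set T) (mD : measurable D).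
Local Notation L := (sqi mu D : set (T -> R^o)).
Local Notation N := (nrm (dot mu D)).

Let mulq (x y : R^o) : R := x * y.

Let mul_psd : psd_on [set: R^o] mulq.
Proof.
split; [split=> w _ c u v _ _|move=> u v _ _|move=> u _]; rewrite /mulq.
- by rewrite mulrDl /GRing.scale /= mulrA.
- by rewrite mulrDr /GRing.scale /= mulrCA.
- exact: mulrC.
- by rewrite -expr2 sqr_ge0.
Qed.

Let nrm_mul (x : R^o) : nrm mulq x = `|x : R|.
Proof. by rewrite /nrm /mulq -expr2 sqrtr_sqr. Qed.

Let mul_complete : complete_on [set: R^o] mulq.
Proof.
move=> u _ cu.
have : cvg ((u : nat -> R) @ \oo).
  apply/cauchy_cvgP/cauchy_exP => e e0.
  have [K hK] := cu (e / 2) (divr_gt0 e0 (ltr0n R 2)).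
  exists (u K); exists K => // n /= Kn; rewrite /ball /=.
  have := hK K n (leqnn K) Kn; rewrite nrm_mul => h; lra.
move=> cv; exists (lim ((u : nat -> R) @ \oo)) => //.
have h : (fun n => (u n : R) - lim ((u : nat -> R) @ \oo)) @ \oo --> (0 : R).
  by rewrite -(subrr (lim ((u : nat -> R) @ \oo))); apply: cvgB => //; exact: cvg_cst.
rewrite (_ : (fun n => _) = (fun n => `|(u n : R) - lim ((u : nat -> R) @ \oo)|)).
  by rewrite -(normr0 R); exact: cvg_norm.
by apply/funext => n; rewrite nrm_mul.
Qed.

(** Besides completeness this keeps a subsequence that converges almost everywhere, which Fatou's
    lemma needs when Ladyzhenskaya's inequality is extended. *)
Lemma L2_riesz (u : nat -> T -> R^o) : (forall n, L (u n)) ->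
  (forall e : R, 0 < e -> exists K, forall n m, (K <= n)%N -> (K <= m)%N ->
     N (u n - u m) <= e) ->
  exists (f : nat -> nat) (v : T -> R^o), [/\ L v,
    {ae mu, forall x, D x -> (fun k => u (f k) x : R) @ \oo --> (v x : R)} &
    (fun n => N (u n - v)) @ \oo --> (0 : R)].
Proof.
move=> Lu cu; have hL := sqi_subsp mu mD; have pL := dot_psd mu mD.
have e2 (g : T -> R^o) : (fun x => (nrm mulq (g x) ^+ 2)%:E) = (fun x => ((g x : R) ^+ 2)%:E).
  by apply/funext => x; rewrite nrm_mul real_normK ?num_real.
have sq g : L g -> (\int[mu]_(x in D) ((g x : R) ^+ 2)%:E)%E = (N g ^+ 2)%:E.
  by move=> Lg; rewrite (nrm_sqr pL)// /dot -EFin_Rint//; exact: Lg.2.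
have mN (g : T -> R^o) : measurable_fun D (g : T -> R) -> measurable_fun D (fun x => nrm mulq (g x)).
  move=> mg; rewrite (_ : (fun x => _) = (fun x => `|g x : R|)).
    exact: measurableT_comp.
  by apply/funext => x; rewrite nrm_mul.
have [] := @riesz_fischer _ _ _ mu D mD _ _ _ (_ : subsp [set: R^o]) mul_psd mul_complete u.
- by split.
- by [].
- by move=> n; apply: mN; exact: (Lu n).1.
- by move=> n m; apply: (mN (u n - u m)); exact: (subspB hL (Lu n) (Lu m)).1.
- move=> e e0; have e0' : 0 < Num.sqrt e by rewrite sqrtr_gt0.
  have [K hK] := cu _ e0'; exists K => n m Kn Km.
  rewrite (e2 (u n - u m)) (sq (u n - u m)); last exact: subspB.
  rewrite lee_fin -[leRHS]sqr_sqrtr; last exact: ltW.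
  rewrite lerXn2r ?nnegrE ?nrm_ge0 ?sqrtr_ge0//.
  exact: hK.
move=> f [E [v [mE ED DE vE [cvE mv cv]]]].
have cvpt x : E x -> (fun k => u (f k) x : R) @ \oo --> (v x : R).
  by move=> Ex; apply: (cvg_le0 (C := 1) _ (cvE x Ex)) => k; rewrite mul1r nrm_mul.
have mvD : measurable_fun D (v : T -> R).
  have DEE : D = E `|` (D `\` E) by rewrite setUC setDKU.
  rewrite DEE; apply/measurable_funU => //; first exact: measurableD.
  split.
    apply: (measurable_fun_cvg (h := fun k => u (f k) : T -> R)) => // k.
    by apply: measurable_funS (Lu (f k)).1.
  apply: (eq_measurable_fun (fun=> 0 : R)); last exact: measurable_cst.
  by move=> x /set_mem[_ nE]; rewrite (vE x).2.
have small e : 0 < e -> exists K, forall n, (K <= n)%N -> L (u n - v) /\ N (u n - v) <= e.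
  move=> e0; have [K hK] := cv _ (exprn_gt0 2 e0); exists K => n Kn.
  have := hK n Kn; rewrite (e2 (u n - v)) => h.
  have Luv : L (u n - v).
    split; first by apply: measurable_funB => //; exact: (Lu n).1.
    apply: intg_ge0P => //; [|by move=> x _; exact: sqr_ge0|].
      by apply: measurable_funX; apply: measurable_funB => //; exact: (Lu n).1.
    by apply: le_lt_trans h _; rewrite ltry.
  split => //; move: h; rewrite sq// lee_fin ler_pXn2r// nnegrE ?nrm_ge0//; exact: ltW.
have Lv : L v.
  have [K /(_ K (leqnn K))[h _]] := small 1 ltr01.
  have := subspB hL (Lu K) h; by rewrite opprB addrC subrK.
exists f, v; split => //.
  apply: negligibleS DE => x /= nx; split; apply: contrapT => h; apply: nx => Dx //.
  by apply: cvpt; apply: contrapT => nE; apply: h.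
apply/cvgrPdist_le => e e0; have [K hK] := small _ e0; exists K => // n /= Kn.
by rewrite sub0r normrN ger0_norm ?nrm_ge0//; case: (hK n Kn).
Qed.

End L2_complete.

(* Comparing [e1 R] with [e2 R] by conversion would unfold the 0 and 1 of an
   abstract [realType]. *)
Opaque e1 e2 wderiv.

Section dot_toolkit.
Context d (T : measurableType d) (R : realType) (mu : {measure set T -> \bar R}).
Variables (D : set T) (mD : measurable D).
Local Notation L := (sqi mu D : set (T -> R^o)).

Lemma Rint_ae (f g : T -> R) : measurable_fun D f -> measurable_fun D g ->
  {ae mu, forall x, D x -> f x = g x} ->
  \int[mu]_(x in D) f x = \int[mu]_(x in D) g x.
Proof.
move=> mf mg fg; rewrite /Rintegral; congr fine.
apply: ae_eq_integral => //; try exact/measurable_EFinP.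
by apply: filterS fg => x h /h ->.
Qed.

Lemma ae_impl (A B : T -> Prop) : (forall x, A x -> B x) ->
  {ae mu, forall x, A x} -> {ae mu, forall x, B x}.
Proof. by move=> AB; apply: negligibleS => x /= nB /AB. Qed.

Lemma dot_ae (f f' g g' : T -> R) : L f -> L f' -> L g -> L g' ->
  {ae mu, forall x, D x -> f x = f' x} -> {ae mu, forall x, D x -> g x = g' x} ->
  dot mu D f g = dot mu D f' g'.
Proof.
move=> Lf Lf' Lg Lg' ff gg; apply: Rint_ae.
- by apply: measurable_funM; [exact: Lf.1|exact: Lg.1].
- by apply: measurable_funM; [exact: Lf'.1|exact: Lg'.1].
by apply: filterS2 ff gg => x hf hg Dx; rewrite hf// hg.
Qed.

Lemma dot0_ae (f : T -> R) : L f -> dot mu D f f = 0 -> {ae mu, forall x, D x -> f x = 0}.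
Proof.
move=> Lf f0; have : {ae mu, forall x, D x -> f x * f x = 0}.
  apply: Rint_ge0_le0 => //.
  - exact: sqi_mul.
  - by move=> x _; rewrite -expr2 sqr_ge0.
  - by rewrite -/(dot mu D f f) f0.
by apply: filterS => x h /h /eqP; rewrite mulf_eq0 orbb => /eqP.
Qed.

Lemma sqi_norm (f : T -> R) : L f -> L (fun x => `|f x|).
Proof.
move=> [mf f2]; split; first exact: measurableT_comp.
by apply: eq_integrable f2 => // x _; rewrite /= real_normK ?num_real.
Qed.

End dot_toolkit.

Section weak_derivatives.
Variables (R : realType) (P : set (R * R)) (M : R).
Hypotheses (oP : open P) (M0 : 0 < M) (PM : in_square P M).
Local Notation mR := (measurableTypeR R).
Local Notation R2 := (mR * mR)%type.
Local Notation mu2 := (leb2 R).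
Local Notation PR := (P : set R2).
Local Notation L := (sqi mu2 PR : set (R * R -> R^o)).
Local Notation dotP := (dot mu2 PR).
Local Notation N := (nrm dotP).
Implicit Types (f g : R * R -> R^o) (d : R * R).

Let mP : measurable PR. Proof. exact: open_measurable2. Qed.
Let hL : subsp L. Proof. exact: (sqi_subsp mu2 mP). Qed.
Let pL : psd_on L dotP. Proof. exact: (dot_psd mu2 mP). Qed.

Lemma L2_sqi f : L2 P f <-> L f.
Proof.
split.
  rewrite /L2 /= inE => /andP[]; rewrite !inE /= => mf nf.
  have mf' : measurable_fun PR (f : R2 -> R) by apply/(measurable_restrictT _ mP).
  split => //; apply: intg_ge0P => //; [exact: measurable_funX|by move=> x _; exact: sqr_ge0|].
  have := finite_norm2_lty nf.
  rewrite (_ : (fun t => _) = ((fun t => ((f t : R) ^+ 2)%:E) \_ PR)) -?integral_mkcond//.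
  by apply/funext => t; rewrite !patchE; case: ifP => // _; rewrite expr0n.
move=> [mf f2]; rewrite /L2 /= inE; apply/andP; split.
  by rewrite inE /=; apply/(measurable_restrictT _ mP).
rewrite inE /=; apply: (finite_norm_patch mP _ _ f2); first by rewrite pnatr_eq0.
by move=> x _; rewrite powR_mulrn// real_normK ?num_real.
Qed.

Lemma test_L psi : test P psi -> L psi. Proof. exact: (test_sqi oP PM). Qed.

Lemma wd_sqi d f g : is_wderiv P d f g -> L g.
Proof. by case=> /L2_sqi. Qed.

Lemma wd_dot d f g psi : is_wderiv P d f g -> test P psi ->
  dotP f (fun x => 'D_d psi x) = - dotP g psi.
Proof. by move=> [_]; apply. Qed.

Lemma wd_lin d (c : R) f g f' g' : L f -> L f' -> is_wderiv P d f g ->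
  is_wderiv P d f' g' -> is_wderiv P d (c *: f + f') (c *: g + g').
Proof.
move=> Lf Lf' wf wf'; have Lg := wd_sqi wf; have Lg' := wd_sqi wf'.
split; first by apply/L2_sqi; apply: hL.2.
move=> psi tp; have [[lin _] _ _] := pL.
have Lp := test_L tp; have Ldp := test_L (test_derive d tp).
have := lin _ Ldp c f f' Lf Lf'; rewrite (wd_dot wf tp) (wd_dot wf' tp).
have := lin _ Lp c g g' Lg Lg'; rewrite /dot => -> ->; ring.
Qed.

(** The difference of two weak derivatives is orthogonal to all test functions. It is integrable on
    [P] because [P] is bounded. *)
Lemma wd_unique d f g g' : is_wderiv P d f g -> is_wderiv P d f g' ->
  {ae mu2, forall x, P x -> g x = g' x}.
Proof.
move=> wg wg'; have Lg := wd_sqi wg; have Lg' := wd_sqi wg'.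
have Lb := subspB hL Lg Lg'.
have : {ae mu2, forall x, P x -> (g - g') x = 0}.
  apply: (@orth_test_null R P oP) => [|psi tp].
    have L1 : L (fun=> 1).
      apply: (continuous_sqi oP PM); first by move=> x; exact: cst_continuous.
      by exists 1 => x; rewrite normr1.
    by apply: eq_integrable (sqi_mul mP Lb L1) => // x _ /=; rewrite mulr1.
  have [[lin _] _ _] := pL.
  have := lin_onB (lin psi (test_L tp)) Lg Lg'.
  have := wd_dot wg tp; have := wd_dot wg' tp; rewrite /dot => -> /oppr_inj -> ->.
  by rewrite subrr.
by apply: ae_impl => x h /h /eqP; rewrite subr_eq0 => /eqP.
Qed.

Lemma test_wd d psi : axis d -> test P psi -> is_wderiv P d psi (fun x => 'D_d psi x).
Proof.
move=> ad tp; split; first by apply/L2_sqi; apply: test_L; exact: test_derive.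
by move=> phi tphi; exact: (test_by_parts oP M0 PM).
Qed.

Definition wdable d f := exists g, is_wderiv P d f g.

Lemma wderivP d f : wdable d f -> is_wderiv P d f (wderiv P d f).
Proof. by move=> [g wg]; apply: (getPex (P := [set g : R * R -> R | is_wderiv P d f g])); exists g. Qed.

Lemma wderiv_sqi d f : wdable d f -> L (wderiv P d f).
Proof. by move=> /wderivP; exact: wd_sqi. Qed.

Lemma wderiv_ae d f g : is_wderiv P d f g -> {ae mu2, forall x, P x -> wderiv P d f x = g x}.
Proof. by move=> wf; apply: (wd_unique _ wf); apply: wderivP; exists g. Qed.

Lemma W12P f : W12 P f <-> [/\ L f, wdable (e1 R) f & wdable (e2 R) f].
Proof.
by split=> -[h0 h1 h2]; (split; [|exact: h1|exact: h2]); [exact: (L2_sqi f).1 h0|exact: (L2_sqi f).2 h0].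
Qed.

Lemma W12_sqi f : W12 P f -> L f. Proof. by case/W12P. Qed.

Lemma W12_wdable d f : axis d -> W12 P f -> wdable d f.
Proof. by case=> -> /W12P[]. Qed.

Lemma W12_wsqi d f : axis d -> W12 P f -> L (wderiv P d f).
Proof. by move=> ad wf; apply: wderiv_sqi; exact: W12_wdable. Qed.

Lemma W12_subsp : subsp (W12 P : set (R * R -> R^o)).
Proof.
have L0 : L 0 by exact: subsp0.
have wd0 d : is_wderiv P d 0 0.
  split; first exact/L2_sqi.
  move=> psi tp; rewrite -/(dotP 0 (fun x => 'D_d psi x)) -/(dotP 0 psi).
  have [[lin _] _ _] := pL.
  by rewrite (lin_on0 hL (lin _ (test_L tp))) (lin_on0 hL (lin _ (test_L (test_derive d tp)))) oppr0.
split; first by apply/W12P; split => //; exists 0.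
move=> c u v wu wv; apply/W12P; split.
- by apply: hL.2; exact: W12_sqi.
- exists (c *: (wderiv P (e1 R) u : R * R -> R^o) + wderiv P (e1 R) v).
  by apply: wd_lin; (try exact: W12_sqi); apply: wderivP; apply: W12_wdable => //; left.
- exists (c *: (wderiv P (e2 R) u : R * R -> R^o) + wderiv P (e2 R) v).
  by apply: wd_lin; (try exact: W12_sqi); apply: wderivP; apply: W12_wdable => //; right.
Qed.

(** [wderiv] chooses a representative, so it is linear only up to a null set; forms built from it
    become bilinear after integration. *)
Lemma wderiv_lin d (c : R) f g : axis d -> W12 P f -> W12 P g ->
  {ae mu2, forall x, P x -> wderiv P d (c *: f + g) x = c * wderiv P d f x + wderiv P d g x}.
Proof.
move=> ad wf wg.
apply: (@wderiv_ae _ _ (c *: (wderiv P d f : R * R -> R^o) + wderiv P d g)).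
by apply: wd_lin; (try exact: W12_sqi); apply: wderivP; exact: W12_wdable.
Qed.

Definition dotD d f g := dotP (wderiv P d f) (wderiv P d g).

Lemma dot_wderiv_lin d f f' g (c : R) : axis d -> W12 P f -> W12 P f' -> L g ->
  dotP (wderiv P d (c *: f + f')) g = c * dotP (wderiv P d f) g + dotP (wderiv P d f') g.
Proof.
move=> ad wf wf' Lg; have [[lin _] _ _] := pL.
have Lf := W12_wsqi ad wf; have Lf' := W12_wsqi ad wf'.
rewrite -(lin _ Lg)//; apply: (dot_ae mP) => //.
- by apply: W12_wsqi => //; apply: W12_subsp.2.
- exact: hL.2.
- exact: wderiv_lin.
- by apply: aeW.
Qed.

Lemma dotC f g : dotP f g = dotP g f.
Proof. by apply: eq_Rintegral => x _; rewrite mulrC. Qed.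

Lemma dotD_psd d : axis d -> psd_on (W12 P : set (R * R -> R^o)) (dotD d).
Proof.
move=> ad; split; [split=> w Ww c u v Wu Wv|by move=> u v _ _; exact: dotC|].
- by rewrite /dotD dot_wderiv_lin//; exact: W12_wsqi.
- by rewrite /dotD !(dotC (wderiv P d w)) dot_wderiv_lin//; exact: W12_wsqi.
- by move=> u Wu; apply: (psd_ge0 pL); exact: W12_wsqi.
Qed.

Lemma psdD (X : lmodType R) (S : set X) (p q : X -> X -> R) :
  psd_on S p -> psd_on S q -> psd_on S (fun u v => p u v + q u v).
Proof.
move=> [[p1 p2] p3 p4] [[q1 q2] q3 q4]; split; [split=> w Sw c u v Su Sv|move=> u v Su Sv|move=> u Su].
- by rewrite (p1 w)// (q1 w)//; ring.
- by rewrite (p2 w)// (q2 w)//; ring.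
- by rewrite p3// q3.
- by rewrite addr_ge0 ?p4 ?q4.
Qed.

Definition ip12 f g := dotP f g + dotD (e1 R) f g + dotD (e2 R) f g.

Lemma ip12_psd : psd_on (W12 P : set (R * R -> R^o)) ip12.
Proof.
apply: psdD; last by apply: dotD_psd; right.
apply: psdD; last by apply: dotD_psd; left.
apply: psd_on_sub pL => f; exact: W12_sqi.
Qed.

Lemma dot_ge0 f : 0 <= dotP f f.
Proof. by apply: Rintegral_ge0 => x _; rewrite -expr2 sqr_ge0. Qed.

Lemma ip12_ge0 f : 0 <= ip12 f f.
Proof. by rewrite /ip12 /dotD !addr_ge0 ?dot_ge0. Qed.

Lemma norm12E f : norm12 P f = nrm ip12 f.
Proof. by []. Qed.

Lemma ip12_ge f : [/\ N f <= nrm ip12 f, N (wderiv P (e1 R) f) <= nrm ip12 f &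
  N (wderiv P (e2 R) f) <= nrm ip12 f].
Proof.
have aux (x y z : R) : 0 <= x -> 0 <= y -> 0 <= z ->
    [/\ Num.sqrt x <= Num.sqrt (x + y + z), Num.sqrt y <= Num.sqrt (x + y + z) &
        Num.sqrt z <= Num.sqrt (x + y + z)].
  by move=> x0 y0 z0; split; apply: ler_wsqrtr; lra.
exact: (aux _ _ _ (dot_ge0 f) (dot_ge0 (wderiv P (e1 R) f)) (dot_ge0 (wderiv P (e2 R) f))).
Qed.

Lemma ip12_geD d f : axis d -> N (wderiv P d f) <= nrm ip12 f.
Proof. by have [_ h1 h2] := ip12_ge f; case=> ->. Qed.

Lemma ip12_le f : nrm ip12 f <= N f + N (wderiv P (e1 R) f) + N (wderiv P (e2 R) f).
Proof.
have aux (x y z : R) : 0 <= x -> 0 <= y -> 0 <= z ->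
    Num.sqrt (x + y + z) <= Num.sqrt x + Num.sqrt y + Num.sqrt z.
  move=> x0 y0 z0; have h := addr_ge0 (addr_ge0 (sqrtr_ge0 x) (sqrtr_ge0 y)) (sqrtr_ge0 z).
  rewrite -[leRHS]ger0_norm// -sqrtr_sqr; apply: ler_wsqrtr.
  have := sqr_sqrtr x0; have := sqr_sqrtr y0; have := sqr_sqrtr z0.
  have := sqrtr_ge0 x; have := sqrtr_ge0 y; have := sqrtr_ge0 z.
  move: (Num.sqrt x) (Num.sqrt y) (Num.sqrt z) => a b c; nra.
exact: (aux _ _ _ (dot_ge0 f) (dot_ge0 (wderiv P (e1 R) f)) (dot_ge0 (wderiv P (e2 R) f))).
Qed.

Lemma nrm_ae f g : L f -> L g -> {ae mu2, forall x, P x -> f x = g x} -> N f = N g.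
Proof. by move=> Lf Lg fg; rewrite /nrm (dot_ae mP Lf Lg Lf Lg). Qed.

Lemma wderivB_ae d f g : axis d -> W12 P f -> W12 P g ->
  {ae mu2, forall x, P x -> wderiv P d (f - g) x = wderiv P d f x - wderiv P d g x}.
Proof.
move=> ad wf wg; have := wderiv_lin (-1) ad wg wf; rewrite scaleN1r addrC.
by apply: ae_impl => x h /h ->; rewrite mulN1r addrC.
Qed.

Lemma nrm_wderivB d f g : axis d -> W12 P f -> W12 P g ->
  N (wderiv P d (f - g)) = N ((wderiv P d f : R * R -> R^o) - wderiv P d g).
Proof.
move=> ad wf wg; apply: nrm_ae; last exact: wderivB_ae.
  by apply: W12_wsqi => //; exact: (subspB W12_subsp).
by apply: (subspB hL); exact: W12_wsqi.
Qed.

Lemma dot_cvg (u : nat -> R * R -> R^o) l psi : (forall n, L (u n)) -> L l -> L psi ->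
  (fun n => N (u n - l)) @ \oo --> (0 : R) -> (fun n => dotP (u n) psi) @ \oo --> dotP l psi.
Proof.
move=> Lu Ll Lp; apply: (cvg_le0 (C := N psi)) => n.
have [[lin _] _ _] := pL; rewrite -(lin_onB (lin psi Lp))// mulrC.
by apply: (psd_CS hL pL) => //; exact: (subspB hL).
Qed.

(** Weak differentiation is a closed operator: both sides of its defining identity are continuous
    for the L^2 norm. *)
Lemma wd_limit d (u w : nat -> R * R -> R^o) f g : (forall n, L (u n)) -> L f -> L g ->
  (forall n, is_wderiv P d (u n) (w n)) ->
  (fun n => N (u n - f)) @ \oo --> (0 : R) -> (fun n => N (w n - g)) @ \oo --> (0 : R) ->
  is_wderiv P d f g.
Proof.
move=> Lu Lf Lg uw uf wg; split; first exact/L2_sqi.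
move=> psi tp; have Lp := test_L tp; have Ldp := test_L (test_derive d tp).
have h1 := dot_cvg Lu Lf Ldp uf.
have h2 : (fun n => - dotP (w n) psi) @ \oo --> - dotP g psi.
  by apply: cvgN; exact: (dot_cvg (fun n => wd_sqi (uw n)) Lg Lp wg).
apply: (cvg_unique (@Rhausdorff R) h1).
rewrite (_ : (fun n => _) = (fun n => - dotP (w n) psi))//.
by apply/funext => n; exact: (wd_dot (uw n) tp).
Qed.

Lemma L_complete : complete_on L dotP.
Proof. by move=> u Lu cu; have [_ [v [Lv _ h]]] := L2_riesz mP Lu cu; exists v. Qed.

Lemma W12_complete : complete_on (W12 P : set (R * R -> R^o)) ip12.
Proof.
move=> u Wu cu.
have [f Lf uf] : exists2 f, L f & (fun n => N (u n - f)) @ \oo --> (0 : R).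
  apply: L_complete => [n|e e0]; first exact: W12_sqi.
  have [K hK] := cu e e0; exists K => n m Kn Km; apply: le_trans (hK n m Kn Km).
  by have [] := ip12_ge (u n - u m).
have wlim d : axis d -> exists2 g, L g &
    (fun n => N ((wderiv P d (u n) : R * R -> R^o) - g)) @ \oo --> (0 : R).
  move=> ad; apply: L_complete => [n|e e0]; first exact: W12_wsqi.
  have [K hK] := cu e e0; exists K => n m Kn Km; apply: le_trans (hK n m Kn Km).
  by rewrite -nrm_wderivB//; exact: ip12_geD.
have [g1 Lg1 ug1] := wlim _ (or_introl erefl); have [g2 Lg2 ug2] := wlim _ (or_intror erefl).
have Lu n := W12_sqi (Wu n).
have w1 : is_wderiv P (e1 R) f g1.
  apply: (wd_limit Lu Lf Lg1 _ uf ug1) => n; apply: wderivP; apply: W12_wdable => //; by left.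
have w2 : is_wderiv P (e2 R) f g2.
  apply: (wd_limit Lu Lf Lg2 _ uf ug2) => n; apply: wderivP; apply: W12_wdable => //; by right.
have Wf : W12 P f by apply/W12P; split => //; [exists g1|exists g2].
exists f => //.
have E d g n : axis d -> is_wderiv P d f g ->
    N (wderiv P d (u n - f)) = N ((wderiv P d (u n) : R * R -> R^o) - g).
  move=> ad wg; rewrite nrm_wderivB//; apply: nrm_ae.
  - by apply: (subspB hL); exact: W12_wsqi.
  - by apply: (subspB hL); [exact: W12_wsqi|exact: wd_sqi wg].
  - by apply: ae_impl (wderiv_ae wg) => x h /h; rewrite !fctE => ->.
have lim0 : (fun n => N (u n - f) + N ((wderiv P (e1 R) (u n) : R * R -> R^o) - g1) +
    N ((wderiv P (e2 R) (u n) : R * R -> R^o) - g2)) @ \oo --> (0 + 0 + 0 : R).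
  by apply: cvgD => //; apply: cvgD.
rewrite !addr0 in lim0.
apply: (squeeze_cvgr _ (cvg_cst (0 : R)) lim0); apply: nearW => n.
rewrite nrm_ge0 /=; apply: le_trans (ip12_le _) _.
have eqle (x y : R) : x = y -> x <= y by move=> ->.
have E1 := E _ _ n (or_introl erefl) w1; have E2 := E _ _ n (or_intror erefl) w2.
exact: (lerD (lerD (lexx _) (eqle _ _ E1)) (eqle _ _ E2)).
Qed.

Lemma test_W12 psi : test P psi -> W12 P psi.
Proof.
move=> tp; apply/W12P; split; first exact: test_L.
  by eexists; apply: test_wd => //; left.
by eexists; apply: test_wd => //; right.
Qed.

Lemma test_subsp : subsp (test P : set (R * R -> R^o)).
Proof. by split; [exact: test0|move=> c u v; exact: test_lin]. Qed.

Lemma test_wderiv_ae d psi : axis d -> test P psi ->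
  {ae mu2, forall x, P x -> wderiv P d psi x = 'D_d psi x}.
Proof. by move=> ad tp; apply: wderiv_ae; exact: test_wd. Qed.

Lemma test_dot_wderiv d psi g : axis d -> test P psi -> L g ->
  dotP (wderiv P d psi) g = dotP (fun x => 'D_d psi x) g.
Proof.
move=> ad tp Lg; apply: (dot_ae mP) => //.
- by apply: W12_wsqi => //; exact: test_W12.
- by apply: test_L; exact: test_derive.
- exact: test_wderiv_ae.
- exact: aeW.
Qed.

Lemma W120_subsp : subsp (W12_0 P : set (R * R -> R^o)).
Proof. exact: (closure_in_subsp W12_subsp test_subsp test_W12 ip12_psd). Qed.

Lemma W120_W12 : W12_0 P `<=` W12 P. Proof. by move=> f []. Qed.

Lemma test_W120 : test P `<=` W12_0 P.
Proof. exact: (sub_closure_in W12_subsp test_W12 ip12_psd). Qed.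

Lemma W120_complete : complete_on (W12_0 P : set (R * R -> R^o)) ip12.
Proof. exact: (closure_in_complete W12_subsp test_W12 ip12_psd W12_complete). Qed.

End weak_derivatives.

(** * Inequalities for test functions *)

Section rectangles.
Variable R : realType.
Local Notation mR := (measurableTypeR R).
Local Notation R2 := (mR * mR)%type.
Local Notation mu := (@lebesgue_measure R).
Local Notation mu2 := (leb2 R).
Variables (a a' c c' : R).
Hypotheses (aa : a < a') (cc : c < c').
Local Notation I := (`[a, a'[%classic : set mR).
Local Notation J := (`[c, c'[%classic : set mR).

(** Half-open, so that adjacent cells tile a square without overlap. *)
Definition rect : set R2 := I `*` J.
Local Notation Q := rect.

Let mI : measurable I. Proof. exact: measurable_itv. Qed.
Let mJ : measurable J. Proof. exact: measurable_itv. Qed.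

Lemma rect_measurable : measurable Q. Proof. exact: measurableX. Qed.
Let mQ := rect_measurable.

Lemma mu_itvco (x y : R) : x < y -> mu (`[x, y[%classic : set mR) = (y - x)%:E.
Proof. by move=> xy; rewrite lebesgue_measure_itv /= lte_fin xy EFinB. Qed.

Lemma mu_rect : mu2 Q = ((a' - a) * (c' - c))%:E.
Proof.
have -> : mu2 Q = (mu I * mu J)%E by exact: product_measure1E.
by rewrite !mu_itvco.
Qed.

Lemma itv_integrable (x y : R) (f : R -> R) : continuous f ->
  mu.-integrable (`[x, y[%classic : set mR) (EFin \o f).
Proof.
move=> cf; apply: (@integrableS _ _ _ mu `[x, y]%classic) => //.
  by move=> z /=; rewrite !in_itv /= => /andP[-> /ltW ->].
apply: continuous_compact_integrable; first exact: segment_compact.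
exact: continuous_subspaceT.
Qed.

Lemma rect_integrable (f : R * R -> R) : continuous f -> mu2.-integrable Q (EFin \o f).
Proof.
move=> cf; have /compact_bounded[C [_ hC]] : compact (f @` cbox a a' c c').
  apply: continuous_compact; first exact: continuous_subspaceT.
  by apply: compact_setX; exact: segment_compact.
have C1 : C < `|C| + 1 by rewrite (le_lt_trans (ler_norm _))// ltrDl.
apply: (@intg_bounded _ _ _ _ _ mQ _ (`|C| + 1)).
- by rewrite mu_rect ltry.
- exact: continuous_measurable2.
move=> z [z1 z2]; apply: (hC _ C1); exists z => //.
by split; [move: z1|move: z2]; rewrite /= !in_itv /= => /andP[-> /ltW ->].
Qed.

Definition slice1 (F : R * R -> R) (y : R) : R := \int[mu]_(x in I) F (x, y).
Definition slice2 (F : R * R -> R) (x : R) : R := \int[mu]_(y in J) F (x, y).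

Let cut (F : R * R -> R) : R2 -> \bar R := ((fun z => (F z)%:E) \_ Q).

Let cut_ge0 F : (forall z, 0 <= F z) -> forall z, (0 <= cut F z)%E.
Proof. by move=> F0 z; rewrite /cut patchE; case: ifP => // _; rewrite lee_fin. Qed.

Let cut_meas F : continuous F -> measurable_fun setT (cut F).
Proof.
move=> cF; apply/(measurable_restrictT _ mQ); apply/measurable_EFinP.
exact: continuous_measurable2.
Qed.

Let cut1 F x y : cut F (x, y) = if (x \in I) && (y \in J) then (F (x, y))%:E else 0%E.
Proof.
rewrite /cut patchE; congr (if _ then _ else _).
by apply/idP/andP => [/set_mem[/= ? ?]|[/set_mem ? /set_mem ?]]; [split; apply/mem_set|apply/mem_set].
Qed.

Let slice1E F y : continuous F ->
  (\int[mu]_x cut F (x, y) = if y \in J then (slice1 F y)%:E else 0)%E.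
Proof.
move=> cF; have cF1 := continuous_slice1 (y := y) cF.
case: ifPn => yJ; last first.
  by apply: integral0_eq => x _; rewrite cut1 (negbTE yJ) andbF.
rewrite /slice1 (EFin_Rint mI); last exact: itv_integrable.
rewrite [RHS]integral_mkcond; apply: eq_integral => x _.
by rewrite cut1 yJ andbT patchE.
Qed.

Let slice2E F x : continuous F ->
  (\int[mu]_y cut F (x, y) = if x \in I then (slice2 F x)%:E else 0)%E.
Proof.
move=> cF; have cF1 := continuous_slice2 (x := x) cF.
case: ifPn => xI; last first.
  by apply: integral0_eq => y _; rewrite cut1 (negbTE xI).
rewrite /slice2 (EFin_Rint mJ); last exact: itv_integrable.
rewrite [RHS]integral_mkcond; apply: eq_integral => y _.
by rewrite cut1 xI patchE.
Qed.

Variables F G : R * R -> R.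
Hypotheses (cF : continuous F) (cG : continuous G).
Hypotheses (F0 : forall z, 0 <= F z) (G0 : forall z, 0 <= G z).

Let iF : (\int[mu2]_(z in Q) (F z)%:E = \int[mu]_y \int[mu]_x cut F (x, y))%E.
Proof.
rewrite integral_mkcond; apply: etrans (fubini_tonelli1 _ (cut_meas cF) (cut_ge0 F0)) _.
exact: (fubini_tonelli _ (cut_meas cF) (cut_ge0 F0)).
Qed.

Let iG : (\int[mu2]_(z in Q) (G z)%:E = \int[mu]_x \int[mu]_y cut G (x, y))%E.
Proof.
by rewrite integral_mkcond; apply: etrans (fubini_tonelli1 _ (cut_meas cG) (cut_ge0 G0)) _.
Qed.

Let A (y : R) := (\int[mu]_x cut F (x, y))%E.
Let B (x : R) := (\int[mu]_y cut G (x, y))%E.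

Let mA : measurable_fun setT (A : mR -> \bar R).
Proof. exact: (measurable_fun_fubini_tonelli_G _ (cut_meas cF) (cut_ge0 F0)). Qed.

Let mB : measurable_fun setT (B : mR -> \bar R).
Proof. exact: (measurable_fun_fubini_tonelli_F _ (cut_meas cG) (cut_ge0 G0)). Qed.

Let A0 y : (0 <= A y)%E. Proof. by apply: integral_ge0 => x _; exact: cut_ge0. Qed.
Let B0 x : (0 <= B x)%E. Proof. by apply: integral_ge0 => y _; exact: cut_ge0. Qed.

Let slices z : Q z -> (slice1 F z.2 * slice2 G z.1)%:E = (A z.2 * B z.1)%E.
Proof.
by move=> [z1 z2]; rewrite /A /B slice1E// slice2E// !mem_set// EFinM.
Qed.

Let off z : ~ Q z -> (A z.2 * B z.1 = 0)%E.
Proof.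
move=> nz; rewrite /A /B slice1E// slice2E//.
case: ifPn => [/set_mem z2|_]; last by rewrite mul0e.
case: ifPn => [/set_mem z1|_]; last by rewrite mule0.
by exfalso; apply: nz.
Qed.

Let mAB : measurable_fun [set: R2] (fun z : R2 => A z.2 * B z.1)%E.
Proof.
by apply: emeasurable_funM; [exact: measurableT_comp measurable_snd|exact: measurableT_comp measurable_fst].
Qed.

Let AB0 (z : R2) : (0 <= A z.2 * B z.1)%E. Proof. exact: mule_ge0. Qed.

Let iAB : (\int[mu2]_(z in Q) (slice1 F z.2 * slice2 G z.1)%:E =
  (\int[mu2]_(z in Q) F z * \int[mu2]_(z in Q) G z)%:E)%E.
Proof.
rewrite EFinM !(EFin_Rint mQ); try exact: rect_integrable.
transitivity (\int[mu2]_z (A z.2 * B z.1))%E.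
  rewrite integral_mkcond; apply: eq_integral => z _; rewrite patchE.
  by case: ifPn => [/set_mem/slices//|/negP nz]; rewrite off// => Qz; apply: nz; exact: mem_set.
apply: etrans (fubini_tonelli1 _ mAB AB0) _.
rewrite [X in (X * _)%E]iF [X in (_ * X)%E]iG -/A -/B /fubini_F /=.
transitivity (\int[mu]_x ((\int[mu]_y A y) * B x))%E.
  by apply: eq_integral => x _; rewrite ge0_integralZr.
rewrite ge0_integralZl//; exact: integral_ge0.
Qed.

Let mS : measurable_fun Q (fun z : R2 => slice1 F z.2 * slice2 G z.1).
Proof.
apply/measurable_EFinP; apply: (eq_measurable_fun (fun z : R2 => A z.2 * B z.1)%E).
  by move=> z /set_mem Qz; rewrite /= slices.
exact: measurable_funS mAB.
Qed.

Lemma slice1_ge0 y : 0 <= slice1 F y. Proof. exact: Rintegral_ge0. Qed.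
Lemma slice2_ge0 x : 0 <= slice2 G x. Proof. exact: Rintegral_ge0. Qed.

Lemma rect_prod_integrable :
  mu2.-integrable Q (EFin \o (fun z : R2 => slice1 F z.2 * slice2 G z.1)).
Proof.
apply: intg_ge0P => //; last by rewrite iAB ltry.
by move=> z _; rewrite mulr_ge0 ?slice1_ge0 ?slice2_ge0.
Qed.

(** One factor depends on the second coordinate only and the other on the first, so Tonelli's
    theorem separates them. Ladyzhenskaya's inequality rests on this identity. *)
Lemma rect_prod : \int[mu2]_(z in Q) (slice1 F z.2 * slice2 G z.1) =
  \int[mu2]_(z in Q) F z * \int[mu2]_(z in Q) G z.
Proof. by rewrite /Rintegral iAB. Qed.

End rectangles.

Lemma sqr_add_le (R : realType) (u v x y h k : R) : u ^+ 2 <= h * x -> v ^+ 2 <= k * y ->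
  (u + v) ^+ 2 <= 2 * h * x + 2 * k * y.
Proof.
rewrite -!mulrA; move: (h * x) (k * y) => {}h {}k h1 h2.
by have := sqr_ge0 (u - v); rewrite !sqrrD mulrN sqrrN !mulr2n; lra.
Qed.

Section rint_toolkit.
Context d (T : measurableType d) (R : realType) (mu : {measure set T -> \bar R}).
Variables (D : set T) (mD : measurable D).

(** Integrability and value together, for the affine integrands met when an oscillation bound is
    integrated twice. *)
Lemma Rint_affine (m al be ga : R) (f g : T -> R) : mu D = m%:E ->
  mu.-integrable D (EFin \o f) -> mu.-integrable D (EFin \o g) ->
  mu.-integrable D (EFin \o (fun x => al * f x + be * g x + ga)) /\
  \int[mu]_(x in D) (al * f x + be * g x + ga) =
  al * \int[mu]_(x in D) f x + be * \int[mu]_(x in D) g x + ga * m.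
Proof.
move=> Dm hf hg; have hc : mu.-integrable D (EFin \o (fun=> ga)).
  apply: (@intg_bounded _ _ _ _ _ mD _ `|ga|) => //; by rewrite Dm ltry.
have h1 := intgZ mD al hf; have h2 := intgZ mD be hg; have h3 := intgD mD h1 h2.
split; first exact: intgD.
rewrite (@RintegralD _ _ _ mu D (fun x => al * f x + be * g x) (fun=> ga))//.
rewrite (@RintegralD _ _ _ mu D (fun x => al * f x) (fun x => be * g x))//.
by rewrite !RintegralZl// Rintegral_cst// Dm.
Qed.

Lemma Rint_subset (D' : set T) (f : T -> R) : measurable D' -> D `<=` D' ->
  (forall x, 0 <= f x) -> mu.-integrable D' (EFin \o f) ->
  \int[mu]_(x in D) f x <= \int[mu]_(x in D') f x.
Proof.
move=> mD' sub f0 hf; rewrite -lee_fin !EFin_Rint//; last exact: integrableS hf.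
apply: ge0_subset_integral => //; first exact: (measurable_int mu hf).
by move=> x _; rewrite lee_fin.
Qed.

End rint_toolkit.

(** * Oscillation on rectangles *)

Section oscillation.
Variable R : realType.
Local Notation mR := (measurableTypeR R).
Local Notation R2 := (mR * mR)%type.
Local Notation mu := (@lebesgue_measure R).
Local Notation mu2 := (leb2 R).

Lemma itv_CS (a a' : R) (f : R -> R) : a < a' -> continuous f ->
  (\int[mu]_(x in `[a, a'[) `|f x|) ^+ 2 <= (a' - a) * \int[mu]_(x in `[a, a'[) (f x ^+ 2).
Proof.
move=> aa cf; pose I : set mR := `[a, a'[%classic.
have mI : measurable I by exact: measurable_itv.
have sq (h : R -> R) : continuous h -> sqi mu I h.
  move=> ch; split; first exact: measurable_funS (continuous_measurable_fun ch).
  by apply: itv_integrable => x; apply: (cvgM (ch x) (ch x)).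
have s1 : sqi mu I (fun=> 1) by apply: sq => x; exact: cvg_cst.
have sf := sqi_norm mI (sq _ cf).
have hL := sqi_subsp mu mI; have pL := dot_psd mu mI.
have := psd_CS hL pL sf s1.
have -> : dot mu I (fun x => `|f x|) (fun=> 1) = \int[mu]_(x in I) `|f x|.
  by apply: eq_Rintegral => x _; rewrite mulr1.
rewrite ger0_norm; last by apply: Rintegral_ge0 => x _; exact: normr_ge0.
move=> h; have h0 : 0 <= \int[mu]_(x in I) `|f x|.
  by apply: Rintegral_ge0 => x _; exact: normr_ge0.
have : (\int[mu]_(x in I) `|f x|) ^+ 2 <= (nrm (dot mu I) (fun x => `|f x|) * nrm (dot mu I) (fun=> 1)) ^+ 2.
  by rewrite lerXn2r// nnegrE// mulr_ge0// nrm_ge0.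
rewrite exprMn !(nrm_sqr pL)// => h2; apply: le_trans h2 _.
rewrite le_eqVlt; apply/orP; left; apply/eqP; rewrite mulrC; congr (_ * _).
  transitivity (\int[mu]_(x in I) (1 : R)); first by apply: eq_Rintegral => x _; rewrite mulr1.
  by rewrite Rintegral_cst// mul1r; exact: (congr1 fine (mu_itvco aa)).
by apply: eq_Rintegral => x _; rewrite -expr2 real_normK ?num_real.
Qed.

Variable w : R * R -> R.
Hypothesis sw : smooth w.

Let cD d : continuous (fun z => 'D_d w z).
Proof. by apply: smooth_continuous; exact: smooth_derive. Qed.

(** The right-hand side depends on the horizontal line only, not on the two points of it. *)
Lemma osc1_abs (a a' y x s : R) : x \in `[a, a'[ -> s \in `[a, a'[ ->
  `|w (x, y) - w (s, y)| <= slice1 a a' (fun z => `|'D_(e1 R) w z|) y.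
Proof.
wlog sx : x s / s <= x.
  move=> hw hx hs; have [sx|/ltW xs] := leP s x; first exact: hw.
  by rewrite distrC; exact: hw.
rewrite !in_itv /= => /andP[ax xa] /andP[as_ sa].
rewrite -(FTC_slice1 sw y sx).
have c1 : continuous (fun x => 'D_(e1 R) w (x, y)) by exact: (continuous_slice1 (y := y) (cD (d := e1 R))).
have i1 : mu.-integrable (`[s, x]%classic : set mR) (EFin \o (fun x => 'D_(e1 R) w (x, y))).
  apply: continuous_compact_integrable; first exact: segment_compact.
  exact: continuous_subspaceT.
apply: le_trans (le_normr_Rintegral _ i1) _ => //.
apply: Rint_subset => //.
- by move=> z /=; rewrite !in_itv /= => /andP[sz zx]; rewrite (le_trans as_ sz) (le_lt_trans zx).
- apply: itv_integrable => z; apply: cvg_norm; exact: c1.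
Qed.

Lemma osc2_abs (c c' x y t : R) : y \in `[c, c'[ -> t \in `[c, c'[ ->
  `|w (x, y) - w (x, t)| <= slice2 c c' (fun z => `|'D_(e2 R) w z|) x.
Proof.
wlog sx : y t / t <= y.
  move=> hw hx hs; have [sx|/ltW xs] := leP t y; first exact: hw.
  by rewrite distrC; exact: hw.
rewrite !in_itv /= => /andP[ax xa] /andP[as_ sa].
rewrite -(FTC_slice2 sw x sx).
have c1 : continuous (fun y => 'D_(e2 R) w (x, y)) by exact: (continuous_slice2 (x := x) (cD (d := e2 R))).
have i1 : mu.-integrable (`[t, y]%classic : set mR) (EFin \o (fun y => 'D_(e2 R) w (x, y))).
  apply: continuous_compact_integrable; first exact: segment_compact.
  exact: continuous_subspaceT.
apply: le_trans (le_normr_Rintegral _ i1) _ => //.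
apply: Rint_subset => //.
- by move=> z /=; rewrite !in_itv /= => /andP[sz zx]; rewrite (le_trans as_ sz) (le_lt_trans zx).
- apply: itv_integrable => z; apply: cvg_norm; exact: c1.
Qed.

Lemma osc1 (a a' y x s : R) : a < a' -> x \in `[a, a'[ -> s \in `[a, a'[ ->
  (w (x, y) - w (s, y)) ^+ 2 <= (a' - a) * slice1 a a' (fun z => 'D_(e1 R) w z ^+ 2) y.
Proof.
move=> aa hx hs.
apply: le_trans (itv_CS aa (continuous_slice1 (y := y) (cD (d := e1 R)))).
rewrite -[leLHS]real_normK ?num_real// lerXn2r ?nnegrE//; last exact: osc1_abs.
by apply: Rintegral_ge0 => z _; exact: normr_ge0.
Qed.

Lemma osc2 (c c' x y t : R) : c < c' -> y \in `[c, c'[ -> t \in `[c, c'[ ->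
  (w (x, y) - w (x, t)) ^+ 2 <= (c' - c) * slice2 c c' (fun z => 'D_(e2 R) w z ^+ 2) x.
Proof.
move=> aa hx hs.
apply: le_trans (itv_CS aa (continuous_slice2 (x := x) (cD (d := e2 R)))).
rewrite -[leLHS]real_normK ?num_real// lerXn2r ?nnegrE//; last exact: osc2_abs.
by apply: Rintegral_ge0 => z _; exact: normr_ge0.
Qed.

Variables (a a' c c' : R).
Hypotheses (aa : a < a') (cc : c < c').
Local Notation Q := (rect a a' c c').
Let mQ : measurable Q. Proof. exact: rect_measurable. Qed.

(** The product formula with the second function equal to 1, divided by the height of the
    rectangle. *)
Lemma rect_slice1 (F : R * R -> R) : continuous F -> (forall z, 0 <= F z) ->
  mu2.-integrable Q (EFin \o (fun z : R2 => slice1 a a' F z.2)) /\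
  \int[mu2]_(z in Q) slice1 a a' F z.2 = (a' - a) * \int[mu2]_(z in Q) F z.
Proof.
move=> cF F0; have c1 : continuous (fun _ : R * R => 1 : R) by move=> z; exact: cvg_cst.
have h : c' - c != 0 by rewrite subr_eq0 gt_eqF.
have e (z : R2) : slice1 a a' F z.2 = (c' - c)^-1 * (slice1 a a' F z.2 * slice2 c c' (fun=> 1) z.1).
  have -> : slice2 c c' (fun=> 1) z.1 = c' - c by rewrite /slice2 Rintegral_cst// mul1r; exact: (congr1 fine (mu_itvco cc)).
  by rewrite mulrCA mulVf// mulr1.
have h1 := rect_prod_integrable aa cc cF c1 F0 (fun=> ler01).
split; first by apply: eq_integrable (intgZ mQ (c' - c)^-1 h1) => // z _; rewrite /= -e.
transitivity (\int[mu2]_(z in Q) ((c' - c)^-1 * (slice1 a a' F z.2 * slice2 c c' (fun=> 1) z.1))).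
  by apply: eq_Rintegral => z _; exact: e.
rewrite RintegralZl// (rect_prod aa cc cF c1 F0 (fun=> ler01)) Rintegral_cst// mul1r.
rewrite [fine _](congr1 fine (mu_rect aa cc)) /=; by field.
Qed.

Lemma rect_slice2 (F : R * R -> R) : continuous F -> (forall z, 0 <= F z) ->
  mu2.-integrable Q (EFin \o (fun z : R2 => slice2 c c' F z.1)) /\
  \int[mu2]_(z in Q) slice2 c c' F z.1 = (c' - c) * \int[mu2]_(z in Q) F z.
Proof.
move=> cF F0; have c1 : continuous (fun _ : R * R => 1 : R) by move=> z; exact: cvg_cst.
have h : a' - a != 0 by rewrite subr_eq0 gt_eqF.
have e (z : R2) : slice2 c c' F z.1 = (a' - a)^-1 * (slice1 a a' (fun=> 1) z.2 * slice2 c c' F z.1).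
  have -> : slice1 a a' (fun=> 1) z.2 = a' - a by rewrite /slice1 Rintegral_cst// mul1r; exact: (congr1 fine (mu_itvco aa)).
  by rewrite mulKf.
have h1 := rect_prod_integrable aa cc c1 cF (fun=> ler01) F0.
split; first by apply: eq_integrable (intgZ mQ (a' - a)^-1 h1) => // z _; rewrite /= -e.
transitivity (\int[mu2]_(z in Q) ((a' - a)^-1 * (slice1 a a' (fun=> 1) z.2 * slice2 c c' F z.1))).
  by apply: eq_Rintegral => z _; exact: e.
rewrite RintegralZl// (rect_prod aa cc c1 cF (fun=> ler01) F0) Rintegral_cst// mul1r.
rewrite [fine _](congr1 fine (mu_rect aa cc)) /=; by field.
Qed.

(* Integrate the oscillation bound for [(w z - w p) ^+ 2] first in [z], then in
   [p]. *)
Lemma cell_ineq : \int[mu2]_(z in Q) (w z ^+ 2) <=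
  ((a' - a) * (c' - c))^-1 * (\int[mu2]_(z in Q) w z) ^+ 2 +
  (a' - a) ^+ 2 * \int[mu2]_(z in Q) ('D_(e1 R) w z ^+ 2) +
  (c' - c) ^+ 2 * \int[mu2]_(z in Q) ('D_(e2 R) w z ^+ 2).
Proof.
have cw := smooth_continuous sw.
have csq (f : R * R -> R) : continuous f -> continuous (fun z => f z ^+ 2).
  by move=> cf z; apply: (cvgM (cf z) (cf z)).
have [iA eA] := rect_slice1 (csq _ (cD (d := e1 R))) (fun z => sqr_ge0 _).
have [iB eB] := rect_slice2 (csq _ (cD (d := e2 R))) (fun z => sqr_ge0 _).
have iw := rect_integrable aa cc cw; have iw2 := rect_integrable aa cc (csq _ cw).
have mm := mu_rect aa cc.
have pt z p : Q z -> Q p -> (w z - w p) ^+ 2 <=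
    2 * (a' - a) * slice1 a a' (fun z => 'D_(e1 R) w z ^+ 2) z.2 +
    2 * (c' - c) * slice2 c c' (fun z => 'D_(e2 R) w z ^+ 2) p.1.
  case: z p => x y [s t] [/= x1 y1] [/= s1 t1].
  have h1 := osc1 y aa x1 s1; have h2 := osc2 s cc y1 t1.
  have -> : w (x, y) - w (s, t) = (w (x, y) - w (s, y)) + (w (s, y) - w (s, t)).
    by rewrite addrA subrK.
  exact: sqr_add_le h1 h2.
set S2 := \int[mu2]_(z in Q) (w z ^+ 2).
set S1 := \int[mu2]_(z in Q) w z.
set G1 := \int[mu2]_(z in Q) ('D_(e1 R) w z ^+ 2) in eA *.
set G2 := \int[mu2]_(z in Q) ('D_(e2 R) w z ^+ 2) in eB *.
set A := slice1 a a' _ in iA eA pt; set B := slice2 c c' _ in iB eB pt.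
set m := (a' - a) * (c' - c) in mm *.
have m0 : 0 < m by rewrite mulr_gt0// subr_gt0.
have S2E : \int[mu2]_(z in Q) (w z ^+ 2) = S2 by [].
have S1E : \int[mu2]_(z in Q) w z = S1 by [].
clearbody A B G1 G2 S1 S2 m.
have st1 p : Q p -> m * w p ^+ 2 + (- 2 * S1) * w p + S2 <=
    2 * (c' - c) * m * B p.1 + 0 * w p + 2 * (a' - a) * ((a' - a) * G1).
  move=> Qp.
  have [j1 e1] := Rint_affine mQ 1 (- 2 * w p) (w p ^+ 2) mm iw2 iw.
  have [j2 e2] := Rint_affine mQ (2 * (a' - a)) 0 (2 * (c' - c) * B p.1) mm iA iw.
  have := le_Rintegral mQ j1 j2 _; rewrite e1 e2 eA S2E S1E => h.
  suff : forall z, Q z -> 1 * w z ^+ 2 + (- 2 * w p) * w z + w p ^+ 2 <=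
      2 * (a' - a) * A z.2 + 0 * w z + 2 * (c' - c) * B p.1.
    by move=> /h; clear; move: (B p.1) (w p) => b0 w0; rewrite !mul0r; lra.
  move=> z Qz; have := pt z p Qz Qp.
  have -> : (w z - w p) ^+ 2 = 1 * w z ^+ 2 + (- 2 * w p) * w z + w p ^+ 2 by ring.
  by rewrite mul0r addr0.
have [j1 e1] := Rint_affine mQ m (- 2 * S1) S2 mm iw2 iw.
have [j2 e2] := Rint_affine mQ (2 * (c' - c) * m) 0 (2 * (a' - a) * ((a' - a) * G1)) mm iB iw.
have := le_Rintegral mQ j1 j2 st1; rewrite e1 e2 eB S2E S1E => h.
(* After both integrations, [2 * m * S2 - 2 * S1 ^+ 2] is at most [2 * m] times the gradient
   terms. *)
rewrite -(ler_pM2l m0) !mulrDr (mulrA m m^-1) mulfV ?gt_eqF// mul1r.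
move: h; clear; rewrite mul0r addr0; move: (a' - a) (c' - c) => h1 h2.
rewrite !expr2 => h; lra.
Qed.

End oscillation.

Section strips.
Context d (T : measurableType d) (R : realType) (mu : {measure set T -> \bar R}).
Variables (D : set T) (mD : measurable D) (f : T -> R).
Hypothesis hf : mu.-integrable D (EFin \o f).

(** [g] is a coordinate: used with the first and then with the second projection, it cuts a square
    into cells. *)
Lemma Rint_strips (g : T -> measurableTypeR R) (a : nat -> R) n : measurable_fun setT g ->
  (forall i, a i <= a i.+1) ->
  \int[mu]_(x in D `&` g @^-1` `[a 0%N, a n[) f x =
  \sum_(i < n) \int[mu]_(x in D `&` g @^-1` `[a i, a i.+1[) f x.
Proof.
move=> mg ai.
have mS (x y : R) : measurable (D `&` g @^-1` `[x, y[).
  by apply: measurableI => //; rewrite -[_ @^-1` _]setTI; apply: mg => //; exact: measurable_itv.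
have a0 m : a 0%N <= a m by elim: m => // m IH; exact: le_trans (ai m).
elim: n => [|n IH].
  rewrite big_ord0 (_ : _ `&` _ = set0) ?Rintegral_set0//.
  by apply/seteqP; split => // x [_ /=]; rewrite in_itv /= => /andP[h1 h2]; move: (le_lt_trans h1 h2); rewrite ltxx.
rewrite big_ord_recr /= -IH -Rintegral_setU//.
- congr (Rintegral _ _ _); rewrite -setIUr -preimage_setU; congr (_ `&` _ @^-1` _).
  by rewrite -itv_bndbnd_setU// bnd_simp; [exact: a0|exact: ai].
- by apply: integrableS hf => //; [exact: measurableU|move=> x [] []].
apply/disj_setPS => x [[_ /=]]; rewrite in_itv /= => /andP[_ h1] [_ /=].
by rewrite in_itv /= leNgt h1.
Qed.

End strips.

Lemma continuous_mul2 (R : realType) (f g : R * R -> R) : continuous f -> continuous g ->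
  continuous (fun z => f z * g z).
Proof. by move=> cf cg z; apply: (cvgM (cf z) (cg z)). Qed.

(** * Inequalities of Poincare and Ladyzhenskaya, and the grid estimate *)

Section test_inequalities.
Variables (R : realType) (P : set (R * R)) (M : R).
Hypotheses (oP : open P) (M0 : 0 < M) (PM : in_square P M).
Local Notation mR := (measurableTypeR R).
Local Notation R2 := (mR * mR)%type.
Local Notation mu2 := (leb2 R).
Local Notation PR := (P : set R2).
Local Notation S := (rect (- M) M (- M) M).
Local Notation dotP := (dot mu2 PR).
Local Notation N := (nrm dotP).

Let mP : measurable PR. Proof. exact: open_measurable2. Qed.
Let MM : - M < M. Proof. by have := M0; lra. Qed.
Let mS : measurable S. Proof. exact: rect_measurable. Qed.

Lemma dom_square : PR `<=` S.
Proof.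
move=> z /PM[]; rewrite !ltr_norml => /andP[/ltW a1 a2] /andP[/ltW b1 b2].
by split; rewrite /= in_itv /= ?a1 ?a2 ?b1 ?b2.
Qed.

Lemma Rint_square (F : R2 -> R) : (forall z, ~ P z -> F z = 0) ->
  \int[mu2]_(z in PR) F z = \int[mu2]_(z in S) F z.
Proof.
move=> F0; rewrite /Rintegral; congr fine.
rewrite (@integral_dom R P)//; last by move=> z /F0 ->.
rewrite -(@integral_dom R S)// => z nS; rewrite F0// => /dom_square; exact: nS.
Qed.

Variable w : R * R -> R.
Hypothesis tw : test P w.
Let sw := test_smooth tw.
Let cw : continuous w := smooth_continuous sw.
Let cD d : continuous (fun z => 'D_d w z).
Proof. by apply: smooth_continuous; exact: smooth_derive. Qed.
Let D1 : R * R -> R := fun z => 'D_(e1 R) w z.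
Let D2 : R * R -> R := fun z => 'D_(e2 R) w z.

Let w_off z : ~ P z -> w z = 0. Proof. exact: (test_off tw). Qed.
Let left_off y : w (- M, y) = 0.
Proof. by apply: w_off => /PM[/=]; rewrite normrN gtr0_norm// ltxx. Qed.
Let bot_off x : w (x, - M) = 0.
Proof. by apply: w_off => /PM[_ /=]; rewrite normrN gtr0_norm// ltxx. Qed.

Let MI : - M \in `[- M, M[. Proof. by rewrite in_itv /= lexx MM. Qed.

Lemma dot_square (f g : R2 -> R) : test P f ->
  dotP f g = \int[mu2]_(z in S) (f z * g z).
Proof. by move=> tf; apply: Rint_square => z /(test_off tf) ->; rewrite mul0r. Qed.

(** [w] vanishes on the left side of the square of side [2 * M]: one such factor comes from
    Cauchy-Schwarz along horizontal lines, the other from integrating over the line. *)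
Lemma poincare : dotP w w <= 4 * M ^+ 2 * dotP D1 D1.
Proof.
have td1 : test P D1 by exact: test_derive.
have c2 : continuous (fun z => D1 z ^+ 2) by apply: continuous_mul2; exact: cD.
have [iA eA] := rect_slice1 MM MM c2 (fun z => sqr_ge0 _).
rewrite (dot_square w tw) (dot_square D1 td1).
have cw2 : continuous (fun z => w z * w z) by exact: continuous_mul2.
have iw := rect_integrable MM MM cw2.
have : \int[mu2]_(z in S) (w z * w z) <= \int[mu2]_(z in S) ((M - - M) * slice1 (- M) M (fun z => D1 z ^+ 2) z.2).
  apply: le_Rintegral => //; first exact: intgZ.
  move=> [x y] [/= x1 y1]; have := osc1 sw y MM x1 MI.
  by rewrite left_off subr0 expr2.
rewrite RintegralZl// eA => h; apply: le_trans h _.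
rewrite le_eqVlt; apply/orP; left; apply/eqP.
have -> : \int[mu2]_(z in S) (D1 z ^+ 2) = \int[mu2]_(z in S) (D1 z * D1 z) by [].
move: (Rintegral _ _ _) => I; ring.
Qed.

(** The square of [w] is bounded by the integral of [|D_1 (w^2)|] along the horizontal line and by
    that of [|D_2 (w^2)|] along the vertical one. The product of the two bounds integrates by
    [rect_prod], and each factor is at most [2 * N w * N (D_i w)]. *)
Lemma ladyzhenskaya : dotP (fun z => w z ^+ 2) (fun z => w z ^+ 2) <=
  4 * dotP w w * (N D1 * N D2).
Proof.
have td1 : test P D1 by exact: test_derive.
have td2 : test P D2 by exact: test_derive.
have tw2 : test P (fun z => w z * w z) by exact: test_mul.
have sw2 := test_smooth tw2.
have dE d z : 'D_d (fun z => w z * w z) z = 2 * (w z * 'D_d w z).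
  have [_ ->] := derive_mul (smooth_derivable z d sw) (smooth_derivable z d sw).
  by rewrite mulrC -mulr2n mulr_natl.
pose F d (z : R * R) := `|'D_d (fun z => w z * w z) z|.
have cF d : continuous (F d).
  have c := smooth_continuous (smooth_derive d sw2).
  by move=> z; apply: cvg_norm; exact: c.
have F0 d z : 0 <= F d z by exact: normr_ge0.
have iAB := rect_prod_integrable MM MM (cF (e1 R)) (cF (e2 R)) (F0 (e1 R)) (F0 (e2 R)).
have eAB := rect_prod MM MM (cF (e1 R)) (cF (e2 R)) (F0 (e1 R)) (F0 (e2 R)).
have hL := sqi_subsp mu2 mP; have pL := dot_psd mu2 mP.
have FN d : \int[mu2]_(z in S) F d z <= 2 * (N w * N (fun z => 'D_d w z)).
  have td : test P (fun z => 'D_d w z) by exact: test_derive.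
  have sn f : test P f -> sqi mu2 PR (fun z => `|f z|).
    by move=> tf; apply: sqi_norm => //; exact: (test_sqi oP PM).
  rewrite -Rint_square; last first.
    by move=> z /w_off w0; rewrite /F dE w0 mul0r mulr0 normr0.
  have -> : \int[mu2]_(z in PR) F d z = 2 * dotP (fun z => `|w z|) (fun z => `|'D_d w z|).
    rewrite /dot -RintegralZl//; last exact: (sqi_mul mP (sn _ tw) (sn _ td)).
    by apply: eq_Rintegral => z _; rewrite /F dE !normrM (ger0_norm (ler0n _ 2)).
  rewrite ler_pM2l//; apply: le_trans (ler_norm _) _.
  apply: le_trans (psd_CS hL pL (sn _ tw) (sn _ td)) _.
  have nn f : N (fun z => `|f z|) = N f.
    by rewrite /nrm; congr Num.sqrt; apply: eq_Rintegral => z _; rewrite -normrM ger0_norm// -expr2 sqr_ge0.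
  by rewrite (nn w) (nn (fun z => 'D_d w z)).
rewrite (dot_square (f := fun z => w z ^+ 2) _ tw2).
have step : \int[mu2]_(z in S) (w z ^+ 2 * w z ^+ 2) <=
   \int[mu2]_(z in S) (slice1 (- M) M (F (e1 R)) z.2 * slice2 (- M) M (F (e2 R)) z.1).
  apply: le_Rintegral => //.
    by apply: rect_integrable => //; apply: continuous_mul2; exact: continuous_mul2.
  move=> [x y] [/= x1 y1].
  have h1 := osc1_abs sw2 y x1 MI; have h2 := osc2_abs sw2 x y1 MI.
  rewrite left_off mul0r subr0 in h1; rewrite bot_off mul0r subr0 in h2.
  have p0 : 0 <= w (x, y) * w (x, y) by rewrite -expr2 sqr_ge0.
  exact: (ler_pM p0 p0 (le_trans (ler_norm _) h1) (le_trans (ler_norm _) h2)).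
apply: le_trans step _; rewrite eAB.
have I0 d : 0 <= \int[mu2]_(z in S) F d z by apply: Rintegral_ge0 => z _; exact: F0.
apply: le_trans (ler_pM (I0 _) (I0 _) (FN (e1 R)) (FN (e2 R))) _.
rewrite -(nrm_sqr pL (test_sqi oP PM tw)).
have alg (x y z : R) : 2 * (x * y) * (2 * (x * z)) <= 4 * x ^+ 2 * (y * z).
  by rewrite le_eqVlt; apply/orP; left; apply/eqP; ring.
exact: (alg (N w) (N D1) (N D2)).
Qed.

Definition grid (n i : nat) : R := - M + i%:R * (2 * M / n.+1%:R).

Lemma grid_lt n i : grid n i < grid n i.+1.
Proof.
by rewrite /grid ltrD2l ltr_pM2r ?ltr_nat// divr_gt0// mulr_gt0.
Qed.

Lemma grid0 n : grid n 0 = - M. Proof. by rewrite /grid mul0r addr0. Qed.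
Lemma gridN n : grid n n.+1 = M.
Proof. by rewrite /grid mulrC divfK ?pnatr_eq0//; ring. Qed.
Lemma gridB n i : grid n i.+1 - grid n i = 2 * M / n.+1%:R.
Proof. by rewrite /grid -natr1; ring. Qed.

Definition cell n (ij : nat * nat) : set R2 :=
  rect (grid n ij.1) (grid n ij.1.+1) (grid n ij.2) (grid n ij.2.+1).

Lemma grid_le n i j : (i <= j)%N -> grid n i <= grid n j.
Proof.
move=> ij; rewrite /grid lerD2l ler_wpM2r ?ler_nat// divr_ge0//.
by rewrite mulr_ge0// ltW.
Qed.

Lemma cell_sub n (ij : 'I_n.+1 * 'I_n.+1) : cell n (val ij.1, val ij.2) `<=` S.
Proof.
case: ij => i j [x y] [/=]; rewrite !in_itv /= => /andP[h1 h2] /andP[h3 h4].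
have gi := grid_le n (leq0n i); have gj := grid_le n (leq0n j).
have gi' := grid_le n (ltn_ord i); have gj' := grid_le n (ltn_ord j).
rewrite grid0 in gi gj; rewrite gridN in gi' gj'.
by split; rewrite /= in_itv /=; apply/andP; split;
  [exact: le_trans h1|exact: lt_le_trans gi'|exact: le_trans h3|exact: lt_le_trans gj'].
Qed.

Lemma Rint_cells n (f : R2 -> R) : mu2.-integrable S (EFin \o f) ->
  \int[mu2]_(z in S) f z =
  \sum_(ij : 'I_n.+1 * 'I_n.+1) \int[mu2]_(z in cell n (val ij.1, val ij.2)) f z.
Proof.
move=> hf; have gs i : grid n i <= grid n i.+1 by exact: ltW (grid_lt n i).
have mfst := @measurable_fst _ _ mR mR; have msnd := @measurable_snd _ _ mR mR.
have := Rint_strips mS hf n.+1 mfst gs.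
rewrite grid0 gridN (_ : S `&` _ = S); last first.
  by apply/seteqP; split => [z []//|z Sz]; split => //; case: Sz.
move=> ->; rewrite -(pair_bigA _ (fun i j : 'I_n.+1 => \int[mu2]_(z in cell n (val i, val j)) f z)) /=.
apply: eq_bigr => i _; pose S' : set R2 := S `&` fst @^-1` `[grid n i, grid n i.+1[.
have mS' : measurable S'.
  by apply: measurableI => //; rewrite -[_ @^-1` _]setTI; apply: mfst => //; exact: measurable_itv.
have hf' : mu2.-integrable S' (EFin \o f) by apply: integrableS hf => // z [].
have := Rint_strips mS' hf' n.+1 msnd gs.
rewrite grid0 gridN (_ : S' `&` _ = S'); last first.
  by apply/seteqP; split => [z []//|z Sz]; split => //; case: Sz => -[].
move=> ->; apply: eq_bigr => j _; congr (Rintegral _ _ _).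
apply/seteqP; split => [z [[_ z1] z2]|z cz]; first exact: (conj z1 z2).
by case: (cz) => z1 z2; split => //; split => //; exact: (@cell_sub n (i, j) z cz).
Qed.

(** [cell_ineq] summed over the square cells of side [h]: the part of [w] not controlled by finitely
    many cell integrals is small with [h]. *)
Lemma grid_ineq n h : h = 2 * M / n.+1%:R ->
  dotP w w <= h ^- 2 * \sum_(ij : 'I_n.+1 * 'I_n.+1)
      (\int[mu2]_(z in cell n (val ij.1, val ij.2)) w z) ^+ 2 +
    h ^+ 2 * (dotP D1 D1 + dotP D2 D2).
Proof.
move=> hE; have td1 : test P D1 by exact: test_derive.
have td2 : test P D2 by exact: test_derive.
rewrite (dot_square w tw) (dot_square D1 td1) (dot_square D2 td2).
have int2 (f : R * R -> R) : continuous f -> mu2.-integrable S (EFin \o (fun z => f z * f z)).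
  by move=> cf; apply: rect_integrable => //; exact: continuous_mul2.
rewrite (Rint_cells n (int2 _ cw)) (Rint_cells n (int2 _ (cD (d := e1 R)))).
rewrite (Rint_cells n (int2 _ (cD (d := e2 R)))) -big_split /= !mulr_sumr -big_split /=.
apply: ler_sum => -[i j] _ /=.
have := cell_ineq sw (grid_lt n i) (grid_lt n j); rewrite !gridB -hE.
have alg (s x g k : R) : s <= (h * h)^-1 * x + h ^+ 2 * g + h ^+ 2 * k ->
  s <= h ^- 2 * x + h ^+ 2 * (g + k) by rewrite mulrDr addrA expr2.
exact: alg.
Qed.

End test_inequalities.

Lemma cvg_lbound (R : realType) (x : nat -> R) (l c : R) : x @ \oo --> l ->
  (forall n, c <= x n) -> c <= l.
Proof.
move=> xl cx; rewrite -(cvg_lim (@Rhausdorff R) xl); apply: limr_ge; first exact: cvgP xl.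
exact: nearW.
Qed.

Section fatou_squares.
Context d (T : measurableType d) (R : realType) (mu : {measure set T -> \bar R}).
Variables (D : set T) (mD : measurable D).

(** Gives the square integrability of the limit together with the bound; for squares of Sobolev
    functions the former is not known beforehand. *)
Lemma fatou_sqi (g_ : nat -> T -> R) (g : T -> R) (K : R) :
  (forall n, sqi mu D (g_ n)) -> (forall n, dot mu D (g_ n) (g_ n) <= K) ->
  measurable_fun D g -> {ae mu, forall x, D x -> (fun n => g_ n x) @ \oo --> g x} ->
  sqi mu D g /\ dot mu D g g <= K.
Proof.
move=> sg gK mg [B [mB B0 subB]]; pose E := D `\` B.
have mE : measurable E by exact: measurableD.
have Econv x : E x -> (fun n => (g_ n x * g_ n x)%:E) @ \oo --> (g x * g x)%:E.
  move=> [Dx nB]; apply: cvg_EFin; first exact: nearW.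
  have h : (fun n => g_ n x) @ \oo --> g x.
    by apply: contrapT => h; apply: nB; apply: subB => /(_ Dx).
  exact: cvgM.
have mgg : measurable_fun D (fun x => (g x * g x)%:E).
  by apply/measurable_EFinP; exact: measurable_funM.
have gg0 x : (0 <= (g x * g x)%:E)%E by rewrite lee_fin -expr2 sqr_ge0.
have IE : (\int[mu]_(x in D) (g x * g x)%:E <= K%:E)%E.
  have -> : (\int[mu]_(x in D) (g x * g x)%:E = \int[mu]_(x in E) (g x * g x)%:E)%E.
    exact: ge0_negligible_integral.
  have -> : (\int[mu]_(x in E) (g x * g x)%:E =
     \int[mu]_(x in E) limn_einf (fun n => (g_ n x * g_ n x)%:E))%E.
    by apply: eq_integral => x /set_mem Ex; rewrite (cvg_limn_einf_sup (Econv x Ex)).1.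
  have gn0 n x : (0 <= (g_ n x * g_ n x)%:E)%E by rewrite lee_fin -expr2 sqr_ge0.
  apply: (@le_trans _ _ (limn_einf (fun n => \int[mu]_(x in E) (g_ n x * g_ n x)%:E))%E).
    apply: (fatou mu mE (f := fun n x => (g_ n x * g_ n x)%:E)) => // n.
    apply/measurable_EFinP; apply: measurable_funS (_ : measurable_fun D _) => //.
      exact: subDsetl.
    by apply: measurable_funM; exact: (sg n).1.
  rewrite limn_einf_lim; apply: lime_le; first exact: is_cvg_einfs.
  apply: nearW => n; apply: (@le_trans _ _ (\int[mu]_(x in E) (g_ n x * g_ n x)%:E)%E).
    by apply: ereal_inf_lbound; exists n => //=.
  apply: (@le_trans _ _ (\int[mu]_(x in D) (g_ n x * g_ n x)%:E)%E).
    apply: ge0_subset_integral => //; last exact: subDsetl.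
    by apply/measurable_EFinP; apply: measurable_funM; exact: (sg n).1.
  by rewrite -EFin_Rint ?lee_fin; [exact: gK| |exact: (sqi_mul mD (sg n) (sg n))].
have sgg : sqi mu D g.
  split => //; apply: intg_ge0P; [exact: measurable_funX|by move=> x _; exact: sqr_ge0|].
  by apply: le_lt_trans IE _; rewrite ltry.
by split => //; rewrite -lee_fin /dot EFin_Rint//; exact: (sqi_mul mD sgg sgg).
Qed.

End fatou_squares.

(** * Ladyzhenskaya's inequality by density *)

Section ladyzhenskaya_extension.
Variables (R : realType) (P : set (R * R)) (M : R).
Hypotheses (oP : open P) (M0 : 0 < M) (PM : in_square P M).
Local Notation mR := (measurableTypeR R).
Local Notation R2 := (mR * mR)%type.
Local Notation mu2 := (leb2 R).
Local Notation PR := (P : set R2).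
Local Notation dotP := (dot mu2 PR).
Local Notation N := (nrm dotP).
Local Notation N1 := (nrm (ip12 P)).
Local Notation L := (sqi mu2 PR : set (R * R -> R^o)).
Implicit Types f : R * R -> R^o.

Let mP : measurable PR. Proof. exact: open_measurable2. Qed.
Let hL : subsp L. Proof. exact: (sqi_subsp mu2 mP). Qed.
Let pL : psd_on L dotP. Proof. exact: (dot_psd mu2 mP). Qed.

Lemma test_ladyzhenskaya f : test P f ->
  L (fun z => f z ^+ 2) /\ dotP (fun z => f z ^+ 2) (fun z => f z ^+ 2) <= 4 * N f ^+ 2 * N1 f ^+ 2.
Proof.
move=> tf; split.
  by apply: (test_sqi oP PM); exact: (test_mul tf (test_smooth tf)).
have Lf := test_L oP PM tf; have Wf := test_W12 oP M0 PM tf.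
have nD d : axis d -> N (fun z => 'D_d f z) <= N1 f.
  move=> ad; apply: le_trans (@ip12_geD R P d f ad); rewrite le_eqVlt; apply/orP; left; apply/eqP.
  apply/esym; apply: nrm_ae => //.
  - exact: W12_wsqi.
  - by apply: (test_L oP PM); exact: test_derive.
  - exact: (test_wderiv_ae oP M0 PM).
apply: le_trans (ladyzhenskaya oP M0 PM tf) _.
rewrite -(nrm_sqr pL Lf).
have alg (x a b c : R) : 0 <= a -> 0 <= b -> a <= c -> b <= c ->
    4 * x ^+ 2 * (a * b) <= 4 * x ^+ 2 * c ^+ 2.
  move=> a0 b0 ac bc; apply: ler_wpM2l; first by rewrite mulr_ge0 ?sqr_ge0.
  by rewrite expr2; apply: ler_pM.
exact: (alg _ _ _ _ (nrm_ge0 _ _) (nrm_ge0 _ _) (nD _ (or_introl erefl)) (nD _ (or_intror erefl))).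
Qed.

Lemma W120_approx f (e : R) : W12_0 P f -> 0 < e ->
  exists phi : nat -> R * R -> R^o, (forall n, test P (phi n)) /\
   (forall n, N1 (f - phi n) < e) /\ (fun n => N1 (f - phi n)) @ \oo --> (0 : R).
Proof.
move=> [_ hf] e0.
have h n : exists phi, test P phi /\ N1 (f - phi) < Num.min e n.+1%:R^-1.
  have [|phi tp hp] := hf (Num.min e n.+1%:R^-1).
    by rewrite lt_min e0 invr_gt0 ltr0n.
  by exists phi.
have {h}[phi hP] := choice h; exists phi.
have h1 n : test P (phi n) by have [tp _] := hP n; apply: tp.
have h2 n : N1 (f - phi n) < e.
  by have [_] := hP n; rewrite lt_min => /andP[h _]; apply: h.
have h3 n : N1 (f - phi n) < n.+1%:R^-1.
  by have [_] := hP n; rewrite lt_min => /andP[_ h]; apply: h.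
split; first exact: h1.
split; first exact: h2.
have hh : (fun n => n.+1%:R^-1 : R) @ \oo --> (0 : R) by exact: cvg_harmonic.
apply: (squeeze_cvgr _ (cvg_cst (0 : R)) hh); apply: nearW => n.
by apply/andP; split; [exact: nrm_ge0|exact: ltW (h3 n)].
Qed.

(** Test functions within [e] of [f] satisfy the inequality with norms enlarged by [e]. A
    subsequence converges almost everywhere, Fatou's lemma applies, and [e] then tends to 0. *)
Lemma W120_ladyzhenskaya f : W12_0 P f ->
  L (fun z => f z ^+ 2) /\ dotP (fun z => f z ^+ 2) (fun z => f z ^+ 2) <= 4 * N f ^+ 2 * N1 f ^+ 2.
Proof.
move=> Vf; have Wf := W120_W12 Vf; have Lf := W12_sqi oP Wf.
have hW := W12_subsp oP PM; have pW := ip12_psd oP PM.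
have half (x y c : R) : x < c / 2 -> y < c / 2 -> x + y <= c by lra.
have tri (x y z q : R) : `|x - y| <= z -> z < q -> x <= y + q.
  by have := ler_norm (x - y); lra.
suff main e : 0 < e -> L (fun z => f z ^+ 2) /\
    dotP (fun z => f z ^+ 2) (fun z => f z ^+ 2) <= 4 * (N f + e) ^+ 2 * (N1 f + e) ^+ 2.
  have [L2f _] := main _ ltr01; split => //.
  pose k e := 4 * (N f + e) ^+ 2 * (N1 f + e) ^+ 2.
  have kc : (k n.+1%:R^-1) @[n --> \oo] --> k 0.
    have h c : (fun n => c + n.+1%:R^-1 : R) @ \oo --> (c + 0 : R).
      by apply: cvgD; [exact: cvg_cst|exact: cvg_harmonic].
    apply: cvgM; last by apply: (cvgM (h _) (h _)).
    by apply: cvgMr; apply: (cvgM (h _) (h _)).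
  have k0 : k 0 = 4 * N f ^+ 2 * N1 f ^+ 2 by rewrite /k !addr0.
  rewrite -k0; apply: (cvg_lbound kc) => n.
  by apply: (main _ _).2; rewrite invr_gt0 ltr0n.
move=> e0; have [phi [tp [ple pc]]] := W120_approx Vf e0.
have Lp n := test_L oP PM (tp n); have Wp n := test_W12 oP M0 PM (tp n).
have Nle g : N g <= N1 g by have [] := @ip12_ge R P g.
have pc' : (fun n => N (phi n - f)) @ \oo --> (0 : R).
  apply: (squeeze_cvgr _ (cvg_cst (0 : R)) pc); apply: nearW => n.
  by rewrite nrm_ge0 /= (nrm_distC hL pL)// Nle.
have [s [v [Lv aev vc]]] : exists (s : nat -> nat) (v : R * R -> R^o), [/\ L v,
    {ae mu2, forall x, P x -> (fun k => phi (s k) x : R) @ \oo --> (v x : R)} &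
    (fun n => N (phi n - v)) @ \oo --> (0 : R)].
  apply: (L2_riesz mP Lp) => d d0.
  have /cvgrPdist_lt/(_ _ (divr_gt0 d0 (ltr0n R 2)))[K _ hK] := pc'.
  exists K => n m Kn Km; have -> : phi n - phi m = (phi n - f) + (f - phi m).
    by rewrite addrA subrK.
  have hK' k : (K <= k)%N -> N (phi k - f) < d / 2.
    by move=> Kk; have := hK _ Kk; rewrite /= sub0r normrN ger0_norm ?nrm_ge0.
  have h1 := hK' _ Kn; have h2 := hK' _ Km.
  apply: le_trans (nrm_triangle hL pL (subspB hL (Lp n) Lf) (subspB hL Lf (Lp m))) _.
  by rewrite (nrm_distC hL pL Lf (Lp m)); exact: half h1 h2.
(* The pointwise limit and [f] are limits in L^2 of the same sequence. *)
have vf : {ae mu2, forall x, P x -> v x = f x}.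
  have Lvf := subspB hL Lv Lf.
  have : dotP (v - f) (v - f) = 0.
    rewrite -(nrm_sqr pL Lvf); suff -> : N (v - f) = 0 by rewrite expr0n.
    have lim0 : (fun n => N (phi n - v) + N (phi n - f)) @ \oo --> (0 + 0 : R) by exact: cvgD.
    apply/eqP; rewrite eq_le nrm_ge0 andbT -[leRHS](addr0 0).
    apply: (cvg_lbound lim0) => n.
    have -> : v - f = (v - phi n) + (phi n - f) by rewrite addrA subrK.
    apply: le_trans (nrm_triangle hL pL (subspB hL Lv (Lp n)) (subspB hL (Lp n) Lf)) _.
    by rewrite (nrm_distC hL pL Lv).
  move=> /(dot0_ae mP Lvf); apply: ae_impl => x h Px; have := h Px.
  by move/eqP; rewrite subr_eq0 => /eqP.
have := @fatou_sqi _ _ _ mu2 PR mP (fun k z => phi (s k) z ^+ 2) (fun z => f z ^+ 2)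
   (4 * (N f + e) ^+ 2 * (N1 f + e) ^+ 2); apply.
- by move=> n; case: (test_ladyzhenskaya (tp (s n))).
- move=> n; have [_ h] := test_ladyzhenskaya (tp (s n)); apply: le_trans h _.
  have h1 : N (phi (s n)) <= N f + e.
    apply: tri (nrm_dist hL pL (Lp (s n)) Lf) _; rewrite (nrm_distC hL pL (Lp (s n)) Lf).
    exact: le_lt_trans (Nle _) (ple (s n)).
  have h2 : N1 (phi (s n)) <= N1 f + e.
    apply: tri (nrm_dist hW pW (Wp (s n)) Wf) _; rewrite (nrm_distC hW pW (Wp (s n)) Wf).
    exact: ple (s n).
  have alg (x y x' y' : R) : 0 <= x -> 0 <= y -> x <= x' -> y <= y' ->
      4 * x ^+ 2 * y ^+ 2 <= 4 * x' ^+ 2 * y' ^+ 2.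
    move=> x0 y0 xx yy; apply: ler_pM; rewrite ?mulr_ge0 ?sqr_ge0//.
      by rewrite ler_pM2l// lerXn2r ?nnegrE//; exact: le_trans xx.
    by rewrite lerXn2r ?nnegrE//; exact: le_trans yy.
  exact: (alg _ _ _ _ (nrm_ge0 _ _) (nrm_ge0 _ _) h1 h2).
- by apply: measurable_funX; exact: Lf.1.
have := negligibleU aev vf; apply: negligibleS => x /= nx; apply: contrapT => /not_orP[/contrapT c1 /contrapT c2].
apply: nx => Px; rewrite -(c2 Px); have := c1 Px; move=> {}c1; exact: (cvgM c1 c1).
Qed.

End ladyzhenskaya_extension.

(** * The space V *)

(** The range of each functional is cut into intervals of length [dl]; the code of a point records
    the interval of each of its values, and one representative is kept for each code that occurs.
    Members are addressed by index, with any default, since [X] has no distinguished element. *)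
Lemma pigeonhole_net (R : realType) (X : Type) (J : finType) (l : J -> X -> R) (B : set X)
  (C dl : R) : 0 < dl -> (forall x j, B x -> `|l j x| <= C) ->
  exists s : seq X, (forall k, (k < size s)%N -> forall x0, B (nth x0 s k)) /\
   forall x, B x -> exists2 k, (k < size s)%N & forall j x0, `|l j x - l j (nth x0 s k)| <= dl.
Proof.
move=> d0 lC; pose K := (Num.truncn (2 * C / dl)).+1.
pose r x j := Num.truncn ((l j x + C) / dl).
have rK x j : B x -> (r x j < K)%N.
  move=> Bx; rewrite /K ltnS; apply: le_truncn; rewrite ler_pM2r ?invr_gt0//.
  have := lC x j Bx; rewrite ler_norml; lra.
have r_itv x j : B x -> (r x j)%:R <= (l j x + C) / dl < (r x j).+1%:R.
  move=> Bx; apply: truncn_itv; rewrite divr_ge0 ?(ltW d0)//.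
  have := lC x j Bx; rewrite ler_norml; lra.
pose code x : {ffun J -> 'I_K} := [ffun j => inord (r x j)].
pose rep (c : {ffun J -> 'I_K}) : option X :=
  match pselect (exists x, B x /\ code x = c) with
  | left h => Some (sval (cid h)) | right _ => None end.
pose s := pmap rep (enum {: {ffun J -> 'I_K}}).
have repP c x : rep c = Some x -> B x /\ code x = c.
  rewrite /rep; case: pselect => // h [<-]; exact: svalP (cid h).
have code_close x y j : B x -> B y -> code x = code y -> `|l j x - l j y| <= dl.
  move=> Bx By /ffunP/(_ j); rewrite !ffunE => /(congr1 val).
  rewrite /= !inordK ?rK// => rr; have := r_itv x j Bx; have := r_itv y j By; rewrite rr.
  rewrite ler_pdivlMr// ltr_pdivrMr// ler_pdivlMr// ltr_pdivrMr// -natr1 => /andP[h1 h2] /andP[h3 h4].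
  rewrite ler_norml; lra.
have sP (z : seq {ffun J -> 'I_K}) : (forall k, (k < size (pmap rep z))%N ->
    forall x0, B (nth x0 (pmap rep z) k)) /\
  forall x, B x -> code x \in z -> exists2 k, (k < size (pmap rep z))%N &
    forall j x0, `|l j x - l j (nth x0 (pmap rep z) k)| <= dl.
  elim: z => [|c z [IH1 IH2]]; first by split.
  split.
    rewrite /=; case rc: (rep c) => [y|] //= [|k] //=; last by rewrite ltnS; exact: IH1.
    by move=> _ _; case: (repP _ _ rc).
  move=> x Bx; rewrite inE => /orP[/eqP cx|xz].
    have [y rc] : exists y, rep c = Some y.
      rewrite /rep; case: pselect => [h|h]; first by eexists.
      by exfalso; apply: h; exists x.
    have [By cy] := repP _ _ rc.
    exists 0%N; first by rewrite /= rc.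
    by move=> j x0; rewrite /= rc /=; apply: code_close => //; rewrite cx.
  have [k kz hk] := IH2 x Bx xz; rewrite /=; case rc: (rep c) => [y|] /=.
    by exists k.+1.
  by exists k.
exists s; split; first exact: (sP _).1.
by move=> x Bx; apply: (sP _).2 => //; rewrite mem_enum.
Qed.

Lemma net_radius1 (R : realType) (c e h : R) : 0 <= c -> 0 < e -> 0 < h ->
  h ^- 2 * (c * (h * e / (2 * (c + 1))) ^+ 2) <= e ^+ 2 / 4.
Proof.
move=> c0 e0 h0; have c1 : 0 < c + 1 by rewrite ltr_wpDl.
have -> : h ^- 2 * (c * (h * e / (2 * (c + 1))) ^+ 2) = e ^+ 2 / 4 * (c / (c + 1) ^+ 2).
  by field; rewrite !gt_eqF.
rewrite ler_piMr ?divr_ge0 ?sqr_ge0// ler_pdivrMr ?exprn_gt0//; nra.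
Qed.

Lemma net_radius2 (R : realType) (e h : R) : 4 * h <= e -> 0 < h -> 0 < e ->
  e ^+ 2 / 4 + h ^+ 2 * 2 ^+ 2 <= e ^+ 2.
Proof. nra. Qed.

Section spaceV_structure.
Variables (R : realType) (P : set (R * R)) (M : R).
Hypotheses (oP : open P) (M0 : 0 < M) (PM : in_square P M).
Variables (a1 a2 : R).
Local Notation mR := (measurableTypeR R).
Local Notation R2 := (mR * mR)%type.
Local Notation mu2 := (leb2 R).
Local Notation PR := (P : set R2).
Local Notation dotP := (dot mu2 PR).
Local Notation N := (nrm dotP).
Local Notation N1 := (nrm (ip12 P)).
Local Notation L := (sqi mu2 PR : set (R * R -> R^o)).
Local Notation V := (spaceV P a1 a2).
Local Notation D := (divfree_test P a1 a2).
Implicit Types u v w : field3 R.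

Let mP : measurable PR. Proof. exact: open_measurable2. Qed.
Let hL : subsp L. Proof. exact: (sqi_subsp mu2 mP). Qed.
Let pL : psd_on L dotP. Proof. exact: (dot_psd mu2 mP). Qed.
Let hW : subsp (W12 P : set (R * R -> R^o)). Proof. exact: (W12_subsp oP PM). Qed.
Let pW : psd_on (W12 P : set (R * R -> R^o)) (ip12 P). Proof. exact: (ip12_psd oP PM). Qed.
Let hW0 : subsp (W12_0 P : set (R * R -> R^o)). Proof. exact: (W120_subsp oP M0 PM). Qed.
Let pW0 : psd_on (W12_0 P : set (R * R -> R^o)) (ip12 P).
Proof. by apply: psd_on_sub pW => f; exact: W120_W12. Qed.

Definition ip3 : field3 R -> field3 R -> R := triple_form (ip12 P).

Lemma normVE : normV P = nrm ip3.
Proof.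
apply/funext => u; rewrite /normV /nrm /ip3 /triple_form; congr Num.sqrt.
by apply: eq_bigr => j _; rewrite norm12E sqr_sqrtr// ip12_ge0.
Qed.

(** The definition differentiates combinations of components; with smooth components the condition
    becomes linear in their derivatives. *)
Lemma divfreeP u : (forall j, test P (comp3 u j)) ->
  (D u <-> forall x, 'D_(e1 R) (comp3 u 0) x - a1^-1 * 'D_(e1 R) (comp3 u 2%:R) x +
    ('D_(e2 R) (comp3 u 1) x - a2^-1 * 'D_(e2 R) (comp3 u 2%:R) x) = 0).
Proof.
move=> tu; have su j := test_smooth (tu j).
have E d (c : R) i j x : 'D_d (fun y => comp3 u i y - c * comp3 u j y) x =
    'D_d (comp3 u i) x - c * 'D_d (comp3 u j) x.
  have -> : (fun y => comp3 u i y - c * comp3 u j y) = (fun y => (- c) * comp3 u j y + comp3 u i y).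
    by apply/funext => y; rewrite mulNr addrC.
  rewrite derive_lin; [|exact: smooth_derivable (su j)|exact: smooth_derivable (su i)].
  by rewrite mulNr addrC.
split=> [[_ h] x|h]; first by have := h x; rewrite !E.
by split => // x; rewrite !E.
Qed.

Lemma divfree_subsp : subsp D.
Proof.
split.
  have t0 j : test P (comp3 (0 : field3 R) j).
    by rewrite (_ : comp3 _ j = fun=> 0); [exact: test0|apply/funext => x; rewrite /comp3 mxE].
  apply/(divfreeP t0) => x.
  have d0 d j : 'D_d (comp3 (0 : field3 R) j) x = 0.
    rewrite (_ : comp3 _ j = cst 0); first exact: derive_cst.
    by apply/funext => y; rewrite /comp3 mxE.
  by rewrite !d0; ring.
move=> c u v Du Dv; have [tu _] := Du; have [tv _] := Dv.
have tw j : test P (comp3 (c *: u + v) j) by rewrite comp3_lin; exact: test_lin.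
apply/(divfreeP tw) => x; have hu := (divfreeP tu).1 Du x; have hv := (divfreeP tv).1 Dv x.
have E d j : 'D_d (comp3 (c *: u + v) j) x = c * 'D_d (comp3 u j) x + 'D_d (comp3 v j) x.
  rewrite comp3_lin; apply: derive_lin; apply: smooth_derivable.
    exact: test_smooth (tu j).
  exact: test_smooth (tv j).
rewrite !E.
have alg (p q r s p' q' r' s' b1 b2 : R) : p - b1 * q + (r - b2 * s) = 0 ->
   p' - b1 * q' + (r' - b2 * s') = 0 ->
   c * p + p' - b1 * (c * q + q') + (c * r + r' - b2 * (c * s + s')) = 0.
  move=> h1 h2; transitivity (c * (p - b1 * q + (r - b2 * s)) + (p' - b1 * q' + (r' - b2 * s'))).
    ring.
  by rewrite h1 h2; ring.
exact: alg hu hv.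
Qed.

Local Notation W30 := (triple (W12_0 P : set (R * R -> R^o))).

Let h30 : subsp W30. Proof. exact: triple_subsp. Qed.
Let p30 : psd_on W30 ip3. Proof. exact: triple_psd. Qed.
Let D30 : D `<=` W30. Proof. by move=> u [tu _] j; exact: (test_W120 oP M0 PM (tu j)). Qed.

Lemma spaceVE : V = closure_in (nrm ip3) W30 D.
Proof. by rewrite -normVE. Qed.

Lemma spaceV_W120 u j : V u -> W12_0 P (comp3 u j).
Proof. by move=> [h _]; exact: h. Qed.

Lemma spaceV_W12 u j : V u -> W12 P (comp3 u j).
Proof. by move=> Vu; apply: W120_W12; exact: spaceV_W120. Qed.

Lemma spaceV_L u j : V u -> L (comp3 u j).
Proof. by move=> Vu; apply: W12_sqi => //; exact: spaceV_W12. Qed.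

Lemma spaceV_subsp : subsp V.
Proof. by rewrite spaceVE; exact: (closure_in_subsp h30 divfree_subsp D30 p30). Qed.

Lemma divfree_spaceV : D `<=` V.
Proof. by rewrite spaceVE; exact: (sub_closure_in h30 D30 p30). Qed.

Lemma spaceV_psd : psd_on V ip3.
Proof. by apply: psd_on_sub p30 => u []. Qed.

Lemma spaceV_psdH : psd_on V (pair3 P).
Proof.
apply: (@psd_on_sub _ _ (triple L) _ (triple_form dotP)).
  by move=> u Vu j; exact: spaceV_L.
exact: triple_psd.
Qed.

Lemma spaceV_complete : complete_on V ip3.
Proof.
rewrite spaceVE; apply: (closure_in_complete h30 D30 p30).
apply: triple_complete => //; exact: (W120_complete oP M0 PM).
Qed.

Lemma pair3_le_ip3 u : pair3 P u u <= ip3 u u.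
Proof.
have alg (x y z : R) : 0 <= y -> 0 <= z -> x <= x + y + z.
  by move=> y0 z0; rewrite -addrA lerDl addr_ge0.
apply: ler_sum => j _; exact: (alg (dotP (comp3 u j) (comp3 u j)) _ _
  (dot_ge0 P (wderiv P (e1 R) (comp3 u j))) (dot_ge0 P (wderiv P (e2 R) (comp3 u j)))).
Qed.

Lemma spaceV_dense v (e : R) : V v -> 0 < e -> exists2 d, D d & nrm ip3 (v - d) < e.
Proof. by rewrite spaceVE => -[_]; apply. Qed.

Lemma comp_le_ip3 u j : nrm (ip12 P) (comp3 u j) <= nrm ip3 u.
Proof.
rewrite ler_wsqrtr// /ip3 /triple_form (bigD1 j)//= lerDl.
by apply: sumr_ge0 => i _; exact: ip12_ge0.
Qed.

Lemma test_dotD d f : axis d -> test P f ->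
  dotP (fun z => 'D_d f z) (fun z => 'D_d f z) = dotD P d f f.
Proof.
move=> ad tf; have Lw := W12_wsqi oP ad (test_W12 oP M0 PM tf).
have Ld := test_L oP PM (test_derive d tf).
have ae := test_wderiv_ae oP M0 PM ad tf.
by apply/esym; exact: (dot_ae mP Lw Ld Lw Ld ae ae).
Qed.

Lemma divfree_grid n (h : R) u : D u -> h = 2 * M / n.+1%:R ->
  pair3 P u u <= h ^- 2 * \sum_(j < 3) \sum_(ij : 'I_n.+1 * 'I_n.+1)
     (\int[mu2]_(z in cell M n (val ij.1, val ij.2)) comp3 u j z) ^+ 2 + h ^+ 2 * ip3 u u.
Proof.
move=> [tu _] hE; rewrite /pair3 /ip3 /triple_form !mulr_sumr -big_split /=.
have alg (p q x y x' y' r : R) : p <= q + h ^+ 2 * (x + y) -> x = x' -> y = y' -> 0 <= r ->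
    p <= q + h ^+ 2 * (r + x' + y').
  move=> hp <- <- r0; apply: le_trans hp _; rewrite lerD2l ler_wpM2l ?sqr_ge0//.
  by rewrite -addrA lerDr.
apply: ler_sum => j _; exact: (alg _ _ _ _ _ _ _ (grid_ineq M0 PM (tu j) hE)
  (test_dotD (or_introl erefl) (tu j)) (test_dotD (or_intror erefl) (tu j)) (dot_ge0 P _)).
Qed.

(** Cauchy-Schwarz on the cell; the root of its area is its side, at most [2 * M]. *)
Lemma cell_functional_le n (ij : 'I_n.+1 * 'I_n.+1) f : test P f ->
  `|\int[mu2]_(z in cell M n (val ij.1, val ij.2)) f z| <= 2 * M * N f.
Proof.
move=> tf; have gl := grid_lt M0 n; set Q := cell M n _.
have mQ : measurable Q by exact: rect_measurable.
have mS := rect_measurable (- M) M (- M) M; have MM : - M < M by have := M0; lra.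
have cf := smooth_continuous (test_smooth tf).
have hLQ := sqi_subsp mu2 mQ; have pLQ := dot_psd mu2 mQ.
have sQ (g : R * R -> R) : continuous g -> sqi mu2 Q g.
  move=> cg; split; first exact: continuous_measurable2.
  by apply: (rect_integrable (gl _) (gl _)); exact: continuous_mul2.
have c1 : continuous (fun _ : R * R => 1 : R) by move=> z; exact: cvg_cst.
have := psd_CS hLQ pLQ (sQ _ cf) (sQ _ c1).
have -> : dot mu2 Q f (fun=> 1) = \int[mu2]_(z in Q) f z.
  by apply: eq_Rintegral => z _; rewrite mulr1.
move=> h; apply: le_trans h _; rewrite mulrC; apply: ler_pM; rewrite ?nrm_ge0//.
  rewrite /nrm; have -> : dot mu2 Q (fun=> 1) (fun=> 1) = (2 * M / n.+1%:R) ^+ 2.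
    transitivity (\int[mu2]_(z in Q) (1 : R)); first by apply: eq_Rintegral => z _; rewrite mulr1.
    rewrite Rintegral_cst// mul1r [fine _](congr1 fine (mu_rect (gl _) (gl _))) /=.
    by rewrite !gridB expr2.
  rewrite sqrtr_sqr ger0_norm ?divr_ge0 ?mulr_ge0 ?(ltW M0)//.
  by rewrite ler_pdivrMr// ler_peMr ?mulr_ge0 ?(ltW M0)// ler1n.
rewrite /nrm ler_wsqrtr// (dot_square PM f tf).
have := @cell_sub _ _ M0 n ij => sub.
by apply: Rint_subset => //; [move=> z; rewrite -expr2 sqr_ge0|apply: rect_integrable => //; exact: continuous_mul2].
Qed.

(** Fields of the unit ball whose cell integrals nearly agree are close in H by the grid estimate,
    and [pigeonhole_net] provides finitely many representatives. No density or extension theorem for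
    the domain enters. *)
Lemma divfree_compact (e : R) : 0 < e -> exists2 s : seq (field3 R),
  (forall k, (k < size s)%N -> D (nth 0 s k)) &
  forall w, D w -> nrm ip3 w <= 1 -> exists2 k, (k < size s)%N & nrm (pair3 P) (w - nth 0 s k) <= e.
Proof.
move=> e0; have two : (1 + 1 : R) <= 2 by lra.
(* Chosen so that [4 * h <= e]: two elements of the unit ball differ by at most 2 in V, so the
   gradient part of the grid estimate is at most [e ^+ 2 / 4]. *)
pose n := Num.truncn (8 * M / e); pose h := 2 * M / n.+1%:R.
have h0 : 0 < h by rewrite divr_gt0// mulr_gt0.
have he : 4 * h <= e.
  have : 8 * M / e < n.+1%:R.
    by have /andP[] := @truncn_itv R (8 * M / e) (divr_ge0 (mulr_ge0 (ler0n _ _) (ltW M0)) (ltW e0)).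
  rewrite ltr_pdivrMr// => h1; rewrite /h mulrA ler_pdivrMr//; move: h1; lra.
pose J : finType := ('I_3 * ('I_n.+1 * 'I_n.+1))%type.
pose l (t : J) (w : field3 R) := \int[mu2]_(z in cell M n (val t.2.1, val t.2.2)) comp3 w t.1 z.
pose B : set (field3 R) := [set w | D w /\ nrm ip3 w <= 1].
pose c : R := \sum_(t : J) 1.
have c0 : 0 <= c by apply: sumr_ge0.
(* [c] counts the cell functionals; this radius makes their share of the grid estimate at most
   [e ^+ 2 / 4]. *)
pose dl := h * e / (2 * (c + 1)).
have d0 : 0 < dl by rewrite divr_gt0 ?mulr_gt0//; lra.
have [|s [sB sN]] := @pigeonhole_net R _ J l B (2 * M) dl d0.
  move=> w t [Dw w1]; apply: le_trans (cell_functional_le t.2 (Dw.1 t.1)) _.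
  rewrite ler_piMr ?mulr_ge0 ?(ltW M0)//; apply: le_trans w1.
  apply: le_trans (comp_le_ip3 w t.1); by have [] := @ip12_ge R P (comp3 w t.1).
exists s; first by move=> k ks; case: (sB k ks 0).
move=> w Dw w1; have [k ks hk] := sN w (conj Dw w1); exists k => //.
set p := nth 0 s k; have [Dp p1] : B p by exact: sB.
have Dv := subspB divfree_subsp Dw Dp.
have hV := spaceV_subsp; have pV := spaceV_psd; have DV := divfree_spaceV.
have v2 : nrm ip3 (w - p) <= 2.
  apply: le_trans (nrm_triangle hV pV (DV _ Dw) _) _; first by rewrite -scaleN1r; apply: (subspZ hV); exact: DV.
  by rewrite (nrmN hV pV (DV _ Dp)); exact: le_trans (lerD w1 p1) two.
have := divfree_grid Dv (erefl h); rewrite -(nrm_sqr pV (DV _ Dv)).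
have lB j ij : \int[mu2]_(z in cell M n (val ij.1, val ij.2)) comp3 (w - p) j z = l (j, ij) w - l (j, ij) p.
  have gl := grid_lt M0 n.
  have it f : test P f -> mu2.-integrable (cell M n (val ij.1, val ij.2)) (EFin \o f).
    move=> tf; apply: (rect_integrable (gl _) (gl _)); exact: smooth_continuous (test_smooth tf).
  rewrite /l -RintegralB//=; [|exact: rect_measurable|apply: it; exact: (Dw.1 _)|apply: it; exact: (Dp.1 _)].
  by rewrite comp3B.
have sumle : \sum_(j < 3) \sum_(ij : 'I_n.+1 * 'I_n.+1)
     (\int[mu2]_(z in cell M n (val ij.1, val ij.2)) comp3 (w - p) j z) ^+ 2 <= c * dl ^+ 2.
  rewrite pair_bigA /= /c mulr_suml; apply: ler_sum => t _; rewrite lB mul1r.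
  rewrite -[leLHS]real_normK ?num_real// lerXn2r ?nnegrE ?(ltW d0)//.
  by rewrite -surjective_pairing; exact: hk.
move=> hh; rewrite -(ler_pXn2r (ltn0Sn 1)) ?nnegrE ?nrm_ge0 ?(ltW e0)//.
rewrite (nrm_sqr spaceV_psdH (DV _ Dv)); apply: le_trans hh _.
have t1 : h ^- 2 * (c * dl ^+ 2) <= e ^+ 2 / 4.
  exact: net_radius1.
have hi0 : 0 <= h ^- 2 by rewrite invr_ge0 sqr_ge0.
have q2 : h ^+ 2 * nrm ip3 (w - p) ^+ 2 <= h ^+ 2 * 2 ^+ 2.
  by rewrite ler_wpM2l ?sqr_ge0// lerXn2r ?nnegrE ?nrm_ge0.
apply: le_trans (lerD (ler_wpM2l hi0 sumle) q2) _.
exact: le_trans (lerD t1 (lexx _)) (net_radius2 he h0 e0).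
Qed.

End spaceV_structure.

(** * The forms of the problem *)

Section trilinear.
Variables (R : realType) (P : set (R * R)) (M : R).
Hypotheses (oP : open P) (M0 : 0 < M) (PM : in_square P M).
Local Notation mR := (measurableTypeR R).
Local Notation R2 := (mR * mR)%type.
Local Notation mu2 := (leb2 R).
Local Notation PR := (P : set R2).
Local Notation dotP := (dot mu2 PR).
Local Notation N := (nrm dotP).
Local Notation N1 := (nrm (ip12 P)).
Local Notation L := (sqi mu2 PR : set (R * R -> R^o)).
Local Notation W0 := (W12_0 P).
Implicit Types f g h : R * R -> R^o.

Let mP : measurable PR. Proof. exact: open_measurable2. Qed.
Let hL : subsp L. Proof. exact: (sqi_subsp mu2 mP). Qed.
Let pL : psd_on L dotP. Proof. exact: (dot_psd mu2 mP). Qed.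

Definition pmul f g : R * R -> R^o := fun z => f z * g z.

Lemma W0_L f : W0 f -> L f.
Proof. by move=> /W120_W12; exact: W12_sqi. Qed.

Lemma N_le_N1 f : N f <= N1 f. Proof. by have [] := @ip12_ge R P f. Qed.

Lemma W0_square f : W0 f -> N (pmul f f) <= 2 * (N f * N1 f).
Proof.
move=> Wf; have [L2 h] := W120_ladyzhenskaya oP M0 PM Wf.
have p0 : 0 <= 2 * (N f * N1 f) by rewrite !mulr_ge0 ?nrm_ge0.
rewrite -(ler_pXn2r (ltn0Sn 1)) ?nnegrE ?nrm_ge0//.
rewrite (nrm_sqr pL); last exact: L2.
apply: le_trans h _; rewrite le_eqVlt; apply/orP; left; apply/eqP.
by move: (N f) (N1 f) => x y; ring.
Qed.

Lemma pmul_L f h : W0 f -> W0 h -> L (pmul f h).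
Proof.
move=> Wf Wh; have Lf := W0_L Wf; have Lh := W0_L Wh.
have [L2f _] := W120_ladyzhenskaya oP M0 PM Wf.
have [L2h _] := W120_ladyzhenskaya oP M0 PM Wh.
split; first by apply: measurable_funM; [exact: Lf.1|exact: Lh.1].
by apply: eq_integrable (sqi_mul mP L2f L2h) => // z _; rewrite /= /pmul exprMn.
Qed.

(** Hoelder's inequality with two L^4 norms, each bounded by Ladyzhenskaya's inequality. The
    interpolated form is kept for [f]; for [h] the L^2 norm is bounded by the Sobolev norm. *)
Lemma pmul_le f h : W0 f -> W0 h ->
  N (pmul f h) <= 2 * Num.sqrt (N f * N1 f) * N1 h.
Proof.
move=> Wf Wh; have Lff := pmul_L Wf Wf; have Lhh := pmul_L Wh Wh.
have Lfh := pmul_L Wf Wh.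
have e0 : dotP (pmul f h) (pmul f h) = dotP (pmul f f) (pmul h h).
  by apply: eq_Rintegral => z _; rewrite /pmul mulrACA.
have k0 : 0 <= 2 * Num.sqrt (N f * N1 f) * N1 h by rewrite !mulr_ge0 ?sqrtr_ge0 ?nrm_ge0.
rewrite -(ler_pXn2r (ltn0Sn 1)) ?nnegrE ?nrm_ge0//.
rewrite (nrm_sqr pL Lfh) e0; apply: le_trans (ler_norm _) _.
apply: le_trans (psd_CS hL pL Lff Lhh) _.
apply: le_trans (ler_pM (nrm_ge0 _ _) (nrm_ge0 _ _) (W0_square Wf) (W0_square Wh)) _.
rewrite !exprMn sqr_sqrtr ?mulr_ge0 ?nrm_ge0//.
have alg (x y z w : R) : 0 <= x -> 0 <= y -> 0 <= w -> z <= w ->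
    2 * (x * y) * (2 * (z * w)) <= 2 ^+ 2 * (x * y) * w ^+ 2.
  move=> x0 y0 w0 zw; have -> : 2 * (x * y) * (2 * (z * w)) = 2 ^+ 2 * (x * y) * (z * w) by ring.
  by rewrite ler_wpM2l ?mulr_ge0 ?sqr_ge0// expr2 ler_wpM2r.
by apply: alg; rewrite ?nrm_ge0 ?N_le_N1.
Qed.

Lemma tri_le f g h : W0 f -> L g -> W0 h ->
  `|dotP g (pmul f h)| <= 2 * Num.sqrt (N f * N1 f) * N g * N1 h.
Proof.
move=> Wf Lg Wh; apply: le_trans (psd_CS hL pL Lg (pmul_L Wf Wh)) _.
rewrite mulrAC mulrC; apply: ler_wpM2r; first exact: nrm_ge0.
exact: pmul_le.
Qed.

Lemma tri_smooth f g h (K : R) : W0 f -> W0 h -> L g -> (forall z, `|g z| <= K) ->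
  `|dotP g (pmul f h)| <= K * (N f * N h).
Proof.
move=> Wf Wh Lg gK; have Lf := W0_L Wf; have Lh := W0_L Wh.
have ig := sqi_mul mP Lg (pmul_L Wf Wh); apply: le_trans (le_normr_Rintegral mP ig) _.
have K0 : 0 <= K by apply: le_trans (gK (0, 0)); exact: normr_ge0.
have Lf' := sqi_norm mP Lf; have Lh' := sqi_norm mP Lh.
have ifh := sqi_mul mP Lf' Lh'.
apply: (@le_trans _ _ (\int[mu2]_(z in PR) (K * (`|f z| * `|h z|)))).
  apply: le_Rintegral => //; [exact: intg_norm|exact: intgZ|].
  by move=> z _; rewrite !normrM ler_wpM2r// mulr_ge0.
rewrite RintegralZl// ler_wpM2l//; apply: le_trans (ler_norm _) _.
apply: le_trans (psd_CS hL pL Lf' Lh') _.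
have nn k : N (fun z => `|k z|) = N k.
  by rewrite /nrm; congr Num.sqrt; apply: eq_Rintegral => z _; rewrite -normrM ger0_norm// -expr2 sqr_ge0.
by rewrite (nn f) (nn h).
Qed.

Lemma tri_linf (c : R) f f' g h : L g -> W0 f -> W0 f' -> W0 h ->
  dotP g (pmul (c *: f + f') h) = c * dotP g (pmul f h) + dotP g (pmul f' h).
Proof.
move=> Lg Wf Wf' Wh; have [[_ l2] _ _] := pL; rewrite -(l2 g)//; try exact: pmul_L.
by apply: eq_Rintegral => z _; rewrite /pmul !fctE /GRing.scale /=; ring.
Qed.

Lemma tri_linh (c : R) f g h h' : L g -> W0 f -> W0 h -> W0 h' ->
  dotP g (pmul f (c *: h + h')) = c * dotP g (pmul f h) + dotP g (pmul f h').
Proof.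
move=> Lg Wf Wf' Wh; have [[_ l2] _ _] := pL; rewrite -(l2 g)//; try exact: pmul_L.
by apply: eq_Rintegral => z _; rewrite /pmul !fctE /GRing.scale /=; ring.
Qed.

(** The product rule moved off [g]: the transport term is antisymmetric in [g] and [h] up to the
    derivative of the transporting component [f]. *)
Lemma tri_by_parts d f g h : axis d -> test P f -> test P g -> test P h ->
  dotP (wderiv P d g) (pmul f h) + dotP (wderiv P d h) (pmul f g) =
  - dotP (fun z => 'D_d f z) (pmul g h).
Proof.
move=> ad tf tg th; have tfh : test P (pmul f h) by exact: (test_mul tf (test_smooth th)).
have tfg : test P (pmul f g) by exact: (test_mul tf (test_smooth tg)).
have Lt k : test P k -> L k by exact: (test_L oP PM).
have Ld k : test P k -> L (fun z => 'D_d k z) by move=> tk; apply: Lt; exact: test_derive.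
rewrite (test_dot_wderiv oP M0 PM ad tg (Lt _ tfh)) (test_dot_wderiv oP M0 PM ad th (Lt _ tfg)).
have := test_by_parts oP M0 PM ad tfh tg.
have -> : \int[mu2]_(x in PR) (pmul f h x * 'D_d g x) = dotP (fun z => 'D_d g z) (pmul f h).
  by apply: eq_Rintegral => x _; rewrite mulrC.
have -> : \int[mu2]_(x in PR) ('D_d (pmul f h) x * g x) =
    dotP (fun z => 'D_d f z) (pmul g h) + dotP (fun z => 'D_d h z) (pmul f g).
  have tgh : test P (pmul g h) by exact: (test_mul tg (test_smooth th)).
  rewrite /dot -RintegralD//; [|exact: (sqi_mul mP (Ld _ tf) (Lt _ tgh))|exact: (sqi_mul mP (Ld _ th) (Lt _ tfg))].
  apply: eq_Rintegral => x _.
  have [_ ->] := derive_mul (smooth_derivable x d (test_smooth tf)) (smooth_derivable x d (test_smooth th)).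
  by rewrite /pmul; ring.
by move=> ->; ring.
Qed.

End trilinear.

Lemma sum6_le (R : realType) (F G : 'I_3 -> R) (k : R) : (forall i, `|F i| <= k) -> (forall i, `|G i| <= k) ->
  `|\sum_(i < 3) (F i + G i)| <= 6 * k.
Proof.
move=> Fk Gk; apply: le_trans (ler_norm_sum _ _ _) _.
have h i : `|F i + G i| <= 2 * k.
  by apply: le_trans (ler_normD _ _) _; have := lerD (Fk i) (Gk i); rewrite -mulr2n mulr_natl.
apply: le_trans (ler_sum _ (fun i _ => h i)) _.
by rewrite !big_ord_recl big_ord0 addr0; lra.
Qed.

Lemma eq_opp_eq0 (R : realType) (x : R) : x = - x -> x = 0.
Proof. lra. Qed.

Section forms_on_spaceV.
Variables (R : realType) (P : set (R * R)) (M : R).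
Hypotheses (oP : open P) (M0 : 0 < M) (PM : in_square P M).
Variables (a1 a2 nu : R).
Local Notation mR := (measurableTypeR R).
Local Notation R2 := (mR * mR)%type.
Local Notation mu2 := (leb2 R).
Local Notation PR := (P : set R2).
Local Notation dotP := (dot mu2 PR).
Local Notation N := (nrm dotP).
Local Notation N1 := (nrm (ip12 P)).
Local Notation L := (sqi mu2 PR : set (R * R -> R^o)).
Local Notation W0 := (W12_0 P).
Local Notation V := (spaceV P a1 a2).
Local Notation D := (divfree_test P a1 a2).
Local Notation nH := (nrm (pair3 P)).
Local Notation nV := (nrm (ip3 P)).
Implicit Types u v w : field3 R.

Let mP : measurable PR. Proof. exact: open_measurable2. Qed.
Let hL : subsp L. Proof. exact: (sqi_subsp mu2 mP). Qed.
Let pL : psd_on L dotP. Proof. exact: (dot_psd mu2 mP). Qed.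
Let hW0 : subsp (W0 : set (R * R -> R^o)). Proof. exact: (W120_subsp oP M0 PM). Qed.
Let pW : psd_on (W12 P : set (R * R -> R^o)) (ip12 P). Proof. exact: (ip12_psd oP PM). Qed.
Let hW : subsp (W12 P : set (R * R -> R^o)). Proof. exact: (W12_subsp oP PM). Qed.
Let hV := @spaceV_subsp R P M oP M0 PM a1 a2.
Let pV := @spaceV_psd R P M oP PM a1 a2.
Let DV := @divfree_spaceV R P M oP M0 PM a1 a2.
Let VL u j : V u -> L (comp3 u j). Proof. exact: (spaceV_L oP). Qed.
Let VW u j : V u -> W12 P (comp3 u j). Proof. exact: spaceV_W12. Qed.
Let VW0 u j : V u -> W0 (comp3 u j). Proof. exact: spaceV_W120. Qed.
Let VD d u j : axis d -> V u -> L (wderiv P d (comp3 u j)).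
Proof. by move=> ad Vu; apply: (W12_wsqi oP ad); exact: VW. Qed.

(* Eliminating [D_3], the convection term of [u] on [v] is
   [drift e1 u * D_1 v + drift e2 u * D_2 v], and [div u] is
   [D_1 (drift e1 u) + D_2 (drift e2 u)]. *)
Definition drift (d : R * R) (u : field3 R) : R * R -> R^o :=
  if d == e1 R then (- a1^-1) *: (comp3 u 2%:R : R * R -> R^o) + comp3 u 0
  else (- a2^-1) *: (comp3 u 2%:R : R * R -> R^o) + comp3 u 1.

Lemma drift_lin d (c : R) u v : drift d (c *: u + v) = c *: drift d u + drift d v.
Proof.
by rewrite /drift; case: ifP => _; apply/funext => x; rewrite /comp3 !fctE !mxE /GRing.scale /=; ring.
Qed.

Lemma drift_W0 d u : V u -> W0 (drift d u).
Proof. by move=> Vu; rewrite /drift; case: ifP => _; apply: hW0.2; exact: VW0. Qed.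

Lemma drift_test d u : D u -> test P (drift d u).
Proof. by move=> [tu _]; rewrite /drift; case: ifP => _; exact: test_lin. Qed.

(** Bounds the norm of either [drift] component by that of the field. *)
Definition kdrift : R := 1 + `|a1^-1| + `|a2^-1|.

Lemma kdrift_ge1 : 1 <= kdrift.
Proof. by rewrite /kdrift -addrA lerDl addr_ge0. Qed.

Lemma comp_le_nH u j : N (comp3 u j) <= nH u.
Proof.
rewrite ler_wsqrtr// /pair3 (bigD1 j)//= lerDl.
by apply: sumr_ge0 => i _; exact: dot_ge0.
Qed.

Lemma comp_le_nV u j : N1 (comp3 u j) <= nV u. Proof. exact: comp_le_ip3. Qed.

Let lin_bound (X : lmodType R) (S : set X) q (c k : R) (x y : X) : subsp S -> psd_on S q ->
  S x -> S y -> nrm q x <= k -> nrm q y <= k -> `|c| + 1 <= kdrift ->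
  nrm q (c *: x + y) <= kdrift * k.
Proof.
move=> hS hq Sx Sy xk yk ck; apply: le_trans (nrm_triangle hS hq (subspZ hS c Sx) Sy) _.
rewrite (nrmZ hS hq)//; have k0 := le_trans (nrm_ge0 q x) xk.
apply: le_trans (lerD (ler_wpM2l (normr_ge0 c) xk) yk) _.
by rewrite -{2}(mul1r k) -mulrDl ler_wpM2r.
Qed.

Let kd1 : `|- a1^-1| + 1 <= kdrift.
Proof. by rewrite normrN /kdrift addrC lerDl. Qed.
Let kd2 : `|- a2^-1| + 1 <= kdrift.
Proof. by rewrite normrN /kdrift addrC addrAC lerDl. Qed.

Lemma drift_nH d u : V u -> N (drift d u) <= kdrift * nH u.
Proof.
move=> Vu; rewrite /drift; case: ifP => _;
  apply: (lin_bound hL pL (VL _ Vu) (VL _ Vu)) => //; exact: comp_le_nH.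
Qed.

Lemma drift_nV d u : V u -> N1 (drift d u) <= kdrift * nV u.
Proof.
move=> Vu; rewrite /drift; case: ifP => _;
  apply: (lin_bound hW pW (VW _ Vu) (VW _ Vu)) => //; exact: comp_le_nV.
Qed.

Lemma Dj_comp v x i (j : 'I_3) : Dj P a1 a2 j v x ord0 i =
  match nat_of_ord j with
  | 0%N => wderiv P (e1 R) (comp3 v i) x
  | 1%N => wderiv P (e2 R) (comp3 v i) x
  | _ => - a1^-1 * wderiv P (e1 R) (comp3 v i) x - a2^-1 * wderiv P (e2 R) (comp3 v i) x
  end.
Proof.
rewrite /Dj; case: (nat_of_ord j) => [|[|n]]; first by rewrite mxE.
  by rewrite mxE.
have E (A B : field3 R) (c c' : R) : (- c *: A - c' *: B) x ord0 i = - c * A x ord0 i - c' * B x ord0 i.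
  by rewrite !fctE !mxE.
have F d : vderiv P d v x ord0 i = wderiv P d (comp3 v i) x by rewrite mxE.
apply: etrans (E _ _ _ _) _.
exact: (congr2 (fun p q => - a1^-1 * p - a2^-1 * q) (F (e1 R)) (F (e2 R))).
Qed.

(** On the diagonal, [b_form u u v] is by definition the pairing of [convection P a1 a2 u] with
    [v]. *)
Definition b_form u v w : R :=
  pair3 P (fun x => \sum_(j < 3) comp3 u j x *: Dj P a1 a2 j v x) w.

Let bterm d u v w i : R := dotP (wderiv P d (comp3 v i)) (pmul (drift d u) (comp3 w i)).

Lemma b_formE u v w : V u -> V v -> V w ->
  b_form u v w = \sum_(i < 3) (bterm (e1 R) u v w i + bterm (e2 R) u v w i).
Proof.
move=> Vu Vv Vw; rewrite /b_form /pair3; apply: eq_bigr => i _.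
have L1 := VD i (or_introl erefl : axis (e1 R)) Vv; have L2 := VD i (or_intror erefl : axis (e2 R)) Vv.
have p1 := pmul_L oP M0 PM (drift_W0 (e1 R) Vu) (VW0 i Vw).
have p2 := pmul_L oP M0 PM (drift_W0 (e2 R) Vu) (VW0 i Vw).
rewrite /bterm /dot -RintegralD//; [|exact: (sqi_mul mP L1 p1)|exact: (sqi_mul mP L2 p2)].
apply: eq_Rintegral => x _.
have -> : comp3 (fun x => \sum_(j < 3) comp3 u j x *: Dj P a1 a2 j v x) i x =
   comp3 u 0 x * wderiv P (e1 R) (comp3 v i) x + comp3 u 1 x * wderiv P (e2 R) (comp3 v i) x +
   comp3 u 2%:R x * (- a1^-1 * wderiv P (e1 R) (comp3 v i) x - a2^-1 * wderiv P (e2 R) (comp3 v i) x).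
  have i1 : lift ord0 ord0 = 1 :> 'I_3 by exact/val_inj.
  have i2 : lift ord0 (lift ord0 ord0) = 2%:R :> 'I_3 by exact/val_inj.
  have E j : (comp3 u j x *: Dj P a1 a2 j v x) ord0 i = comp3 u j x * Dj P a1 a2 j v x ord0 i.
    by rewrite mxE.
  rewrite {1}/comp3 summxE (eq_bigr _ (fun j _ => E j)) !big_ord_recl big_ord0 addr0 i1 i2.
  have D0 : Dj P a1 a2 0 v x ord0 i = wderiv P (e1 R) (comp3 v i) x := Dj_comp v x i 0.
  have D1 : Dj P a1 a2 1 v x ord0 i = wderiv P (e2 R) (comp3 v i) x := Dj_comp v x i 1.
  have D2 : Dj P a1 a2 2%:R v x ord0 i = - a1^-1 * wderiv P (e1 R) (comp3 v i) x -
    a2^-1 * wderiv P (e2 R) (comp3 v i) x := Dj_comp v x i 2%:R.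
  rewrite addrA; exact: (congr2 +%R (congr2 +%R (congr1 ( *%R (comp3 u 0 x)) D0)
    (congr1 ( *%R (comp3 u 1 x)) D1)) (congr1 ( *%R (comp3 u 2%:R x)) D2)).
rewrite /pmul /drift eqxx e12 !fctE /GRing.scale /=.
have alg (p q r s t : R) : r * p + s * q + t * (- a1^-1 * p - a2^-1 * q) =
   p * ((- a1^-1 * t + r)) + q * (- a2^-1 * t + s) by ring.
have dist (p q y z k : R) : (p * y + q * z) * k = p * (y * k) + q * (z * k) by ring.
by apply: etrans (congr1 (fun k => k * _) (alg _ _ _ _ _)) (dist _ _ _ _ _).
Qed.

(** The root comes from the transporting field, whose L^4 norm interpolates between H and V; the
    gradient and the third field each cost a V norm. *)
Lemma bterm_le d u v w i : axis d -> V u -> V v -> V w ->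
  `|bterm d u v w i| <= 2 * kdrift * Num.sqrt (nH u * nV u) * nV v * nV w.
Proof.
move=> ad Vu Vv Vw; have W0u := drift_W0 d Vu; have W0w := VW0 i Vw.
apply: le_trans (tri_le oP M0 PM W0u (VD i ad Vv) W0w) _.
have k1 := le_trans ler01 kdrift_ge1.
have h1 : Num.sqrt (N (drift d u) * N1 (drift d u)) <= kdrift * Num.sqrt (nH u * nV u).
  have sE (k t : R) : 0 <= k -> k * Num.sqrt t = Num.sqrt (k ^+ 2 * t).
    by move=> k0; rewrite sqrtrM ?sqr_ge0// sqrtr_sqr ger0_norm.
  rewrite (sE _ (nH u * nV u) k1); apply: ler_wsqrtr.
  apply: le_trans (ler_pM (nrm_ge0 _ _) (nrm_ge0 _ _) (drift_nH d Vu) (drift_nV d Vu)) _.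
  by rewrite mulrACA expr2.
have h2 : N (wderiv P d (comp3 v i)) <= nV v.
  exact: le_trans (@ip12_geD R P d (comp3 v i) ad) (comp_le_nV v i).
have h3 := comp_le_nV w i.
have alg (s s' x x' y y' : R) : 0 <= s -> 0 <= x -> 0 <= y -> s <= kdrift * s' -> x <= x' -> y <= y' ->
    2 * s * x * y <= 2 * kdrift * s' * x' * y'.
  move=> s0 x0 y0 ss xx yy; apply: ler_pM; rewrite ?mulr_ge0//; apply: ler_pM; rewrite ?mulr_ge0//.
  by rewrite -mulrA ler_pM2l.
exact: (alg _ _ _ _ _ _ (sqrtr_ge0 _) (nrm_ge0 _ _) (nrm_ge0 _ _) h1 h2 h3).
Qed.

Lemma b_form_le u v w : V u -> V v -> V w ->
  `|b_form u v w| <= 12 * kdrift * Num.sqrt (nH u * nV u) * nV v * nV w.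
Proof.
move=> Vu Vv Vw; rewrite (b_formE Vu Vv Vw).
apply: le_trans (sum6_le (fun i => bterm_le i (or_introl erefl) Vu Vv Vw)
  (fun i => bterm_le i (or_intror erefl) Vu Vv Vw)) _.
by rewrite !mulrA; have -> : (6 : R) * 2 = 12 by ring.
Qed.

Let sumlin (F F' G G' H H' : 'I_3 -> R) (c : R) : (forall i, F i = c * G i + H i) ->
  (forall i, F' i = c * G' i + H' i) ->
  \sum_(i < 3) (F i + F' i) = c * \sum_(i < 3) (G i + G' i) + \sum_(i < 3) (H i + H' i).
Proof.
move=> h h'; rewrite mulr_sumr -big_split /=; apply: eq_bigr => i _; rewrite h h'; ring.
Qed.

Let bt_lin (u v w u' v' w' u2 v2 w2 : field3 R) (c : R) :
  V u -> V v -> V w -> V u' -> V v' -> V w' -> V u2 -> V v2 -> V w2 ->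
  (forall d i, axis d -> bterm d u v w i = c * bterm d u' v' w' i + bterm d u2 v2 w2 i) ->
  b_form u v w = c * b_form u' v' w' + b_form u2 v2 w2.
Proof.
move=> Vu Vv Vw Vu' Vv' Vw' Vu2 Vv2 Vw2 h.
rewrite (b_formE Vu Vv Vw) (b_formE Vu' Vv' Vw') (b_formE Vu2 Vv2 Vw2).
exact: (sumlin (fun i => h _ i (or_introl erefl)) (fun i => h _ i (or_intror erefl))).
Qed.

Lemma b_form_lin1 v w : V v -> V w -> lin_on V (fun u => b_form u v w).
Proof.
move=> Vv Vw c u u' Vu Vu'; apply: (bt_lin (hV.2 c _ _ Vu Vu') Vv Vw Vu Vv Vw Vu' Vv Vw) => d i ad.
rewrite /bterm drift_lin.
exact: (tri_linf oP M0 PM c (VD i ad Vv) (drift_W0 d Vu) (drift_W0 d Vu') (VW0 i Vw)).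
Qed.

Lemma b_form_lin2 u w : V u -> V w -> lin_on V (fun v => b_form u v w).
Proof.
move=> Vu Vw c v v' Vv Vv'; apply: (bt_lin Vu (hV.2 c _ _ Vv Vv') Vw Vu Vv Vw Vu Vv' Vw) => d i ad.
rewrite /bterm comp3_lin.
exact: (dot_wderiv_lin oP PM c ad (VW i Vv) (VW i Vv') (pmul_L oP M0 PM (drift_W0 d Vu) (VW0 i Vw))).
Qed.

Lemma b_form_lin3 u v : V u -> V v -> lin_on V (b_form u v).
Proof.
move=> Vu Vv c w w' Vw Vw'; apply: (bt_lin Vu Vv (hV.2 c _ _ Vw Vw') Vu Vv Vw Vu Vv Vw') => d i ad.
rewrite /bterm comp3_lin.
exact: (tri_linh oP M0 PM c (VD i ad Vv) (drift_W0 d Vu) (VW0 i Vw) (VW0 i Vw')).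
Qed.

Lemma drift_div u x : D u -> 'D_(e1 R) (drift (e1 R) u) x + 'D_(e2 R) (drift (e2 R) u) x = 0.
Proof.
move=> [tu h]; have := h x; rewrite /drift eqxx e12.
have E (c : R) i j : (- c) *: (comp3 u j : R * R -> R^o) + comp3 u i =
    (fun y => comp3 u i y - c * comp3 u j y).
  by apply/funext => y; rewrite !fctE /GRing.scale /= addrC mulNr.
by rewrite !E.
Qed.

(** Component by component, integration by parts leaves the divergence of the drift, which
    vanishes. *)
Lemma b_form_antisym u v w : D u -> D v -> D w -> b_form u v w = - b_form u w v.
Proof.
move=> Du Dv Dw; have Vu := DV Du; have Vv := DV Dv; have Vw := DV Dw.
rewrite (b_formE Vu Vv Vw) (b_formE Vu Vw Vv); apply/eqP; rewrite -addr_eq0 -big_split /=; apply/eqP.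
apply: big1 => i _.
have tv := Dv.1 i; have tw := Dw.1 i.
have bp d : axis d -> bterm d u v w i + bterm d u w v i =
    - dotP (fun z => 'D_d (drift d u) z) (pmul (comp3 v i) (comp3 w i)).
  by move=> ad; exact: (tri_by_parts oP M0 PM ad (drift_test d Du) tv tw).
have tvw : test P (pmul (comp3 v i) (comp3 w i)) by exact: (test_mul tv (test_smooth tw)).
have Lvw := test_L oP PM tvw.
have Ld d := test_L oP PM (test_derive d (drift_test d Du)).
have zero : dotP (fun z => 'D_(e1 R) (drift (e1 R) u) z) (pmul (comp3 v i) (comp3 w i)) +
   dotP (fun z => 'D_(e2 R) (drift (e2 R) u) z) (pmul (comp3 v i) (comp3 w i)) = 0.
  rewrite /dot -RintegralD//; [|exact: (sqi_mul mP (Ld (e1 R)) Lvw)|exact: (sqi_mul mP (Ld (e2 R)) Lvw)].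
  rewrite -[RHS](mul0r (fine (mu2 PR))) -(Rintegral_cst mu2 mP 0).
  by apply: eq_Rintegral => z _; rewrite -mulrDl drift_div// mul0r.
have alg (x y x' y' s t : R) : x + x' = - s -> y + y' = - t -> s + t = 0 -> x + y + (x' + y') = 0.
  by move=> h1 h2 h3; rewrite addrACA h1 h2 -opprD h3 oppr0.
exact: (alg _ _ _ _ _ _ (bp _ (or_introl erefl)) (bp _ (or_intror erefl)) zero).
Qed.

Lemma b_form_skew u v : D u -> D v -> b_form u v v = 0.
Proof.
by move=> Du Dv; apply: eq_opp_eq0; exact: b_form_antisym.
Qed.

Lemma spaceV_approx u : V u -> exists p : nat -> field3 R, (forall n, D (p n)) /\
  (fun n => nV (u - p n)) @ \oo --> (0 : R).
Proof.
move=> Vu; have h n : exists p, D p /\ nV (u - p) < n.+1%:R^-1.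
  have [|p Dp hp] := @spaceV_dense R P a1 a2 u n.+1%:R^-1 Vu; first by rewrite invr_gt0.
  by exists p.
have [p hp] := choice h; exists p; split; first by move=> n; have [Dp _] := hp n; exact: Dp.
have hh : (fun n => n.+1%:R^-1 : R) @ \oo --> (0 : R) by exact: cvg_harmonic.
apply: (squeeze_cvgr _ (cvg_cst (0 : R)) hh); apply: nearW => n.
by apply/andP; split; [exact: nrm_ge0|have [_ hn] := hp n; exact: ltW hn].
Qed.

Lemma nH_le_nV3 u : nH u <= nV u.
Proof. by apply: ler_wsqrtr; exact: pair3_le_ip3. Qed.

End forms_on_spaceV.

(* The quadratic form of [- lapl] is
   [|D_1 u|^2 + |D_2 u|^2 + |D_1 u / a1 + D_2 u / a2|^2]. *)
Lemma elliptic_form_ge (R : realType) (p q x y z m k nu : R) : 0 < nu -> 0 <= x -> 0 <= y ->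
  0 <= k -> `|z| <= Num.sqrt y * Num.sqrt x -> m <= k * x ->
  nu / (k + 1) * (m + x + y) <=
  nu * ((1 + p ^- 2) * x + (1 + q ^- 2) * y + 2 * p^-1 * q^-1 * z).
Proof.
move=> nu0 x0 y0 k0 zxy mx; rewrite -!exprVn; move: p^-1 q^-1 => {}p {}q.
have k1 : 0 < k + 1 by lra.
rewrite -mulrA ler_pM2l// mulrC ler_pdivrMr//.
have pos : 0 <= p ^+ 2 * x + q ^+ 2 * y + 2 * p * q * z.
  rewrite -(sqr_sqrtr x0) -(sqr_sqrtr y0).
  move: (Num.sqrt x) (Num.sqrt y) (sqrtr_ge0 x) (sqrtr_ge0 y) zxy => X Y X0 Y0 zXY.
  have h : `|p * q * z| <= `|p| * `|q| * (Y * X) by rewrite !normrM ler_wpM2l ?mulr_ge0.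
  have -> : 2 * p * q * z = 2 * (p * q * z) by ring.
  have := sqr_ge0 (`|p| * X - `|q| * Y); rewrite sqrrB !exprMn !real_normK ?num_real//.
  have := ler_norm (- (p * q * z)); rewrite normrN.
  move: h; move: (p * q * z) (normr_ge0 p) => w; rewrite mulr2n; lra.
have e : (1 + p ^+ 2) * x + (1 + q ^+ 2) * y + 2 * p * q * z =
   x + y + (p ^+ 2 * x + q ^+ 2 * y + 2 * p * q * z) by ring.
rewrite e; move: (p ^+ 2 * x + q ^+ 2 * y + 2 * p * q * z) pos => w w0; nra.
Qed.

Lemma ord3_bound (R : realType) (Z : Type) (f : 'I_3 -> Z -> R) :
  (forall i, exists C, forall z, `|f i z| <= C) -> exists C, forall i z, `|f i z| <= C.
Proof.
move=> /choice[C hC]; exists (\sum_(i < 3) `|C i|) => i z.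
apply: le_trans (hC i z) (le_trans (ler_norm _) _).
by rewrite (bigD1 i)//= lerDl; exact: sumr_ge0.
Qed.

Section evolution_data.
Variables (R : realType) (P : set (R * R)) (M : R).
Hypotheses (oP : open P) (M0 : 0 < M) (PM : in_square P M).
Variables (a1 a2 nu : R).
Hypothesis nu0 : 0 < nu.
Local Notation mR := (measurableTypeR R).
Local Notation R2 := (mR * mR)%type.
Local Notation mu2 := (leb2 R).
Local Notation PR := (P : set R2).
Local Notation dotP := (dot mu2 PR).
Local Notation N := (nrm dotP).
Local Notation N1 := (nrm (ip12 P)).
Local Notation L := (sqi mu2 PR : set (R * R -> R^o)).
Local Notation W0 := (W12_0 P).
Local Notation V := (spaceV P a1 a2).
Local Notation D := (divfree_test P a1 a2).
Local Notation nH := (nrm (pair3 P)).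
Local Notation nV := (nrm (ip3 P)).
Local Notation b_form := (b_form P a1 a2).
Local Notation kd := (kdrift a1 a2).
Implicit Types u v w : field3 R.

Let mP : measurable PR. Proof. exact: open_measurable2. Qed.
Let hL : subsp L. Proof. exact: (sqi_subsp mu2 mP). Qed.
Let pL : psd_on L dotP. Proof. exact: (dot_psd mu2 mP). Qed.
Let hV := @spaceV_subsp R P M oP M0 PM a1 a2.
Let pV := @spaceV_psd R P M oP PM a1 a2.
Let pH := @spaceV_psdH R P oP a1 a2.
Let DV := @divfree_spaceV R P M oP M0 PM a1 a2.
Let hD := @divfree_subsp R P a1 a2.
Let VL u j : V u -> L (comp3 u j). Proof. exact: (spaceV_L oP). Qed.
Let VW u j : V u -> W12 P (comp3 u j). Proof. exact: spaceV_W12. Qed.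
Let VW0 u j : V u -> W0 (comp3 u j). Proof. exact: spaceV_W120. Qed.
Let VD d u j : axis d -> V u -> L (wderiv P d (comp3 u j)).
Proof. by move=> ad Vu; apply: (W12_wsqi oP ad); exact: VW. Qed.
Let k1 : 0 <= kd. Proof. exact: le_trans ler01 (kdrift_ge1 a1 a2). Qed.

(** Antisymmetry moves the derivative onto [v], whose derivatives are bounded; Cauchy-Schwarz then
    uses H norms only. *)
Let b_smooth_test v : D v -> exists2 K : R, 0 <= K &
  forall u w, D u -> D w -> `|b_form u w v| <= K * nH u * nH w.
Proof.
move=> Dv.
have bd d : exists C, forall i z, `|'D_d (comp3 v i) z| <= C.
  by apply: ord3_bound => i; exact: (test_bounded (test_derive d (Dv.1 i))).
have [C1 hC1] := bd (e1 R); have [C2 hC2] := bd (e2 R).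
pose K := `|C1| + `|C2|; have K0 : 0 <= K by exact: addr_ge0.
have hK d : axis d -> forall i z, `|'D_d (comp3 v i) z| <= K.
  case=> -> i z.
    by apply: le_trans (hC1 i z) (le_trans (ler_norm _) _); rewrite lerDl.
  by apply: le_trans (hC2 i z) (le_trans (ler_norm _) _); rewrite lerDr.
exists (6 * (K * kd)); first by rewrite !mulr_ge0.
move=> u w Du Dw; rewrite (b_form_antisym oP M0 PM Du Dw Dv) normrN.
rewrite (b_formE oP M0 PM (DV Du) (DV Dv) (DV Dw)).
have h d i : axis d -> `|dotP (wderiv P d (comp3 v i)) (pmul (drift a1 a2 d u) (comp3 w i))| <=
    K * kd * nH u * nH w.
  move=> ad; have W1 := drift_W0 oP M0 PM d (DV Du); have W2 := VW0 i (DV Dw).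
  rewrite (test_dot_wderiv oP M0 PM ad (Dv.1 i) (pmul_L oP M0 PM W1 W2)).
  have Lg := test_L oP PM (test_derive d (Dv.1 i)).
  apply: le_trans (tri_smooth oP M0 PM W1 W2 Lg (hK d ad i)) _.
  rewrite -!mulrA; apply: ler_wpM2l => //; rewrite mulrA.
  exact: (ler_pM (nrm_ge0 _ _) (nrm_ge0 _ _) (drift_nH oP d (DV Du)) (comp_le_nH P w i)).
apply: le_trans (sum6_le (fun i => h _ i (or_introl erefl)) (fun i => h _ i (or_intror erefl))) _.
by rewrite !mulrA.
Qed.

Let sqrt_le u : Num.sqrt (nH u * nV u) <= nV u.
Proof.
rewrite -[leRHS]ger0_norm ?nrm_ge0// -sqrtr_sqr; apply: ler_wsqrtr.
by rewrite expr2; apply: ler_wpM2r; [exact: nrm_ge0|exact: nH_le_nV3].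
Qed.

Let b_le u v w : V u -> V v -> V w -> `|b_form u v w| <= 12 * kd * nV u * nV v * nV w.
Proof.
move=> Vu Vv Vw; apply: le_trans (b_form_le oP M0 PM Vu Vv Vw) _.
apply: ler_wpM2r; first exact: nrm_ge0.
apply: ler_wpM2r; first exact: nrm_ge0.
by apply: ler_wpM2l; [rewrite mulr_ge0|exact: sqrt_le].
Qed.

(** Antisymmetry is available on test fields; both sides are continuous in V, so the estimate
    extends by density. *)
Lemma b_form_smooth v : D v -> exists2 K : R, 0 <= K &
  forall u w, V u -> V w -> `|b_form u w v| <= K * nH u * nH w.
Proof.
move=> Dv; have Vv := DV Dv; have [K K0 hK] := b_smooth_test Dv; exists K => // u w Vu Vw.
have [p [Dp pu]] := spaceV_approx Vu; have [q [Dq qw]] := spaceV_approx Vw.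
pose al n := nV (u - p n); pose be n := nV (w - q n).
pose Cb := 12 * kd.
(* The three terms bound the cost of replacing [u] by [p n], that of replacing [w] by [q n], and the
   estimate for the replaced pair. *)
pose B n := Cb * al n * nV w * nV v + Cb * (nV u + al n) * be n * nV v +
  K * (nH u + al n) * (nH w + be n).
have cst (c : R) : (fun _ : nat => c) @ \oo --> c by exact: cvg_cst.
have Bc : B @ \oo --> Cb * 0 * nV w * nV v + Cb * (nV u + 0) * 0 * nV v +
  K * (nH u + 0) * (nH w + 0).
  apply: cvgD; first apply: cvgD.
  - exact: (cvgM (cvgM (cvgM (cst _) pu) (cst _)) (cst _)).
  - exact: (cvgM (cvgM (cvgM (cst _) (cvgD (cst _) pu)) qw) (cst _)).
  - exact: (cvgM (cvgM (cst _) (cvgD (cst _) pu)) (cvgD (cst _) qw)).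
have -> : K * nH u * nH w = Cb * 0 * nV w * nV v + Cb * (nV u + 0) * 0 * nV v +
  K * (nH u + 0) * (nH w + 0) by rewrite !addr0 !(mulr0, mul0r) !add0r.
apply: (cvg_lbound Bc) => n.
have Vp := DV (Dp n); have Vq := DV (Dq n).
have Vup := subspB hV Vu Vp; have Vwq := subspB hV Vw Vq.
have eb : b_form u w v = b_form (u - p n) w v + b_form (p n) (w - q n) v + b_form (p n) (q n) v.
  rewrite (lin_onB (b_form_lin1 oP M0 PM Vw Vv) Vu Vp) (lin_onB (b_form_lin2 oP M0 PM Vp Vv) Vw Vq).
  by rewrite addrA subrK subrK.
have h1 : `|b_form (u - p n) w v| <= Cb * al n * nV w * nV v := b_le Vup Vw Vv.
have near_le (q0 : field3 R -> field3 R -> R) (x y : field3 R) : psd_on V q0 -> V x -> V y ->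
    nrm q0 y <= nrm q0 x + nrm q0 (x - y).
  move=> hq Vx Vy; have Vxy := subspB hV Vx Vy; have Vyx := subspB hV Vy Vx.
  have e0 : y = x + (y - x) by rewrite addrC subrK.
  rewrite {1}e0; apply: le_trans (nrm_triangle hV hq Vx Vyx) _.
  by rewrite (nrm_distC hV hq Vy Vx).
have h2 : `|b_form (p n) (w - q n) v| <= Cb * (nV u + al n) * be n * nV v.
  apply: le_trans (b_le Vp Vwq Vv) _.
  apply: ler_wpM2r; first exact: nrm_ge0.
  apply: ler_wpM2r; first exact: nrm_ge0.
  apply: ler_wpM2l; first by rewrite mulr_ge0.
  exact: (near_le _ _ _ pV Vu Vp).
have nHp (x y : field3 R) : V x -> V y -> nH y <= nH x + nV (x - y).
  move=> Vx Vy; apply: le_trans (near_le _ _ _ pH Vx Vy) _; rewrite lerD2l.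
  exact: nH_le_nV3.
have h3 : `|b_form (p n) (q n) v| <= K * (nH u + al n) * (nH w + be n).
  apply: le_trans (hK _ _ (Dp n) (Dq n)) _.
  apply: (ler_pM (mulr_ge0 K0 (nrm_ge0 _ _)) (nrm_ge0 _ _) _ (nHp _ _ Vw Vq)).
  exact: (ler_wpM2l K0 (nHp _ _ Vu Vp)).
rewrite eb; exact: le_trans (ler_normD _ _) (lerD (le_trans (ler_normD _ _) (lerD h1 h2)) h3).
Qed.

Definition grad_form (d d' : R * R) u v : R :=
  \sum_(i < 3) dotP (wderiv P d (comp3 u i)) (wderiv P d' (comp3 v i)).

(** Written through [lapl], so that the equation obtained is literally that of [weak_solution];
    [a_formE] gives the gradient form. *)
Definition a_form u v : R := - ((nu *: lapl P a1 a2 u) v).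

Lemma pair3_vderiv d d' u v : pair3 P (vderiv P d u) (vderiv P d' v) = grad_form d d' u v.
Proof.
have E e x j : comp3 (vderiv P e x) j = wderiv P e (comp3 x j).
  by apply/funext => z; rewrite /comp3 mxE.
apply: eq_bigr => i _; exact: (congr2 (dot mu2 PR) (E d u i) (E d' v i)).
Qed.

Lemma a_formE u v : a_form u v = nu * ((1 + a1 ^- 2) * grad_form (e1 R) (e1 R) u v +
  (1 + a2 ^- 2) * grad_form (e2 R) (e2 R) u v + 2 * a1^-1 * a2^-1 * grad_form (e2 R) (e1 R) u v).
Proof.
have alg (c1 c2 c3 x y z : R) : - (nu * (c1 * - x + c2 * - y + c3 * - z)) =
  nu * (c1 * x + c2 * y + c3 * z) by ring.
apply: etrans (alg _ _ _ _ _ _) _.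
have h (c1 c2 c3 x y z x' y' z' : R) : x = x' -> y = y' -> z = z' ->
  nu * (c1 * x + c2 * y + c3 * z) = nu * (c1 * x' + c2 * y' + c3 * z') by move=> -> -> ->.
by apply: h; exact: pair3_vderiv.
Qed.

Lemma grad_form_lin1 d d' v : axis d -> axis d' -> V v -> lin_on V (fun u => grad_form d d' u v).
Proof.
move=> ad ad' Vv c u u' Vu Vu'; rewrite /grad_form mulr_sumr -big_split; apply: eq_bigr => i _.
rewrite comp3_lin; exact: (dot_wderiv_lin oP PM c ad (VW i Vu) (VW i Vu') (VD i ad' Vv)).
Qed.

Lemma grad_form_sym d d' u v : grad_form d d' u v = grad_form d' d v u.
Proof. by apply: eq_bigr => i _; exact: dotC. Qed.

Lemma grad_form_lin2 d d' u : axis d -> axis d' -> V u -> lin_on V (grad_form d d' u).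
Proof.
move=> ad ad' Vu c v v' Vv Vv'; rewrite !(grad_form_sym d d').
exact: (grad_form_lin1 ad' ad Vu).
Qed.

Lemma grad_form_le d d' u v : axis d -> axis d' -> V u -> V v ->
  `|grad_form d d' u v| <= 3 * (nV u * nV v).
Proof.
move=> ad ad' Vu Vv; apply: le_trans (ler_norm_sum _ _ _) _.
have h i : `|dotP (wderiv P d (comp3 u i)) (wderiv P d' (comp3 v i))| <= nV u * nV v.
  apply: le_trans (psd_CS hL pL (VD i ad Vu) (VD i ad' Vv)) _.
  apply: ler_pM; rewrite ?nrm_ge0//.
    exact: le_trans (@ip12_geD R P d (comp3 u i) ad) (comp_le_nV P u i).
  exact: le_trans (@ip12_geD R P d' (comp3 v i) ad') (comp_le_nV P v i).
apply: le_trans (ler_sum _ (fun i _ => h i)) _.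
by rewrite sumr_const card_ord mulr_natl.
Qed.

(** A second integration by parts puts both derivatives on the test field. *)
Lemma grad_form_smooth d d' v : axis d -> axis d' -> D v -> exists2 K : R, 0 <= K &
  forall u, V u -> `|grad_form d d' u v| <= K * nH u.
Proof.
move=> ad ad' Dv; exists (\sum_(i < 3) N (fun z => 'D_d (fun y => 'D_d' (comp3 v i) y) z)).
  by apply: sumr_ge0 => i _; exact: nrm_ge0.
move=> u Vu; apply: le_trans (ler_norm_sum _ _ _) _; rewrite mulr_suml; apply: ler_sum => i _.
have td := test_derive d' (Dv.1 i).
rewrite (dotC P (wderiv P d _)) (test_dot_wderiv oP M0 PM ad' (Dv.1 i) (VD i ad Vu)).
rewrite (dotC P (fun z => 'D_d' _ z)).
have := wd_dot (wderivP (W12_wdable oP ad (VW i Vu))) td.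
have Ldd := test_L oP PM (test_derive d td).
move=> /(congr1 (fun x => `|x|)); rewrite normrN => <-.
apply: le_trans (psd_CS hL pL (VL i Vu) Ldd) _; rewrite mulrC.
by apply: ler_wpM2l; [exact: nrm_ge0|exact: comp_le_nH].
Qed.

Let lin3 (X : lmodType R) (S : set X) (c0 c1 c2 c3 : R) (F G H : X -> R) :
  lin_on S F -> lin_on S G -> lin_on S H ->
  lin_on S (fun x => c0 * (c1 * F x + c2 * G x + c3 * H x)).
Proof.
move=> hF hG hH c x y Sx Sy; rewrite (hF c x y Sx Sy) (hG c x y Sx Sy) (hH c x y Sx Sy).
ring.
Qed.

Let le3 (c1 c2 c3 x y z k : R) : `|x| <= k -> `|y| <= k -> `|z| <= k ->
  `|nu * (c1 * x + c2 * y + c3 * z)| <= nu * (`|c1| + `|c2| + `|c3|) * k.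
Proof.
move=> hx hy hz; rewrite normrM (gtr0_norm nu0) -mulrA ler_pM2l// !mulrDl.
apply: le_trans (ler_normD _ _) _; apply: lerD; last by rewrite normrM ler_wpM2l.
by apply: le_trans (ler_normD _ _) _; apply: lerD; rewrite normrM ler_wpM2l.
Qed.

Let ax1 : axis (e1 R) := or_introl erefl.
Let ax2 : axis (e2 R) := or_intror erefl.

Lemma a_form_bil : bil_on V a_form.
Proof.
split=> w Vw.
  have := lin3 nu (1 + a1 ^- 2) (1 + a2 ^- 2) (2 * a1^-1 * a2^-1) (grad_form_lin1 ax1 ax1 Vw)
    (grad_form_lin1 ax2 ax2 Vw) (grad_form_lin1 ax2 ax1 Vw).
  by move=> h c u v Vu Vv; rewrite (a_formE u) (a_formE v) a_formE; exact: h.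
have := lin3 nu (1 + a1 ^- 2) (1 + a2 ^- 2) (2 * a1^-1 * a2^-1) (grad_form_lin2 ax1 ax1 Vw)
  (grad_form_lin2 ax2 ax2 Vw) (grad_form_lin2 ax2 ax1 Vw).
by move=> h c u v Vu Vv; rewrite (a_formE w u) (a_formE w v) a_formE; exact: h.
Qed.

Definition ka : R := nu * (`|1 + a1 ^- 2| + `|1 + a2 ^- 2| + `|2 * a1^-1 * a2^-1|).

Lemma a_form_le u v : V u -> V v -> `|a_form u v| <= ka * 3 * nV u * nV v.
Proof.
move=> Vu Vv; rewrite a_formE.
apply: le_trans (le3 _ _ _ (grad_form_le ax1 ax1 Vu Vv) (grad_form_le ax2 ax2 Vu Vv)
  (grad_form_le ax2 ax1 Vu Vv)) _.
by rewrite !mulrA.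
Qed.

Lemma a_form_smooth v : D v -> exists2 K : R, 0 <= K & forall u, V u -> `|a_form u v| <= K * nH u.
Proof.
move=> Dv; have [K1 K10 h1] := grad_form_smooth ax1 ax1 Dv.
have [K2 K20 h2] := grad_form_smooth ax2 ax2 Dv; have [K3 K30 h3] := grad_form_smooth ax2 ax1 Dv.
have ka0 : 0 <= ka by rewrite /ka mulr_ge0 ?addr_ge0 ?(ltW nu0).
exists (ka * (K1 + K2 + K3)); first by rewrite mulr_ge0// !addr_ge0.
move=> u Vu; rewrite a_formE.
have up (x K : R) : `|x| <= K * nH u -> K <= K1 + K2 + K3 -> `|x| <= (K1 + K2 + K3) * nH u.
  by move=> hx hK; apply: le_trans hx _; apply: ler_wpM2r => //; exact: nrm_ge0.
have q1 : K1 <= K1 + K2 + K3 by rewrite -addrA lerDl addr_ge0.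
have q2 : K2 <= K1 + K2 + K3 by rewrite addrAC lerDr addr_ge0.
have q3 : K3 <= K1 + K2 + K3 by rewrite lerDr addr_ge0.
apply: le_trans (le3 _ _ _ (up _ _ (h1 u Vu) q1) (up _ _ (h2 u Vu) q2) (up _ _ (h3 u Vu) q3)) _.
by rewrite mulrA.
Qed.

(** [elliptic_form_ge] in each component, with the Poincare constant [4 * M ^+ 2]. The denominator
    adds 1 to it because the V norm includes the L^2 norm. *)
Lemma a_form_coercive u : D u -> nu / (4 * M ^+ 2 + 1) * ip3 P u u <= a_form u u.
Proof.
move=> Du; have Vu := DV Du; rewrite a_formE.
have sums (F G H : 'I_3 -> R) (c1 c2 c3 : R) :
    nu * (c1 * \sum_i F i + c2 * \sum_i G i + c3 * \sum_i H i) =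
    \sum_i nu * (c1 * F i + c2 * G i + c3 * H i).
  by rewrite !mulr_sumr -!big_split /= mulr_sumr.
rewrite /grad_form (sums (fun i => _) (fun i => _) (fun i => _)).
rewrite /ip3 /triple_form mulr_sumr; apply: ler_sum => i _.
apply: elliptic_form_ge => //.
- exact: dot_ge0.
- exact: dot_ge0.
- by rewrite mulr_ge0 ?sqr_ge0.
- exact: (psd_CS hL pL (VD i ax2 Vu) (VD i ax1 Vu)).
have := poincare M0 PM (Du.1 i).
by rewrite (test_dotD oP M0 PM ax1 (Du.1 i)).
Qed.

End evolution_data.

(** * The problem as an instance of the abstract equation *)

Section assembly.
Variables (R : realType) (P : set (R * R)) (M : R).
Hypotheses (oP : open P) (M0 : 0 < M) (PM : in_square P M).
Variables (a1 a2 nu : R).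
Hypothesis nu0 : 0 < nu.
Local Notation V := (spaceV P a1 a2).
Local Notation H := (spaceH P a1 a2).
Local Notation D := (divfree_test P a1 a2).
Local Notation nH := (nrm (pair3 P)).

Lemma evolution_setting_spaceV : exists (ca Ca Cb : R) (kap : field3 R -> R),
  evolution_setting V D (pair3 P) (ip3 P) (a_form P a1 a2 nu) (b_form P a1 a2) ca Ca Cb kap.
Proof.
have hk (v : field3 R) : exists K : R, 0 <= K /\ (D v -> (forall u, V u -> `|a_form P a1 a2 nu u v| <= K * nH u) /\
    (forall u w, V u -> V w -> `|b_form P a1 a2 u w v| <= K * nH u * nH w)).
  (* Nothing is asked of the constant outside [D] except that it be nonnegative. *)
  have [Dv|nDv] := pselect (D v); last by exists 0.
  have [K1 K10 h1] := a_form_smooth oP M0 PM nu0 Dv.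
  have [K2 K20 h2] := b_form_smooth oP M0 PM Dv.
  exists (K1 + K2); split; first exact: addr_ge0.
  move=> _; split=> [u Vu|u w Vu Vw].
    apply: le_trans (h1 u Vu) _; apply: ler_wpM2r; first exact: nrm_ge0.
    by rewrite lerDl.
  apply: le_trans (h2 u w Vu Vw) _; apply: ler_wpM2r; first exact: nrm_ge0.
  by apply: ler_wpM2r; [exact: nrm_ge0|rewrite lerDr].
have [kap hkap] := choice hk.
exists (nu / (4 * M ^+ 2 + 1)), (ka a1 a2 nu * 3), (12 * kdrift a1 a2), kap.
have DV := @divfree_spaceV R P M oP M0 PM a1 a2.
split.
- exact: (spaceV_subsp oP M0 PM).
- exact: divfree_subsp.
- exact: DV.
- exact: (spaceV_psdH oP).
- exact: (spaceV_psd oP PM).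
- by move=> u _; exact: pair3_le_ip3.
- exact: (spaceV_complete oP M0 PM).
- by move=> v Vv e e0; exact: (spaceV_dense Vv e0).
- exact: (a_form_bil oP PM).
- by move=> u v Vu Vv; exact: (a_form_le oP nu0 Vu Vv).
- by rewrite divr_gt0// ltr_wpDl// mulr_ge0// sqr_ge0.
- by move=> u Du; exact: (a_form_coercive oP M0 PM nu0 Du).
- move=> w Vw; split => v Vv; first exact: (b_form_lin2 oP M0 PM Vw Vv).
  exact: (b_form_lin3 oP M0 PM Vw Vv).
- by move=> v w Vv Vw; exact: (b_form_lin1 oP M0 PM Vv Vw).
- by move=> u v w Vu Vv Vw; exact: (b_form_le oP M0 PM Vu Vv Vw).
- by move=> u v Du Dv; exact: (b_form_skew oP M0 PM Du Dv).
- by move=> v; case: (hkap v).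
- by move=> u v Vu Dv; have [_ /(_ Dv)[h _]] := hkap v; exact: h.
- by move=> u w v Vu Vw Dv; have [_ /(_ Dv)[_ h]] := hkap v; exact: h.
move=> e e0; have [s sD sN] := divfree_compact oP M0 PM a1 a2 e0.
exists s; first by move=> p /(nthP 0)[k ks <-]; exact: sD.
move=> w Dw w1; have [k ks hk'] := sN w Dw w1; exists (nth 0 s k) => //.
exact: mem_nth.
Qed.

Lemma spaceV_spaceH : V `<=` H.
Proof.
move=> u Vu; split; first by move=> j; exact: (L2_sqi oP (comp3 u j)).2 (spaceV_L oP j Vu).
move=> e e0; have [d Dd hd] := spaceV_dense Vu e0; exists d => //.
by apply: le_lt_trans hd; exact: nH_le_nV3.
Qed.

(** Only the convergence of pairings and a common bound are kept: this is all the abstract theorem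
    uses of the initial data. *)
Lemma spaceH_approx u0 : H u0 -> exists (z : nat -> field3 R) (K : R),
  (forall n, D (z n) /\ pair3 P (z n) (z n) <= K) /\
  forall v, V v -> (fun n => pair3 P (z n) v) @ \oo --> pair3 P u0 v.
Proof.
move=> [Lu0 hu0]; pose L3 := triple (sqi (leb2 R) P : set (R * R -> R^o)).
have mP : measurable (P : set (measurableTypeR R * measurableTypeR R)) by exact: open_measurable2.
have hL3 : subsp L3 by apply: triple_subsp; exact: (sqi_subsp (leb2 R) mP).
have pL3 : psd_on L3 (pair3 P) by exact: (triple_psd (dot_psd (leb2 R) mP)).
have Su0 : L3 u0 by move=> j; exact: (L2_sqi oP (comp3 u0 j)).1 (Lu0 j).
have h n : exists z, D z /\ nH (u0 - z) < n.+1%:R^-1.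
  by have [|z Dz hz] := hu0 n.+1%:R^-1; [rewrite invr_gt0|exists z].
have [z hz] := choice h; have Sz n : L3 (z n).
  by move=> j; have [[tz _] _] := hz n; exact: (test_L oP PM (tz j)).
exists z, ((nH u0 + 1) ^+ 2); split.
  move=> n; have [Dz hn] := hz n; split; first exact: Dz.
  rewrite -(nrm_sqr pL3 (Sz n)) lerXn2r ?nnegrE ?addr_ge0 ?nrm_ge0//.
  have n1 : n.+1%:R^-1 <= 1 :> R by rewrite invf_le1// ler1n.
  have alg (x y t : R) : `|x - y| <= t -> t <= 1 -> y <= x + 1.
    by rewrite ler_norml => /andP[+ _]; lra.
  exact: alg (nrm_dist hL3 pL3 Su0 (Sz n)) (le_trans (ltW hn) n1).
move=> v Vv; have Sv : L3 v by move=> j; exact: (spaceV_L oP j Vv).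
have hh : (fun n => n.+1%:R^-1 : R) @ \oo --> (0 : R) by exact: cvg_harmonic.
apply: (cvg_le0 (C := nH v) _ hh) => n.
have [[lin _] _ _] := pL3; rewrite -(lin_onB (lin v Sv) (Sz n) Su0).
apply: le_trans (psd_CS hL3 pL3 (subspB hL3 (Sz n) Su0) Sv) _.
rewrite mulrC (nrm_distC hL3 pL3 (Sz n) Su0); apply: ler_wpM2l; first exact: nrm_ge0.
by have [_ hn] := hz n; exact: ltW hn.
Qed.

End assembly.

Lemma bochner_sub (R : realType) (T : R) (p : \bar R) (X : lmodType R) (N : X -> R)
  (S S' : set X) : S `<=` S' -> bochner T p N S `<=` bochner T p N S'.
Proof.
move=> sub u [uS [s [hs hc]] fn]; split => //.
  by apply: ae_impl uS => t h It; exact: sub (h It).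
exists s; split => // n; exact: simple_in_sub sub (hs n).
Qed.

Theorem theorem4 (R : realType) (T nu : R) (hT : 0 < T) (hnu : 0 < nu)
    (Omega : set 'rV[R]_3) (hOmega : bounded_lipschitz_domain Omega)
    (a1 a2 b : R) (ha1 : a1 != 0) (ha2 : a2 != 0)
    (hL : Omega `&` plane a1 a2 b !=set0)
    (hP : union_lipschitz_domains (cross_section Omega a1 a2 b))
    (u0 : field3 R) (hu0 : spaceH (cross_section Omega a1 a2 b) a1 a2 u0)
    (f : R -> functional R)
    (hf : bochner T 2%:E (norm_dualV (cross_section Omega a1 a2 b) a1 a2)
            (dualV (cross_section Omega a1 a2 b) a1 a2) f) :
  exists u : R -> field3 R,
    weak_solution T nu (cross_section Omega a1 a2 b) a1 a2 u0 f u.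
Proof.
have [_ _ _ bO _] := hOmega; have oO : open Omega by case: hOmega.
have oP := @cross_section_open R Omega a1 a2 b oO.
have [M M0 PM] := @cross_section_in_square R Omega a1 a2 b bO.
set P := cross_section Omega a1 a2 b in hu0 hf oP PM *.
have [ca [Ca [Cb [kap ES]]]] := evolution_setting_spaceV oP M0 PM a1 a2 hnu.
have [z [K [zK zc]]] := spaceH_approx oP PM hu0.
(* This equality of seminorms identifies the concrete dual space and Bochner classes with the
   abstract ones. *)
have NE := @normVE R P.
have fB : bochner T 2%:E (ndual (spaceV P a1 a2) (ip3 P)) (dualof (spaceV P a1 a2) (ip3 P)) f.
  by move: hf; rewrite /norm_dualV /dualV NE.
have [u [g [uV uH gB ug]]] := evolution_existence ES hT fB zc zK.
exists u; split.
  split; first split.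
  - by rewrite NE.
  - by apply: bochner_sub uH; exact: (spaceV_spaceH oP).
  - exists g; first by rewrite /norm_dualV /dualV NE.
    by move=> v Vv; case: (ug v Vv).
move=> v Vv; have [ig wg eg hF] := ug v Vv; split; last exact: hF.
exists (fun t => g t v); split; [exact: ig|exact: wg|].
apply: ae_impl eg => t h It; rewrite (h It) /a_form opprK.
(* With [h] equal to the time derivative, the equation is an identity: [nu *: lapl] is minus the
   form [a_form], and the convection pairing is [b_form u u v]. *)
have alg (x y w : R) : x + y - w - y + w = x by ring.
exact: alg.
Qed.
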